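(* Let $v=(E,G)$ be a vertex on a connected component $\mathcal{C}$ of $C_{\ell,0}(N)$, where $G=\langle P\rangle$, and let $\mathfrak{a}=(P,N)$ be the $\mathcal{O}$-ideal generated by $P$ (viewed in $\mathcal{O}/N\mathcal{O}$) and $N$. Let $m_{\mathfrak{a}}$ be the order of the natural projection of $\lambda$ in $(\mathcal{O}/N\mathcal{O})^{\times}/\operatorname{Stab}(G)$. Then $\#\mathcal{C}=nm_{\mathfrak{a}}$, and $C_{\ell,0}(N)$ contains $\frac{\phi_{\mathcal{O}}(\mathfrak{a}^{-1}N\mathcal{O})}{\phi(N)m_{\mathfrak{a}}}$ components isomorphic to $\mathcal{C}$.
   Context: Setting: $q$ a power of a prime $p\ge5$; $\ell\ne p$ prime; $K$ imaginary quadratic; $\mathcal{O}\subseteq\mathcal{O}_K$ an order of conductor $f$; $N$ a positive integer coprime to $p,\ell,f$. $C_\ell$ is the crater (level-0 subgraph) of an ordinary component of the $\ell$-isogeny graph over $\mathbb{F}_q$, consisting of (isomorphism classes of) curves $E$ with $\operatorname{End}(E)=\mathcal{O}$ and $j(E)\notin\{0,1728\}$. Assume $\ell\mathcal{O}=\mathfrak{l}\overline{\mathfrak{l}}$ (split, or ramified with $\mathfrak{l}=\overline{\mathfrak{l}}$); crater edges are the isogenies induced by $\mathfrak{l}$ and $\overline{\mathfrak{l}}$. Let $n$ be the order of $[\mathfrak{l}]$ in $Cl(\mathcal{O})$ (so $C_\ell$ has $n$ vertices) and write $\mathfrak{l}^n=\lambda\mathcal{O}$ with $\lambda\in\mathcal{O}$.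 $E[N]$ is identified with $\mathcal{O}/N\mathcal{O}$ as $\mathcal{O}/N\mathcal{O}$-modules. A $\Gamma_0(N)$-level structure is a cyclic subgroup of $E[N]$ of order $N$; $(E,\gamma)\sim(E',\gamma')$ if an isomorphism $\varphi:E\to E'$ has $\varphi(\gamma)=\gamma'$. $C_{\ell,0}(N)$ has vertices the classes of $(E,G)$ with $E$ in $C_\ell$ and $G$ a $\Gamma_0(N)$-structure, and edges $(E,G)$—$(E',\varphi(G))$ for crater isogenies $\varphi$. $\operatorname{Stab}(G)=\{\alpha\in(\mathcal{O}/N\mathcal{O})^\times:\alpha G=G\}$. For an $\mathcal{O}$-ideal $\mathfrak{b}$, $\phi_{\mathcal{O}}(\mathfrak{b})=\#(\mathcal{O}/\mathfrak{b})^{\times}$; $\phi$ is Euler's totient function. *)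

(* Defs.v *)
From HB Require Import structures.
From mathcomp Require Import all_boot all_order all_algebra all_field.
From mathcomp Require Import finmap mathcomp_extra boolp classical_sets.
From mathcomp Require Import functions cardinality.
From Stdlib Require Import Relation_Operators.

Set Implicit Arguments.
Unset Strict Implicit.
Unset Printing Implicit Defensive.

Import GRing.Theory Num.Theory.

Local Open Scope classical_set_scope.
Local Open Scope card_scope.
Local Open Scope ring_scope.

(** * Imaginary quadratic orders and their ideals *)

(* Every imaginary quadratic field is Q(sqrt (- d)) for some d > 0; we take it
   inside algC, so that its nontrivial automorphism is x |-> x^*. *)
Definition imag_quad_field (d : nat) : set algC :=
  [set z | exists x y : rat, z = ratr x + ratr y * sqrtC (- d%:R)].

Definition ring_of_integers (K : set algC) : set algC :=
  [set z | K z /\ z \in Aint].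

(* Z + f O_K, the order of conductor f; every order of K has this form. *)
Definition order_of_conductor (K : set algC) (f : nat) : set algC :=
  [set z | exists (a : int) (b : algC),
     ring_of_integers K b /\ z = a%:~R + f%:R * b].

Section Ideals.
Implicit Types O I J : set algC.

Definition is_ideal O I :=
  [/\ I `<=` O, I 0, forall x y, I x -> I y -> I (x + y)
    & forall r x, O r -> I x -> I (r * x)].

Definition is_prime_ideal O I :=
  [/\ is_ideal O I, ~ I 1
    & forall x y, O x -> O y -> I (x * y) -> I x \/ I y].

Definition scale_ideal (c : algC) I : set algC :=
  [set z | exists2 x, I x & z = c * x].

Definition mul_ideal I J : set algC :=
  [set z | exists (r : nat) (x y : 'I_r -> algC),
     (forall i, I (x i) /\ J (y i)) /\ z = \sum_(i < r) x i * y i].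

Definition exp_ideal O I (n : nat) : set algC := iter n (mul_ideal I) O.

Definition conj_ideal I : set algC := [set z | I z^*].

Definition inv_ideal O I : set algC := [set z | forall x, I x -> O (z * x)].

Definition ideal_gen2 O (x y : algC) : set algC :=
  [set z | exists r s, [/\ O r, O s & z = r * x + s * y]].

(* [I] = 1 in Cl(O): I is a principal fractional ideal. *)
Definition trivial_class O I := exists2 c : algC, c != 0 & I = scale_ideal c O.

Definition unit_mod O I (x : algC) :=
  O x /\ exists2 y, O y & I (x * y - 1).

Definition residue_class O I (x : algC) : set algC :=
  [set y | O y /\ I (y - x)].

Definition unit_group_mod O I : set (set algC) :=
  [set residue_class O I x | x in unit_mod O I].

End Ideals.

(* fset_set takes the junk value fset0 on infinite sets, but O / I is finite
   for every nonzero ideal I. *)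
Definition phi_order (O I : set algC) : nat :=
  #|` fset_set (unit_group_mod O I : set {classic set algC})|.

Definition least_positive (Q : nat -> Prop) (n : nat) :=
  [/\ (0 < n)%N, Q n & forall i, (0 < i < n)%N -> ~ Q i].

(* The order of [I] in Cl(O). *)
Definition class_order (O I : set algC) (n : nat) :=
  least_positive (fun i => trivial_class O (exp_ideal O I i)) n.

(** * Elliptic curves y^2 = x^3 + a x + b (in characteristic not 2 or 3) *)

Record curve (k : fieldType) := Curve {
  coefA : k;
  coefB : k;
  smooth : 4%:R * coefA ^+ 3 + 27%:R * coefB ^+ 2 != 0 }.

(* None is the point at infinity. *)
Definition pt (k : fieldType) := option (k * k).

Section Curves.
Variable k : fieldType.
Implicit Types (E : curve k) (P Q : pt k) (G H : set (pt k)).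
Implicit Types (phi psi : pt k -> pt k).

Definition jinv E : k :=
  1728%:R * (4%:R * coefA E ^+ 3)
  / (4%:R * coefA E ^+ 3 + 27%:R * coefB E ^+ 2).

Definition points E : set (pt k) :=
  [set P | if P is Some (x, y) then y ^+ 2 = x ^+ 3 + coefA E * x + coefB E
           else True].

Definition padd E P Q : pt k :=
  match P, Q with
  | None, _ => Q
  | _, None => P
  | Some (x1, y1), Some (x2, y2) =>
      if (x1 == x2) && (y1 == - y2) then None
      else let s := if x1 == x2 then (3%:R * x1 ^+ 2 + coefA E) / (2%:R * y1)
                    else (y2 - y1) / (x2 - x1) in
           let x3 := s ^+ 2 - x1 - x2 in
           Some (x3, s * (x1 - x3) - y1)
  end.

Definition pmul E (n : nat) P : pt k := iter n (padd E P) None.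

Definition torsion E (n : nat) : set (pt k) :=
  [set P | points E P /\ pmul E n P = None].

(* All multiples i P with i >= 0; this is a group when P is a torsion point. *)
Definition cyclic_subgroup E P : set (pt k) := range (fun i => pmul E i P).

Definition ordinary (p : nat) E := exists2 P, torsion E p P & P <> None.

(* In what follows, maps are total functions on pt k, of which only the
   restriction to points E matters. *)

Definition almost_everywhere E (Q : pt k -> Prop) :=
  finite_set [set P | points E P /\ ~ Q P].

Definition point_hom E E' phi :=
  (forall P, points E P -> points E' (phi P)) /\
  (forall P Q, points E P -> points E Q ->
     phi (padd E P Q) = padd E' (phi P) (phi Q)).

(* Homomorphisms given by rational functions (U / W, V / W) in the two
   coordinates. When k is algebraically closed, E has infinitely many points,
   so this excludes the zero map. *)
Definition isogeny E E' phi :=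
  point_hom E E' phi /\
  exists U V W : {poly {poly k}},
    almost_everywhere E (fun P => exists x y,
      [/\ P = Some (x, y), W.[x%:P].[y] != 0 &
          phi P = Some (U.[x%:P].[y] / W.[x%:P].[y],
                        V.[x%:P].[y] / W.[x%:P].[y])]).

(* The x-coordinate of phi (x, y) is a rational function r(x) of x alone, and
   [k(E) : phi^* k(E')] = [k(x) : k(r)] is the maximum of the degrees of the
   numerator and denominator of r in lowest terms. *)
Definition isogeny_degree E phi (n : nat) :=
  exists r s : {poly k},
    [/\ coprimep r s, n = (maxn (size r) (size s)).-1 &
        almost_everywhere E (fun P => exists x y y',
          [/\ P = Some (x, y), s.[x] != 0 &
              phi P = Some (r.[x] / s.[x], y')])].

Definition degree_isogeny E E' (n : nat) phi :=
  isogeny E E' phi /\ isogeny_degree E phi n.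

Definition isomorphism E E' phi :=
  isogeny E E' phi /\
  exists psi, [/\ isogeny E' E psi,
    forall P, points E P -> psi (phi P) = P &
    forall P, points E' P -> phi (psi P) = P].

Definition ker E phi : set (pt k) := [set P | points E P /\ phi P = None].

Definition endomorphism E phi :=
  isogeny E E phi \/ forall P, points E P -> phi P = None.

(* rho restricts to a ring isomorphism from O to End(E). *)
Definition End_iso (O : set algC) E (rho : algC -> pt k -> pt k) :=
  [/\ forall a, O a -> endomorphism E (rho a),
      [/\ forall P, points E P -> rho 1 P = P,
          forall a b P, O a -> O b -> points E P ->
            rho (a + b) P = padd E (rho a P) (rho b P) &
          forall a b P, O a -> O b -> points E P ->
            rho (a * b) P = rho a (rho b P)],
      forall a, O a -> (forall P, points E P -> rho a P = None) -> a = 0 &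
      forall phi, endomorphism E phi ->
        exists2 a, O a & forall P, points E P -> phi P = rho a P].

(* E[I], for O acting on E through rho. *)
Definition ideal_torsion E (rho : algC -> pt k -> pt k) (I : set algC) :
    set (pt k) :=
  [set P | points E P /\ forall a, I a -> rho a P = None].

(* theta induces an O-linear isomorphism O / N O -> E[N]. *)
Definition torsion_iso (O : set algC) E (rho : algC -> pt k -> pt k) (N : nat)
    (theta : algC -> pt k) :=
  [/\ theta @` O = torsion E N,
      forall a b, O a -> O b -> theta (a + b) = padd E (theta a) (theta b),
      forall a b, O a -> O b -> theta (a * b) = rho a (theta b) &
      forall a, O a -> (theta a = None <-> scale_ideal N%:R O a)].

(** * Isogeny graphs *)

(* The isogenies induced by l and its conjugate. Both isomorphisms O -> End(E)
   may be used: they differ by conjugation, which swaps the two kernels. *)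
Definition crater_isogeny (O l : set algC) (ell : nat) E E' phi :=
  degree_isogeny E E' ell phi /\
  exists2 rho, End_iso O E rho &
    ker E phi = ideal_torsion E rho l \/
    ker E phi = ideal_torsion E rho (conj_ideal l).

Section Over.
Variables (F : finFieldType) (iota : {rmorphism F -> k}).

Definition defined_over E :=
  exists a b : F, coefA E = iota a /\ coefB E = iota b.

(* Vertices are k-isomorphism classes, so isomorphic curves are joined too. *)
Definition isogeny_graph_step (ell : nat) E E' :=
  [/\ defined_over E, defined_over E' &
      exists phi, isomorphism E E' phi \/ degree_isogeny E E' ell phi].

Definition isogeny_component (ell : nat) E : set (curve k) :=
  [set E' | clos_refl_sym_trans _ (isogeny_graph_step ell) E E'].

(* All representatives of the level-0 vertices of the component of E0, where
   O is the endomorphism ring on the crater. *)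
Definition crater (O : set algC) (ell : nat) (E0 : curve k) : set (curve k) :=
  [set E | isogeny_component ell E0 E /\ exists rho, End_iso O E rho].

End Over.

(** ** Gamma_0(N)-level structures *)

Definition Gamma0_structure E (N : nat) G :=
  (exists2 P, torsion E N P & G = cyclic_subgroup E P) /\ G #= `I_N.

Definition level_curve := (curve k * set (pt k))%type.

Definition level_equiv (x y : level_curve) :=
  exists2 phi, isomorphism x.1 y.1 phi & phi @` x.2 = y.2.

Definition level_curves (C : set (curve k)) (N : nat) : set level_curve :=
  [set x | C x.1 /\ Gamma0_structure x.1 N x.2].

Definition level_class (C : set (curve k)) (N : nat) (x : level_curve) :
    set level_curve :=
  [set y | level_curves C N y /\ level_equiv x y].

Definition level_vertices (C : set (curve k)) (N : nat) :
    set (set level_curve) :=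
  [set level_class C N x | x in level_curves C N].

(* The arcs from the class of x to w. Crater isogenies are taken up to
   isomorphisms of the target, so an arc is determined by its kernel; an
   undirected edge is an arc together with its dual. *)
Definition arcs (O l : set algC) (ell : nat) (x : level_curve)
    (w : set level_curve) : set (set (pt k)) :=
  [set H | exists E' phi,
     [/\ crater_isogeny O l ell x.1 E' phi, w (E', phi @` x.2)
       & H = ker x.1 phi]].

Definition adjacent (O l : set algC) (ell : nat) (v w : set level_curve) :=
  exists2 x, v x & arcs O l ell x w !=set0.

Definition component (C : set (curve k)) (O l : set algC) (ell N : nat)
    (v : set level_curve) : set (set level_curve) :=
  [set w | clos_refl_sym_trans _
     (fun u u' => [/\ level_vertices C N u, level_vertices C N u'
                    & adjacent O l ell u u']) v w].

Definition is_component (C : set (curve k)) (O l : set algC) (ell N : nat)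
    (D : set (set level_curve)) :=
  exists2 v, level_vertices C N v & D = component C O l ell N v.

(* Isomorphism of the induced multigraphs: a bijection on vertices preserving
   the number of arcs from any vertex to any other (or to itself). *)
Definition subgraph_iso (O l : set algC) (ell : nat)
    (D D' : set (set level_curve)) :=
  exists2 h : set level_curve -> set level_curve, set_bij D D' h &
    forall v w x y, D v -> D w -> v x -> h v y ->
      arcs O l ell x w #= arcs O l ell y (h w).

(* Representatives in O of the elements of Stab(G) in (O / N O)^*. *)
Definition Stab (O : set algC) (N : nat) (rho : algC -> pt k -> pt k) G :
    set algC :=
  [set a | unit_mod O (scale_ideal N%:R O) a /\ rho a @` G = G].

(* The order of the image of a in (O / N O)^* / Stab(G). *)
Definition order_mod_Stab (O : set algC) (N : nat)
    (rho : algC -> pt k -> pt k) G (a : algC) (m : nat) :=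
  least_positive (fun i => Stab O N rho G (a ^+ i)) m.

End Curves.

(* Main.v *)
(* Let c = (E, R) be a curve of the crater with R : O -> End(E). The
   quotient by E[l] is again such a curve, the dual isogeny being the
   quotient by the torsion of the conjugate ideal; iterating gives a chain
   of curves E_0 = E, E_1, ... whose i-th map has kernel E[l^i], so that E_i
   and E_j are isomorphic exactly when n divides i - j, and the n-th map is
   R(lambda) up to isomorphism. As the only automorphisms are +1 and -1,
   which fix every subgroup G, the component of (E, G) is the cycle of the
   (E_i, image of G), of length n m where m is the order of lambda modulo
   the stabilizer of G. Moving G by a unit modulo Ann(P) = a^-1 N O gives
   cycles of the same shape, and each cycle is hit by phi(N) m of the
   phi_O(a^-1 N O) points so obtained.

   If g kills the kernel of a separable isogeny f, the coordinates of g
   descend along f, so g factors through f; and E / H is built from the sums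
   of the two coordinates over the translates by H. *)

From Pilot Require Import Defs.
From HB Require Import structures.
From mathcomp Require Import all_boot all_order all_algebra all_field.
From mathcomp Require Import finmap mathcomp_extra boolp classical_sets.
From mathcomp Require Import functions cardinality.
From mathcomp Require Import ring zify.
From Stdlib Require Import Relation_Operators.

Set Implicit Arguments.
Unset Strict Implicit.
Unset Printing Implicit Defensive.

Import GRing.Theory Num.Theory.

Local Open Scope classical_set_scope.
Local Open Scope card_scope.
Local Open Scope ring_scope.

(** * The group law *)

Section GroupLawFormulas.
Variables (k : fieldType) (E : curve k).
Local Notation a := (coefA E).
Local Notation b := (Defs.coefB E).
Hypothesis k2 : (2%:R : k) != 0.

(** A rational function is treated as a function on points that agrees with (A(x) + B(x) y) / D(x)
    off a finite list; identities are proved at almost all points and then extended, by the group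
    law or by clearing denominators. Poles at infinity are read off degrees. Separability enters
    only as the equality of the degree of the x-coordinate map with the number of points in the
    kernel, which holds once the degree is invertible in [k]. The delicate point of the chain is
    that E / E[l] has endomorphism ring exactly O. An endomorphism of it corresponds to some z with
    all ell z^j and ell (1 + z)^j in O, and z lies in O because ell is prime to the conductor; that
    coprimality is itself forced by ell O = l lbar with l prime. The quotient is defined over F
    because Frobenius, being an endomorphism, commutes with O and preserves E[l]. Crater isogenies
    allow either identification of O with End(E). With one of them fixed, the steps through lbar are
    the l-steps of the curve with the conjugate identification, so a single chain serves both
    directions. *)

Definition on_curve (P : pt k) : bool :=
  if P is Some (x, y) then y ^+ 2 == x ^+ 3 + a * x + b else true.

Lemma on_curveP P : reflect (points E P) (on_curve P).
Proof. by case: P => [[x y]|] /=; [apply: eqP | apply: ReflectT]. Qed.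

(** The second equation is the difference of the two curve equations divided by [x2 - x1]; for
    [x1 = x2] it becomes the tangent equation. One relation thus covers secants and tangents, and
    doubling is not a separate case in the associativity proof. *)
Definition is_slope (x1 y1 x2 y2 s : k) :=
  y2 = y1 + s * (x2 - x1) /\
  s ^+ 2 * (x2 - x1) + 2%:R * y1 * s
    = (x2 - x1) ^+ 2 + 3%:R * x1 * (x2 - x1) + (3%:R * x1 ^+ 2 + a).

Lemma is_slope_sym x1 y1 x2 y2 s :
  is_slope x1 y1 x2 y2 s -> is_slope x2 y2 x1 y1 s.
Proof.
case=> -> h; split; first by ring.
apply/eqP; rewrite -subr_eq0; apply/eqP.
transitivity ((s ^+ 2 * (x2 - x1) + 2%:R * y1 * s) -
   ((x2 - x1) ^+ 2 + 3%:R * x1 * (x2 - x1) + (3%:R * x1 ^+ 2 + a))); first by ring.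
by rewrite h subrr.
Qed.

Lemma slope_exists x1 y1 x2 y2 :
  on_curve (Some (x1, y1)) -> on_curve (Some (x2, y2)) ->
  ~~ ((x1 == x2) && (y1 == - y2)) -> exists s, is_slope x1 y1 x2 y2 s.
Proof.
move=> /eqP h1 /eqP h2; rewrite negb_and.
have [e12 | ne _] := eqVneq x1 x2.
  subst x2; rewrite /= => ne.
  have e : y1 = y2.
    have : (y1 - y2) * (y1 + y2) = 0 by rewrite -subr_sqr h1 h2 subrr.
    move/eqP; rewrite mulf_eq0 subr_eq0 addr_eq0 (negPf ne) orbF.
    by move/eqP.
  have y0 : y1 != 0.
    apply: contra ne => /eqP y0; by rewrite -e y0 oppr0.
  exists ((3%:R * x1 ^+ 2 + a) / (2%:R * y1)); rewrite /is_slope -e; split.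
    by rewrite subrr mulr0 addr0.
  by field; rewrite k2 y0.
have d0 : x2 - x1 != 0 by rewrite subr_eq0 eq_sym.
exists ((y2 - y1) / (x2 - x1)); split; first by field.
have -> : ((y2 - y1) / (x2 - x1)) ^+ 2 * (x2 - x1) + 2%:R * y1 * ((y2 - y1) / (x2 - x1)) = (y2 ^+ 2 - y1 ^+ 2) / (x2 - x1).
  by field.
by rewrite h1 h2; field.
Qed.

Lemma padd_slope x1 y1 x2 y2 s :
  ~~ ((x1 == x2) && (y1 == - y2)) -> is_slope x1 y1 x2 y2 s ->
  padd E (Some (x1, y1)) (Some (x2, y2))
  = Some (s ^+ 2 - x1 - x2, s * (x1 - (s ^+ 2 - x1 - x2)) - y1).
Proof.
move=> ne [e1 e2]; rewrite /padd (negPf ne).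
suff -> : (if x1 == x2 then (3%:R * x1 ^+ 2 + a) / (2%:R * y1)
           else (y2 - y1) / (x2 - x1)) = s by [].
have [e|n] := eqVneq x1 x2; last first.
  rewrite e1 addrC addKr mulfK //; by rewrite subr_eq0 eq_sym.
subst x2; move: e1 e2; rewrite subrr !mulr0 expr0n /= !add0r addr0 => e1 <-.
have y0 : y1 != 0.
  by apply: contra ne => /eqP y0; rewrite e1 y0 oppr0 !eqxx.
by field; rewrite k2 y0.
Qed.

Lemma third_point_on x1 y1 x2 y2 s :
  on_curve (Some (x1, y1)) -> is_slope x1 y1 x2 y2 s ->
  on_curve (Some (s ^+ 2 - x1 - x2, s * (x1 - (s ^+ 2 - x1 - x2)) - y1)).
Proof.
move=> /eqP h1 [e1 e2]; apply/eqP.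
(* The curve equation at the third point is the one at the first point plus this multiple of the
   slope relation. *)
have : (s ^+ 2 - x1 - x2 - x1) * ((s ^+ 2 * (x2 - x1) + 2%:R * y1 * s) - ((x2 - x1) ^+ 2 + 3%:R * x1 * (x2 - x1) + (3%:R * x1 ^+ 2 + a))) = 0.
  by rewrite e2 subrr mulr0.
have : y1 ^+ 2 - (x1 ^+ 3 + a * x1 + b) = 0 by rewrite h1 subrr.
move=> h3 h4; apply/eqP; rewrite -subr_eq0; apply/eqP.
rewrite -[RHS]addr0 -{1}h3 -h4; ring.
Qed.

Lemma padd_on P Q : on_curve P -> on_curve Q -> on_curve (padd E P Q).
Proof.
case: P Q => [[x1 y1]|] [[x2 y2]|] // h1 h2.
case: (boolP ((x1 == x2) && (y1 == - y2))) => [e|ne]; first by rewrite /padd e.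
have [s hs] := slope_exists h1 h2 ne.
rewrite (padd_slope ne hs); exact: third_point_on h1 hs.
Qed.

Lemma padd_comm P Q : on_curve P -> on_curve Q -> padd E P Q = padd E Q P.
Proof.
case: P Q => [[x1 y1]|] [[x2 y2]|] // h1 h2.
have sw : ((x1 == x2) && (y1 == - y2)) = ((x2 == x1) && (y2 == - y1)).
  by rewrite eq_sym -(inj_eq oppr_inj y1) opprK (eq_sym y2).
case: (boolP ((x1 == x2) && (y1 == - y2))) => [e|ne].
  by rewrite /padd e -sw e.
have [s hs] := slope_exists h1 h2 ne.
rewrite (padd_slope ne hs) (padd_slope _ (is_slope_sym hs)) -?sw //.
case: hs => -> _; congr (Some (_, _)); ring.
Qed.

Definition pneg (P : pt k) : pt k :=
  if P is Some (x, y) then Some (x, - y) else None.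

Lemma pneg_on P : on_curve P -> on_curve (pneg P).
Proof. by case: P => [[x y]|] //=; rewrite sqrrN. Qed.

Lemma padd_None P Q : on_curve P -> on_curve Q ->
  padd E P Q = None -> Q = pneg P.
Proof.
case: P Q => [[x1 y1]|] [[x2 y2]|] // h1 h2.
case: (boolP ((x1 == x2) && (y1 == - y2))) => [/andP[/eqP-> /eqP->] _|ne].
  by rewrite /= opprK.
have [s hs] := slope_exists h1 h2 ne.
by rewrite (padd_slope ne hs).
Qed.

Lemma paddN P : padd E P (pneg P) = None.
Proof. by case: P => [[x y]|] //=; rewrite opprK !eqxx. Qed.

(* In coordinates centred at the middle point Q, the curve and the slopes of
   the lines PQ and QT determine everything rationally. *)
Lemma padd_assoc_affine x1 y1 x2 y2 x3 y3 la mu :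
  on_curve (Some (x1, y1)) -> on_curve (Some (x2, y2)) ->
  is_slope x2 y2 x1 y1 la -> is_slope x2 y2 x3 y3 mu -> la != mu ->
  ~~ ((x2 == x1) && (y2 == - y1)) -> x2 != x3 ->
  la ^+ 2 - x2 - x1 != x3 -> mu ^+ 2 - x2 - x3 != x1 ->
  on_curve (Some (x3, y3)) ->
  padd E (padd E (Some (x1, y1)) (Some (x2, y2))) (Some (x3, y3))
  = padd E (Some (x1, y1)) (padd E (Some (x2, y2)) (Some (x3, y3))).
Proof.
move=> h1 h2 s1 s2 nlm ne1 n23 nU nW h3.
have d : la - mu != 0 by rewrite subr_eq0.
have ne2 : ~~ ((x2 == x3) && (y2 == - y3)) by rewrite (negPf n23).
rewrite (padd_comm h1 h2) (padd_slope ne1 s1) (padd_slope ne2 s2).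
set U := Some _; set W := Some (mu ^+ 2 - _ - _, _).
have hU : on_curve U := third_point_on h2 s1.
have hW : on_curve W := third_point_on h2 s2.
have neU : ~~ ((la ^+ 2 - x2 - x1 == x3) && ((la * (x2 - (la ^+ 2 - x2 - x1)) - y2) == - y3)).
  by rewrite (negPf nU).
have neW : ~~ ((mu ^+ 2 - x2 - x3 == x1) && ((mu * (x2 - (mu ^+ 2 - x2 - x3)) - y2) == - y1)).
  by rewrite (negPf nW).
rewrite (padd_comm h1 hW).
have [t1 ht1] := slope_exists hU h3 neU.
have [t2 ht2] := slope_exists hW h1 neW.
rewrite (padd_slope neU ht1) (padd_slope neW ht2).
have dU : x3 - (la ^+ 2 - x2 - x1) != 0 by rewrite subr_eq0 eq_sym.
have dW : x1 - (mu ^+ 2 - x2 - x3) != 0 by rewrite subr_eq0 eq_sym.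
have e1 : t1 = (y3 - (la * (x2 - (la ^+ 2 - x2 - x1)) - y2)) / (x3 - (la ^+ 2 - x2 - x1)).
  by case: ht1 => -> _; field.
have e2 : t2 = (y1 - (mu * (x2 - (mu ^+ 2 - x2 - x3)) - y2)) / (x1 - (mu ^+ 2 - x2 - x3)).
  by case: ht2 => -> _; field.
(* Subtracting the two slope relations at the middle point removes the curve coefficient and leaves
   [y2] rational in the abscissae and the slopes; after substitution the identity is one between
   free variables. *)
have ey : y2 = ((x1 - x2) ^+ 2 - (x3 - x2) ^+ 2 + 3%:R * x2 * (x1 - x3) - la ^+ 2 * (x1 - x2) + mu ^+ 2 * (x3 - x2)) / (2%:R * (la - mu)).
  apply: (mulIf (mulf_neq0 k2 d)); rewrite divfK ?mulf_neq0 //.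
  rewrite (_ : y2 * _ = (la ^+ 2 * (x1 - x2) + 2%:R * y2 * la) - (mu ^+ 2 * (x3 - x2) + 2%:R * y2 * mu) - la ^+ 2 * (x1 - x2) + mu ^+ 2 * (x3 - x2)); last by ring.
  by case: s1 s2 => [_ ->] [_ ->]; ring.
case: s1 s2 => [ey1 _] [ey3 _].
congr (Some (_, _)).
- rewrite e1 e2 ey1 ey3 ey; field.
  by rewrite k2 d dU dW.
- rewrite e1 e2 ey1 ey3 ey; field.
  by rewrite k2 d dU dW.
Qed.

(** What remains of associativity when the first two summands are opposite. *)
Lemma padd_cancel_affine x1 y1 x3 y3 mu :
  on_curve (Some (x1, y1)) -> on_curve (Some (x3, y3)) ->
  is_slope x1 (- y1) x3 y3 mu -> x1 != x3 ->
  mu ^+ 2 - x1 - x3 != x1 ->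
  padd E (Some (x1, y1)) (padd E (Some (x1, - y1)) (Some (x3, y3)))
  = Some (x3, y3).
Proof.
move=> h1 h3 s n13 nW.
have h1' : on_curve (Some (x1, - y1)) by move: h1; rewrite /= sqrrN.
have ne2 : ~~ ((x1 == x3) && (- y1 == - y3)) by rewrite (negPf n13).
rewrite (padd_slope ne2 s).
have hW := third_point_on h1' s.
have nW' : ~~ ((x1 == mu ^+ 2 - x1 - x3) && (y1 == - (mu * (x1 - (mu ^+ 2 - x1 - x3)) - - y1))).
  by rewrite eq_sym (negPf nW).
have [t ht] := slope_exists h1 hW nW'.
rewrite (padd_slope nW' ht).
have d : mu ^+ 2 - x1 - x3 - x1 != 0 by rewrite subr_eq0.
have -> : t = - mu.
  case: ht => e _; apply: (mulIf d); apply: (addrI y1); rewrite -e; ring.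
case: s => -> _; congr (Some (_, _)); ring.
Qed.

End GroupLawFormulas.

(** * Points as a type, and properties of almost all points *)

Record good_char (k : fieldType) : Prop :=
  GoodChar { char_ne2 : (2%:R : k) != 0; char_ne3 : (3%:R : k) != 0 }.

(** Carrying [ch] in the type lets the group structure, whose laws depend on the characteristic, be
    a canonical instance. *)
Definition ept (k : closedFieldType) (ch : good_char k) (E : curve k) : Type :=
  {P : pt k | on_curve E P}.

HB.instance Definition _ (k : closedFieldType) (ch : good_char k) (E : curve k) :=
  Choice.copy (ept ch E) {P : option (k * k) | on_curve E P}.

Lemma roots_seq (k : closedFieldType) (D : {poly k}) :
  D != 0 -> exists r : seq k, forall z, root D z -> z \in r.
Proof.
move=> D0; have [r e] := closed_field_poly_normal D; exists r => z.
by rewrite e rootZ ?lead_coef_eq0 // root_prod_XsubC.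
Qed.

(** A root of 1 plus the product of the [X - z] over [r] lies outside [r]. *)
Lemma notin_seq (k : closedFieldType) (r : seq k) : exists z : k, z \notin r.
Proof.
case: r => [|x r]; first by exists 0.
set p := \prod_(z <- x :: r) ('X - z%:P) + 1.
have sp : size p != 1%N.
  rewrite /p size_polyDl size_prod_XsubC ?size_poly1 //.
have [z rz] := closed_rootP p sp; exists z; apply/negP => zr.
move: rz; rewrite /root /p hornerD hornerC.
move: zr; rewrite -root_prod_XsubC => /eqP ->.
by rewrite add0r oner_eq0.
Qed.

Lemma sqrt_exists (k : closedFieldType) (c : k) : exists y, y ^+ 2 = c.
Proof.
have sp : size ('X^2 - c%:P) != 1%N by rewrite size_XnsubC.
have [y] := closed_rootP _ sp.
by rewrite /root !hornerE subr_eq0 => /eqP; exists y.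
Qed.

(* Locked, so that rewriting with hornerE does not unfold it. *)
HB.lock Definition cubic (k : fieldType) (E : curve k) : {poly k} :=
  'X^3 + coefA E *: 'X + (Defs.coefB E)%:P.

Section Points.
Variables (k : closedFieldType) (ch : good_char k) (E : curve k).
Local Notation a := (coefA E).
Local Notation b := (Defs.coefB E).
Local Notation ept := (ept ch E).
Local Notation cubic := (cubic E).

(** The default 0 at infinity keeps [xc] even and [yc] odd at every point. *)
Definition xc (P : ept) : k := if sval P is Some xy then xy.1 else 0.
Definition yc (P : ept) : k := if sval P is Some xy then xy.2 else 0.

Definition ept0 : ept := exist _ None isT.
Definition ept_opp (P : ept) : ept := exist _ (pneg (sval P)) (pneg_on (svalP P)).
Definition ept_add (P Q : ept) : ept :=
  exist _ (padd E (sval P) (sval Q)) (padd_on (char_ne2 ch) (svalP P) (svalP Q)).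

Lemma cubicE z : cubic.[z] = z ^+ 3 + a * z + b.
Proof. by rewrite cubic.unlock !hornerE. Qed.

Lemma size_cubic : size cubic = 4.
Proof.
rewrite cubic.unlock -addrA size_polyDl ?size_polyXn //.
rewrite (leq_ltn_trans (size_polyD _ _)) // gtn_max.
rewrite (leq_ltn_trans (size_scale_leq _ _)) ?size_polyX //.
by rewrite (leq_ltn_trans (size_polyC_leq1 _)).
Qed.

Lemma cubic_neq0 : cubic != 0.
Proof. by rewrite -size_poly_eq0 size_cubic. Qed.

Lemma ept_inj (P Q : ept) : sval P = sval Q -> P = Q.
Proof. exact: val_inj. Qed.

Lemma ept_eq (P Q : ept) : P != ept0 -> Q != ept0 -> xc P = xc Q -> yc P = yc Q -> P = Q.
Proof.
case: P Q => [[[x y]|] hP] [[[x' y']|] hQ] //= _ _; rewrite /xc /yc /=.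
by move=> ex ey; apply: ept_inj; rewrite /= ex ey.
Qed.

Lemma eptS (P : ept) : P != ept0 -> sval P = Some (xc P, yc P).
Proof.
by case: P => [[[x y]|] hP].
Qed.

Lemma on_curve_xy (P : ept) : P != ept0 -> on_curve E (Some (xc P, yc P)).
Proof. by move=> /eptS <-; exact: (svalP P). Qed.

Lemma ycE (P : ept) : P != ept0 -> yc P ^+ 2 = cubic.[xc P].
Proof. by move=> /on_curve_xy /eqP ->; rewrite cubicE. Qed.

Lemma ept_of_xy (x y : k) : y ^+ 2 = cubic.[x] ->
  exists P : ept, [/\ P != ept0, xc P = x & yc P = y].
Proof.
rewrite cubicE => /eqP h.
by exists (exist _ (Some (x, y)) h : ept).
Qed.

Lemma xc_surj (x : k) : exists P : ept, P != ept0 /\ xc P = x.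
Proof.
have [y hy] := sqrt_exists cubic.[x].
by have [P [? ? ?]] := ept_of_xy hy; exists P.
Qed.

Lemma xc_opp P : xc (ept_opp P) = xc P.
Proof. by case: P => [[[x y]|] hP]. Qed.

Lemma yc_opp P : yc (ept_opp P) = - yc P.
Proof. by case: P => [[[x y]|] hP] //=; rewrite /yc /= oppr0. Qed.

Lemma ept_opp0 P : (ept_opp P == ept0) = (P == ept0).
Proof. by case: P => [[[x y]|] hP]. Qed.

Lemma xc_eq (P Q : ept) : P != ept0 -> Q != ept0 -> xc P = xc Q ->
  P = Q \/ P = ept_opp Q.
Proof.
move=> hP hQ e; have := ycE hP; rewrite e -ycE // => /eqP.
rewrite eqf_sqr => /orP[] /eqP ey; [left | right]; apply: ept_eq => //.
- by rewrite ept_opp0.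
- by rewrite xc_opp.
- by rewrite yc_opp.
Qed.

(** The substitute for a generic point: by [ae_and] and [ae_ex], finitely many properties that hold
    almost everywhere hold together at some point. *)
Definition ae (Q : ept -> Prop) := exists s : seq ept, forall P, P \notin s -> Q P.

Lemma ae_and (Q R : ept -> Prop) : ae Q -> ae R -> ae (fun P => Q P /\ R P).
Proof.
move=> [s hs] [t ht]; exists (s ++ t) => P.
by rewrite mem_cat negb_or => /andP[/hs ? /ht ?].
Qed.

Lemma ae_mono (Q R : ept -> Prop) : (forall P, Q P -> R P) -> ae Q -> ae R.
Proof. by move=> h [s hs]; exists s => P /hs /h. Qed.

Lemma ae_mono2 (Q1 Q2 R : ept -> Prop) :
  (forall P, Q1 P -> Q2 P -> R P) -> ae Q1 -> ae Q2 -> ae R.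
Proof. by move=> h h1 h2; apply: ae_mono (ae_and h1 h2) => P [/h]; apply. Qed.

Lemma ae_mono3 (Q1 Q2 Q3 R : ept -> Prop) :
  (forall P, Q1 P -> Q2 P -> Q3 P -> R P) -> ae Q1 -> ae Q2 -> ae Q3 -> ae R.
Proof.
move=> h h1 h2 h3; apply: ae_mono (ae_and (ae_and h1 h2) h3) => P [[? ?] ?].
exact: h.
Qed.

Lemma ae_all (Q : ept -> Prop) : (forall P, Q P) -> ae Q.
Proof. by exists [::]. Qed.

Lemma ae_neq (R : ept) : ae (fun P => P != R).
Proof. by exists [:: R] => P; rewrite inE. Qed.

Lemma ae_notin (s : seq ept) : ae (fun P => P \notin s).
Proof. by exists s. Qed.

Lemma ae_xc (D : {poly k}) : D != 0 -> ae (fun P => D.[xc P] != 0).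
Proof.
move=> D0; have [r hr] := roots_seq D0.
have [lift hl] := choice xc_surj.
exists (ept0 :: map lift r ++ map (fun x => ept_opp (lift x)) r) => P.
rewrite inE mem_cat !negb_or => /and3P[P0 h1 h2]; apply/negP => hD.
have xr := hr _ hD.
have [l0 lx] := hl (xc P).
have [e|e] := xc_eq P0 l0 (esym lx).
- by move/negP: h1; apply; rewrite e; exact: map_f.
- by move/negP: h2; apply; rewrite e; exact: (map_f (fun x => ept_opp (lift x))).
Qed.

(** This is the norm of A + B y down to k(x). The degree of [A ^+ 2] is even and that of
    [B ^+ 2 * cubic] is odd, so they cannot cancel. *)
Lemma norm_neq0 (A B : {poly k}) : (A != 0) || (B != 0) ->
  A ^+ 2 - B ^+ 2 * cubic != 0.
Proof.
have [->|B0 _] := eqVneq B 0.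
  by rewrite orbF expr0n /= mul0r subr0 => A0; rewrite expf_neq0.
rewrite subr_eq0; apply/negP => /eqP e.
have A0 : A != 0.
  apply: contra B0 => /eqP A0; move: e; rewrite A0 expr0n /= => /esym/eqP.
  by rewrite mulf_eq0 (negPf cubic_neq0) orbF sqrf_eq0.
have : size (A ^+ 2) = size (B ^+ 2 * cubic) by rewrite e.
rewrite !expr2 !size_mul ?mulf_neq0 ?cubic_neq0 // size_cubic.
have := A0; rewrite -size_poly_gt0; have := B0; rewrite -size_poly_gt0.
case: (size A) => // m; case: (size B) => // n _ _.
rewrite !addSn !addnS /= => /(congr1 odd).
by rewrite /= !oddD !addbb.
Qed.

Lemma ae_poly (A B : {poly k}) : (A != 0) || (B != 0) ->
  ae (fun P => A.[xc P] + B.[xc P] * yc P != 0).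
Proof.
move=> h; have := ae_and (ae_neq ept0) (ae_xc (norm_neq0 h)).
apply: ae_mono => P [P0]; rewrite !hornerE; apply: contra => /eqP e.
by rewrite -ycE // -exprMn subr_sqr e mulr0.
Qed.

Lemma ae_ex (Q : ept -> Prop) : ae Q -> exists P, Q P.
Proof.
move=> [s hs]; have [z hz] := notin_seq (map xc s).
have [P [_ e]] := xc_surj z; exists P; apply: hs.
by apply: contra hz => Ps; rewrite -e map_f.
Qed.

End Points.

Arguments ae {k ch E}.
Arguments ept0 {k ch E}.

(** * Associativity from generic points *)

Section Group.
Variables (k : closedFieldType) (ch : good_char k) (E : curve k).
Local Notation a := (coefA E).
Local Notation b := (Defs.coefB E).
Local Notation ept := (ept ch E).
Local Notation k2 := (char_ne2 ch).
Local Notation fE := (cubic E).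
Implicit Types P Q T : ept.

Lemma cubic_simple z : fE.[z] = 0 -> 3%:R * z ^+ 2 + a != 0.
Proof.
rewrite cubicE => h; apply: contra (smooth E) => /eqP h2.
have -> : a = - (3%:R * z ^+ 2) by apply/eqP; rewrite -addr_eq0 addrC h2.
have -> : b = 2%:R * z ^+ 3.
  have -> : b = (z ^+ 3 + a * z + b) - (3%:R * z ^+ 2 + a) * z + 2%:R * z ^+ 3 by ring.
  by rewrite h h2 mul0r subrr add0r.
by apply/eqP; ring.
Qed.

Lemma cubic_deriv z : fE^`().[z] = 3%:R * z ^+ 2 + a.
Proof. rewrite cubic.unlock !derivE !hornerE /=. ring. Qed.

(** For T not above [x2], the excluded equality says that Q + T has abscissa [x1], where Q is
    [(x2, y2)]. The function A + B y expressing it is nonzero: B is [- 2 y2], and if [y2 = 0] then A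
    = 0 would give the cubic a double root at [x2]. *)
Lemma slope_ae x2 y2 x1 : on_curve E (Some (x2, y2)) ->
  ae (fun T => T != ept0 -> (yc T - y2) ^+ 2 != (xc T + x1 + x2) * (xc T - x2) ^+ 2).
Proof.
move=> /eqP; rewrite -cubicE => h.
pose A : {poly k} := fE + (y2 ^+ 2)%:P - ('X + (x1 + x2)%:P) * ('X - x2%:P) ^+ 2.
pose B : {poly k} := (- (2%:R * y2))%:P.
have nz : (A != 0) || (B != 0).
  have [B0|] := eqVneq B 0; last by rewrite orbT.
  have y0 : y2 = 0.
    move/eqP: B0; rewrite polyC_eq0 oppr_eq0 mulf_eq0 (negPf k2) /=.
    by move/eqP.
  rewrite orbF; apply/negP => A0.
  have := cubic_simple (z := x2); rewrite -h y0 expr0n /= => /(_ erefl).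
  rewrite -cubic_deriv => /negP; apply; apply/eqP.
  have -> : fE = ('X + (x1 + x2)%:P) * ('X - x2%:P) ^+ 2.
    by apply/eqP; move: A0; rewrite /A y0 expr0n /= polyC0 addr0 subr_eq0.
  rewrite !derivE !hornerE /=; ring.
apply: ae_mono (ae_poly ch E nz) => T hT T0; apply: contra hT => /eqP e.
rewrite /A /B !hornerE -ycE //.
apply/eqP.
rewrite /=; transitivity ((yc T - y2) ^+ 2 - (xc T + x1 + x2) * (xc T - x2) ^+ 2); first by ring.
by rewrite e subrr.
Qed.

Lemma ae_neqxc (z : k) : ae (fun T => z != xc T).
Proof.
have D0 : 'X - z%:P != 0 by rewrite polyXsubC_eq0.
by apply: ae_mono (ae_xc ch E D0) => T; rewrite !hornerE subr_eq0 eq_sym.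
Qed.

Lemma ae_noncollinear x2 y2 la :
  ae (fun T => yc T != y2 + la * (xc T - x2)).
Proof.
have nz : ((- (y2%:P + la%:P * ('X - x2%:P))) != 0) || ((1 : {poly k}) != 0).
  by rewrite oner_neq0 orbT.
apply: ae_mono (ae_poly ch E nz) => T; rewrite !hornerE /=.
by apply: contra => /eqP ->; apply/eqP; ring.
Qed.

(** For fixed P and Q only finitely many T are in degenerate position; for the others the affine
    formulas apply. *)
Lemma ept_add_gen P Q : ae (fun T =>
  ept_add (ept_add P Q) T = ept_add P (ept_add Q T)).
Proof.
have [-> |P0] := eqVneq P ept0.
  by apply: ae_all => T; apply: ept_inj => /=; case: (padd _ (sval Q) _).
have [-> |Q0] := eqVneq Q ept0.
  apply: ae_all => T; apply: ept_inj => /=.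
  by case: (sval P) => [[? ?]|].
pose x1 := xc P; pose y1 := yc P; pose x2 := xc Q; pose y2 := yc Q.
have h1 := on_curve_xy P0; have h2 := on_curve_xy Q0.
have := slope_ae x1 h2.
have [/andP[/eqP e1 /eqP e2]|ne] := boolP ((x2 == x1) && (y2 == - y1)).
  move=> h; have := ae_and (ae_neqxc x2) (ae_neq ept0).
  apply: (ae_mono2 _ h) => T h3 [nT T0].
  apply: ept_inj => /=.
  rewrite (eptS P0) (eptS Q0) (eptS T0) -/x1 -/x2 -/y1 -/y2 e1 e2.
  have -> : padd E (Some (x1, y1)) (Some (x1, - y1)) = None.
    by rewrite /padd opprK !eqxx.
  rewrite [padd E None _]/=.
  have hT := on_curve_xy T0.
  have n : ~~ ((x2 == xc T) && (y2 == - yc T)) by rewrite (negPf nT).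
  have [mu hmu] := slope_exists k2 h2 hT n.
  have hmu' := hmu; rewrite -/x2 -/y2 e1 e2 in hmu'.
  rewrite (padd_cancel_affine k2 h1 hT hmu') //; first by rewrite -/x1 -e1.
  have := h3 T0; apply: contra => /eqP em; case: hmu => -> _.
  apply/eqP.
  rewrite -/x2 -/y2 (_ : xc T + x1 + x2 = mu ^+ 2); first by ring.
  by move/eqP: em; rewrite !subr_eq => /eqP ->; rewrite e1 /x1; ring.
have [la hla] := slope_exists k2 h2 h1 ne.
have hc := ae_noncollinear x2 y2 la.
have hU := ae_neqxc (la ^+ 2 - x2 - x1).
move=> h; have := ae_and (ae_and (ae_neqxc x2) (ae_neq ept0)) (ae_and hc hU).
apply: (ae_mono2 _ h) => T h3 [[nT T0] [nc nU]].
apply: ept_inj => /=; rewrite (eptS P0) (eptS Q0) (eptS T0).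
have hT := on_curve_xy T0.
have n : ~~ ((x2 == xc T) && (y2 == - yc T)) by rewrite (negPf nT).
have [mu hmu] := slope_exists k2 h2 hT n.
apply: (padd_assoc_affine k2 h1 h2 hla hmu) => //.
- apply: contra nc => /eqP ->; case: hmu => -> _; exact: eqxx.
- have := h3 T0; apply: contra => /eqP em; case: hmu => -> _.
  rewrite (_ : xc T + x1 + x2 = mu ^+ 2); last first.
    by move/eqP: em; rewrite !subr_eq => /eqP ->; rewrite /x1 /x2; ring.
  apply/eqP; rewrite /x2 /y2; ring.
Qed.

Lemma ept_addC : commutative (@ept_add k ch E).
Proof.
move=> P Q; apply: ept_inj => /=.
exact: padd_comm k2 _ _ (svalP P) (svalP Q).
Qed.

Lemma ept_add0 : left_id ept0 (@ept_add k ch E).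
Proof. by move=> P; apply: ept_inj. Qed.

Lemma ept_addN : left_inverse ept0 (@ept_opp k ch E) (@ept_add k ch E).
Proof. by move=> P; rewrite ept_addC; apply: ept_inj; rewrite /= paddN. Qed.

Lemma ept_add_eq0 P Q : ept_add P Q = ept0 -> Q = ept_opp P.
Proof.
move=> /(congr1 sval) h; apply: ept_inj => /=.
exact: padd_None k2 _ _ (svalP P) (svalP Q) h.
Qed.

(** If R + T lies in the exceptional list, then T = -R + (R + T) lies in its translate by -R. Only
    the generic associativity of -R, R, T is used, associativity itself being still to be proved. *)
Lemma ept_add_preimage R (Q : ept -> Prop) : ae Q -> ae (fun T => Q (ept_add R T)).
Proof.
move=> [s hs].
have h := ept_add_gen (ept_opp R) R.
have := ae_notin (map (ept_add (ept_opp R)) s).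
apply: (ae_mono2 _ h) => T; rewrite ept_addN ept_add0 => e nT.
by apply: hs; apply: contra nT => h2; rewrite e map_f.
Qed.

Lemma ae_yc_neq0 : ae (fun T => T != ept0 -> yc T != 0).
Proof.
have nz : ((0 : {poly k}) != 0) || ((1 : {poly k}) != 0) by rewrite oner_neq0 orbT.
by apply: ae_mono (ae_poly ch E nz) => T; rewrite !hornerE.
Qed.

(** If the sum has abscissa [xc T], the addition formula gives it the ordinate [- yc T]; so a fixed
    T has [yc T = 0]. *)
Lemma ept_translate_fix Q : ae (fun T => ept_add Q T = T -> Q = ept0).
Proof.
have [->|Q0] := eqVneq Q ept0; first exact: ae_all.
have := ae_and (ae_and (ae_neq ept0) ae_yc_neq0) (ae_neqxc (xc Q)).
apply: ae_mono => T [[T0 /(_ T0) yT nT]] /(congr1 sval) /=.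
rewrite (eptS Q0) (eptS T0).
have n : ~~ ((xc Q == xc T) && (yc Q == - yc T)) by rewrite (negPf nT).
have [s hs] := slope_exists k2 (on_curve_xy Q0) (on_curve_xy T0) n.
rewrite (padd_slope k2 n hs); case: hs => ey _ [ex ey2].
suff : 2%:R * yc T = 0 by move/eqP; rewrite mulf_eq0 (negPf yT) (negPf k2).
have {1}-> : 2%:R * yc T = yc T + yc T by ring.
by rewrite -{1}ey2 {1}ey ex; ring.
Qed.

(** Let A and B be the two bracketings. Four generic associativities give A + T = B + T for almost
    all T; then (-A + B) + T = T, and [ept_translate_fix] forces -A + B = 0. *)
Lemma ept_addA : associative (@ept_add k ch E).
Proof.
move=> P Q R; set A := ept_add P _; set B := ept_add _ R.
have e : ae (fun T => ept_add A T = ept_add B T).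
  have g1 := ept_add_gen (ept_add P Q) R.
  have g2 := ept_add_preimage R (ept_add_gen P Q).
  have g3 := ept_add_gen Q R.
  have g4 := ept_add_gen P (ept_add Q R).
  apply: ae_mono (ae_and (ae_and g1 g2) (ae_and g3 g4)) => T [[e1 e2] [e3 e4]].
  by rewrite /A /B e1 e2 e4 e3.
have [T [[eT g1] [g2 fT]]] := ae_ex (ae_and (ae_and e (ept_add_gen (ept_opp A) A))
   (ae_and (ept_add_gen (ept_opp A) B) (ept_translate_fix (ept_add (ept_opp A) B)))).
have : ept_add (ept_opp A) B = ept0.
  by apply: fT; rewrite g2 -eT -g1 ept_addN ept_add0.
move=> /ept_add_eq0 ->; apply: ept_inj => /=.
by case: (padd _ _ _) => [[x y]|] //=; rewrite opprK.
Qed.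

HB.instance Definition _ :=
  GRing.isZmodule.Build ept ept_addA ept_addC ept_add0 ept_addN.

Lemma ept_addE P Q : sval (P + Q) = padd E (sval P) (sval Q).
Proof. by []. Qed.

Lemma xcN P : xc (- P) = xc P. Proof. exact: xc_opp. Qed.
Lemma ycN P : yc (- P) = - yc P. Proof. exact: yc_opp. Qed.
End Group.

(** * Rational functions on a curve *)

Section AddFormulas.
Variables (k : closedFieldType) (ch : good_char k) (E : curve k).
Implicit Types P Q : ept ch E.

Lemma ept_add_secant P Q : P != 0 -> Q != 0 -> xc P != xc Q ->
  let s := (yc Q - yc P) / (xc Q - xc P) in
  let x := s ^+ 2 - xc P - xc Q in
  [/\ P + Q != 0, xc (P + Q) = x & yc (P + Q) = s * (xc P - x) - yc P].
Proof.
move=> P0 Q0 n s x.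
have e : sval (P + Q) = Some (x, s * (xc P - x) - yc P).
  by rewrite ept_addE (eptS P0) (eptS Q0) /padd (negPf n).
rewrite /xc /yc e; split => //.
by apply/eqP => h; move: e; rewrite h.
Qed.

Lemma ept_double P : P != 0 -> yc P != 0 ->
  let s := (3%:R * xc P ^+ 2 + coefA E) / (2%:R * yc P) in
  let x := s ^+ 2 - xc P - xc P in
  [/\ P + P != 0, xc (P + P) = x & yc (P + P) = s * (xc P - x) - yc P].
Proof.
move=> P0 y0 s x.
have ny : (yc P == - yc P) = false.
  apply/negP; rewrite -addr_eq0 -mulr2n -mulr_natl mulf_eq0 (negPf y0).
  by rewrite (negPf (char_ne2 ch)).
have e : sval (P + P) = Some (x, s * (xc P - x) - yc P).
  by rewrite ept_addE (eptS P0) /padd ny eqxx.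
rewrite /xc /yc e; split => //.
by apply/eqP => h; move: e; rewrite h.
Qed.

Lemma ept_xc_eq P Q : P != 0 -> Q != 0 -> xc P = xc Q -> P = Q \/ P = - Q.
Proof. exact: xc_eq. Qed.

End AddFormulas.

Section RationalFunctions.
Variables (k : closedFieldType) (ch : good_char k) (E : curve k).
Local Notation ept := (ept ch E).
Implicit Types (P Q : ept) (g h : ept -> k).

(** The function field k(x) + k(x) y, seen through functions on points. Its subfield k(x) is [ratx],
    which consists of the even functions ([ratf_even]). *)
Definition ratf g := exists A B D : {poly k}, D != 0 /\
  ae (fun P => g P = (A.[xc P] + B.[xc P] * yc P) / D.[xc P]).

Definition ratx g := exists A D : {poly k}, D != 0 /\
  ae (fun P => g P = A.[xc P] / D.[xc P]).

Lemma ae_opp (Q : ept -> Prop) : ae Q -> ae (fun P => Q (- P)).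
Proof.
move=> [s hs]; exists (map -%R s) => P hP; apply: hs.
by apply: contra hP => h; rewrite -[P]opprK map_f.
Qed.

Lemma ae_add R (Q : ept -> Prop) : ae Q -> ae (fun P => Q (R + P)).
Proof. exact: ept_add_preimage. Qed.

Lemma ratf_eq g h : ae (fun P => g P = h P) -> ratf g -> ratf h.
Proof.
move=> e [A [B [D [D0 hg]]]]; exists A, B, D; split => //.
by apply: ae_mono2 e hg => P ->.
Qed.

Lemma ratx_ratf g : ratx g -> ratf g.
Proof.
move=> [A [D [D0 hg]]]; exists A, 0, D; split => //.
by apply: ae_mono hg => P ->; rewrite horner0 mul0r addr0.
Qed.

Lemma ratxC c : ratx (fun=> c).
Proof.
exists c%:P, 1; split; first exact: oner_neq0.
by apply: ae_all => P; rewrite !hornerE divr1.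
Qed.

Lemma ratfC c : ratf (fun=> c). Proof. exact: ratx_ratf (ratxC c). Qed.

Lemma ratx_xc : ratx (@xc k ch E).
Proof.
exists 'X, 1; split; first exact: oner_neq0.
by apply: ae_all => P; rewrite !hornerE divr1.
Qed.

Lemma ratf_xc : ratf (@xc k ch E). Proof. exact: ratx_ratf ratx_xc. Qed.

Lemma ratf_yc : ratf (@yc k ch E).
Proof.
exists 0, 1, 1; split; first exact: oner_neq0.
by apply: ae_all => P; rewrite !hornerE divr1.
Qed.

Lemma ratfD g h : ratf g -> ratf h -> ratf (fun P => g P + h P).
Proof.
move=> [A [B [D [D0 hg]]]] [A' [B' [D' [D0' hh]]]].
exists (A * D' + A' * D), (B * D' + B' * D), (D * D'); split.
  by rewrite mulf_neq0.
apply: ae_mono2 (ae_and hg hh) (ae_and (ae_xc ch E D0) (ae_xc ch E D0')).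
move=> P [-> ->] [d d']; rewrite !hornerE /=; field.
by rewrite d d'.
Qed.

Lemma ratfM g h : ratf g -> ratf h -> ratf (fun P => g P * h P).
Proof.
move=> [A [B [D [D0 hg]]]] [A' [B' [D' [D0' hh]]]].
exists (A * A' + B * B' * cubic E), (A * B' + A' * B), (D * D'); split.
  by rewrite mulf_neq0.
apply: ae_mono2 (ae_and hg hh) (ae_and (ae_neq ept0) (ae_and (ae_xc ch E D0) (ae_xc ch E D0'))).
move=> P [-> ->] [P0 [d d']]; rewrite !hornerM !hornerD !hornerM -ycE //; field.
by rewrite d d'.
Qed.

Lemma ratfN g : ratf g -> ratf (fun P => - g P).
Proof.
move=> hg; apply: ratf_eq (ratfM (ratfC (-1)) hg).
by apply: ae_all => P; rewrite mulN1r.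
Qed.

Lemma ratfB g h : ratf g -> ratf h -> ratf (fun P => g P - h P).
Proof. by move=> hg hh; apply: ratfD hg (ratfN hh). Qed.

(** Plays the part of the field property of the function field: inverses, sums of isogenies and
    constancy arguments all split on it. *)
Lemma ratf_dichotomy g : ratf g -> ae (fun P => g P = 0) \/ ae (fun P => g P != 0).
Proof.
move=> [A [B [D [D0 hg]]]].
have [nz|] := boolP ((A != 0) || (B != 0)).
  right; apply: ae_mono3 hg (ae_poly ch E nz) (ae_xc ch E D0).
  by move=> P -> h1 h2; rewrite mulf_neq0 ?invr_eq0.
rewrite negb_or !negbK => /andP[/eqP A0 /eqP B0]; left.
by apply: ae_mono hg => P ->; rewrite A0 B0 !horner0 !mul0r addr0 mul0r.
Qed.

Lemma ratfV g : ratf g -> ratf (fun P => (g P)^-1).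
Proof.
move=> hg; have [z|nz] := ratf_dichotomy hg.
  by apply: ratf_eq (ratfC 0); apply: ae_mono z => P ->; rewrite invr0.
case: hg => [A [B [D [D0 hg]]]].
have nzAB : (A != 0) || (B != 0).
  have [P [+ gP]] := ae_ex (ae_and hg nz).
  apply: contra_eqT; rewrite negb_or !negbK => /andP[/eqP -> /eqP ->].
  by rewrite !horner0 !mul0r addr0 mul0r.
(* Numerator and denominator of the inverse are multiplied by the conjugate A - B y. *)
exists (A * D), (- B * D), (A ^+ 2 - B ^+ 2 * cubic E); split.
  exact: norm_neq0.
apply: ae_mono3 hg (ae_and (ae_neq ept0) (ae_poly ch E nzAB)) (ae_and (ae_xc ch E D0) (ae_xc ch E (@norm_neq0 k E A B nzAB))).
move=> P -> [P0 n] [d]; rewrite !(hornerM, hornerD, hornerN, horner_exp) -ycE //.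
by move=> h; rewrite invf_div; field; rewrite h n.
Qed.

Lemma ratf_div g h : ratf g -> ratf h -> ratf (fun P => g P / h P).
Proof. by move=> hg hh; apply: ratfM hg (ratfV hh). Qed.

Lemma ratfX g n : ratf g -> ratf (fun P => g P ^+ n).
Proof.
move=> hg; elim: n => [|n IH]; first exact: ratfC.
by apply: ratf_eq (ratfM hg IH); apply: ae_all => P; rewrite exprS.
Qed.

Lemma ratf_horner (A : {poly k}) g : ratf g -> ratf (fun P => A.[g P]).
Proof.
move=> hg; elim/poly_ind: A => [|A c IH].
  by apply: ratf_eq (ratfC 0); apply: ae_all => P; rewrite horner0.
apply: ratf_eq (ratfD (ratfM IH hg) (ratfC c)); apply: ae_all => P.
by rewrite hornerMXaddC.
Qed.

Lemma ratf_even g : ratf g -> ae (fun P => g (- P) = g P) -> ratx g.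
Proof.
move=> [A [B [D [D0 hg]]]] ev; exists A, D; split => //.
apply: ae_mono3 hg (ae_opp hg) (ae_and ev (ae_xc ch E D0)) => P h1 h2 [e d].
have k2 := char_ne2 ch.
have -> : g P = (g P + g (- P)) / 2%:R by rewrite e; field.
by rewrite h1 h2 xcN ycN; field; rewrite d k2.
Qed.

Lemma ratf_odd g : ratf g -> ae (fun P => g (- P) = - g P) ->
  ratx (fun P => g P / yc P).
Proof.
move=> hg od; apply: ratf_even; first by apply: ratf_div hg ratf_yc.
by apply: ae_mono od => P ->; rewrite ycN invrN mulrNN.
Qed.

Lemma ratx_reduce g : ratx g -> exists A D : {poly k},
  [/\ coprimep A D, D != 0 & ae (fun P => D.[xc P] != 0 /\ g P = A.[xc P] / D.[xc P])].
Proof.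
move=> [A [D [D0 hg]]].
pose d := gcdp A D.
have d0 : d != 0 by rewrite gcdp_eq0 negb_and D0 orbT.
have eA : A = A %/ d * d by rewrite divpK // dvdp_gcdl.
have eD : D = D %/ d * d by rewrite divpK // dvdp_gcdr.
exists (A %/ d), (D %/ d); split.
- by rewrite coprimep_div_gcd // D0 orbT.
- by apply: contra D0 => /eqP h; rewrite eD h mul0r.
- apply: ae_mono2 hg (ae_xc ch E D0) => P ->.
  have -> : A.[xc P] = (A %/ d).[xc P] * d.[xc P] by rewrite -hornerM -eA.
  have -> : D.[xc P] = (D %/ d).[xc P] * d.[xc P] by rewrite -hornerM -eD.
  rewrite mulf_eq0 negb_or => /andP[h1 h2]; split => //.
  by rewrite -mulf_div divff // mulr1.
Qed.

Lemma coprimep_fracE (A D A' D' : {poly k}) : coprimep A D -> coprimep A' D' ->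
  A * D' = A' * D -> D != 0 -> exists2 c : k, c != 0 & A = c *: A' /\ D = c *: D'.
Proof.
move=> cop cop' e D0.
have h1 : D %| D'.
  by rewrite -(@Gauss_dvdpr _ _ A) ?e ?dvdp_mull // coprimep_sym.
have h2 : D' %| D.
  by rewrite -(@Gauss_dvdpr _ _ A') -?e ?dvdp_mull // coprimep_sym.
have : D %= D' by rewrite /eqp h1 h2.
move=> /eqpP [[c1 c2] /= /andP[n1 n2] ec].
have eD : D = (c2 / c1) *: D'.
  by rewrite mulrC -scalerA -ec scalerA mulVf // scale1r.
have D'0 : D' != 0 by apply: contra D0 => /eqP h; rewrite eD h scaler0.
exists (c2 / c1); first by rewrite mulf_neq0 ?invr_eq0.
split => //; apply: (mulIf D'0); rewrite e [in LHS]eD.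
by rewrite -scalerAr scalerAl.
Qed.

Lemma ratx_unique (A D A' D' : {poly k}) : D != 0 -> D' != 0 ->
  ae (fun P : ept => A.[xc P] / D.[xc P] = A'.[xc P] / D'.[xc P]) ->
  A * D' = A' * D.
Proof.
move=> D0 D'0 h; apply/eqP; rewrite -subr_eq0; apply/negPn/negP => n.
have [P [[e n1] [n2 n3]]] := ae_ex (ae_and (ae_and h (ae_xc ch E D0)) (ae_and (ae_xc ch E D'0) (ae_xc ch E n))).
move/negP: n3; apply; rewrite hornerD hornerN !hornerM subr_eq0.
by move/eqP: e; rewrite eqr_div.
Qed.

End RationalFunctions.

(** * Isogenies *)

Section Isogenies.
Variables (k : closedFieldType) (ch : good_char k).
Local Notation ept := (ept ch).
Implicit Types E : curve k.

Definition ishom E E' (f : ept E -> ept E') := {morph f : P Q / P + Q}.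

Definition isog E E' (f : ept E -> ept E') :=
  [/\ ishom f, ae (fun P => f P != 0),
      ratf (fun P => xc (f P)) & ratf (fun P => yc (f P))].

(** With the zero map included, maps are closed under addition and endomorphisms can form a ring. *)
Definition isog0 E E' (f : ept E -> ept E') := isog f \/ f = fun=> 0.

Section Hom.
Variables (E E' : curve k) (f g : ept E -> ept E').

Lemma hom0 : ishom f -> f 0 = 0.
Proof. by move=> hf; apply: (addrI (f 0)); rewrite -hf !addr0. Qed.

Lemma homN : ishom f -> {morph f : P / - P}.
Proof. by move=> hf P; apply: (addrI (f P)); rewrite -hf !subrr hom0. Qed.

Lemma homB : ishom f -> {morph f : P Q / P - Q}.
Proof. by move=> hf P Q; rewrite hf homN. Qed.

Lemma homMn n : ishom f -> {morph f : P / P *+ n}.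
Proof.
by move=> hf P; elim: n => [|n IH]; rewrite ?mulr0n ?hom0 // !mulrS hf IH.
Qed.

Lemma hom_inj : ishom f -> (forall P, f P = 0 -> P = 0) -> injective f.
Proof.
move=> hf h P Q e; apply/eqP; rewrite -subr_eq0; apply/eqP; apply: h.
by rewrite homB // e subrr.
Qed.

Lemma isog0_hom : isog0 f -> ishom f.
Proof. by case=> [[]|->] // P Q; rewrite addr0. Qed.

(** Every P is a difference (P + T) - T of two points at which f and g agree. *)
Lemma hom_ae_eq : ishom f -> ishom g -> ae (fun P => f P = g P) -> f = g.
Proof.
move=> hf hg h; apply/funext => P.
have [T [e1 e2]] := ae_ex (ae_and h (ae_add P h)).
by apply: (addIr (f T)); rewrite -hf e2 hg e1.
Qed.

Lemma hom_ae_const Q : ishom f -> ae (fun P => f P = Q) -> f = fun=> 0.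
Proof.
move=> hf h; apply/funext => P.
have [T [e1 e2]] := ae_ex (ae_and h (ae_add P h)).
by apply: (addIr (f T)); rewrite -hf e2 e1 add0r.
Qed.

Lemma isog_not0 : isog f -> f <> fun=> 0.
Proof.
move=> [_ h _ _] e; have [P] := ae_ex h; by rewrite e eqxx.
Qed.

End Hom.

(** If x o f were c almost everywhere, y o f would take two opposite values only, hence by
    [ratf_dichotomy] one of them almost everywhere; and a homomorphism that is constant almost
    everywhere is zero. *)
Lemma isog_xc_neq E E' (f : ept E -> ept E') c :
  isog f -> ae (fun P => xc (f P) != c).
Proof.
move=> [hf nf rx ry].
have h : ratf (fun P => xc (f P) - c) by apply: ratfB rx (ratfC _ _ c).
have [z|nz] := ratf_dichotomy h; last first.
  by apply: ae_mono nz => P; rewrite subr_eq0.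
exfalso; apply: (@isog_not0 _ _ f) => //.
have [y0 hy] := sqrt_exists (cubic E').[c].
have key : ae (fun P => xc (f P) = c /\ (yc (f P) = y0 \/ yc (f P) = - y0)).
  apply: ae_mono2 z nf => P /eqP; rewrite subr_eq0 => /eqP e nP; split => //.
  by have := ycE nP; rewrite e -hy => /eqP; rewrite eqf_sqr => /orP[] /eqP; [left|right].
have const y : y ^+ 2 = (cubic E').[c] -> ae (fun P => yc (f P) = y) -> f = fun=> 0.
  move=> hy' h'; have [Q [Q0 xQ yQ]] := ept_of_xy ch hy'.
  apply: (hom_ae_const (Q := Q)) => //; apply: ae_mono3 key nf h' => P [e _] nP e'.
  by apply: ept_eq => //; rewrite ?xQ ?yQ.
have [z'|nz'] := ratf_dichotomy (ratfB ry (ratfC _ _ y0)).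
  by apply: (const y0) => //; apply: ae_mono z' => P /eqP; rewrite subr_eq0 => /eqP.
apply: (const (- y0)); first by rewrite sqrrN.
apply: ae_mono2 key nz' => P [_ [] //] -> ; by rewrite subrr eqxx.
Qed.

Lemma isog_ae_neq E E' (f : ept E -> ept E') Q : isog f -> ae (fun P => f P != Q).
Proof.
move=> hf; apply: ae_mono (isog_xc_neq (xc Q) hf) => P.
by apply: contra => /eqP ->.
Qed.

Lemma ae_isog E E' (f : ept E -> ept E') (Q : ept E' -> Prop) :
  isog f -> ae Q -> ae (fun P => Q (f P)).
Proof.
move=> hf [s hs].
suff h : ae (fun P => f P \notin s) by apply: ae_mono h => P; exact: hs.
elim: s {hs} => [|R s IH]; first exact: ae_all.
by apply: ae_mono2 (isog_ae_neq R hf) IH => P h1 h2; rewrite inE negb_or h1.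
Qed.

Lemma isog_ratf E E' (f : ept E -> ept E') (g : ept E' -> k) :
  isog f -> ratf g -> ratf (fun P => g (f P)).
Proof.
move=> hf [A [B [D [D0 hg]]]]; have [_ _ rx ry] := hf.
apply: (ratf_eq (g := fun P => (A.[xc (f P)] + B.[xc (f P)] * yc (f P)) / D.[xc (f P)])).
  by apply: ae_mono (ae_isog hf hg) => P ->.
apply: ratf_div; last exact: ratf_horner.
by apply: ratfD; [apply: ratf_horner | apply: ratfM => //; apply: ratf_horner].
Qed.

Lemma isog_comp E E' E'' (f : ept E -> ept E') (g : ept E' -> ept E'') :
  isog f -> isog g -> isog (g \o f).
Proof.
move=> hf hg; have [f1 f2 f3 f4] := hf; have [g1 g2 g3 g4] := hg.
split.
- by move=> P Q; rewrite /= f1 g1.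
- exact: ae_isog hf g2.
- exact: isog_ratf hf g3.
- exact: isog_ratf hf g4.
Qed.

Lemma isog0_comp E E' E'' (f : ept E -> ept E') (g : ept E' -> ept E'') :
  isog0 f -> isog0 g -> isog0 (g \o f).
Proof.
move=> [hf|->] [hg|eg].
- by left; apply: isog_comp.
- by right; rewrite eg.
- by right; apply/funext => P /=; case: hg => /hom0.
- by right; rewrite eg.
Qed.

Lemma isog_id E : isog (@id (ept E)).
Proof.
split => //.
- exact: ae_neq.
- exact: ratf_xc.
- exact: ratf_yc.
Qed.

Lemma isog_opp E E' (f : ept E -> ept E') : isog f -> isog (fun P => - f P).
Proof.
move=> [h1 h2 h3 h4]; split.
- by move=> P Q; rewrite h1 opprD.
- by apply: ae_mono h2 => P; rewrite oppr_eq0.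
- by apply: ratf_eq h3; apply: ae_all => P; rewrite xcN.
- by apply: ratf_eq (ratfN h4); apply: ae_all => P; rewrite ycN.
Qed.

Lemma isog0_opp E E' (f : ept E -> ept E') : isog0 f -> isog0 (fun P => - f P).
Proof.
case=> [/isog_opp|->]; first by left.
by right; apply/funext => P; rewrite oppr0.
Qed.

Lemma isog_yc_neq0 E E' (f : ept E -> ept E') : isog f -> ae (fun P => yc (f P) != 0).
Proof.
move=> hf; have h := isog_ratf hf (ratf_yc ch E').
have [z|//] := ratf_dichotomy h.
have [T [h1 [h2 h3]]] := ae_ex (ae_and z (ae_and (ae_isog hf (ae_neq (0 : ept E')))
   (ae_isog hf (@ae_yc_neq0 k ch E')))).
by have := h3 h2; rewrite h1 eqxx.
Qed.

(** By [ratf_dichotomy] either the secant formula applies generically, or f = -g, or f = g; in the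
    last case the doubling formula applies. *)
Lemma isog0_add E E' (f g : ept E -> ept E') :
  isog0 f -> isog0 g -> isog0 (fun P => f P + g P).
Proof.
move=> [hf|->] [hg|->]; first last.
- by right; apply/funext => P; rewrite addr0.
- by left; rewrite (_ : (fun P => _) = g) //; apply/funext => P; rewrite add0r.
- by left; rewrite (_ : (fun P => _) = f) //; apply/funext => P; rewrite addr0.
have [f1 f2 f3 f4] := hf; have [g1 g2 g3 g4] := hg.
have h1 : ishom (fun P => f P + g P) by move=> P Q; rewrite f1 g1 addrACA.
have [z|nz] := ratf_dichotomy (ratfB g3 f3); last first.
  pose s P := (yc (g P) - yc (f P)) / (xc (g P) - xc (f P)).
  have rs : ratf s by apply: ratf_div; apply: ratfB.
  pose x P := s P ^+ 2 - xc (f P) - xc (g P).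
  have rx : ratf x by apply: ratfB => //; apply: ratfB => //; apply: ratfX.
  have key : ae (fun P => [/\ f P + g P != 0, xc (f P + g P) = x P &
      yc (f P + g P) = s P * (xc (f P) - x P) - yc (f P)]).
    apply: ae_mono3 f2 g2 nz => P fP gP nP; apply: ept_add_secant => //.
    by apply: contra nP => /eqP ->; rewrite subrr.
  left; split => //.
  - by apply: ae_mono key => P [].
  - by apply: ratf_eq rx; apply: ae_mono key => P [_ ->].
  - apply: (ratf_eq (g := fun P => s P * (xc (f P) - x P) - yc (f P))).
      by apply: ae_mono key => P [_ _ ->].
    by apply: ratfB => //; apply: ratfM => //; apply: ratfB.
have alt : ae (fun P => f P = g P \/ f P = - g P).
  apply: ae_mono3 f2 g2 z => P fP gP /eqP; rewrite subr_eq0 => /eqP e.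
  exact: ept_xc_eq.
have [w|nw] := ratf_dichotomy (ratfB f4 g4); last first.
  right; apply: (hom_ae_const (Q := 0)) => //.
  by apply: ae_mono2 alt nw => P [] -> ; rewrite ?subrr ?eqxx // addNr.
have efg : f = g.
  apply: hom_ae_eq => //; have gy := isog_yc_neq0 hg.
  apply: ae_mono3 alt w gy => P [] // -> /eqP; rewrite ycN -opprD oppr_eq0.
  rewrite -mulr2n -mulr_natl mulf_eq0 (negPf (char_ne2 ch)) /= => /eqP ->.
  by rewrite eqxx.
left; rewrite -efg in h1 *.
pose s P := (3%:R * xc (f P) ^+ 2 + coefA E') / (2%:R * yc (f P)).
have rs : ratf s.
  apply: ratf_div; last by apply: ratfM => //; apply: ratfC.
  by apply: ratfD; [apply: ratfM; [apply: ratfC | apply: ratfX] | apply: ratfC].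
pose x P := s P ^+ 2 - xc (f P) - xc (f P).
have rx : ratf x by apply: ratfB => //; apply: ratfB => //; apply: ratfX.
have key : ae (fun P => [/\ f P + f P != 0, xc (f P + f P) = x P &
      yc (f P + f P) = s P * (xc (f P) - x P) - yc (f P)]).
  by apply: ae_mono2 f2 (isog_yc_neq0 hf) => P fP yP; apply: ept_double.
split => //.
- by apply: ae_mono key => P [].
- by apply: ratf_eq rx; apply: ae_mono key => P [_ ->].
- apply: (ratf_eq (g := fun P => s P * (xc (f P) - x P) - yc (f P))).
    by apply: ae_mono key => P [_ _ ->].
  by apply: ratfB => //; apply: ratfM => //; apply: ratfB.
Qed.

Lemma isog0_muln E n : isog0 (fun P : ept E => P *+ n).
Proof.
elim: n => [|n IH]; first by right.
have := isog0_add (or_introl (isog_id E)) IH.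
by rewrite (_ : (fun P => _) = (fun P => P *+ n.+1)) //; apply/funext => P; rewrite mulrS.
Qed.

(** x o f is even and y o f is odd, so x o f and (y o f) / y lie in k(x). *)
Lemma isog_std E E' (f : ept E -> ept E') : isog f ->
  exists r s c d : {poly k}, [/\ coprimep r s, s != 0, d != 0 &
    ae (fun P => [/\ s.[xc P] != 0, xc (f P) = r.[xc P] / s.[xc P] &
                     yc (f P) = yc P * (c.[xc P] / d.[xc P])])].
Proof.
move=> hf; have [f1 f2 f3 f4] := hf.
have := ratf_even f3; case.
  by apply: ae_all => P; rewrite (homN f1) xcN.
move=> A [D hA].
have [r [s [cop s0 hr]]] := ratx_reduce (ex_intro _ A (ex_intro _ D hA)).
have := ratf_odd f4; case.
  by apply: ae_all => P; rewrite (homN f1) ycN.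
move=> c [d [d0 hc]]; exists r, s, c, d; split => //.
apply: ae_mono2 (ae_and hr hc) (isog_yc_neq0 (isog_id E)) => P [[h1 h2] h3] h4.
by split => //; rewrite -h3 mulrC divfK.
Qed.

(** A root of [r - x(Q) s] is the abscissa of a preimage of Q or of -Q, so the image contains almost
    every point; a subgroup with finite complement is everything. *)
Lemma isog_surj E E' (f : ept E -> ept E') : isog f -> forall Q, exists P, f P = Q.
Proof.
move=> hf; have [f1 f2 f3 f4] := hf.
have [r [s [c [d [cop s0 d0 [t ht]]]]]] := isog_std hf.
have nc z : r - z *: s != 0.
  rewrite subr_eq0; apply/negP => /eqP e.
  have [P [nP hP]] := ae_ex (ae_and (isog_xc_neq z hf) (ex_intro _ t ht)).
  case: hP => h1 h2 _; move: nP; rewrite h2 e hornerZ mulfK //.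
  by rewrite eqxx.
(* If two members of the pencil were constant, r and s would both be constant, and so would x o
   f. *)
have [z0 hz0] : exists z0, forall z, z != z0 -> size (r - z *: s) != 1%N.
  have [h|/existsNP [z0 /negP hz]] := pselect (forall z, size (r - z *: s) != 1%N).
    by exists 0.
  exists z0 => z nz; apply/negP => /size_poly1P [u u0 eu].
  move: hz; rewrite negbK => /size_poly1P [v v0 ev].
  have es : s = ((v - u) / (z - z0))%:P.
    have dz : z - z0 != 0 by rewrite subr_eq0.
    have e : (z - z0) *: s = (v - u)%:P.
      by rewrite polyCB -ev -eu scalerBl opprB [r - _ + _]addrC addrA subrK.
    by rewrite mulrC polyCM mul_polyC -e scalerA mulVf // scale1r.
  have [P [nP hP]] := ae_ex (ae_and (isog_xc_neq ((u + z * s.[0]) / s.[0]) hf) (ex_intro _ t ht)).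
  case: hP => h1 h2 _; move/negP: nP; apply; rewrite h2.
  have -> : r = u%:P + z *: s by rewrite -eu subrK.
  by rewrite hornerD hornerC hornerZ es !hornerC.
have im : ae (fun Q => exists P, f P = Q).
  have hq : ae (fun Q : ept E' => xc Q \notin z0 :: map (fun P => r.[xc P] / s.[xc P]) t).
    elim: (z0 :: _) => [|w l IH]; first exact: ae_all.
    apply: ae_mono2 (ae_neqxc ch E' w) IH => Q h1 h2.
    by rewrite inE negb_or h2 eq_sym h1.
  move: f2 => [t' ht'].
  have hq' : ae (fun Q : ept E' => xc Q \notin map (fun P => r.[xc P] / s.[xc P]) t').
    elim: (map _ _) => [|w l IH]; first exact: ae_all.
    apply: ae_mono2 (ae_neqxc ch E' w) IH => Q h1 h2.
    by rewrite inE negb_or h2 eq_sym h1.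
  apply: ae_mono3 hq hq' (ae_neq (0 : ept E')) => Q.
  rewrite inE negb_or => /andP[n1 n2] n3 Q0.
  have [x rx] := closed_rootP _ (hz0 _ n1).
  move: rx; rewrite /root hornerD hornerN hornerZ subr_eq0 => /eqP rx.
  have sx : s.[x] != 0.
    apply/negP => /eqP sx; move: rx; rewrite sx mulr0 => /eqP rx.
    by have := coprimep_root cop rx; rewrite sx eqxx.
  have [P [P0 xP]] := xc_surj ch E x.
  have ex : r.[xc P] / s.[xc P] = xc Q by rewrite xP rx mulfK.
  have Pt : P \notin t by apply: contra n2 => h; rewrite -ex (map_f (fun P => r.[xc P] / s.[xc P])).
  have Pt' : P \notin t' by apply: contra n3 => h; rewrite -ex (map_f (fun P => r.[xc P] / s.[xc P])).
  have [_ e _] := ht _ Pt.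
  have [h|h] := ept_xc_eq (ht' _ Pt') Q0 (etrans e ex); first by exists P.
  by exists (- P); rewrite homN // h opprK.
move=> Q; have [T [[P1 h1] [P2 h2]]] := ae_ex (ae_and im (ae_add Q im)).
by exists (P2 - P1); rewrite homB // h1 h2 addrK.
Qed.

Lemma isog_ker_finite E E' (f : ept E -> ept E') : isog f ->
  exists s : seq (ept E), uniq s /\ forall P, (P \in s) = (f P == 0).
Proof.
move=> [_ [t ht] _ _]; exists (undup [seq P <- t | f P == 0]); split.
  exact: undup_uniq.
move=> P; rewrite mem_undup mem_filter andb_idr // => fP.
by apply: contraLR fP => /ht.
Qed.

End Isogenies.

(** * Polynomial fractions and descent *)

Section RationalFractions.
Variable k : closedFieldType.
Implicit Types (p q r s u v A D : {poly k}) (c z : k).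

(** The degree of r / s as a self-map of the projective line, when r and s are coprime. *)
Definition rdeg r s := (maxn (size r) (size s)).-1.

Definition ac (Q : k -> Prop) := exists l : seq k, forall c, c \notin l -> Q c.

Lemma ac_and (Q R : k -> Prop) : ac Q -> ac R -> ac (fun c => Q c /\ R c).
Proof.
move=> [s hs] [t ht]; exists (s ++ t) => P.
by rewrite mem_cat negb_or => /andP[/hs ? /ht ?].
Qed.

Lemma ac_mono (Q R : k -> Prop) : (forall c, Q c -> R c) -> ac Q -> ac R.
Proof. by move=> h [s hs]; exists s => c /hs /h. Qed.

Lemma ac_ex (Q : k -> Prop) : ac Q -> exists c, Q c.
Proof. by move=> [l hl]; have [c /hl] := notin_seq l; exists c. Qed.

Lemma ac_list (Q : k -> Prop) n : ac Q ->
  exists l : seq k, [/\ uniq l, size l = n & forall c, c \in l -> Q c].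
Proof.
move=> [s hs]; elim: n => [|n [l [ul sl hl]]]; first by exists [::].
have [c] := notin_seq (s ++ l); rewrite mem_cat negb_or => /andP[c1 c2].
exists (c :: l); rewrite /= c2 ul sl; split => // x.
by rewrite inE => /orP[/eqP->|/hl//]; apply: hs.
Qed.

Lemma ac_root p : p != 0 -> ac (fun c => p.[c] != 0).
Proof. by move=> /roots_seq [l hl]; exists l => c; apply: contra => /hl. Qed.

Lemma poly_eq_ae p q D : D != 0 -> (forall x, D.[x] != 0 -> p.[x] = q.[x]) -> p = q.
Proof.
move=> D0 h; apply/eqP; rewrite -subr_eq0; apply/negPn/negP => n.
have [x] := ac_ex (ac_and (ac_root D0) (ac_root n)).
by case=> /h e; rewrite hornerD hornerN e subrr eqxx.
Qed.

Lemma coprimep_rootP r s z : coprimep r s -> r.[z] = 0 -> s.[z] != 0.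
Proof. by move=> cop /eqP h; apply: coprimep_root cop _. Qed.

Lemma root_pencil r s c z : coprimep r s -> root (r - c *: s) z ->
  s.[z] != 0 /\ r.[z] / s.[z] = c.
Proof.
move=> cop; rewrite /root hornerD hornerN hornerZ subr_eq0 => /eqP e.
have sz : s.[z] != 0.
  apply/negP => /eqP sz; move: e; rewrite sz mulr0 => rz.
  by have := coprimep_rootP cop rz; rewrite sz eqxx.
by rewrite e mulfK.
Qed.

(** The only bad c is the one that cancels the two coefficients of degree [rdeg r s], which are not
    both zero. *)
Lemma size_pencil r s : (r != 0) || (s != 0) ->
  ac (fun c => size (r - c *: s) = (rdeg r s).+1).
Proof.
move=> nz; set n := rdeg r s.
have m0 : (0 < maxn (size r) (size s))%N by rewrite leq_max !size_poly_gt0.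
have en : n.+1 = maxn (size r) (size s) by rewrite /n /rdeg prednK.
have hn : (r`_n != 0) || (s`_n != 0).
  have [h|h] := leqP (size s) (size r).
    have -> : n = (size r).-1 by rewrite /n /rdeg (maxn_idPl h).
    by rewrite -/(lead_coef r) lead_coef_eq0 -size_poly_gt0 -(maxn_idPl h) m0.
  have -> : n = (size s).-1 by rewrite /n /rdeg (maxn_idPr (ltnW h)).
  by rewrite orbC -/(lead_coef s) lead_coef_eq0 -size_poly_gt0 -(maxn_idPr (ltnW h)) m0.
exists [:: r`_n / s`_n] => c; rewrite inE => hc.
apply/eqP; rewrite eqn_leq; apply/andP; split.
  rewrite (leq_trans (size_polyD _ _)) // size_polyN en geq_max leq_maxl /=.
  by rewrite (leq_trans (size_scale_leq _ _)) // leq_maxr.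
rewrite ltnNge; apply/negP => h.
have := nth_default 0 h; rewrite coefB coefZ => /eqP; rewrite subr_eq0 => /eqP e.
move: hn; rewrite e; have [->|sn _] := eqVneq s`_n 0; first by rewrite mulr0 eqxx.
by move: hc; rewrite e mulfK // eqxx.
Qed.

Lemma pencil_factor r s : (r != 0) || (s != 0) ->
  ac (fun c => exists rho : seq k, exists2 a : k, a != 0 &
    size rho = rdeg r s /\ r - c *: s = a *: \prod_(z <- rho) ('X - z%:P)).
Proof.
move=> nz; apply: ac_mono (size_pencil nz) => c hc.
have [rho e] := closed_field_poly_normal (r - c *: s).
have n0 : r - c *: s != 0 by rewrite -size_poly_eq0 hc.
exists rho, (lead_coef (r - c *: s)); first by rewrite lead_coef_eq0.
split => //; move: hc; rewrite {1}e size_scale ?lead_coef_eq0 //.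
by rewrite size_prod_XsubC => [[]].
Qed.

Lemma deriv_eq0_coef p i : p^`() = 0 -> (i%:R : k) != 0 -> p`_i = 0.
Proof.
case: i => [|i] h; first by rewrite eqxx.
move=> ni; have := coef_deriv p i; rewrite h coef0 -mulr_natl => /esym/eqP.
by rewrite mulf_eq0 (negPf ni) => /eqP.
Qed.

(** If the Wronskian vanishes, coprimality makes s divide its own derivative, so s' = 0 and then r'
    = 0. A polynomial with zero derivative has no coefficient at an index invertible in k, whereas a
    generic [r - c s] has degree [rdeg r s]. *)
Lemma wronskian_neq0 r s : coprimep r s -> s != 0 ->
  ((rdeg r s)%:R : k) != 0 -> r^`() * s - r * s^`() != 0.
Proof.
move=> cop s0 hn; rewrite subr_eq0; apply/negP => /eqP e.
have ds : s^`() = 0.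
  apply/eqP/negPn/negP => n.
  have : s %| s^`().
    by rewrite -(@Gauss_dvdpr _ _ r) -?e ?dvdp_mull // coprimep_sym.
  move=> /(dvdp_leq n); rewrite leqNgt.
  by rewrite lt_size_deriv.
have dr : r^`() = 0.
  by apply/eqP; move/eqP: e; rewrite ds mulr0 mulf_eq0 (negPf s0) orbF.
have nz : (r != 0) || (s != 0) by rewrite s0 orbT.
have [c /= hc] := ac_ex (size_pencil nz).
have : (r - c *: s)`_(rdeg r s) = 0.
  by rewrite coefB coefZ !deriv_eq0_coef // mulr0 subrr.
have -> : rdeg r s = (size (r - c *: s)).-1 by rewrite hc.
move/eqP; rewrite -/(lead_coef _) lead_coef_eq0.
by rewrite -size_poly_eq0 hc.
Qed.

(** A multiple root z of [r - c s] is a zero of the Wronskian, and c = r(z) / s(z); so finitely many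
    c are lost. *)
Lemma pencil_separable r s : coprimep r s -> s != 0 ->
  ((rdeg r s)%:R : k) != 0 ->
  ac (fun c => exists rho : seq k, [/\ uniq rho, size rho = rdeg r s &
    forall z, z \in rho -> root (r - c *: s) z]).
Proof.
move=> cop s0 hn.
have nz : (r != 0) || (s != 0) by rewrite s0 orbT.
have [l hl] := roots_seq (wronskian_neq0 cop s0 hn).
have h2 : ac (fun c => c \notin map (fun z => r.[z] / s.[z]) l).
  by exists (map (fun z => r.[z] / s.[z]) l).
apply: ac_mono (ac_and h2 (pencil_factor nz)).
move=> c [nl [rho [a a0 [sr e]]]]; exists rho; split => //; last first.
  by move=> z; rewrite e rootZ // root_prod_XsubC.
have dv : \prod_(z <- rho) ('X - z%:P) %| r - c *: s by rewrite e dvdpZr.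
suff : separable_poly (r - c *: s).
  by move/(dvdp_separable dv); rewrite separable_prod_XsubC.
rewrite unlock; apply/Pdiv.ClosedField.coprimepP => z rz.
have [sz ec] := root_pencil cop rz.
apply: contra nl => /eqP; rewrite !derivE hornerD hornerN hornerZ => dz.
rewrite -ec; apply: (map_f (fun z => r.[z] / s.[z])); apply: hl.
rewrite /root !(hornerD, hornerN, hornerM).
move/eqP: dz; rewrite subr_eq0 => /eqP ->; rewrite -ec.
by apply/eqP; field.
Qed.

(* v^n p(u/v) for p of degree at most n *)
Definition hcomp n p u v : {poly k} := \sum_(i < n.+1) p`_i *: (u ^+ i * v ^+ (n - i)).

Lemma hcompE n p u v x : (size p <= n.+1)%N -> v.[x] != 0 ->
  (hcomp n p u v).[x] = v.[x] ^+ n * p.[u.[x] / v.[x]].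
Proof.
move=> sp vx; rewrite (horner_coef_wide _ sp) mulr_sumr horner_sum.
apply: eq_bigr => i _; rewrite hornerZ hornerM !horner_exp expr_div_n [RHS]mulrCA.
have -> : v.[x] ^+ n = v.[x] ^+ (n - i) * v.[x] ^+ i.
  by rewrite -exprD subnK // -ltnS.
congr (_ * _); rewrite -mulrA [_ * (_ / _)]mulrC divfK ?expf_neq0 //.
by rewrite mulrC.
Qed.

Lemma size_hcomp n p u v : (size (hcomp n p u v) <= n * rdeg u v + 1)%N.
Proof.
apply: (leq_trans (size_sum _ _ _)); apply/bigmax_leqP => i _.
apply: (leq_trans (size_scale_leq _ _)).
have su : (size u <= (rdeg u v).+1)%N.
  by rewrite /rdeg (leq_trans _ (leqSpred _)) // leq_maxl.
have sv : (size v <= (rdeg u v).+1)%N.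
  by rewrite /rdeg (leq_trans _ (leqSpred _)) // leq_maxr.
have pw (q : {poly k}) j : (size q <= (rdeg u v).+1)%N -> (size (q ^+ j) <= j * rdeg u v + 1)%N.
  move=> sq; apply: (leq_trans (size_poly_exp_leq _ _)); rewrite addn1 ltnS mulnC leq_mul2l.
  by apply/orP; right; case: (size q) sq.
apply: (leq_trans (size_polyMleq _ _)).
have /= h1 := pw u i su; have /= h2 := pw v (n - i)%N sv.
have hi : (i <= n)%N by rewrite -ltnS.
have hn : (n * rdeg u v = i * rdeg u v + (n - i) * rdeg u v)%N by rewrite -mulnDl subnKC.
rewrite hn; move: h1 h2; set a1 := size _; set a2 := size (v ^+ _).
by move: (i * _)%N ((n - i) * _)%N => b1 b2; lia.
Qed.

End RationalFractions.

(** * Composition of fractions, and descent along their fibres *)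

Section Composition.
Variable k : closedFieldType.
Implicit Types (p q r s u v A D : {poly k}) (c z : k).

Lemma prod_scale_seq (rho : seq k) (w t : k) :
  w ^+ size rho * \prod_(z <- rho) (t - z) = \prod_(z <- rho) (w * t - z * w).
Proof.
elim: rho => [|z rho IH]; first by rewrite !big_nil mulr1.
by rewrite !big_cons -IH /= exprS; ring.
Qed.

Lemma hcomp_factor (rho : seq k) (a : k) u v : v != 0 ->
  hcomp (size rho) (a *: \prod_(z <- rho) ('X - z%:P)) u v
  = a *: \prod_(z <- rho) (u - z *: v).
Proof.
move=> v0; apply: (poly_eq_ae v0) => x vx; rewrite hcompE //; last first.
  by rewrite (leq_trans (size_scale_leq _ _)) // size_prod_XsubC.
rewrite !hornerZ mulrCA; congr (_ * _).
rewrite !horner_prod; under eq_bigr do rewrite hornerXsubC.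
rewrite prod_scale_seq; apply: eq_bigr => z _.
by rewrite mulrC divfK // !hornerE.
Qed.

Lemma hcompB n c p q u v : hcomp n (p - c *: q) u v = hcomp n p u v - c *: hcomp n q u v.
Proof.
rewrite /hcomp scaler_sumr -sumrB; apply: eq_bigr => i _.
by rewrite coefB coefZ scalerBl scalerA.
Qed.

Lemma size_prod_const (rho : seq k) (F : k -> {poly k}) m :
  (forall z, z \in rho -> size (F z) = m.+1) ->
  size (\prod_(z <- rho) F z) = (size rho * m).+1.
Proof.
elim: rho => [|z rho IH] h; first by rewrite big_nil size_poly1.
have hz : size (F z) = m.+1 by apply: h; rewrite mem_head.
have h2 := IH (fun x hx => h x (introT orP (or_intror hx))).
rewrite big_cons size_mul -?size_poly_eq0 ?hz ?h2 //.
by rewrite addSn /= mulSn addnS.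
Qed.

(** For generic c the roots z of [r - c s] avoid the values where [u - z v] drops in degree, and the
    composed pencil is a multiple of the product of the [u - z v]; this shows its degree. A common
    zero of the two composed polynomials would be a zero of this product for almost all c, yet it
    determines c. *)
Lemma rdeg_hcomp r s u v : coprimep r s -> coprimep u v -> v != 0 -> s != 0 ->
  let n := rdeg r s in
  coprimep (hcomp n r u v) (hcomp n s u v) /\
  rdeg (hcomp n r u v) (hcomp n s u v) = (n * rdeg u v)%N.
Proof.
move=> cop cop' v0 s0 n.
have nzs : (r != 0) || (s != 0) by rewrite s0 orbT.
have nzv : (u != 0) || (v != 0) by rewrite v0 orbT.
have [bad hbad] := size_pencil nzv.
have good : ac (fun c => exists rho : seq k, exists2 a : k, a != 0 &
    [/\ size rho = n, forall z, z \in rho -> root (r - c *: s) z,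
        forall z, z \in rho -> size (u - z *: v) = (rdeg u v).+1 &
        hcomp n r u v - c *: hcomp n s u v = a *: \prod_(z <- rho) (u - z *: v)]).
  have h2 : ac (fun c => c \notin map (fun z => r.[z] / s.[z]) bad).
    by exists (map (fun z => r.[z] / s.[z]) bad).
  apply: ac_mono (ac_and h2 (pencil_factor nzs)) => c [nb [rho [a a0 [sr e]]]].
  have hr z : z \in rho -> root (r - c *: s) z.
    by move=> hz; rewrite e rootZ // root_prod_XsubC.
  exists rho, a => //; split => //.
    move=> z /hr /(root_pencil cop) [_ ec]; apply: hbad.
    by apply: contra nb => hz; rewrite -ec (map_f (fun z => r.[z] / s.[z])).
  by rewrite -hcompB e /n -sr hcomp_factor.
have cp : coprimep (hcomp n r u v) (hcomp n s u v).
  apply/Pdiv.ClosedField.coprimepP => x /eqP rx; apply/negP => /eqP sx.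
  have h2 : ac (fun c => c != r.[u.[x] / v.[x]] / s.[u.[x] / v.[x]]).
    by exists [:: r.[u.[x] / v.[x]] / s.[u.[x] / v.[x]]] => c; rewrite inE.
  have [c [nc [rho [a a0 [_ hr _ e]]]]] := ac_ex (ac_and h2 good).
  have : (a *: \prod_(z <- rho) (u - z *: v)).[x] = 0.
    by rewrite -e hornerD hornerN hornerZ rx sx mulr0 subrr.
  move/eqP; rewrite hornerZ mulf_eq0 (negPf a0) /= horner_prod prodf_seq_eq0.
  move=> /hasP [z hz /=]; rewrite hornerD hornerN hornerZ subr_eq0 => /eqP ux.
  have vx : v.[x] != 0.
    apply/negP => /eqP vx; move: ux; rewrite vx mulr0 => ux.
    by have := coprimep_rootP cop' ux; rewrite vx eqxx.
  have [sz ec] := root_pencil cop (hr z hz).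
  by move: nc; rewrite ux mulfK // ec eqxx.
split => //.
have nzh : (hcomp n r u v != 0) || (hcomp n s u v != 0).
  apply/negPn/negP; rewrite negb_or !negbK => /andP[/eqP e1 /eqP e2].
  by move: cp; rewrite e1 e2 coprimep0 eqp01.
have [c [[rho [a a0 [sr _ hz e]]] hs]] := ac_ex (ac_and good (size_pencil nzh)).
by move: hs; rewrite e size_scale // (size_prod_const hz) sr => -[].
Qed.

(** Interpolation. Let al and be have degree at most t: their coefficients are 2 t + 2 unknowns, and
    each of 2 t + 1 generic fibres of r / s imposes a single linear condition because A / D is
    constant on it. The identity then holds at all points of these fibres, too many for its
    degree. *)
Lemma descent r s A D : coprimep r s -> (0 < rdeg r s)%N -> s != 0 -> D != 0 ->
  ac (fun c => exists rho : seq k, [/\ uniq rho, size rho = rdeg r s,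
    forall z, z \in rho -> root (r - c *: s) z /\ D.[z] != 0 &
    forall z z', z \in rho -> z' \in rho -> A.[z] * D.[z'] = A.[z'] * D.[z]]) ->
  exists al be : {poly k}, be != 0 /\ forall x, s.[x] != 0 ->
    al.[r.[x] / s.[x]] * D.[x] = be.[r.[x] / s.[x]] * A.[x].
Proof.
move=> cop n0 s0 D0 good; set n := rdeg r s in n0 good.
pose t := maxn (size A) (size D).
have t0 : (0 < t)%N by rewrite /t leq_max !size_poly_gt0 D0 orbT.
have [cs [ucs scs hcs]] := ac_list (2 * t + 1) good.
have /boolp.choice [rho hrho] : forall c, exists l : seq k, c \in cs ->
    [/\ uniq l, size l = n,
    forall z, z \in l -> root (r - c *: s) z /\ D.[z] != 0 &
    forall z z', z \in l -> z' \in l -> A.[z] * D.[z'] = A.[z'] * D.[z]].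
  move=> c.
  have [/hcs [l hl]|nc] := boolP (c \in cs); first by exists l.
  by exists [::].
pose ci (i : 'I_(2 * t + 1)) := nth 0 cs i.
pose zi i := nth 0 (rho (ci i)) 0.
have cin i : ci i \in cs by rewrite mem_nth // scs.
have zin i : zi i \in rho (ci i).
  by have [_ e _ _] := hrho _ (cin i); rewrite mem_nth // e.
(* Column i is the condition at one chosen point of the i-th fibre; one row more than columns
   ensures a nonzero kernel vector. *)
pose Mx := col_mx (\matrix_(j < t.+1, i < 2 * t + 1) (ci i ^+ j * D.[zi i]))
                  (\matrix_(j < t.+1, i < 2 * t + 1) (- (ci i ^+ j * A.[zi i]))).
have [w w0 hw] : exists2 w : 'rV[k]_(t.+1 + t.+1), w != 0 & w *m Mx = 0.
  exists (nz_row (kermx Mx)).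
    rewrite nz_row_eq0 -mxrank_eq0 mxrank_ker -lt0n subn_gt0.
    by rewrite (leq_ltn_trans (rank_leq_col _)) //; lia.
  by apply/sub_kermxP; exact: nz_row_sub.
pose al := \poly_(j < t.+1) (lsubmx w 0 (inord j)).
pose be := \poly_(j < t.+1) (rsubmx w 0 (inord j)).
have hi i : al.[ci i] * D.[zi i] = be.[ci i] * A.[zi i].
  have /matrixP /(_ 0 i) := hw; rewrite -{1}[w]hsubmxK mul_row_col !mxE => /eqP.
  under eq_bigr do rewrite [X in _ * X]mxE mulrA.
  under [X in _ + X]eq_bigr do rewrite [X in _ * X]mxE mulrN mulrA.
  rewrite sumrN subr_eq0 -!mulr_suml => /eqP e.
  rewrite !horner_poly; under eq_bigr do rewrite inord_val.
  by rewrite e; congr (_ * _); apply: eq_bigr => j _; rewrite inord_val.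
(* The identity cleared of denominators by s^t. Its size is at most t n + t, and it will have (2 t +
   1) n distinct roots. *)
pose H := hcomp t al r s * D - hcomp t be r s * A.
have sal : (size al <= t.+1)%N by exact: size_poly.
have sbe : (size be <= t.+1)%N by exact: size_poly.
have HE x : s.[x] != 0 -> H.[x] = s.[x] ^+ t *
    (al.[r.[x] / s.[x]] * D.[x] - be.[r.[x] / s.[x]] * A.[x]).
  by move=> sx; rewrite /H hornerD hornerN !hornerM !hcompE //; ring.
have Hroot c z : c \in cs -> z \in rho c -> H.[z] = 0.
  move=> hc hz; have [i ei] : exists i, c = ci i.
    have hx : (index c cs < 2 * t + 1)%N by rewrite -scs index_mem.
    by exists (Ordinal hx); rewrite /ci /= nth_index.
  have [_ _ h3 h4] := hrho _ hc.
  have [/(root_pencil cop) [sz ec] Dz] := h3 _ hz.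
  rewrite HE // ec; apply/eqP; rewrite mulf_eq0; apply/orP; right.
  have zic : zi i \in rho c by rewrite ei.
  have [_ Dzi] := h3 _ zic.
  rewrite -(mulIr_eq0 _ (mulIf Dzi)) mulrBl -[_ * A.[z] * _]mulrA (h4 _ _ hz zic).
  by rewrite mulrA {1}ei -(mulrA (be.[_])) mulrAC hi -ei; apply/eqP; ring.
have H0 : H = 0.
  apply/eqP/negPn/negP => Hn.
  pose L := [seq nth 0 (rho c) j | c <- cs, j <- iota 0 n].
  have uL : uniq L.
    apply: allpairs_uniq => //; first exact: iota_uniq.
    move=> [c j] [c' j'] /allpairsP [[c1 j1] /= [hc hj [-> ->]]].
    move=> /allpairsP [[c2 j2] /= [hc' hj' [-> ->]]] e {c j c' j'}.
    move: hj hj'; rewrite !mem_iota /= !add0n => hj hj'.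
    have [u1 e1 r1 _] := hrho _ hc; have [u2 e2 r2 _] := hrho _ hc'.
    have m1 : nth 0 (rho c1) j1 \in rho c1 by rewrite mem_nth // e1.
    have m2 : nth 0 (rho c2) j2 \in rho c2 by rewrite mem_nth // e2.
    have [/(root_pencil cop) [_ k1] _] := r1 _ m1.
    have [/(root_pencil cop) [_ k2] _] := r2 _ m2.
    have ec : c1 = c2 by rewrite -k1 e k2.
    subst c2; congr (_, _); apply/eqP.
    by rewrite -(nth_uniq 0 _ _ u1) ?e1 // e.
  have rL : all (root H) L.
    apply/allP => z /allpairsP [[c j] /= [hc]]; rewrite mem_iota add0n => hj ->.
    have [_ e1 _ _] := hrho _ hc.
    by apply/eqP; apply: (Hroot c) => //; rewrite mem_nth ?e1.
  have := max_poly_roots Hn rL uL; rewrite size_allpairs size_iota scs ltnNge => /negP; apply.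
  have sh p (q : {poly k}) : (size q <= t)%N -> (size (hcomp t p r s * q)%R <= t * n + t)%N.
    move=> hq; apply: (leq_trans (size_polyMleq _ _)).
    by have := size_hcomp t p r s; rewrite -/n; lia.
  apply: (leq_trans (size_polyD _ _)); rewrite size_polyN geq_max.
  have tD : (size D <= t)%N by rewrite leq_maxr.
  have tA : (size A <= t)%N by rewrite leq_maxl.
  have b1 := sh al D tD; have b2 := sh be A tA.
  have le : (t * n + t <= (2 * t + 1) * n)%N by nia.
  by rewrite (leq_trans b1 le) (leq_trans b2 le).
have conc x : s.[x] != 0 -> al.[r.[x] / s.[x]] * D.[x] = be.[r.[x] / s.[x]] * A.[x].
  move=> sx; have := HE _ sx; rewrite H0 horner0 => /esym/eqP.
  by rewrite mulf_eq0 expf_eq0 (negPf sx) andbF subr_eq0 => /eqP.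
exists al, be; split => //; apply/negP => /eqP be0.
(* If be = 0, then al vanishes at almost every c, so al = 0 as well and the kernel vector would be
   zero. *)
have al0 : al = 0.
  apply/eqP/negPn/negP => aln.
  have [c [[rh [_ sr hr _]] nc]] := ac_ex (ac_and good (ac_root aln)).
  have hz : nth 0 rh 0 \in rh by rewrite mem_nth // sr.
  have [/(root_pencil cop) [sz ec] Dz] := hr _ hz.
  have := conc _ sz; rewrite be0 horner0 mul0r ec => /eqP.
  by rewrite mulf_eq0 (negPf Dz) (negPf nc).
move/negP: w0; apply; apply/eqP; rewrite -[w]hsubmxK.
have -> : lsubmx w = 0.
  apply/rowP => j; rewrite [RHS]mxE; have := congr1 (fun p : {poly k} => p`_j) al0.
  by rewrite coef_poly ltn_ord coef0 inord_val.
have -> : rsubmx w = 0.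
  apply/rowP => j; rewrite [RHS]mxE; have := congr1 (fun p : {poly k} => p`_j) be0.
  by rewrite coef_poly ltn_ord coef0 inord_val.
by rewrite row_mx0.
Qed.

End Composition.

(** * Degrees, kernels and factorization *)

Section Degree.
Variables (k : closedFieldType) (ch : good_char k).
Local Notation ept := (ept ch).
Implicit Types E : curve k.

Definition x_map E E' (f : ept E -> ept E') (r s : {poly k}) :=
  [/\ coprimep r s, s != 0 &
      ae (fun P => s.[xc P] != 0 /\ xc (f P) = r.[xc P] / s.[xc P])].

Definition has_deg E E' (f : ept E -> ept E') n :=
  exists r s, x_map f r s /\ n = rdeg r s.

Definition kersize E E' (f : ept E -> ept E') n :=
  exists K : seq (ept E), [/\ uniq K, size K = n & forall P, (P \in K) = (f P == 0)].

(* A separable isogeny, of degree n. *)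
Definition sepk E E' (f : ept E -> ept E') n :=
  [/\ isog f, has_deg f n & kersize f n].

Lemma has_deg_exists E E' (f : ept E -> ept E') : isog f -> exists n, has_deg f n.
Proof.
move=> /isog_std [r [s [c [d [cop s0 d0 h]]]]]; exists (rdeg r s), r, s.
by split => //; split => //; apply: ae_mono h => P [].
Qed.

Lemma x_map_unique E E' (f : ept E -> ept E') r s r' s' :
  x_map f r s -> x_map f r' s' -> exists2 c, c != 0 & r = c *: r' /\ s = c *: s'.
Proof.
move=> [cop s0 h] [cop' s0' h']; apply: coprimep_fracE => //.
apply: (ratx_unique s0 s0').
by apply: ae_mono2 h h' => P [_ e] [_ e']; rewrite -e -e'.
Qed.

Lemma has_deg_unique E E' (f : ept E -> ept E') n n' :
  has_deg f n -> has_deg f n' -> n = n'.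
Proof.
move=> [r [s [h ->]]] [r' [s' [h' ->]]].
by have [c c0 [-> ->]] := x_map_unique h h'; rewrite /rdeg !size_scale.
Qed.

Lemma kersize_unique E E' (f : ept E -> ept E') n n' :
  kersize f n -> kersize f n' -> n = n'.
Proof.
move=> [K [uK <- hK]] [K' [uK' <- hK']]; apply/perm_size/uniq_perm => // P.
by rewrite hK hK'.
Qed.

Lemma kersize_exists E E' (f : ept E -> ept E') : isog f -> exists n, kersize f n.
Proof. by move=> /isog_ker_finite [K [uK hK]]; exists (size K), K. Qed.

Lemma kersize_gt0 E E' (f : ept E -> ept E') n : ishom f -> kersize f n -> (0 < n)%N.
Proof.
move=> hf [K [_ <- hK]]; have : (0 : ept E) \in K by rewrite hK hom0.
by case: K {hK}.
Qed.

(** Discarding the images of the bad points and the abscissae below which the formula for x o f may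
    fail leaves Q whose fibre is described by the roots of [r - x(Q) s]. *)
Lemma generic_fibre E E' (f : ept E -> ept E') r s (R : ept E -> Prop) :
  isog f -> x_map f r s -> ae R ->
  ae (fun Q => [/\ Q != 0, yc Q != 0,
    forall P, f P = Q -> [/\ P != 0, R P, s.[xc P] != 0 & xc Q = r.[xc P] / s.[xc P]] &
    forall z, root (r - xc Q *: s) z -> exists P, f P = Q /\ xc P = z]).
Proof.
move=> hf [cop s0 h] hR; have [f1 f2 _ _] := hf.
have [t ht] := ae_and (ae_and h hR) (ae_and (ae_neq (0 : ept E)) f2).
have g1 : ae (fun Q => Q \notin map f t) by exact: ae_notin.
have g2 : ae (fun Q : ept E' => xc Q \notin map (fun P => r.[xc P] / s.[xc P]) t).
  elim: {ht} (map _ t) => [|w l IH]; first exact: ae_all.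
  apply: ae_mono2 (ae_neqxc ch E' w) IH => Q h1 h2.
  by rewrite inE negb_or h2 eq_sym h1.
apply: ae_mono3 (ae_and g1 g2) (ae_neq (0 : ept E')) (@ae_yc_neq0 k ch E').
move=> Q [n1 n2] Q0 /(_ Q0) y0; split => //.
  move=> P eP; have Pt : P \notin t by apply: contra n1 => hP; rewrite -eP map_f.
  by have [[[h1 h2] h3] [h4 h5]] := ht _ Pt; rewrite -eP.
move=> z /(root_pencil cop) [sz ez].
have [P [P0 xP]] := xc_surj ch E z.
have Pt : P \notin t.
  by apply: contra n2 => hP; rewrite -ez -xP (map_f (fun P => r.[xc P] / s.[xc P])).
have [[[h1 h2] h3] [h4 h5]] := ht _ Pt.
have e : xc (f P) = xc Q by rewrite h2 xP.
have [eQ|eQ] := ept_xc_eq h5 Q0 e; first by exists P.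
by exists (- P); rewrite homN // eQ opprK xcN.
Qed.

(** The fibre is the coset P0 + K. Two of its points with the same abscissa are equal or opposite,
    and opposite ones would give Q = -Q, excluded by [yc Q != 0]. *)
Lemma fibre_roots E E' (f : ept E -> ept E') r s K Q P0 :
  ishom f -> uniq K -> (forall P, (P \in K) = (f P == 0)) ->
  [/\ Q != 0, yc Q != 0 & forall P, f P = Q -> P != 0 /\
       s.[xc P] != 0 /\ xc Q = r.[xc P] / s.[xc P]] -> f P0 = Q ->
  let L := [seq xc (P0 + T) | T <- K] in
  [/\ uniq L, forall z, z \in L -> root (r - xc Q *: s) z &
      forall P, f P = Q -> xc P \in L].
Proof.
move=> hf uK hK [Q0 y0 hQ] e0 L.
have hfib T : T \in K -> f (P0 + T) = Q.
  by rewrite hK hf e0 => /eqP ->; rewrite addr0.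
split.
- rewrite map_inj_in_uniq // => T T' hT hT' e.
  have [n1 _] := hQ _ (hfib _ hT); have [n2 _] := hQ _ (hfib _ hT').
  have [|eN] := ept_xc_eq n1 n2 e; first exact: addrI.
  have : Q = - Q by rewrite -{1}(hfib _ hT) eN homN // hfib.
  move/(congr1 (@yc _ _ _)); rewrite ycN => /eqP.
  by rewrite -addr_eq0 -mulr2n -mulr_natl mulf_eq0 (negPf y0) (negPf (char_ne2 ch)).
- move=> z /mapP [T hT ->]; have [_ [s0 e]] := hQ _ (hfib _ hT).
  by rewrite /root hornerD hornerN hornerZ e divfK // subrr.
- move=> P eP; apply/mapP; exists (P - P0); last by rewrite addrC subrK.
  by rewrite hK homB // eP e0 subrr.
Qed.

(** For generic Q the polynomial [r - x(Q) s] has degree n and at least one root for each kernel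
    element. *)
Lemma ker_le_deg E E' (f : ept E -> ept E') n j :
  isog f -> has_deg f n -> kersize f j -> (j <= n)%N.
Proof.
move=> hf [r [s [hx ->]]] [K [uK <- hK]].
have [cop s0 _] := hx; have f1 : ishom f by case: hf.
have nz : (r != 0) || (s != 0) by rewrite s0 orbT.
have [bad hbad] := size_pencil nz.
have g2 : ae (fun Q : ept E' => xc Q \notin bad).
  elim: bad {hbad} => [|w l IH]; first exact: ae_all.
  apply: ae_mono2 (ae_neqxc ch E' w) IH => Q h1 h2.
  by rewrite inE negb_or h2 eq_sym h1.
have [Q [[Q0 y0 hQ _] /hbad sz]] := ae_ex (ae_and (generic_fibre hf hx (ae_all (fun=> I))) g2).
have [P0 eP0] := isog_surj hf Q.
have h : [/\ Q != 0, yc Q != 0 & forall P, f P = Q -> P != 0 /\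
       s.[xc P] != 0 /\ xc Q = r.[xc P] / s.[xc P]].
  by split => // P /hQ [].
have /= [uL rL _] := fibre_roots f1 uK hK h eP0.
have nz2 : r - xc Q *: s != 0 by rewrite -size_poly_eq0 sz.
have := max_poly_roots nz2 (introT allP rL) uL.
by rewrite size_map sz ltnS.
Qed.

(** With n invertible in k, a generic [r - x(Q) s] has n distinct roots, each lying under a point of
    the fibre of Q; so the kernel is not smaller than n. *)
Lemma deg_sepk E E' (f : ept E -> ept E') n :
  isog f -> has_deg f n -> (n%:R : k) != 0 -> sepk f n.
Proof.
move=> hf hd hn; split => //.
have [j hj] := kersize_exists hf.
suff -> : n = j by [].
apply/eqP; rewrite eqn_leq (ker_le_deg hf hd hj) andbT.
case: hd hn => r [s [hx ->]] hn; have [K [uK <- hK]] := hj.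
have [cop s0 _] := hx; have f1 : ishom f by case: hf.
have [bad hbad] := pencil_separable cop s0 hn.
have g2 : ae (fun Q : ept E' => xc Q \notin bad).
  elim: bad {hbad} => [|w l IH]; first exact: ae_all.
  apply: ae_mono2 (ae_neqxc ch E' w) IH => Q h1 h2.
  by rewrite inE negb_or h2 eq_sym h1.
have [Q [[Q0 y0 hQ hr] /hbad [rho [urho <- hrho]]]] := ae_ex (ae_and (generic_fibre hf hx (ae_all (fun=> I))) g2).
have [P0 eP0] := isog_surj hf Q.
have h : [/\ Q != 0, yc Q != 0 & forall P, f P = Q -> P != 0 /\
       s.[xc P] != 0 /\ xc Q = r.[xc P] / s.[xc P]].
  by split => // P /hQ [].
have /= [uL rL hL] := fibre_roots f1 uK hK h eP0.
rewrite -(size_map (fun T => xc (P0 + T))); apply: uniq_leq_size => // z /hrho /hr.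
by case=> P [/hL + <-].
Qed.

Lemma kersize_comp E E' E'' (f : ept E -> ept E') (g : ept E' -> ept E'') a b :
  isog f -> ishom g -> kersize f a -> kersize g b -> kersize (g \o f) (a * b).
Proof.
move=> hf hg [K [uK <- hK]] [L [uL <- hL]]; have f1 : ishom f by case: hf.
have /boolp.choice [lift hlift] := isog_surj hf.
exists [seq lift W + T | W <- L, T <- K]; split.
- apply: allpairs_uniq => // -[V0 T0] [V0' T0'] /allpairsP [[V T] [/= hV hT [-> ->]]].
  move=> /allpairsP [[V' T'] [/= hV' hT' [-> ->]]] e.
  have eV : V = V'.
    move: (congr1 f e); rewrite !f1 !hlift.
    by move: hT hT'; rewrite !hK => /eqP -> /eqP ->; rewrite !addr0.
  by move: e; rewrite eV => /addrI ->.
- by rewrite size_allpairs mulnC.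
- move=> P; apply/allpairsP/eqP => [[[W T] [/= hW hT ->]]|e].
    rewrite f1 hlift; move: hW hT; rewrite hL hK => /eqP hW /eqP ->.
    by rewrite addr0.
  exists (f P, P - lift (f P)); split => /=.
  - by rewrite hL; apply/eqP.
  - by rewrite hK homB // hlift subrr.
  - by rewrite addrC subrK.
Qed.

Lemma x_map_comp E E' E'' (f : ept E -> ept E') (g : ept E' -> ept E'') u v r s :
  isog f -> x_map f u v -> x_map g r s ->
  x_map (g \o f) (hcomp (rdeg r s) r u v) (hcomp (rdeg r s) s u v).
Proof.
move=> hf [cop v0 h] [cop' s0 h'].
have [cp _] := rdeg_hcomp cop' cop v0 s0.
have hp := ae_isog hf h'.
have sr : (size r <= (rdeg r s).+1)%N.
  by rewrite /rdeg (leq_trans _ (leqSpred _)) // leq_maxl.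
have ss : (size s <= (rdeg r s).+1)%N.
  by rewrite /rdeg (leq_trans _ (leqSpred _)) // leq_maxr.
have key : ae (fun P => (hcomp (rdeg r s) s u v).[xc P] != 0 /\
  xc (g (f P)) = (hcomp (rdeg r s) r u v).[xc P] / (hcomp (rdeg r s) s u v).[xc P]).
  apply: ae_mono2 h hp => P [vx e] [sx e'].
  rewrite !hcompE // -e; split; first by rewrite mulf_neq0 // expf_neq0.
  by rewrite e' -mulf_div divff ?mul1r // expf_neq0.
split => //; apply/eqP => z.
by have [P [h1 _]] := ae_ex key; move: h1; rewrite z horner0 eqxx.
Qed.

Lemma has_deg_comp E E' E'' (f : ept E -> ept E') (g : ept E' -> ept E'') a b :
  isog f -> has_deg f a -> has_deg g b -> has_deg (g \o f) (a * b).
Proof.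
move=> hf [u [v [hu ->]]] [r [s [hr ->]]].
exists (hcomp (rdeg r s) r u v), (hcomp (rdeg r s) s u v).
split; first exact: x_map_comp.
case: hu hr => cop v0 _ [cop' s0 _].
by have [_ ->] := rdeg_hcomp cop' cop v0 s0; rewrite mulnC.
Qed.

Lemma sepk_comp E E' E'' (f : ept E -> ept E') (g : ept E' -> ept E'') a b :
  sepk f a -> sepk g b -> sepk (g \o f) (a * b).
Proof.
move=> [f1 f2 f3] [g1 g2 g3]; split.
- exact: isog_comp.
- exact: has_deg_comp.
- by apply: kersize_comp => //; case: g1.
Qed.

(** Degree and kernel size are both multiplicative and the second never exceeds the first; equality
    for the composite forces it for both factors. *)
Lemma sepk_compP E E' E'' (f : ept E -> ept E') (g : ept E' -> ept E'') n :
  isog f -> isog g -> sepk (g \o f) n ->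
  exists a b, [/\ n = (a * b)%N, sepk f a & sepk g b].
Proof.
move=> hf hg [_ hd hk]; have f1 : ishom f by case: hf. have g1 : ishom g by case: hg.
have [a ha] := has_deg_exists hf; have [b hb] := has_deg_exists hg.
have [a' ha'] := kersize_exists hf; have [b' hb'] := kersize_exists hg.
have e1 := has_deg_unique hd (has_deg_comp hf ha hb).
have e2 := kersize_unique hk (kersize_comp hf g1 ha' hb').
have la := ker_le_deg hf ha ha'; have lb := ker_le_deg hg hb hb'.
have pa := kersize_gt0 f1 ha'; have pb := kersize_gt0 g1 hb'.
have ea : a' = a by move: e1 e2 la lb pa pb; nia.
have eb : b' = b by move: e1 e2 la lb pa pb; nia.
by exists a, b; split => //; split => //; rewrite -?ea -?eb.
Qed.

(** By separability the abscissae of a generic fibre of f form a full fibre of r / s, which is the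
    input of [descent]. *)
Lemma ratx_descent E E' (f : ept E -> ept E') n (u : ept E' -> k) :
  sepk f n -> ratx (fun P => u (f P)) -> ratx u.
Proof.
move=> [hf [r [s [hx en]]] hk] hu; have f1 : ishom f by case: hf.
have n0 := kersize_gt0 f1 hk; have [cop s0 _] := hx.
have [A [D [_ D0 hA]]] := ratx_reduce hu.
have gen := generic_fibre hf hx hA.
have [K [uK sK hK]] := hk.
have fact Q : [/\ Q != 0, yc Q != 0,
    forall P, f P = Q -> [/\ P != 0, D.[xc P] != 0 /\ u (f P) = A.[xc P] / D.[xc P],
      s.[xc P] != 0 & xc Q = r.[xc P] / s.[xc P]] &
    forall z, root (r - xc Q *: s) z -> exists P, f P = Q /\ xc P = z] ->
   [/\ Q != 0, yc Q != 0 & forall P, f P = Q -> P != 0 /\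
       s.[xc P] != 0 /\ xc Q = r.[xc P] / s.[xc P]].
  by case=> h1 h2 h3 _; split => // P /h3 [].
have [al [be [be0 hab]]] : exists al be : {poly k}, be != 0 /\ forall x, s.[x] != 0 ->
    al.[r.[x] / s.[x]] * D.[x] = be.[r.[x] / s.[x]] * A.[x].
  apply: descent => //; first by rewrite -en.
  case: gen => l hl; exists (map (@xc _ _ _) l) => c nc.
  have [Q [Q0 xQ]] := xc_surj ch E' c.
  have Ql : Q \notin l by apply: contra nc => h; rewrite -xQ map_f.
  have [P0 eP0] := isog_surj hf Q; have gQ := hl _ Ql.
  have /= [uL rL hL] := fibre_roots f1 uK hK (fact _ gQ) eP0.
  case: gQ => _ _ g1 _.
  have hfib T : T \in K -> f (P0 + T) = Q.
    by rewrite hK f1 eP0 => /eqP ->; rewrite addr0.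
  exists [seq xc (P0 + T) | T <- K]; rewrite size_map -en; split => //.
    move=> z hz; rewrite -xQ; split; first exact: rL.
    by case/mapP: hz => T /hfib /g1 [_ [h _] _ _] ->.
  move=> z z' /mapP [T hT ->] /mapP [T' hT' ->].
  have [_ [d e] _ _] := g1 _ (hfib _ hT); have [_ [d' e'] _ _] := g1 _ (hfib _ hT').
  by apply/eqP; rewrite -eqr_div // -e -e' !hfib.
exists al, be; split => //.
apply: ae_mono2 gen (ae_xc ch E' be0) => Q [_ _ hQ _] nb.
have [P eP] := isog_surj hf Q; have [_ [d e] sx ex] := hQ _ eP.
move: (hab _ sx); rewrite -ex => h.
by apply/eqP; rewrite -eP e eP eqr_div // mulrC -h mulrC.
Qed.

(** As a homomorphism h is forced: g of any preimage. The content is its rationality; since descent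
    is available for functions of x only, it is applied to x o h and to the even function (y o h) /
    y. *)
Lemma isog_factor E E' E'' (f : ept E -> ept E') (g : ept E -> ept E'') n :
  sepk f n -> isog0 g -> (forall P, f P = 0 -> g P = 0) ->
  exists2 h : ept E' -> ept E'', isog0 h & forall P, h (f P) = g P.
Proof.
move=> hs hg0 hker; have [hf _ _] := hs; have f1 : ishom f by case: hf.
case: hg0 => [hg|->]; last by exists (fun=> 0) => //; right.
have [g1 g2 g3 g4] := hg.
have /boolp.choice [lift hlift] := isog_surj hf.
pose h Q := g (lift Q).
have hh P : h (f P) = g P.
  apply/eqP; rewrite -subr_eq0 /h -homB //; apply/eqP/hker.
  by rewrite homB // hlift subrr.
have homh : ishom h.
  move=> Q Q'; rewrite -(hlift Q) -(hlift Q') -f1 !hh; exact: g1.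
have hN Q : h (- Q) = - h Q by exact: homN.
have gN P : g (- P) = - g P by exact: homN.
have fN P : f (- P) = - f P by exact: homN.
have nz : ae (fun Q => h Q != 0).
  have [t ht] := g2; exists (map f t) => Q hQ.
  have [P e] := isog_surj hf Q; rewrite -e hh; apply: ht.
  by apply: contra hQ => h1; rewrite -e map_f.
exists h => //; left; split => //.
- apply: ratx_ratf; apply: (ratx_descent hs).
  apply: ratf_even; last by apply: ae_all => P; rewrite !hh gN xcN.
  by apply: ratf_eq g3; apply: ae_all => P; rewrite hh.
- pose u Q := yc (h Q) / yc Q.
  have hu : ratx u.
    apply: (ratx_descent hs); apply: ratf_even.
      apply: ratf_div; last by apply: isog_ratf hf (ratf_yc _ _).
      by apply: ratf_eq g4; apply: ae_all => P; rewrite hh.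
    by apply: ae_all => P; rewrite /u !hh gN fN !ycN invrN mulrNN.
  apply: ratf_eq (ratfM (ratf_yc _ _) (ratx_ratf hu)).
  apply: ae_mono2 (ae_neq (0 : ept E')) (@ae_yc_neq0 k ch E') => Q Q0 /(_ Q0) y0.
  by rewrite /u mulrC divfK.
Qed.

End Degree.

(** * Multiplication by m *)

Section Multiplication.
Variables (k : closedFieldType) (ch : good_char k) (E : curve k).
Local Notation ept := (ept ch E).
Local Notation a := (coefA E).
Local Notation b := (Defs.coefB E).
Local Notation fE := (cubic E).
Local Notation k2 := (char_ne2 ch).
Implicit Types P Q : ept.

(** Sum and product are invariant under Q -> -Q, hence expressible by abscissae alone; they give a
    recursion for x o [m] that does not involve y. *)
Lemma xc_add_sub P Q : P != 0 -> Q != 0 -> xc P != xc Q ->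
  let d := (xc P - xc Q) ^+ 2 in
  xc (P + Q) + xc (P - Q) =
    (2%:R * (xc P + xc Q) * (a + xc P * xc Q) + 4%:R * b) / d /\
  xc (P + Q) * xc (P - Q) =
    ((xc P * xc Q - a) ^+ 2 - 4%:R * b * (xc P + xc Q)) / d.
Proof.
move=> P0 Q0 n d.
have [_ e1 _] := ept_add_secant P0 Q0 n.
have NQ0 : - Q != 0 by rewrite oppr_eq0.
have n' : xc P != xc (- Q) by rewrite xcN.
have [_ e2 _] := ept_add_secant P0 NQ0 n'.
have d0 : xc Q - xc P != 0 by rewrite subr_eq0 eq_sym.
have d1 : xc P - xc Q != 0 by rewrite subr_eq0.
have hP := ycE P0; have hQ := ycE Q0; rewrite !cubicE in hP hQ.
rewrite e1 e2 !xcN !ycN /d; split.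
- transitivity ((2%:R * (yc P ^+ 2 + yc Q ^+ 2)) / (xc P - xc Q) ^+ 2 - 2%:R * (xc P + xc Q)).
    by field; rewrite d0 d1.
  by rewrite hP hQ; field.
- transitivity (((yc Q ^+ 2 - yc P ^+ 2) ^+ 2
     - 2%:R * (yc P ^+ 2 + yc Q ^+ 2) * ((xc P + xc Q) * (xc P - xc Q) ^+ 2)
     + (xc P + xc Q) ^+ 2 * (xc P - xc Q) ^+ 4) / (xc P - xc Q) ^+ 4).
    by field; rewrite d0 d1.
  by rewrite hP hQ; field.
Qed.

(** Besides the degree m^2, the induction carries that the numerator has the larger degree, so that
    leading terms in the recursion cannot cancel. *)
Definition mul_deg_inv m := exists r s : {poly k},
  [/\ x_map (fun P => P *+ m) r s, size r = (m ^ 2).+1 & (size s <= m ^ 2)%N].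

Lemma mul_deg_inv1 : mul_deg_inv 1.
Proof.
exists 'X, 1; split; rewrite ?size_polyX ?size_poly1 //.
split; [exact: coprimep1 | exact: oner_neq0 |].
by apply: ae_all => P; rewrite !hornerE oner_neq0 divr1 mulr1n.
Qed.

Lemma mul_deg_inv2 : mul_deg_inv 2.
Proof.
(* With f the cubic, [F1] is its derivative, and duplication reads x(2P) = (f'^2 - 8 x f) / (4
   f). *)
pose F1 : {poly k} := 3%:R *: 'X^2 + a%:P.
pose r := F1 ^+ 2 - 8%:R *: ('X * fE); pose s := 4%:R *: fE.
have n4 : (4%:R : k) != 0 by rewrite (_ : 4%:R = 2%:R * 2%:R :> k) ?mulf_neq0 ?k2 //; ring.
have F1E z : F1.[z] = 3%:R * z ^+ 2 + a by rewrite /F1 !hornerE.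
have er : r = 'X^4 + (- (2%:R * a) *: 'X^2 - (8%:R * b) *: 'X + (a ^+ 2)%:P).
  rewrite /r /F1 cubic.unlock -!mul_polyC ?polyCN ?polyCM ?polyC_natr; ring.
clearbody F1; exists r, s; split.
- split.
  + apply/Pdiv.ClosedField.coprimepP => z; rewrite /root /r !(hornerD, hornerN, hornerZ, hornerM, horner_exp, hornerX) F1E.
    move=> rz; apply/negP; rewrite mulf_eq0 (negPf n4) /= => /eqP fz.
    move: rz; rewrite fz !mulr0 subr0 -?expr2 sqrf_eq0; apply/negP.
    exact: cubic_simple fz.
  + by rewrite /s scaler_eq0 (negPf n4) cubic_neq0.
  + have g : ae (fun P => [/\ P != 0, yc P != 0 & fE.[xc P] != 0]).
      apply: ae_mono3 (ae_neq (0 : ept)) (@ae_yc_neq0 k ch E) (ae_xc ch E (cubic_neq0 E)).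
      by move=> P P0 /(_ P0) y0 f0; split.
    apply: ae_mono g => P [P0 y0 f0].
    have [_ e _] := ept_double P0 y0.
    rewrite mulr2n e /s hornerZ mulf_neq0 //; split => //.
    rewrite /r !(hornerD, hornerN, hornerZ, hornerM, horner_exp, hornerX) F1E -ycE //.
    by field; rewrite n4 y0 k2.
- rewrite er size_polyDl size_polyXn // (leq_ltn_trans (size_polyD _ _)) // gtn_max.
  rewrite (leq_ltn_trans (size_polyC_leq1 _)) // andbT.
  rewrite (leq_ltn_trans (size_polyD _ _)) // gtn_max size_polyN.
  by rewrite !(leq_ltn_trans (size_scale_leq _ _)) ?size_polyX ?size_polyXn.
- by rewrite /s size_scale // size_cubic.
Qed.

(** These are the denominator, sum and product of [xc_add_sub] at abscissae x and r / s, homogenized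
    in r and s. If the first vanishes then r = x s; the second becomes 4 s^2 f(x) and the third s^2
    f'(x)^2 modulo f(x), so f would have a double root. *)
Lemma parallelogram_coprime (x r s : k) : (r != 0) || (s != 0) ->
  (x * s - r) ^+ 2 = 0 ->
  2%:R * (x * r + a * s) * (x * s + r) + 4%:R * b * s ^+ 2 = 0 ->
  (x * r - a * s) ^+ 2 - 4%:R * b * (s * (x * s + r)) = 0 -> False.
Proof.
move=> nz /eqP; rewrite sqrf_eq0 subr_eq0 => /eqP er e1 e2.
have s0 : s != 0.
  apply/negP => /eqP s0; move: nz; rewrite -er s0 mulr0 eqxx //.
have n4 : (4%:R : k) != 0 by rewrite (_ : 4%:R = 2%:R * 2%:R :> k) ?mulf_neq0 ?k2 //; ring.
have f0 : fE.[x] = 0.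
  apply/eqP; rewrite -(mulrI_eq0 _ (mulfI (mulf_neq0 n4 (expf_neq0 2 s0)))) -e1 -er cubicE.
  by apply/eqP; ring.
have := cubic_simple f0; rewrite -sqrf_eq0 => /negP; apply.
rewrite -(mulrI_eq0 _ (mulfI (expf_neq0 2 s0))).
have -> : s ^+ 2 * (3%:R * x ^+ 2 + a) ^+ 2 =
   ((x * r - a * s) ^+ 2 - 4%:R * b * (s * (x * s + r))) + 8%:R * x * s ^+ 2 * fE.[x].
  by rewrite -er cubicE; ring.
by rewrite e2 f0 mulr0 addr0.
Qed.

(** T0 divides [T1 * Q0] and [T2 * Q0], hence [gcdp T1 T2 * Q0], and is coprime to that gcd. *)
Lemma dvdp_proportional (T0 T1 T2 Q0 Q1 Q2 : {poly k}) :
  (forall z, T0.[z] = 0 -> T1.[z] = 0 -> T2.[z] = 0 -> False) ->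
  T1 * Q0 = Q1 * T0 -> T2 * Q0 = Q2 * T0 -> T0 %| Q0.
Proof.
move=> nc e1 e2.
have cop : coprimep T0 (gcdp T1 T2).
  apply/Pdiv.ClosedField.coprimepP => z /eqP h0; apply/negP => h.
  have : root (gcdp T1 T2) z by [].
  by rewrite root_gcd => /andP[/eqP h1 /eqP h2]; apply: nc h0 h1 h2.
rewrite -(Gauss_dvdpl _ cop) -(eqp_dvdr _ (gcdp_mul2l _ _ _)) dvdp_gcd.
by rewrite ![Q0 * _]mulrC e1 e2 !dvdp_mull.
Qed.

Lemma size_sqr_poly (A : {poly k}) M : size A = M.+2 -> size (A ^+ 2) = (2 * M).+3.
Proof.
move=> h; have A0 : A != 0 by rewrite -size_poly_eq0 h.
by rewrite expr2 size_mul // h; lia.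
Qed.

Let arith1 u v M : (u <= M)%N -> (v <= M.+1)%N -> ((u + v).-1 < (2 * M).+3)%N.
Proof. lia. Qed.
Let arith2 u v M : (u <= M.+2)%N -> (v <= M.+1)%N -> ((u + v).-1 <= (2 * M).+2)%N.
Proof. lia. Qed.
Let arith3 u M : (u <= M)%N -> ((u + u).-1 <= (2 * M).+2)%N.
Proof. lia. Qed.
Let arith4 u A B M : (A + B = (2 * M).+2)%N -> (B < u)%N -> ((2 * M).+3 <= (A.+1 + u).-1)%N.
Proof. lia. Qed.
Let arith5 u A B M : (A + B = (2 * M).+2)%N -> (u <= A)%N -> ((B.+1 + u).-1 <= (2 * M).+2)%N.
Proof. lia. Qed.
Let arith6 u A B M : (A + B = (2 * M).+2)%N -> (u + A.+1).-1 = (2 * M).+3 -> u = B.+1.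
Proof. lia. Qed.
Let arith7 m : (2 <= m)%N -> (m.-1 ^ 2 + m.+1 ^ 2 = (2 * m ^ 2).+2)%N.
Proof. by case: m => // n _; rewrite /= !expnS !expn0; lia. Qed.

(** The triple (denominator, sum, product) formed from x((m + 1) P) and x((m - 1) P) is proportional
    to the one [xc_add_sub] gives for P and m P. Neither has a common zero, so they agree up to a
    scalar. The products then yield the degree of the new numerator, as 2 m^2 + 2 = (m - 1)^2 + (m +
    1)^2, and the sums bound the new denominator. *)
Lemma mul_deg_invS m : (2 <= m)%N -> mul_deg_inv m -> mul_deg_inv m.-1 -> mul_deg_inv m.+1.
Proof.
move=> m2 [r [s [hx sr ss]]] [r' [s' [hx' sr' ss']]].
have [cop s0 hm] := hx; have [cop' s0' hm'] := hx'.
have mm : (m ^ 2 = m * m)%N by rewrite expnS expn1.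
have dm : has_deg (fun P => P *+ m) (m ^ 2).
  exists r, s; split => //; rewrite /rdeg sr (maxn_idPl _) //.
  by rewrite (leq_trans ss).
have im : isog (fun P => P *+ m).
  case: (isog0_muln ch E m) => // e; exfalso.
  have : has_deg (fun P => P *+ m) 0.
    exists 0, 1; split; last by rewrite /rdeg size_poly0 size_poly1.
    split; [exact: coprimep1 | exact: oner_neq0|].
    apply: ae_all => P; rewrite horner0 hornerC oner_neq0 mul0r; split => //.
    by have := congr1 (fun g => g P) e => /= ->.
  by move/(has_deg_unique dm) => /eqP; rewrite expn_eq0 /=; case: (m) m2.
(* Otherwise x o [m] = x generically, and [m] would have degree 1 rather than m^2. *)
have nx : ae (fun P => xc (P *+ m) != xc P).
  have [z|nz] := ratf_dichotomy (ratfB (let: And4 _ _ h _ := im in h) (ratf_xc ch E)); last first.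
    by apply: ae_mono nz => P; rewrite subr_eq0.
  exfalso; have : has_deg (fun P => P *+ m) 1.
    exists 'X, 1; split; last by rewrite /rdeg size_polyX size_poly1.
    split; [exact: coprimep1 | exact: oner_neq0|].
    apply: ae_mono z => P /eqP; rewrite subr_eq0 => /eqP ->.
    by rewrite !hornerE oner_neq0 divr1.
  by move/(has_deg_unique dm); move: m2; rewrite mm; nia.
have im1 : isog (fun P => P *+ m.+1).
  case: (isog0_muln ch E m.+1) => // e; exfalso.
  have [P hP] := ae_ex nx; have := congr1 (fun g => g P) e => /=.
  rewrite mulrS => /eqP; rewrite addrC addr_eq0 => /eqP eP.
  by move: hP; rewrite eP xcN eqxx.
have [d [r2 [s2 [hx2 _]]]] := has_deg_exists im1.
have [cop2 s02 hm2] := hx2.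
pose Q0 := ('X * s - r) ^+ 2.
pose Q1 := 2%:R *: (('X * r + a *: s) * ('X * s + r)) + (4%:R * b) *: s ^+ 2.
pose Q2 := ('X * r - a *: s) ^+ 2 - (4%:R * b) *: (s * ('X * s + r)).
have horn := (hornerD, hornerN, hornerZ, hornerM, horner_exp, hornerX).
have Q0E z : Q0.[z] = (z * s.[z] - r.[z]) ^+ 2 by rewrite /Q0 !horn.
have Q1E z : Q1.[z] = 2%:R * (z * r.[z] + a * s.[z]) * (z * s.[z] + r.[z]) + 4%:R * b * s.[z] ^+ 2.
  by rewrite /Q1 !horn mulrA.
have Q2E z : Q2.[z] = (z * r.[z] - a * s.[z]) ^+ 2 - 4%:R * b * (s.[z] * (z * s.[z] + r.[z])).
  by rewrite /Q2 !horn.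
have key : ae (fun P => [/\ Q0.[xc P] != 0, s2.[xc P] != 0, s'.[xc P] != 0,
   r2.[xc P] / s2.[xc P] + r'.[xc P] / s'.[xc P] = Q1.[xc P] / Q0.[xc P] &
   r2.[xc P] / s2.[xc P] * (r'.[xc P] / s'.[xc P]) = Q2.[xc P] / Q0.[xc P]]).
  have imne : ae (fun P => P *+ m != 0) by case: im.
  have g1 := ae_and (ae_and hm hm') (ae_and hm2 nx).
  apply: ae_mono3 g1 imne (ae_neq (0 : ept)) => P [[[h1 h2] [h3 h4]] [[h5 h6] h7]] h8 h9.
  have h7' : xc P != xc (P *+ m) by rewrite eq_sym.
  have [e1 e2] := xc_add_sub h9 h8 h7'.
  have eN : xc (P - P *+ m) = xc (P *+ m.-1).
    rewrite -xcN opprB; congr xc; apply: (addIr P).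
    by rewrite subrK -mulrSr prednK //; apply: ltn_trans m2.
  rewrite -mulrS eN in e1 e2.
  have d0 : xc P * s.[xc P] - r.[xc P] != 0.
    by apply: contra h7'; rewrite subr_eq0 h2 => /eqP <-; rewrite mulfK.
  have d1 : xc P - r.[xc P] / s.[xc P] != 0 by rewrite -h2 subr_eq0.
  split => //.
  - by rewrite Q0E expf_neq0.
  - rewrite -h6 -h4 e1 Q0E Q1E h2; field.
    by rewrite h1 d0.
  - rewrite -h6 -h4 e2 Q0E Q2E h2; field.
    by rewrite h1 d0.
pose T0 := s2 * s'; pose T1 := r2 * s' + r' * s2; pose T2 := r2 * r'.
have T00 : T0 != 0 by rewrite mulf_neq0.
have Q00 : Q0 != 0.
  apply/eqP => z; have [P [h _ _ _ _]] := ae_ex key.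
  by move: h; rewrite z horner0 eqxx.
have e1 : T1 * Q0 = Q1 * T0.
  apply: (ratx_unique (ch := ch) (E := E) T00 Q00); apply: ae_mono key => P [h1 h2 h3 <- _].
  by rewrite /T1 /T0 !horn; field; rewrite h2 h3.
have e2 : T2 * Q0 = Q2 * T0.
  apply: (ratx_unique (ch := ch) (E := E) T00 Q00); apply: ae_mono key => P [h1 h2 h3 _ <-].
  by rewrite /T2 /T0 !horn mulf_div.
have ncT z : T0.[z] = 0 -> T1.[z] = 0 -> T2.[z] = 0 -> False.
  rewrite /T0 /T1 /T2 !horn => /eqP; rewrite mulf_eq0 => /orP[] /eqP h.
    have r2n : r2.[z] != 0.
      apply/negP => /eqP h'; by have := coprimep_rootP cop2 h'; rewrite h eqxx.
    rewrite h mulr0 addr0 => /eqP; rewrite mulf_eq0 (negPf r2n) /= => /eqP h2 /eqP.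
    rewrite mulf_eq0 (negPf r2n) /= => /eqP h'.
    by have := coprimep_rootP cop' h'; rewrite h2 eqxx.
  have rn : r'.[z] != 0.
    apply/negP => /eqP h'; by have := coprimep_rootP cop' h'; rewrite h eqxx.
  rewrite h mulr0 add0r => /eqP; rewrite mulf_eq0 (negPf rn) /= => /eqP h2 /eqP.
  rewrite mulf_eq0 (negPf rn) orbF /= => /eqP h'.
  by have := coprimep_rootP cop2 h'; rewrite h2 eqxx.
have ncQ z : Q0.[z] = 0 -> Q1.[z] = 0 -> Q2.[z] = 0 -> False.
  rewrite Q0E Q1E Q2E; apply: parallelogram_coprime.
  rewrite -negb_and; apply/negP => /andP[/eqP h1 /eqP h2].
  by have := coprimep_rootP cop h1; rewrite h2 eqxx.
have dv1 := dvdp_proportional ncT e1 e2.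
have dv2 := dvdp_proportional ncQ (esym e1) (esym e2).
have : T0 %= Q0 by rewrite /eqp dv1 dv2.
move=> /eqpP [[c1 c2] /= /andP[n1 n2] ec].
have eT2 : c1 *: T2 = c2 *: Q2.
  by apply: (mulIf Q00); rewrite -!scalerAl e2 scalerAr ec -scalerAr.
have eT1 : c1 *: T1 = c2 *: Q1.
  by apply: (mulIf Q00); rewrite -!scalerAl e1 scalerAr ec -scalerAr.
have r'0 : r' != 0 by rewrite -size_poly_gt0 sr'.
have r0 : r != 0 by rewrite -size_poly_gt0 sr.
have sXr : size ('X * r) = (m ^ 2).+2 by rewrite mulrC size_mulX // sr.
have sXs : (size ('X * s)%R <= (m ^ 2).+1)%N by rewrite mulrC size_mulX // ltnS.
have sas c : (size (c *: s) <= m ^ 2)%N by rewrite (leq_trans (size_scale_leq _ _)).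
have sXsr : (size ('X * s + r)%R <= (m ^ 2).+1)%N.
  by rewrite (leq_trans (size_polyD _ _)) // geq_max sXs sr leqnn.
have sQ2 : size Q2 = (2 * m ^ 2).+3.
  have sA : size ('X * r - a *: s) = (m ^ 2).+2.
    rewrite size_polyDl ?sXr // size_polyN.
    by rewrite (leq_ltn_trans (sas a)).
  have sA2 := size_sqr_poly sA.
  rewrite /Q2 size_polyDl sA2 //.
  rewrite size_polyN (leq_ltn_trans (size_scale_leq _ _)) //.
  rewrite (leq_ltn_trans (size_polyMleq _ _)) //.
  exact: arith1 ss sXsr.
have mm1 : ((m.-1 ^ 2) + (m.+1 ^ 2) = (2 * m ^ 2).+2)%N.
  exact: arith7.
have sr2 : size r2 = (m.+1 ^ 2).+1.
  have r20 : r2 != 0.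
    apply/eqP => z; move: eT2; rewrite /T2 z mul0r scaler0 => /eqP.
    by rewrite eq_sym scaler_eq0 (negPf n2) /= -size_poly_eq0 sQ2.
  have := congr1 (size \o polyseq) eT2.
  rewrite /= !size_scale // sQ2 /T2 size_mul // sr'.
  exact: arith6 mm1.
exists r2, s2; split => //.
(* A larger denominator would let [r' * s2] dominate [T1] and exceed the degree of [Q1]. *)
rewrite leqNgt; apply/negP => hs.
have s1 : (size Q1 <= (2 * m ^ 2).+2)%N.
  rewrite /Q1 (leq_trans (size_polyD _ _)) // geq_max; apply/andP; split.
    rewrite (leq_trans (size_scale_leq _ _)) // (leq_trans (size_polyMleq _ _)) //.
    have : (size ('X * r + a *: s)%R <= (m ^ 2).+2)%N.
      rewrite (leq_trans (size_polyD _ _)) // geq_max sXr leqnn /=.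
      by rewrite (leq_trans (sas a)) // !leqW.
    by move/arith2; apply.
  rewrite (leq_trans (size_scale_leq _ _)) // expr2 (leq_trans (size_polyMleq _ _)) //.
  exact: arith3 ss.
have s3 : ((2 * m ^ 2).+3 <= size (r' * s2)%R)%N.
  rewrite size_mul // sr'; exact: arith4 mm1 hs.
have s4 : (size (r2 * s')%R <= (2 * m ^ 2).+2)%N.
  rewrite (leq_trans (size_polyMleq _ _)) // sr2; exact: arith5 mm1 ss'.
have := congr1 (size \o polyseq) eT1.
rewrite /= !size_scale // /T1 addrC size_polyDl; last by rewrite (leq_ltn_trans s4).
by move=> e; move: s3; rewrite e ltnNge s1.
Qed.

Lemma mul_deg m : (0 < m)%N -> mul_deg_inv m.
Proof.
suff h n : mul_deg_inv n.+1 /\ mul_deg_inv n.+2 by case: m => // m _; case: (h m).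
elim: n => [|n [IH1 IH2]]; first by split; [exact: mul_deg_inv1 | exact: mul_deg_inv2].
by split => //; apply: mul_deg_invS.
Qed.

Lemma muln_sepk m : (m%:R : k) != 0 -> sepk (fun P => P *+ m) (m ^ 2).
Proof.
move=> nm; have m0 : (0 < m)%N by case: (m) nm => //; rewrite eqxx.
have [r [s [hx sr ss]]] := mul_deg m0.
have dm : has_deg (fun P => P *+ m) (m ^ 2).
  exists r, s; split => //; rewrite /rdeg sr (maxn_idPl _) //.
  by rewrite (leq_trans ss).
apply: deg_sepk => //; last by rewrite natrX expf_neq0.
case: (isog0_muln ch E m) => // e; exfalso.
have : has_deg (fun P => P *+ m) 0.
  exists 0, 1; split; last by rewrite /rdeg size_poly0 size_poly1.
  split; [exact: coprimep1 | exact: oner_neq0|].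
  apply: ae_all => P; rewrite horner0 hornerC oner_neq0 mul0r; split => //.
  by have := congr1 (fun g => g P) e => /= ->.
by move/(has_deg_unique dm) => /eqP; rewrite expn_eq0 /=; case: (m) m0.
Qed.

End Multiplication.

(** * Quotients by finite subgroups *)

Section RegularFunctions.
Variables (k : closedFieldType) (ch : good_char k) (E : curve k).
Local Notation ept := (ept ch E).
Local Notation a := (coefA E).
Local Notation b := (Defs.coefB E).
Local Notation fE := (cubic E).
Local Notation k2 := (char_ne2 ch).
Implicit Types (P Q T V : ept) (g h : ept -> k).

(* wt g j: the pole order of g at infinity is at most j. *)
Definition wt g j := exists A B D : {poly k},
  [/\ D != 0, ae (fun V => g V = (A.[xc V] + B.[xc V] * yc V) / D.[xc V]),
      (2 * size A <= 2 * size D + j)%N &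
      (B == 0) || (2 * size B + 3 <= 2 * size D + j)%N].

Lemma wt_eq g h j : ae (fun V => g V = h V) -> wt g j -> wt h j.
Proof.
move=> e [A [B [D [D0 hg sA sB]]]]; exists A, B, D; split => //.
by apply: ae_mono2 e hg => V ->.
Qed.

Lemma wt_leq g i j : (i <= j)%N -> wt g i -> wt g j.
Proof.
move=> le [A [B [D [D0 hg sA sB]]]]; exists A, B, D; split => //; first by lia.
by case/orP: sB => [->//|sB]; apply/orP; right; lia.
Qed.

Let ar1 sA sD sA' sD' j x y : (2 * sA <= 2 * sD + j)%N -> (x <= (sA + sD').-1)%N -> (2 * sA' <= 2 * sD' + j)%N ->
  (y <= (sA' + sD).-1)%N -> (0 < sD)%N -> (0 < sD')%N -> (2 * maxn x y <= 2 * (sD + sD').-1 + j)%N.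
Proof. lia. Qed.
Let ar2 sB sD sD' j x : (2 * sB + 3 <= 2 * sD + j)%N -> (x <= (sB + sD').-1)%N ->
  (0 < sB)%N -> (0 < sD)%N -> (0 < sD')%N -> (2 * x + 3 <= 2 * (sD + sD').-1 + j)%N.
Proof. lia. Qed.

Lemma wtD g h j : wt g j -> wt h j -> wt (fun V => g V + h V) j.
Proof.
move=> [A [B [D [D0 hg sA sB]]]] [A' [B' [D' [D0' hh sA' sB']]]].
have p0 : (0 < size D)%N by rewrite size_poly_gt0.
have p0' : (0 < size D')%N by rewrite size_poly_gt0.
exists (A * D' + A' * D), (B * D' + B' * D), (D * D'); split.
- by rewrite mulf_neq0.
- apply: ae_mono2 (ae_and hg hh) (ae_and (ae_xc ch E D0) (ae_xc ch E D0')).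
  by move=> P [-> ->] [d d']; rewrite !hornerE /=; field; rewrite d d'.
- rewrite size_mul // (leq_trans (leq_mul (leqnn 2) (size_polyD _ _))) //.
  by apply: (ar1 sA _ sA'); rewrite ?size_polyMleq.
- rewrite size_mul //; have [->|B0] := eqVneq B 0.
    have [->|B0'] := eqVneq B' 0; first by rewrite !mul0r addr0 eqxx.
    rewrite mul0r add0r (negPf B0') /= in sB' *; apply/orP; right.
    rewrite [(size D + _)%N]addnC.
    by apply: (ar2 sB'); rewrite ?size_polyMleq ?size_poly_gt0.
  rewrite (negPf B0) /= in sB.
  have [->|B0'] := eqVneq B' 0.
    rewrite mul0r addr0; apply/orP; right.
    by apply: (ar2 sB); rewrite ?size_polyMleq ?size_poly_gt0.
  rewrite (negPf B0') /= in sB'; apply/orP; right.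
  apply: (@leq_trans (2 * maxn (size (B * D')%R) (size (B' * D)%R) + 3)).
    by rewrite leq_add2r leq_mul2l size_polyD.
  rewrite /maxn; case: ifP => _; last first.
    by apply: (ar2 sB); rewrite ?size_polyMleq ?size_poly_gt0.
  by rewrite [(size D + _)%N]addnC; apply: (ar2 sB'); rewrite ?size_polyMleq ?size_poly_gt0.
Qed.

Let ar3 sA sA' sD sD' j j' x : (2 * sA <= 2 * sD + j)%N -> (2 * sA' <= 2 * sD' + j')%N ->
  (x <= (sA + sA').-1)%N -> (0 < sD)%N -> (0 < sD')%N -> (2 * x <= 2 * (sD + sD').-1 + (j + j'))%N.
Proof. lia. Qed.
Let ar4 sB sB' sD sD' j j' x : (2 * sB + 3 <= 2 * sD + j)%N -> (2 * sB' + 3 <= 2 * sD' + j')%N ->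
  (x <= sB + sB' + 2)%N -> (0 < sD)%N -> (0 < sD')%N -> (2 * x <= 2 * (sD + sD').-1 + (j + j'))%N.
Proof. lia. Qed.
Let ar5 sB sA' sD sD' j j' x : (2 * sB + 3 <= 2 * sD + j)%N -> (2 * sA' <= 2 * sD' + j')%N ->
  (x <= (sA' + sB).-1)%N -> (0 < sB)%N -> (0 < sD)%N -> (0 < sD')%N ->
  (2 * x + 3 <= 2 * (sD + sD').-1 + (j + j'))%N.
Proof. lia. Qed.

Lemma wtM g h i j : wt g i -> wt h j -> wt (fun V => g V * h V) (i + j).
Proof.
move=> [A [B [D [D0 hg sA sB]]]] [A' [B' [D' [D0' hh sA' sB']]]].
have p0 : (0 < size D)%N by rewrite size_poly_gt0.
have p0' : (0 < size D')%N by rewrite size_poly_gt0.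
exists (A * A' + B * B' * fE), (A * B' + A' * B), (D * D'); split.
- by rewrite mulf_neq0.
- apply: ae_mono2 (ae_and hg hh) (ae_and (ae_neq ept0) (ae_and (ae_xc ch E D0) (ae_xc ch E D0'))).
  move=> P [-> ->] [P0 [d d']]; rewrite !(hornerM, hornerD) -ycE //; field.
  by rewrite d d'.
- rewrite size_mul //; apply: (leq_trans (leq_mul (leqnn 2) (size_polyD _ _))).
  have h1 : (2 * size (A * A')%R <= 2 * (size D + size D').-1 + (i + j))%N.
    by apply: (ar3 sA sA'); rewrite ?size_polyMleq.
  have h2 : (2 * size (B * B' * fE)%R <= 2 * (size D + size D').-1 + (i + j))%N.
    have [->|B0] := eqVneq B 0; first by rewrite !mul0r size_poly0.
    have [->|B0'] := eqVneq B' 0; first by rewrite mulr0 mul0r size_poly0.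
    rewrite (negPf B0) /= in sB; rewrite (negPf B0') /= in sB'.
    apply: (ar4 sB sB') => //.
    rewrite !size_mul ?mulf_neq0 ?cubic_neq0 // size_cubic.
    by move: B0 B0'; rewrite -!size_poly_gt0; move: (size B) (size B') => u v; lia.
  by rewrite /maxn; case: ifP.
- rewrite size_mul //.
  have h1 : (B' == 0) || (2 * size (A * B')%R + 3 <= 2 * (size D + size D').-1 + (i + j))%N.
    have [->//|B0'] := eqVneq B' 0; rewrite (negPf B0') /= in sB' *.
    rewrite [(i + j)%N]addnC [(size D + _)%N]addnC.
    by apply: (ar5 sB' sA); rewrite ?size_polyMleq ?size_poly_gt0.
  have h2 : (B == 0) || (2 * size (A' * B)%R + 3 <= 2 * (size D + size D').-1 + (i + j))%N.
    have [->//|B0] := eqVneq B 0; rewrite (negPf B0) /= in sB *.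
    by apply: (ar5 sB sA'); rewrite ?size_polyMleq ?size_poly_gt0.
  case/orP: h1 => [/eqP->|h1].
    rewrite mulr0 add0r mulf_eq0.
    by case/orP: h2 => [->|->]; rewrite ?orbT.
  case/orP: h2 => [/eqP->|h2]; first by rewrite mulr0 addr0 h1 orbT.
  apply/orP; right.
  apply: (@leq_trans (2 * maxn (size (A * B')%R) (size (A' * B)%R) + 3)).
    by rewrite leq_add2r leq_mul2l size_polyD.
  by rewrite /maxn; case: ifP.
Qed.

Lemma wtC c : wt (fun=> c) 0.
Proof.
exists c%:P, 0, 1; split; rewrite ?oner_neq0 ?eqxx //.
  by apply: ae_all => P; rewrite !hornerE divr1.
by rewrite addn0 leq_mul2l /= size_poly1 size_polyC_leq1.
Qed.

Lemma wt_xc : wt (@xc k ch E) 2.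
Proof.
exists 'X, 0, 1; split; rewrite ?oner_neq0 ?eqxx ?size_polyX ?size_poly1 //.
by apply: ae_all => P; rewrite !hornerE divr1.
Qed.

Lemma wt_yc : wt (@yc k ch E) 3.
Proof.
exists 0, 1, 1; split; rewrite ?oner_neq0 ?size_poly0 ?size_poly1 //.
  by apply: ae_all => P; rewrite !hornerE divr1.
by rewrite orbT.
Qed.

Lemma wtN g j : wt g j -> wt (fun V => - g V) j.
Proof.
move=> hg; apply: wt_eq (wtM (wtC (-1)) hg); apply: ae_all => P; exact: mulN1r.
Qed.

Lemma wtB g h j : wt g j -> wt h j -> wt (fun V => g V - h V) j.
Proof. by move=> hg hh; apply: wtD hg (wtN hh). Qed.

Lemma wt_opp g j : wt g j -> wt (fun V => g (- V)) j.
Proof.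
move=> [A [B [D [D0 hg sA sB]]]]; exists A, (- B), D; split => //.
  by apply: ae_mono (ae_opp hg) => P ->; rewrite xcN ycN hornerN mulrN mulNr.
by rewrite size_polyN oppr_eq0.
Qed.

Lemma wt_sum (s : seq ept) (F : ept -> ept -> k) j :
  (forall T, T \in s -> wt (F T) j) -> wt (fun V => \sum_(T <- s) F T V) j.
Proof.
elim: s => [|T s IH] h.
  by apply: wt_eq (wt_leq (leq0n j) (wtC 0)); apply: ae_all => V; rewrite big_nil.
apply: (@wt_eq (fun V => F T V + \sum_(T <- s) F T V)).
  by apply: ae_all => V; rewrite big_cons.
apply: wtD; first by apply: h; rewrite mem_head.
by apply: IH => T' hT'; apply: h; rewrite inE hT' orbT.
Qed.

Lemma wt_prod0 (s : seq ept) (F : ept -> ept -> k) :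
  (forall T, T \in s -> wt (F T) 0) -> wt (fun V => \prod_(T <- s) F T V) 0.
Proof.
elim: s => [|T s IH] h.
  by apply: wt_eq (wtC 1); apply: ae_all => V; rewrite big_nil.
apply: (@wt_eq (fun V => F T V * \prod_(T <- s) F T V)).
  by apply: ae_all => V; rewrite big_cons.
apply: (@wtM _ _ 0 0); first by apply: h; rewrite mem_head.
by apply: IH => T' hT'; apply: h; rewrite inE hT' orbT.
Qed.

Lemma ae_secant T : T != 0 -> ae (fun V => [/\ V != 0, xc V - xc T != 0,
  xc (V + T) = ((yc V - yc T) / (xc V - xc T)) ^+ 2 - xc V - xc T &
  yc (V + T) = - yc T - (yc V - yc T) / (xc V - xc T) * (xc (V + T) - xc T)]).
Proof.
move=> T0; apply: ae_mono2 (ae_neq (0 : ept)) (ae_neqxc ch E (xc T)) => V V0 n.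
have d0 : xc V - xc T != 0 by rewrite subr_eq0 eq_sym.
have [_ e1 e2] := ept_add_secant T0 V0 n.
by rewrite [V + T]addrC e1 e2; split => //; [ring | field].
Qed.

(** V + T tends to the affine point T as V tends to infinity, so there is no pole; the secant
    formula makes this visible in degrees. *)
Lemma wt_xc_add T : T != 0 -> wt (fun V => xc (V + T)) 0.
Proof.
move=> T0.
exists (xc T *: 'X^2 + (a + xc T ^+ 2) *: 'X + (b + yc T ^+ 2 - xc T ^+ 3)%:P),
  (- (2%:R * yc T))%:P, (('X - (xc T)%:P) ^+ 2); split.
- by rewrite expf_neq0 // polyXsubC_eq0.
- apply: ae_mono (ae_secant T0) => V [V0 d -> _]; rewrite !hornerE /=.
  transitivity ((yc V ^+ 2 + yc T ^+ 2 - 2%:R * yc T * yc V) / (xc V - xc T) ^+ 2 - xc V - xc T).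
    by field.
  by rewrite ycE // cubicE; field.
- rewrite size_exp_XsubC addn0 leq_mul2l /= (leq_trans (size_polyD _ _)) // geq_max.
  rewrite (leq_trans (size_polyC_leq1 _)) // andbT (leq_trans (size_polyD _ _)) // geq_max.
  by rewrite !(leq_trans (size_scale_leq _ _)) ?size_polyX ?size_polyXn.
- rewrite size_exp_XsubC; apply/orP; right.
  by have := size_polyC_leq1 (- (2%:R * yc T)); move: (size _) => u; lia.
Qed.

Lemma wt_yc_add T : T != 0 -> wt (fun V => yc (V + T)) 0.
Proof.
move=> T0.
(* With t = x(T), [M x + K] is y^2 + y(T)^2 - (x + 2 t)(x - t)^2 after eliminating y^2: the higher
   terms cancel, which keeps the coefficient of y linear. *)
pose M := a + 3%:R * xc T ^+ 2; pose K := b + yc T ^+ 2 - 2%:R * xc T ^+ 3.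
exists (- (yc T *: ('X - (xc T)%:P) ^+ 3) + (2%:R * yc T) *: fE + yc T *: (M *: 'X + K%:P)),
  (- (M *: 'X + (K + 2%:R * yc T ^+ 2)%:P)), (('X - (xc T)%:P) ^+ 3).
have sl c : (size (M *: 'X + c%:P)%R <= 2)%N.
  rewrite (leq_trans (size_polyD _ _)) // geq_max (leq_trans (size_scale_leq _ _)) ?size_polyX //.
  by rewrite (leq_trans (size_polyC_leq1 _)).
split.
- by rewrite expf_neq0 // polyXsubC_eq0.
- apply: ae_mono (ae_secant T0) => V [V0 d e ->]; rewrite e !(hornerD, hornerN, hornerZ, hornerX, hornerC, horner_exp) /=.
  rewrite -ycE //.
  have hy : yc V ^+ 2 = xc V ^+ 3 + a * xc V + b by rewrite ycE // cubicE.
  transitivity (- yc T - (yc V - yc T) * ((yc V ^+ 2 + yc T ^+ 2 - 2%:R * yc T * yc V) - (xc V + 2%:R * xc T) * (xc V - xc T) ^+ 2) / (xc V - xc T) ^+ 3).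
    by field.
  rewrite {1}hy /M /K; field => //.
- rewrite size_exp_XsubC addn0 leq_mul2l /= (leq_trans (size_polyD _ _)) // geq_max.
  rewrite (leq_trans (size_polyD _ _)) ?geq_max /=; last first.
    rewrite size_polyN (leq_trans (size_scale_leq _ _)) ?size_exp_XsubC //=.
    by rewrite (leq_trans (size_scale_leq _ _)) // size_cubic.
  by rewrite (leq_trans (size_scale_leq _ _)) // (leq_trans (sl _)).
- rewrite size_exp_XsubC size_polyN; apply/orP; right.
  by have := sl (K + 2%:R * yc T ^+ 2); move: (size _) => u; lia.
Qed.

End RegularFunctions.

Lemma size_exp_monic (R : idomainType) (p : {poly R}) m :
  p \is monic -> size (p ^+ m) = ((size p).-1 * m).+1.
Proof.
move=> mp; rewrite -size_exp prednK // size_poly_gt0.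
by rewrite expf_neq0 // monic_neq0.
Qed.

(** * The quotient by a finite subgroup: invariant coordinates and their equation *)

Section Quotient.
Variables (k : closedFieldType) (ch : good_char k) (E : curve k).
Local Notation ept_on := (ept ch).
Local Notation ept := (ept ch E).
Local Notation a := (coefA E).
Local Notation b := (Defs.coefB E).
Local Notation fE := (cubic E).
Local Notation k2 := (char_ne2 ch).
Implicit Types (P Q T V W : ept) (g h : ept -> k).

Variable G : seq ept.
Hypotheses (uG : uniq G) (G0 : 0 \in G)
  (GB : forall P Q, P \in G -> Q \in G -> P - Q \in G).
Local Notation n := (size G).

Let GN P : P \in G -> - P \in G.
Proof. by move=> h; rewrite -sub0r GB. Qed.
Let GD P Q : P \in G -> Q \in G -> P + Q \in G.
Proof. by move=> h h'; rewrite -[Q]opprK GB // GN. Qed.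
Let GaddN V T : T \in G -> (V + T \in G) = (V \in G).
Proof.
move=> hT; apply/idP/idP => h; last exact: GD.
by rewrite -[V](addrK T) GB.
Qed.
Let GoppN V : (- V \in G) = (V \in G).
Proof. by apply/idP/idP => /GN; rewrite ?opprK. Qed.

Lemma perm_shift T : T \in G -> perm_eq (map (fun S => S + T) G) G.
Proof.
move=> hT; apply: uniq_perm => //.
  by rewrite map_inj_uniq // => x y /addIr.
move=> x; apply/mapP/idP => [[S hS ->]|hx]; first exact: GD.
by exists (x - T); rewrite ?GB // subrK.
Qed.

Lemma perm_opp : perm_eq (map -%R G) G.
Proof.
apply: uniq_perm => //; first by rewrite map_inj_uniq //; exact: oppr_inj.
move=> x; apply/mapP/idP => [[S hS ->]|hx]; first exact: GN.
by exists (- x); rewrite ?opprK // GN.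
Qed.

(** Velu's coordinate up to an additive constant. *)
Definition qx V : k := \sum_(T <- G) xc (V + T).
Definition qy V : k := \sum_(T <- G) yc (V + T).
(** The denominator of [qx]: a pair T, -T contributes a square and a point of order 2 a simple
    factor, as the poles require. *)
Definition qs : {poly k} := \prod_(T <- rem 0 G) ('X - (xc T)%:P).

Lemma qx_shift V T : T \in G -> qx (V + T) = qx V.
Proof.
move=> hT; rewrite /qx -[in RHS](perm_big _ (perm_shift hT)) big_map.
by apply: eq_bigr => S _; rewrite -addrA [T + S]addrC.
Qed.

Lemma qy_shift V T : T \in G -> qy (V + T) = qy V.
Proof.
move=> hT; rewrite /qy -[in RHS](perm_big _ (perm_shift hT)) big_map.
by apply: eq_bigr => S _; rewrite -addrA [T + S]addrC.
Qed.

Lemma qx_opp V : qx (- V) = qx V.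
Proof.
rewrite /qx -[in LHS](perm_big _ perm_opp) big_map.
by apply: eq_bigr => S _; rewrite -opprD xcN.
Qed.

Lemma qy_opp V : qy (- V) = - qy V.
Proof.
rewrite /qy -[in LHS](perm_big _ perm_opp) big_map -sumrN.
by apply: eq_bigr => S _; rewrite -opprD ycN.
Qed.

Let memrem T : (T \in rem 0 G) = (T != 0) && (T \in G).
Proof. by rewrite mem_rem_uniq. Qed.

Lemma notG0 V : V \notin G -> V != 0.
Proof. by apply: contra => /eqP ->. Qed.

Lemma notG_xc V T : V \notin G -> T \in G -> T != 0 -> xc V != xc T.
Proof.
move=> hV hT T0; apply/negP => /eqP e.
have [eV|eV] := ept_xc_eq (notG0 hV) T0 e; move/negP: hV; apply; rewrite eV //.
exact: GN.
Qed.

Lemma qs_neq0 V : V \notin G -> qs.[xc V] != 0.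
Proof.
move=> hV; rewrite /qs horner_prod prodf_seq_neq0; apply/allP => T.
by rewrite memrem hornerXsubC subr_eq0 => /andP[T0 hT]; apply: notG_xc.
Qed.

Lemma qs_root V : V != 0 -> qs.[xc V] != 0 -> V \notin G.
Proof.
move=> V0; apply: contra => hV; rewrite /qs horner_prod prodf_seq_eq0.
apply/hasP; exists V; first by rewrite memrem V0.
by rewrite hornerXsubC subrr eqxx.
Qed.

Lemma size_qs : size qs = n.
Proof.
rewrite /qs size_prod_XsubC size_rem // prednK //.
by case: (G) G0.
Qed.

Lemma qs_monic : qs \is monic.
Proof. by rewrite /qs monic_prod_XsubC. Qed.

(* Functions without poles outside G. *)
Definition regG g := exists (A B : {poly k}) (e : nat), forall V, V \notin G ->
  g V * qs.[xc V] ^+ e = A.[xc V] + B.[xc V] * yc V.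

Lemma regG_ext g h : (forall V, V \notin G -> g V = h V) -> regG g -> regG h.
Proof. by move=> e [A [B [m hg]]]; exists A, B, m => V hV; rewrite -e // hg. Qed.

Lemma regGC c : regG (fun=> c).
Proof. by exists c%:P, 0, 0 => V _; rewrite expr0 mulr1 !hornerE. Qed.

Lemma regG_xc : regG (@xc k ch E).
Proof. by exists 'X, 0, 0 => V _; rewrite expr0 mulr1 !hornerE. Qed.

Lemma regG_yc : regG (@yc k ch E).
Proof. by exists 0, 1, 0 => V _; rewrite expr0 mulr1 !hornerE. Qed.

Lemma regGD g h : regG g -> regG h -> regG (fun V => g V + h V).
Proof.
move=> [A [B [m hg]]] [A' [B' [m' hh]]].
exists (A * qs ^+ m' + A' * qs ^+ m), (B * qs ^+ m' + B' * qs ^+ m), (m + m') => V hV.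
rewrite !(hornerD, hornerM, horner_exp) exprD.
transitivity ((g V * qs.[xc V] ^+ m) * qs.[xc V] ^+ m' + (h V * qs.[xc V] ^+ m') * qs.[xc V] ^+ m).
  by ring.
by rewrite hg // hh //; ring.
Qed.

Lemma regGM g h : regG g -> regG h -> regG (fun V => g V * h V).
Proof.
move=> [A [B [m hg]]] [A' [B' [m' hh]]].
exists (A * A' + B * B' * fE), (A * B' + A' * B), (m + m') => V hV.
rewrite exprD mulrACA hg // hh // !(hornerD, hornerM) -ycE ?notG0 //; ring.
Qed.

Lemma regGN g : regG g -> regG (fun V => - g V).
Proof.
move=> hg; apply: regG_ext (regGM (regGC (-1)) hg) => V _; exact: mulN1r.
Qed.

Lemma regGB g h : regG g -> regG h -> regG (fun V => g V - h V).
Proof. by move=> hg hh; apply: regGD hg (regGN hh). Qed.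

Lemma regGX g m : regG g -> regG (fun V => g V ^+ m).
Proof.
move=> hg; elim: m => [|m IH]; first exact: regGC.
by apply: regG_ext (regGM hg IH) => V _; rewrite exprS.
Qed.

Lemma regG_horner (A : {poly k}) g : regG g -> regG (fun V => A.[g V]).
Proof.
move=> hg; elim/poly_ind: A => [|A c IH].
  by apply: regG_ext (regGC 0) => V _; rewrite horner0.
apply: regG_ext (regGD (regGM IH hg) (regGC c)) => V _.
by rewrite hornerMXaddC.
Qed.

Lemma regG_sum (s : seq ept) (F : ept -> ept -> k) :
  (forall T, T \in s -> regG (F T)) -> regG (fun V => \sum_(T <- s) F T V).
Proof.
elim: s => [|T s IH] h.
  by apply: regG_ext (regGC 0) => V _; rewrite big_nil.
apply: (@regG_ext (fun V => F T V + \sum_(T <- s) F T V)).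
  by move=> V _; rewrite big_cons.
apply: regGD; first by apply: h; rewrite mem_head.
by apply: IH => T' hT'; apply: h; rewrite inE hT' orbT.
Qed.

Lemma regG_prod (s : seq ept) (F : ept -> ept -> k) :
  (forall T, T \in s -> regG (F T)) -> regG (fun V => \prod_(T <- s) F T V).
Proof.
elim: s => [|T s IH] h.
  by apply: regG_ext (regGC 1) => V _; rewrite big_nil.
apply: (@regG_ext (fun V => F T V * \prod_(T <- s) F T V)).
  by move=> V _; rewrite big_cons.
apply: regGM; first by apply: h; rewrite mem_head.
by apply: IH => T' hT'; apply: h; rewrite inE hT' orbT.
Qed.

Lemma regG_inv T : T \in G -> T != 0 -> regG (fun V => (xc V - xc T)^-1).
Proof.
move=> hT T0; exists (\prod_(S <- rem T (rem 0 G)) ('X - (xc S)%:P)), 0, 1 => V hV.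
have m : T \in rem 0 G by rewrite memrem T0.
rewrite expr1 /qs (perm_big _ (perm_to_rem m)) big_cons hornerM hornerXsubC.
by rewrite mulrA mulVf ?mul1r ?subr_eq0 ?notG_xc // !hornerE.
Qed.

Lemma notG_secant V T : V \notin G -> T \in G -> T != 0 ->
  xc (V + T) = ((yc V - yc T) / (xc V - xc T)) ^+ 2 - xc V - xc T /\
  yc (V + T) = - yc T - (yc V - yc T) / (xc V - xc T) * (xc (V + T) - xc T).
Proof.
move=> hV hT T0; have nx := notG_xc hV hT T0.
have d0 : xc V - xc T != 0 by rewrite subr_eq0.
have nx' : xc T != xc V by rewrite eq_sym.
have [_ e1 e2] := ept_add_secant T0 (notG0 hV) nx'.
by rewrite [V + T]addrC e1 e2; split; [ring | field].
Qed.

Lemma regG_xc_add T : T \in G -> regG (fun V => xc (V + T)).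
Proof.
move=> hT; have [->|T0] := eqVneq T 0.
  by apply: regG_ext regG_xc => V _; rewrite addr0.
apply: (@regG_ext (fun V => ((yc V - yc T) * (xc V - xc T)^-1) ^+ 2 - xc V - xc T)).
  by move=> V hV; have [-> _] := notG_secant hV hT T0.
apply: regGB (regGC _); apply: regGB regG_xc; apply: regGX.
by apply: regGM (regG_inv hT T0); apply: regGB regG_yc (regGC _).
Qed.

Lemma regG_yc_add T : T \in G -> regG (fun V => yc (V + T)).
Proof.
move=> hT; have [->|T0] := eqVneq T 0.
  by apply: regG_ext regG_yc => V _; rewrite addr0.
apply: (@regG_ext (fun V => - yc T - (yc V - yc T) * (xc V - xc T)^-1 * (xc (V + T) - xc T))).
  by move=> V hV; have [_ ->] := notG_secant hV hT T0.
apply: regGB (regGC _) _; apply: regGM.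
  by apply: regGM (regG_inv hT T0); apply: regGB regG_yc (regGC _).
exact: regGB (regG_xc_add hT) (regGC _).
Qed.

Lemma regG_qx : regG qx.
Proof. by apply: regG_sum => T hT; exact: regG_xc_add. Qed.

Lemma regG_qy : regG qy.
Proof. by apply: regG_sum => T hT; exact: regG_yc_add. Qed.

Lemma regG_opp g : regG g -> regG (fun V => g (- V)).
Proof.
move=> [A [B [e h]]]; exists A, (- B), e => V hV.
by have := h (- V); rewrite GoppN xcN ycN => ->; rewrite // hornerN mulrN mulNr.
Qed.

Lemma ae_notG : ae (fun V => V \notin G).
Proof. exact: ae_notin. Qed.

Lemma regG_ratf g : regG g -> ratf g.
Proof.
move=> [A [B [e h]]]; exists A, B, (qs ^+ e); split.
  by rewrite expf_neq0 // -size_poly_eq0 size_qs; case: (G) G0.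
apply: ae_mono ae_notG => V hV.
by rewrite horner_exp -h // mulfK // expf_neq0 // qs_neq0.
Qed.

(** The difference times a power of [qs] is A + B y, and vanishing almost everywhere forces A = B =
    0. This carries generic identities to every point outside G. *)
Lemma regG_ae_eq g h : regG g -> regG h -> ae (fun V => g V = h V) ->
  forall V, V \notin G -> g V = h V.
Proof.
move=> hg hh e V hV; apply/eqP; rewrite -subr_eq0.
have [A [B [m hd]]] := regGB hg hh.
have nz : ~~ ((A != 0) || (B != 0)).
  apply/negP => nz; have [W [[e1 e2] e3]] := ae_ex (ae_and (ae_and e (ae_poly ch E nz)) ae_notG).
  by move: e2; rewrite -hd // e1 subrr mul0r eqxx.
have := hd V hV; move: nz; rewrite negb_or !negbK => /andP[/eqP -> /eqP ->].
rewrite !horner0 mul0r addr0 => /eqP.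
by rewrite mulf_eq0 expf_eq0 (negPf (qs_neq0 hV)) andbF orbF.
Qed.

Let n_gt0 : (0 < n)%N. Proof. by case: (G) G0. Qed.

Let qs0 : qs != 0. Proof. by rewrite -size_poly_eq0 size_qs; case: n n_gt0. Qed.

(* (x(V + T) + x(V - T)) / 2 has a pole of order at most 2 at T, and of order
   at most 1 if T = - T. *)
Lemma half_sum_poly T : T \in rem 0 G -> exists p : {poly k}, (size p <= n)%N /\
  forall V, V \notin G -> (xc (V + T) + xc (V - T)) * qs.[xc V] = 2%:R * p.[xc V].
Proof.
move=> hT; have := hT; rewrite memrem => /andP[T0 TG].
pose N : {poly k} := ('X + (xc T)%:P) * (a%:P + xc T *: 'X) + (2%:R * b)%:P.
have hN V : V \notin G -> xc (V + T) + xc (V - T) = 2%:R * N.[xc V] / (xc V - xc T) ^+ 2.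
  move=> hV; have [-> _] := xc_add_sub (notG0 hV) T0 (notG_xc hV TG T0).
  by rewrite /N !hornerE /=; congr (_ / _); ring.
have sN : (size N <= 3)%N.
  rewrite (leq_trans (size_polyD _ _)) // geq_max (leq_trans (size_polyC_leq1 _)) // andbT.
  have s2 : (size (a%:P + xc T *: 'X)%R <= 2)%N.
    rewrite (leq_trans (size_polyD _ _)) // geq_max (leq_trans (size_polyC_leq1 _)) //=.
    by rewrite (leq_trans (size_scale_leq _ _)) // size_polyX.
  by rewrite (leq_trans (size_polyMleq _ _)) // size_XaddC.
have sz : size (rem 0 G) = n.-1 by rewrite size_rem.
have n1 : (1 < n)%N by move: hT; rewrite -[n]prednK // -sz ltnS; case: (rem _ _).
have qsE : qs = ('X - (xc T)%:P) * \prod_(S <- rem T (rem 0 G)) ('X - (xc S)%:P).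
  by rewrite /qs (perm_big _ (perm_to_rem hT)) big_cons.
have d0 V : V \notin G -> xc V - xc T != 0.
  by move=> hV; rewrite subr_eq0 notG_xc.
have s1 : size (rem T (rem 0 G)) = n.-2 by rewrite size_rem // sz.
(* A point of order 2 has one factor only in [qs]; but then [N] takes at [xc T] the value 2 f(xc T)
   = 0, and one factor of the denominator cancels. *)
have [eT|nT] := eqVneq (- T) T.
  have y0 : yc T = 0.
    have := congr1 (@yc _ _ _) eT; rewrite ycN => /eqP; rewrite eq_sym -addr_eq0.
    by rewrite -mulr2n -mulr_natl mulf_eq0 (negPf k2) => /eqP.
  have : root N (xc T).
    rewrite /root /N !hornerE /=.
    have := ycE T0; rewrite y0 cubicE expr0n /= => /esym e.
    apply/eqP; transitivity (2%:R * (xc T ^+ 3 + a * xc T + b)); first by ring.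
    by rewrite e mulr0.
  move/factor_theorem => [M eM].
  have sM : (size M <= 2)%N.
    have [->|M0] := eqVneq M 0; first by rewrite size_poly0.
    by move: sN; rewrite eM size_mul ?polyXsubC_eq0 // size_XsubC addn2.
  exists (M * \prod_(S <- rem T (rem 0 G)) ('X - (xc S)%:P)); split.
    rewrite (leq_trans (size_polyMleq _ _)) // size_prod_XsubC s1.
    by move: sM n1; clear; move: (size M) n => u v; lia.
  move=> V hV; rewrite hN // eM qsE !hornerM !hornerXsubC; field; exact: d0.
have hT' : - T \in rem T (rem 0 G).
  by rewrite mem_rem_uniq ?rem_uniq // inE nT memrem oppr_eq0 T0 GN.
exists (N * \prod_(S <- rem (- T) (rem T (rem 0 G))) ('X - (xc S)%:P)); split.
  rewrite (leq_trans (size_polyMleq _ _)) // size_prod_XsubC size_rem // s1.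
  have : (0 < n.-2)%N by rewrite -s1; case: (rem _ _) hT'.
  by move: sN n1; clear; move: (size N) n => u v; lia.
move=> V hV; rewrite hN // qsE (perm_big _ (perm_to_rem hT')) big_cons xcN.
by rewrite !hornerM !hornerXsubC; field; exact: d0.
Qed.

Lemma qr_exists : exists r : {poly k}, [/\ size r = n.+1, r \is monic &
  forall V, V \notin G -> qx V * qs.[xc V] = r.[xc V]].
Proof.
have /boolp.choice [p hp] : forall T, exists q : {poly k}, T \in rem 0 G ->
   (size q <= n)%N /\
   forall V, V \notin G -> (xc (V + T) + xc (V - T)) * qs.[xc V] = 2%:R * q.[xc V].
  move=> T; have [/half_sum_poly [q hq]|nT] := boolP (T \in rem 0 G); first by exists q.
  by exists 0.
pose q := \sum_(T <- rem 0 G) p T.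
have sq : (size q <= n)%N.
  apply: (leq_trans (size_sum _ _ _)); rewrite big_seq.
  by elim/big_ind: _ => // [x y hx hy|T /hp []//]; rewrite geq_max hx hy.
have sX : size ('X * qs) = n.+1 by rewrite mulrC size_mulX // size_qs.
exists ('X * qs + q); split.
- by rewrite size_polyDl sX.
- rewrite monicE lead_coefDl ?sX // -monicE monicMr ?monicX //.
  exact: qs_monic.
- move=> V hV.
  have e1 W : qx W = xc W + \sum_(T <- rem 0 G) xc (W + T).
    by rewrite /qx (perm_big _ (perm_to_rem G0)) big_cons addr0.
  (* Adding the two expressions of [qx V] pairs x(V + T) with x(V - T), the combination that
     [half_sum_poly] controls. *)
  have e2 : qx V = xc V + \sum_(T <- rem 0 G) xc (V - T).
    rewrite -qx_opp e1 xcN; congr (_ + _); apply: eq_bigr => T _.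
    by rewrite -xcN opprD opprK.
  have e3 : 2%:R * (qx V * qs.[xc V]) = 2%:R * ('X * qs + q).[xc V].
    rewrite mulrA mulr_natl mulr2n {1}(e1 V) e2 addrACA -big_split /=.
    rewrite mulrDl mulr_suml hornerD hornerM hornerX mulrDr; congr (_ + _).
      by rewrite mulr_natl mulr2n mulrDl.
    rewrite /q horner_sum mulr_sumr [LHS]big_seq [RHS]big_seq.
    by apply: eq_bigr => T /hp [_ ->].
  exact: (mulfI k2).
Qed.

Definition qr : {poly k} := projT1 (cid qr_exists).
Lemma size_qr : size qr = n.+1. Proof. by rewrite /qr; case: cid => ? []. Qed.
Lemma qr_monic : qr \is monic. Proof. by rewrite /qr; case: cid => ? []. Qed.
Lemma qrE V : V \notin G -> qx V = qr.[xc V] / qs.[xc V].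
Proof.
move=> hV; rewrite /qr; case: cid => r /= [_ _ h].
by rewrite -h // mulfK // qs_neq0.
Qed.

Lemma size_qr_pencil c : size (qr - c *: qs) = n.+1.
Proof.
rewrite size_polyDl size_qr // size_polyN (leq_ltn_trans (size_scale_leq _ _)) //.
by rewrite size_qs.
Qed.

Lemma qr_pencil_monic c : qr - c *: qs \is monic.
Proof.
rewrite monicE lead_coefDl -?monicE ?qr_monic // size_polyN size_qr.
by rewrite (leq_ltn_trans (size_scale_leq _ _)) // size_qs.
Qed.

(** When 2V is outside G, the abscissae on the coset V + G are distinct, so they are all the roots
    of the monic polynomial [qr - qx V qs] of degree n. *)
Lemma fibre_prod_generic : ae (fun V => V \notin G /\
   uniq [seq xc (V + T) | T <- G] /\
   qr - qx V *: qs = \prod_(T <- G) ('X - (xc (V + T))%:P)).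
Proof.
have h2 := @muln_sepk k ch E 2 k2.
have [i2 _ _] := h2.
have g : ae (fun V => V *+ 2 \notin G) by apply: ae_isog i2 ae_notG.
apply: ae_mono2 ae_notG g => V hV h.
have uL : uniq [seq xc (V + T) | T <- G].
  rewrite map_inj_in_uniq // => T T' hT hT' e.
  have n1 : V + T != 0 by apply: notG0; rewrite GaddN.
  have n2 : V + T' != 0 by apply: notG0; rewrite GaddN.
  have [/addrI //|eN] := ept_xc_eq n1 n2 e.
  exfalso; move/negP: h; apply.
  have -> : V *+ 2 = - T - T'.
    apply/eqP; rewrite -subr_eq0 opprB opprK mulr2n; apply/eqP.
    by rewrite [T' + T]addrC addrACA eN addNr.
  by rewrite GB // GN.
split => //; split => //.
have rL : all (root (qr - qx V *: qs)) [seq xc (V + T) | T <- G].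
  apply/allP => z /mapP [T hT ->]; rewrite /root hornerD hornerN hornerZ.
  by rewrite -(qx_shift V hT) qrE ?GaddN // divfK ?subrr // qs_neq0 // GaddN.
have := all_roots_prod_XsubC _ rL; rewrite size_map size_qr_pencil => /(_ erefl).
rewrite uniq_rootsE => /(_ uL) ->.
by rewrite (eqP (qr_pencil_monic _)) scale1r big_map.
Qed.

Lemma fibre_prod V z : V \notin G ->
  qr.[z] - qx V * qs.[z] = \prod_(T <- G) (z - xc (V + T)).
Proof.
move: V; apply: regG_ae_eq.
- by apply: regGB (regGC _) _; apply: regGM regG_qx (regGC _).
- by apply: regG_prod => T hT; apply: regGB (regGC _) (regG_xc_add hT).
- apply: ae_mono fibre_prod_generic => V [_ [_ e]].
  have := congr1 (fun p : {poly k} => p.[z]) e; rewrite hornerD hornerN hornerZ => ->.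
  by rewrite horner_prod; apply: eq_bigr => T _; rewrite hornerXsubC.
Qed.

(** At z = x(W) the left side of [fibre_prod] vanishes, so x(W) = x(V + T) for some T in G. *)
Lemma qx_eq V W : V \notin G -> W \notin G -> qx V = qx W ->
  W - V \in G \/ W + V \in G.
Proof.
move=> hV hW e; have := fibre_prod (xc W) hV.
rewrite e qrE // divfK ?qs_neq0 // subrr => /esym/eqP.
rewrite prodf_seq_eq0 => /hasP [T hT /=]; rewrite subr_eq0 => /eqP e'.
have n1 : V + T != 0 by apply: notG0; rewrite GaddN.
have [->|->] := ept_xc_eq (notG0 hW) n1 e'; [left|right].
  by rewrite addrAC subrr add0r.
by rewrite opprD addrAC addNr add0r GN.
Qed.

(** By [fibre_prod], a common zero would be an abscissa on V + G for every V outside G. *)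
Lemma coprime_qr : coprimep qr qs.
Proof.
apply/Pdiv.ClosedField.coprimepP => z /eqP rz; apply/negP => /eqP sz.
have g : ae (fun V => forall T, T \in G -> z != xc (V + T)).
  have : forall L : seq ept, ae (fun V => forall T, T \in L -> z != xc (V + T)).
    elim=> [|T L IH]; first by apply: ae_all.
    apply: ae_mono2 (ae_add T (ae_neqxc ch E z)) IH => V h1 h2 T'.
    by rewrite inE => /orP[/eqP->|]; [rewrite addrC | apply: h2].
  by apply.
have [V [hV nz]] := ae_ex (ae_and ae_notG g).
have := fibre_prod z hV; rewrite rz sz mulr0 subrr => /esym/eqP.
rewrite prodf_seq_eq0 => /hasP [T hT /=].
by rewrite subr_eq0 (negPf (nz _ hT)).
Qed.

Lemma rdeg_qr : rdeg qr qs = n.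
Proof. by rewrite /rdeg size_qr size_qs (maxn_idPl _). Qed.

Lemma qx_surj c : exists2 V, V \notin G & qx V = c.
Proof.
have sp : size (qr - c *: qs) != 1%N by rewrite size_qr_pencil; case: n n_gt0.
have [z rz] := closed_rootP _ sp.
have [sz ec] := root_pencil coprime_qr rz.
have [V [V0 xV]] := xc_surj ch E z.
have hV : V \notin G by apply: qs_root; rewrite ?xV.
by exists V => //; rewrite qrE // xV.
Qed.

Lemma ae_qx_neq c : ae (fun V => qx V != c).
Proof.
have nz : qr - c *: qs != 0 by rewrite -size_poly_eq0 size_qr_pencil.
apply: ae_mono2 ae_notG (ae_xc ch E nz) => V hV; apply: contra => /eqP e.
by rewrite hornerD hornerN hornerZ -e qrE // divfK ?subrr // qs_neq0.
Qed.

Lemma ae_qx_root (p : {poly k}) : p != 0 -> ae (fun V => p.[qx V] != 0).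
Proof.
move=> /roots_seq [r hr].
have g : ae (fun V => qx V \notin r).
  elim: r {hr} => [|c r IH]; first exact: ae_all.
  by apply: ae_mono2 (ae_qx_neq c) IH => V h1 h2; rewrite inE negb_or h1.
by apply: ae_mono g => V; apply: contra => /hr.
Qed.

(** [descent] along qr / qs, whose fibres are the cosets of G up to sign; no quotient curve exists
    yet. *)
Lemma quot_descent g : ratx g -> (forall V T, V \notin G -> T \in G -> g (V + T) = g V) ->
  exists al be : {poly k}, be != 0 /\ ae (fun V => be.[qx V] * g V = al.[qx V]).
Proof.
move=> /ratx_reduce [A [D [_ D0 hA]]] inv.
have gen : ae (fun V => V \notin G /\ [/\ uniq [seq xc (V + T) | T <- G],
    qr - qx V *: qs = \prod_(T <- G) ('X - (xc (V + T))%:P) &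
    forall T, T \in G -> D.[xc (V + T)] != 0 /\ g (V + T) = A.[xc (V + T)] / D.[xc (V + T)]]).
  have : forall L : seq ept, ae (fun V => forall T, T \in L ->
      D.[xc (V + T)] != 0 /\ g (V + T) = A.[xc (V + T)] / D.[xc (V + T)]).
    elim=> [|T L IH]; first by apply: ae_all.
    apply: ae_mono2 (ae_add T hA) IH => V h1 h2 T'.
    by rewrite inE => /orP[/eqP->|]; [rewrite addrC | apply: h2].
  move=> /(_ G) h; apply: ae_mono2 fibre_prod_generic h => V [h1 [h2 h3]] h4.
  by split.
have [al [be [be0 h]]] : exists al be : {poly k}, be != 0 /\ forall x, qs.[x] != 0 ->
    al.[qr.[x] / qs.[x]] * D.[x] = be.[qr.[x] / qs.[x]] * A.[x].
  apply: descent => //; rewrite ?rdeg_qr ?coprime_qr //.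
  case: gen => l hl; exists (map qx l) => c nc.
  have [V hV eV] := qx_surj c.
  have Vl : V \notin l by apply: contra nc => h; rewrite -eV map_f.
  have [_ [h1 h2 h3]] := hl _ Vl.
  exists [seq xc (V + T) | T <- G]; rewrite size_map; split => //.
    move=> z hz; split; last by case/mapP: hz => T /h3 [h _] ->.
    by rewrite -eV h2 -(big_map (fun T => xc (V + T)) xpredT (fun z => 'X - z%:P)) root_prod_XsubC.
  move=> z z' /mapP [T hT ->] /mapP [T' hT' ->].
  have [d e] := h3 _ hT; have [d' e'] := h3 _ hT'.
  by apply/eqP; rewrite -eqr_div // -e -e' !inv.
exists al, be; split => //.
apply: ae_mono2 ae_notG hA => V hV [d ->].
by rewrite mulrA qrE // -h ?qs_neq0 // mulfK.
Qed.

Let arq x y u v m j : (2 * x <= 2 * y + j)%N -> (0 < x)%N -> (0 < y)%N ->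
  (u + m = v)%N -> (v.+1 + y).-1 = (x + u.+1).-1 -> (2 * m.+1 <= j + 2)%N.
Proof. lia. Qed.

(** [qx] has a double pole at infinity, so a polynomial of degree m in it has a pole of order 2 m.
    The degrees of the monic [qr] and [qs] show it. *)
Lemma wt_qx_poly (al : {poly k}) j : wt (fun V => al.[qx V]) j -> (2 * size al <= j + 2)%N.
Proof.
have [->|al0] := eqVneq al 0; first by rewrite size_poly0.
move=> [A [B [D [D0 h sA _]]]].
pose m := (size al).-1.
have sal : size al = m.+1 by rewrite /m prednK // size_poly_gt0.
have e0 : ae (fun V => al.[qx V] = (hcomp m al qr qs).[xc V] / (qs ^+ m).[xc V]).
  apply: ae_mono ae_notG => V hV; have nz := qs_neq0 hV.
  by rewrite hcompE ?sal // -qrE // horner_exp mulrAC divff ?mul1r // expf_neq0.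
have qm0 : qs ^+ m != 0 by rewrite expf_neq0.
have e1 : ae (fun V => (hcomp m al qr qs).[xc V] / (qs ^+ m).[xc V] = A.[xc V] / D.[xc V]).
  apply: ae_mono (ae_and (ae_and h (ae_opp h)) (ae_and (ae_and e0 (ae_opp e0)) (ae_xc ch E D0))).
  move=> V [[h1 h2] [[h3 h4] d]].
  rewrite -h3; apply: (mulfI k2).
  have -> : 2%:R * al.[qx V] = al.[qx V] + al.[qx (- V)] by rewrite qx_opp; ring.
  by rewrite h1 h2 xcN ycN; field.
have eq := ratx_unique qm0 D0 e1.
have sh : size (hcomp m al qr qs) = (m * n).+1.
  rewrite /hcomp big_ord_recr /= subnn expr0 mulr1 addrC.
  have lc : al`_m != 0 by rewrite -[al`_m]/(lead_coef al) lead_coef_eq0.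
  have sq : size (qr ^+ m) = (m * n).+1.
    by rewrite size_exp_monic ?qr_monic // size_qr mulnC.
  rewrite size_polyDl size_scale // sq // ltnS.
  apply: (leq_trans (size_sum _ _ _)); apply/bigmax_leqP => i _.
  apply: (leq_trans (size_scale_leq _ _)); apply: (leq_trans (size_polyMleq _ _)).
  rewrite size_exp_monic ?qr_monic // size_exp_monic ?qs_monic // size_qr size_qs /=.
  have hi : (i < m)%N by [].
  have -> : (m * n = i * n + (m - i) * n)%N by rewrite -mulnDl subnKC // ltnW.
  move: hi n_gt0; clear; rewrite -subn_gt0; move: (m - i)%N n => d' n' h1 h2.
  rewrite [(n' * i)%N]mulnC; move: (i * n')%N => w.
  by case: n' h2 => // v _; rewrite mulnS [(v * d')%N]mulnC /=; move: (d' * v)%N => u; lia.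
have := congr1 (size \o polyseq) eq => /=.
have hc0 : hcomp m al qr qs != 0 by rewrite -size_poly_eq0 sh.
have A0 : A != 0.
  apply/eqP => A0; move: eq; rewrite A0 mul0r => /eqP.
  by rewrite mulf_eq0 (negPf hc0) (negPf D0).
rewrite size_mul // sh size_mul // size_exp_monic ?qs_monic // size_qs.
have hm : (n.-1 * m + m = m * n)%N by rewrite -mulSnr prednK // mulnC.
rewrite -!size_poly_gt0 in A0 D0; rewrite sal => e.
exact: arq sA A0 D0 hm e.
Qed.

(** By descent g is a reduced fraction al / be in [qx]. A zero of be is a value of [qx] by
    [qx_surj], and al would vanish there too because g has no pole; hence be is constant. The pole
    at infinity bounds the degree. *)
Lemma quot_poly g j : regG g -> wt g j ->
  (forall V, V \notin G -> g (- V) = g V) ->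
  (forall V T, V \notin G -> T \in G -> g (V + T) = g V) ->
  exists al : {poly k}, (2 * size al <= j + 2)%N /\ forall V, V \notin G -> g V = al.[qx V].
Proof.
move=> hg wg ev inv.
have rx : ratx g by apply: ratf_even (regG_ratf hg) _; apply: ae_mono ae_notG.
have [al [be [be0 h]]] := quot_descent rx inv.
pose d := gcdp al be.
have d0 : d != 0 by rewrite gcdp_eq0 negb_and be0 orbT.
have eA : al = al %/ d * d by rewrite divpK // dvdp_gcdl.
have eB : be = be %/ d * d by rewrite divpK // dvdp_gcdr.
have cop : coprimep (al %/ d) (be %/ d) by rewrite coprimep_div_gcd // be0 orbT.
have h' : ae (fun V => (be %/ d).[qx V] * g V = (al %/ d).[qx V]).
  apply: ae_mono2 h (ae_qx_root d0) => V; rewrite {1}eB {1}eA !hornerM => e nz.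
  by apply: (mulIf nz); rewrite -e mulrAC.
have h2 : forall V, V \notin G -> (be %/ d).[qx V] * g V = (al %/ d).[qx V].
  apply: regG_ae_eq h'; last exact: regG_horner regG_qx.
  by apply: regGM hg; exact: regG_horner regG_qx.
have nr z : (be %/ d).[z] != 0.
  apply/negP => /eqP bz; have [V hV eV] := qx_surj z.
  have := h2 V hV; rewrite eV bz mul0r => /esym az.
  by have := coprimep_rootP cop az; rewrite bz eqxx.
have [c c0 ec] : exists2 c, c != 0 & be %/ d = c%:P.
  have : size (be %/ d) == 1%N.
    apply/negPn/negP => ns; have [z rz] := closed_rootP _ ns.
    by move: (nr z); rewrite (eqP rz) eqxx.
  by move=> /size_poly1P [c c0 ec]; exists c.
have h3 : forall V, V \notin G -> g V = (c^-1 *: (al %/ d)).[qx V].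
  by move=> V hV; rewrite hornerZ -h2 // ec hornerC mulKf.
exists (c^-1 *: (al %/ d)); split => //.
apply: wt_qx_poly; apply: wt_eq wg; apply: ae_mono ae_notG => V hV.
exact: h3.
Qed.

Let dx V := \sum_(T <- rem 0 G) xc (V + T).
Let dy V := \sum_(T <- rem 0 G) yc (V + T).

Let qx_dx V : qx V = xc V + dx V.
Proof. by rewrite /qx (perm_big _ (perm_to_rem G0)) big_cons addr0. Qed.
Let qy_dy V : qy V = yc V + dy V.
Proof. by rewrite /qy (perm_big _ (perm_to_rem G0)) big_cons addr0. Qed.

Let wt_dx : wt dx 0.
Proof. by apply: wt_sum => T; rewrite memrem => /andP[T0 _]; apply: wt_xc_add. Qed.
Let wt_dy : wt dy 0.
Proof. by apply: wt_sum => T; rewrite memrem => /andP[T0 _]; apply: wt_yc_add. Qed.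

Lemma wt_qy : wt qy 3.
Proof.
apply: (@wt_eq _ _ _ (fun V => yc V + dy V)); first by apply: ae_all => V; rewrite qy_dy.
by apply: wtD; [exact: wt_yc | apply: wt_leq wt_dy].
Qed.

(** Near infinity qx = x + dx and qy = y + dy with dx and dy regular. The poles of order 6 cancel in
    qy^2 - qx^3, leaving order at most 4, that is a polynomial of degree at most 2 in [qx]. *)
Lemma qy_sq : exists c2 c1 c0 : k, forall V, V \notin G ->
  qy V ^+ 2 = qx V ^+ 3 + c2 * qx V ^+ 2 + c1 * qx V + c0.
Proof.
have [] := @quot_poly (fun V => qy V ^+ 2 - qx V ^+ 3) 4.
- by apply: regGB; apply: regGX; [exact: regG_qy | exact: regG_qx].
- apply: (@wt_eq _ _ _ (fun V => ((a * xc V + b) + 2%:R * (yc V * dy V)) + dy V * dy V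
     - (3%:R * (xc V * xc V * dx V) + (3%:R * (xc V * (dx V * dx V)) + dx V * (dx V * dx V))))).
    apply: ae_mono (ae_neq (0 : ept)) => V V0; rewrite qy_dy qx_dx.
    have := ycE V0; rewrite cubicE => e.
    transitivity ((yc V ^+ 2 - xc V ^+ 3) + 2%:R * (yc V * dy V) + dy V * dy V
     - (3%:R * (xc V * xc V * dx V) + (3%:R * (xc V * (dx V * dx V)) + dx V * (dx V * dx V)))); last by ring.
    by rewrite e; ring.
  have mulc c h j : wt h j -> wt (fun V => c * h V) j.
    by move=> hh; exact: wtM (wtC _ _ c) hh.
  have wx := wt_xc ch E; have wy := wt_yc ch E.
  apply: wtB; apply: wtD.
  + apply: wtD; last by apply: mulc; apply: wt_leq (wtM wy wt_dy).
    by apply: wtD; [apply: mulc; apply: wt_leq wx | apply: wt_leq (wtC _ _ b)].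
  + by apply: wt_leq (wtM wt_dy wt_dy).
  + by apply: mulc; exact: wtM (wtM wx wx) wt_dx.
  + apply: wtD; last by apply: wt_leq (wtM wt_dx (wtM wt_dx wt_dx)).
    by apply: mulc; apply: wt_leq (wtM wx (wtM wt_dx wt_dx)).
- by move=> V _; rewrite qy_opp qx_opp sqrrN.
- by move=> V T _ hT; rewrite qy_shift // qx_shift.
move=> al [sal h]; have {}sal : (size al <= 3)%N by rewrite -(leq_pmul2l (isT : 0 < 2)%N).
exists al`_2, al`_1, al`_0 => V hV; have := h V hV.
rewrite (horner_coef_wide _ sal) !big_ord_recr big_ord0 /= => e.
by rewrite -[LHS](subrK (qx V ^+ 3)) e; ring.
Qed.

Let ar1 m : (0 < m)%N -> (m < m * 4)%N. Proof. lia. Qed.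
Let ar2 m : (0 < m)%N -> (m + m < m * 4)%N. Proof. lia. Qed.
Let ar3 m : (0 < m)%N -> (m + (m + m) < m * 4)%N. Proof. lia. Qed.

(** The preimage of G under doubling has 4 n points, hence room for three successive choices outside
    G and outside the cosets already met. *)
Lemma half_points : exists W1 W2 W3,
  [/\ forall W, W \in [:: W1; W2; W3] -> W \notin G /\ W *+ 2 \in G,
      W1 - W2 \notin G, W1 - W3 \notin G & W2 - W3 \notin G].
Proof.
have [i2 _ [K [uK sK hK]]] := @muln_sepk k ch E 2 k2.
have /boolp.choice [lift hlift] := isog_surj i2.
have i2h : ishom (fun P : ept => P *+ 2) by case: i2.
pose H := [seq lift U + T | U <- G, T <- K].
have uH : uniq H.
  apply: allpairs_uniq => // -[V0 T0] [V0' T0'] /allpairsP [[V T] [/= hV hT [-> ->]]].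
  move=> /allpairsP [[V' T'] [/= hV' hT' [-> ->]]] e.
  have eV : V = V'.
    move: (congr1 (fun P => P *+ 2) e); rewrite !mulrnDl !hlift.
    by move: hT hT'; rewrite !hK => /eqP -> /eqP ->; rewrite !addr0.
  by move: e; rewrite eV => /addrI ->.
have sH : size H = (n * 4)%N by rewrite size_allpairs sK.
have hH W : W \in H -> W *+ 2 \in G.
  move=> /allpairsP [[V T] [/= hV]]; rewrite hK => /eqP hT ->.
  by rewrite mulrnDl hlift hT addr0.
have pick L : (size L < n * 4)%N -> exists2 W, W \in H & W \notin L.
  move=> sL; have [/allP h|/allPn [W]] := boolP (all (mem L) H).
    by have := uniq_leq_size uH h; rewrite sH leqNgt sL.
  by exists W.
pose cos W := [seq W + T | T <- G].
have cosP W V : (V \in cos W) = (V - W \in G).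
  apply/mapP/idP => [[T hT ->]|h]; first by rewrite addrC addKr.
  by exists (V - W) => //; rewrite addrC subrK.
have sc W : size (cos W) = n by rewrite size_map.
have [W3 h3 g3] : exists2 W, W \in H & W \notin G.
  by apply: pick; exact: ar1 n_gt0.
have [W2 h2 g2] : exists2 W, W \in H & W \notin G ++ cos W3.
  by apply: pick; rewrite size_cat sc; exact: ar2 n_gt0.
have [W1 h1 g1] : exists2 W, W \in H & W \notin G ++ cos W3 ++ cos W2.
  by apply: pick; rewrite !size_cat !sc; exact: ar3 n_gt0.
move: g2 g1; rewrite !mem_cat !negb_or !cosP => /andP[g2 d23] /and3P[g1 d13 d12].
exists W1, W2, W3; split => // W.
by rewrite !inE => /or3P[] /eqP ->; split => //; exact: hH.
Qed.

Lemma qy_half W : W *+ 2 \in G -> qy W = 0.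
Proof.
move=> h2; have : qy (- W) = qy W.
  by rewrite -(qy_shift _ h2) mulr2n addrA addNr add0r.
rewrite qy_opp => /eqP; rewrite eq_sym -addr_eq0 -mulr2n -mulr_natl mulf_eq0 (negPf k2).
by move/eqP.
Qed.

Lemma qx_half W W' : W \notin G -> W' \notin G -> W' *+ 2 \in G -> W - W' \notin G ->
  qx W != qx W'.
Proof.
move=> hW hW' h2 d; apply/negP => /eqP e.
have [h|h] := qx_eq hW hW' e; move/negP: d; apply.
  by rewrite -opprB GoppN.
by rewrite -(GaddN _ h2) mulr2n addrA subrK addrC.
Qed.

(** [qy] is odd and G-invariant, so it vanishes at the half points, whose values under [qx] are
    three distinct roots of the cubic. Their distinctness makes the quotient curve smooth. *)
Lemma qy_factor : exists e1 e2 e3 : k, [/\ e1 != e2, e1 != e3, e2 != e3,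
  (forall V, V \notin G -> qy V ^+ 2 = (qx V - e1) * (qx V - e2) * (qx V - e3)) &
  forall e, e \in [:: e1; e2; e3] -> exists W, [/\ W \notin G, W *+ 2 \in G & qx W = e]].
Proof.
have [c2 [c1 [c0 hc]]] := qy_sq.
have [W1 [W2 [W3 [hW d12 d13 d23]]]] := half_points.
have [g1 h1] : W1 \notin G /\ W1 *+ 2 \in G by apply: hW; rewrite !inE eqxx.
have [g2 h2] : W2 \notin G /\ W2 *+ 2 \in G by apply: hW; rewrite !inE eqxx ?orbT.
have [g3 h3] : W3 \notin G /\ W3 *+ 2 \in G by apply: hW; rewrite !inE eqxx ?orbT.
pose p : {poly k} := 'X^3 + (c2 *: 'X^2 + c1 *: 'X + c0%:P).
have pE z : p.[z] = z ^+ 3 + c2 * z ^+ 2 + c1 * z + c0 by rewrite /p !hornerE /=; ring.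
have sl : (size (c2 *: 'X^2 + c1 *: 'X + c0%:P)%R < 4)%N.
  rewrite (leq_ltn_trans (size_polyD _ _)) // gtn_max (leq_ltn_trans (size_polyC_leq1 _)) // andbT.
  rewrite (leq_ltn_trans (size_polyD _ _)) // gtn_max.
  by rewrite !(leq_ltn_trans (size_scale_leq _ _)) ?size_polyX ?size_polyXn.
have sp : size p = 4%N by rewrite /p size_polyDl size_polyXn.
have mp : lead_coef p = 1 by rewrite /p lead_coefDl ?size_polyXn // lead_coefXn.
have r1 W : W \notin G -> W *+ 2 \in G -> root p (qx W).
  by move=> g h; rewrite /root pE -hc // qy_half // expr0n.
have n12 := qx_half g1 g2 h2 d12; have n13 := qx_half g1 g3 h3 d13.
have n23 := qx_half g2 g3 h3 d23.
have rl : all (root p) [:: qx W1; qx W2; qx W3] by rewrite /= !r1.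
have ur : uniq_roots [:: qx W1; qx W2; qx W3].
  by rewrite uniq_rootsE /= !inE negb_or n12 n13 n23.
have ep := @all_roots_prod_XsubC _ p [:: qx W1; qx W2; qx W3] sp rl ur.
exists (qx W1), (qx W2), (qx W3); split => //.
  move=> V hV; rewrite hc // -pE ep mp scale1r !big_cons big_nil !hornerE /=; ring.
by move=> e; rewrite !inE => /or3P[] /eqP ->; [exists W1 | exists W2 | exists W3].
Qed.

(** * The quotient map is a homomorphism *)

Section Image.
Variables (E' : curve k) (phi : ept -> ept_on E') (t e1 e2 e3 : k).
Hypotheses (n12 : e1 != e2) (n13 : e1 != e3) (n23 : e2 != e3)
  (hq : forall V, V \notin G -> qy V ^+ 2 = (qx V - e1) * (qx V - e2) * (qx V - e3))
  (hW : forall e, e \in [:: e1; e2; e3] -> exists W, [/\ W \notin G, W *+ 2 \in G & qx W = e])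
  (ht : e1 + e2 + e3 = 3%:R * t)
  (phi0 : forall V, V \in G -> phi V = 0)
  (phi1 : forall V, V \notin G -> [/\ phi V != 0, xc (phi V) = qx V - t & yc (phi V) = qy V]).

Lemma ae_qy_neq0 : ae (fun V => qy V != 0).
Proof.
apply: ae_mono2 ae_notG (ae_and (ae_qx_neq e1) (ae_and (ae_qx_neq e2) (ae_qx_neq e3))).
move=> V hV [h1 [h2 h3]]; rewrite -sqrf_eq0 hq // !mulf_neq0 // subr_eq0 //.
Qed.

(* The norm of a line to the quotient is again a line. *)
Lemma line_norm mu nu : exists a0 a1 c : k,
  (exists2 V, V \notin G & a0 + a1 * qx V + c * qy V != 0) /\
  forall V, V \notin G -> yc V - mu * xc V - nu = 0 -> a0 + a1 * qx V + c * qy V = 0.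
Proof.
pose L V := yc V - mu * xc V - nu.
pose F V := \prod_(T <- G) L (V + T).
have rL T : T \in G -> regG (fun V => L (V + T)).
  move=> hT; apply: regGB (regGC nu); apply: regGB (regG_yc_add hT) _.
  exact: regGM (regGC mu) (regG_xc_add hT).
have rF : regG F by apply: regG_prod.
have rF' : regG (fun V => F (- V)) by exact: regG_opp.
have wF : wt F 3.
  apply: (@wt_eq _ _ _ (fun V => L V * \prod_(T <- rem 0 G) L (V + T))).
    by apply: ae_all => V; rewrite /F (perm_big _ (perm_to_rem G0)) big_cons addr0.
  apply: (@wtM _ _ _ _ _ 3 0).
    apply: wtB; last by apply: wt_leq (wtC _ _ nu).
    apply: wtB; first exact: wt_yc.
    by apply: (@wt_leq _ _ _ _ 2) => //; exact: wtM (wtC _ _ mu) (wt_xc _ _).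
  apply: wt_prod0 => T; rewrite memrem => /andP[T0 _].
  apply: wtB (wtC _ _ nu); apply: wtB; first exact: wt_yc_add.
  exact: wtM (wtC _ _ mu) (wt_xc_add T0).
have wF' : wt (fun V => F (- V)) 3 by exact: wt_opp.
have invF V T : T \in G -> F (V + T) = F V.
  move=> hT; rewrite /F -[in RHS](perm_big _ (perm_shift hT)) big_map.
  by apply: eq_bigr => U _; rewrite -addrA [T + U]addrC.
have invF' V T : T \in G -> F (- (V + T)) = F (- V).
  by move=> hT; rewrite opprD invF // GN.
have nzL : ae (fun V => L V != 0).
  have nz : ((- (mu *: 'X + nu%:P)) != 0) || ((1 : {poly k}) != 0) by rewrite oner_neq0 orbT.
  apply: ae_mono (ae_poly ch E nz) => V; rewrite !hornerE /= /L.
  by apply: contra => /eqP h; apply/eqP; rewrite -[RHS]h; ring.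
have nzF : ae (fun V => F V != 0).
  have : forall K : seq ept, ae (fun V => forall T, T \in K -> L (V + T) != 0).
    elim=> [|T K IH]; first by apply: ae_all.
    apply: ae_mono2 (ae_add T nzL) IH => V h1 h2 T'.
    by rewrite inE => /orP[/eqP->|]; [rewrite addrC | apply: h2].
  by move=> /(_ G); apply: ae_mono => V h; rewrite prodf_seq_neq0; apply/allP => T /h.
(* Even part of the norm: a pole of order at most 3 leaves degree at most 1 in [qx]. *)
have [al [sal hal]] : exists al : {poly k}, (2 * size al <= 3 + 2)%N /\
    forall V, V \notin G -> F V + F (- V) = al.[qx V].
  apply: quot_poly.
  - exact: regGD.
  - exact: wtD.
  - by move=> V _; rewrite opprK addrC.
  - by move=> V T _ hT; rewrite invF // invF'.
(* Odd part: multiplied by [qy] it is a polynomial of degree at most 3 in [qx] that vanishes at e1,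
   e2, e3, hence a multiple of qy^2; so the odd part is a multiple of [qy]. *)
have [be [sbe hbe]] : exists be : {poly k}, (2 * size be <= (3 + 3) + 2)%N /\
    forall V, V \notin G -> (F V - F (- V)) * qy V = be.[qx V].
  apply: quot_poly.
  - exact: regGM (regGB rF rF') regG_qy.
  - exact: wtM (wtB wF wF') wt_qy.
  - by move=> V _; rewrite opprK qy_opp mulrN -mulNr opprB.
  - by move=> V T _ hT; rewrite invF // invF' // qy_shift.
have {}sal : (size al <= 2)%N by move: sal; move: (size al) => u; clear; lia.
have {}sbe : (size be <= 4)%N by move: sbe; move: (size be) => u; clear; lia.
have rbe e : e \in [:: e1; e2; e3] -> root be e.
  by move=> /hW [W [gW h2 <-]]; rewrite /root -hbe // qy_half // mulr0.
have [c hc] : exists c, forall z, be.[z] = c * ((z - e1) * (z - e2) * (z - e3)).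
  have [->|b0] := eqVneq be 0; first by exists 0 => z; rewrite horner0 mul0r.
  have ul : uniq [:: e1; e2; e3] by rewrite /= !inE negb_or n12 n13 n23.
  have rl : all (root be) [:: e1; e2; e3] by apply/allP.
  have sb : size be = 4.
    by apply/eqP; rewrite eqn_leq sbe; exact: (max_poly_roots b0 rl ul).
  have ur : uniq_roots [:: e1; e2; e3] by rewrite uniq_rootsE.
  have -> := @all_roots_prod_XsubC _ be [:: e1; e2; e3] sb rl ur.
  exists (lead_coef be) => z; rewrite !big_cons big_nil !hornerE /=; ring.
have hodd : forall V, V \notin G -> F V - F (- V) = c * qy V.
  apply: regG_ae_eq.
  - exact: regGB.
  - exact: regGM (regGC c) regG_qy.
  - apply: ae_mono2 ae_notG ae_qy_neq0 => V hV y0; apply: (mulIf y0).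
    by rewrite hbe // hc -hq //; ring.
have hF V : V \notin G -> 2%:R * F V = al`_0 + al`_1 * qx V + c * qy V.
  move=> hV; have -> : 2%:R * F V = (F V + F (- V)) + (F V - F (- V)) by ring.
  rewrite hal // hodd // (horner_coef_wide _ sal) !big_ord_recr big_ord0 /=; ring.
exists al`_0, al`_1, c; split.
  have [V [hV nF]] := ae_ex (ae_and ae_notG nzF).
  by exists V => //; rewrite -hF //; exact: mulf_neq0 k2 nF.
move=> V hV LV; rewrite -hF // /F (perm_big _ (perm_to_rem G0)) big_cons addr0.
have -> : L V = 0 by [].
by rewrite /= mul0r mulr0.
Qed.

Lemma phi_xc_neq V W : V \notin G -> W \notin G -> qx V != qx W -> xc (phi V) != xc (phi W).
Proof.
move=> hV hW' ne; have [_ -> _] := phi1 hV; have [_ -> _] := phi1 hW'.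
by apply: contra ne => /eqP /addIr ->.
Qed.

(** P, Q and -(P + Q) lie on a line, so by [line_norm] their images do too; for generic P these
    three images have distinct abscissae and the addition formula can be read from them. *)
Lemma phi_add_gen Q : ae (fun P => phi (P + Q) = phi P + phi Q).
Proof.
have [hQ|hQ] := boolP (Q \in G).
  apply: ae_mono ae_notG => P hP; rewrite (phi0 hQ) addr0.
  have hPQ : P + Q \notin G by rewrite GaddN.
  have [u1 v1 w1] := phi1 hP; have [u2 v2 w2] := phi1 hPQ.
  by apply: ept_eq => //; rewrite ?v1 ?v2 ?w1 ?w2 ?qx_shift ?qy_shift.
have [i2 _ _] := @muln_sepk k ch E 2 k2.
have c1 := ae_isog i2 (ae_add Q ae_notG).
have c2 := ae_add Q ae_notG.
have c3 := ae_qx_neq (qx Q).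
have c4 := ae_add Q (ae_qx_neq (qx Q)).
have c5 := ae_neqxc ch E (xc Q).
apply: ae_mono (ae_and (ae_and c1 c2) (ae_and (ae_and c3 c4) (ae_and c5 ae_notG))).
move=> P [[g1 g2] [[g3 g4] [g5 g6]]].
rewrite addrC in g2; rewrite addrC in g4.
have d0 : xc Q - xc P != 0 by rewrite subr_eq0.
have g5' : xc P != xc Q by rewrite eq_sym.
have [_ ex ey] := ept_add_secant (notG0 g6) (notG0 hQ) g5'.
pose mu := (yc Q - yc P) / (xc Q - xc P).
have [a0 [a1 [c [[V0 gV0 nz] hL]]]] := line_norm mu (yc P - mu * xc P).
have hP : a0 + a1 * qx P + c * qy P = 0 by apply: hL => //; ring.
have hQ' : a0 + a1 * qx Q + c * qy Q = 0 by apply: hL => //; rewrite /mu; field.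
have hS : a0 + a1 * qx (P + Q) - c * qy (P + Q) = 0.
  rewrite -mulrN -qy_opp -(qx_opp (P + Q)); apply: hL; first by rewrite GoppN.
  by rewrite xcN ycN ey ex -/mu; ring.
have g7 : qx P != qx (P + Q).
  apply/negP => /eqP e; have [h|h] := qx_eq g6 g2 e.
    by move: h; rewrite addrAC subrr add0r (negPf hQ).
  by move/negP: g1; apply; rewrite mulr2n addrA [Q + P]addrC.
(* With c = 0 the form would vanish at two distinct values of [qx], hence identically, against its
   value at [V0]. *)
have c0 : c != 0.
  apply/negP => /eqP c0; move: hP hQ' nz; rewrite c0 !mul0r !addr0 => hP hQ'.
  have : a1 * (qx P - qx Q) = 0.
    by transitivity ((a0 + a1 * qx P) - (a0 + a1 * qx Q)); [ring | rewrite hP hQ' subrr].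
  move/eqP; rewrite mulf_eq0 subr_eq0 (negPf g3) orbF => /eqP a10.
  by move: hP; rewrite a10 !mul0r !addr0 => ->; rewrite eqxx.
pose m := - a1 / c; pose q := - a0 / c.
have lin (x y : k) : a0 + a1 * x + c * y = 0 -> y = m * x + q.
  move=> h; apply: (mulfI c0); rewrite /m /q.
  transitivity ((a0 + a1 * x + c * y) - a0 - a1 * x); first by ring.
  by rewrite h; field.
have yP := lin _ _ hP; have yQ := lin _ _ hQ'.
have yS : - qy (P + Q) = m * qx (P + Q) + q by apply: lin; rewrite mulrN.
have [p1 p2 p3] := phi1 g6; have [q1 q2 q3] := phi1 hQ; have [s1 s2 s3] := phi1 g2.
have nx : xc (phi P) != xc (phi Q) by exact: phi_xc_neq.
have [r1 r2 r3] := ept_add_secant p1 q1 nx.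
have dPQ : qx Q - qx P != 0 by rewrite subr_eq0 eq_sym.
have sl : (yc (phi Q) - yc (phi P)) / (xc (phi Q) - xc (phi P)) = m.
  have -> : xc (phi Q) - xc (phi P) = qx Q - qx P by rewrite p2 q2; ring.
  by rewrite p3 q3 yP yQ; field.
(* Sum of the roots of the cubic minus the squared line, obtained as the second divided difference
   of f at its three distinct zeros. *)
have sum : qx P + qx Q + qx (P + Q) - (e1 + e2 + e3) - m ^+ 2 = 0.
  pose f x := (x - e1) * (x - e2) * (x - e3) - (m * x + q) ^+ 2.
  have fP : f (qx P) = 0 by rewrite /f -hq // yP subrr.
  have fQ : f (qx Q) = 0 by rewrite /f -hq // yQ subrr.
  have fS : f (qx (P + Q)) = 0 by rewrite /f -hq // -yS sqrrN subrr.
  have d1 : qx P - qx Q != 0 by rewrite subr_eq0.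
  have d2 : qx P - qx (P + Q) != 0 by rewrite subr_eq0.
  have d3 : qx Q - qx (P + Q) != 0 by rewrite subr_eq0 eq_sym.
  apply: (mulfI (mulf_neq0 (mulf_neq0 d1 d2) d3)); rewrite mulr0.
  transitivity (f (qx P) * (qx Q - qx (P + Q)) + f (qx Q) * (qx (P + Q) - qx P)
     + f (qx (P + Q)) * (qx P - qx Q)); first by rewrite /f; ring.
  by rewrite fP fQ fS !mul0r !addr0.
have ex3 : xc (phi P + phi Q) = qx (P + Q) - t.
  rewrite r2 sl p2 q2.
  transitivity (qx (P + Q) - t - (qx P + qx Q + qx (P + Q) - (e1 + e2 + e3) - m ^+ 2)
     - ((e1 + e2 + e3) - 3%:R * t)); first by ring.
  by rewrite sum ht subrr !subr0.
apply: ept_eq => //; first by rewrite ex3.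
rewrite s3 r3 -r2 ex3 sl p2 p3 yP.
by rewrite -[LHS]opprK yS; ring.
Qed.

Lemma phi_hom : ishom phi.
Proof.
move=> P Q.
have [T [[h1 h2] h3]] := ae_ex (ae_and (ae_and (phi_add_gen (P + Q)) (phi_add_gen P))
   (ae_add P (phi_add_gen Q))).
apply: (addrI (phi T)); rewrite -h1 addrA addrA -h2.
by rewrite [T + P]addrC h3.
Qed.

End Image.

Theorem quotient_exists : exists (E' : curve k) (t : k) (phi : ept -> ept_on E'),
  [/\ sepk phi n, (forall V, (phi V == 0) = (V \in G)) &
      forall V, V \notin G -> xc (phi V) = qx V - t /\ yc (phi V) = qy V].
Proof.
have [e1 [e2 [e3 [n12 n13 n23 hq hW]]]] := qy_factor.
have k3 := char_ne3 ch.
(* Shifting by the mean of the roots removes the quadratic term, as the short Weierstrass form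
   requires. *)
pose t := (e1 + e2 + e3) / 3%:R.
pose A := (e1 - t) * (e2 - t) + (e1 - t) * (e3 - t) + (e2 - t) * (e3 - t).
pose B := - ((e1 - t) * (e2 - t) * (e3 - t)).
have sm : 4%:R * A ^+ 3 + 27%:R * B ^+ 2 != 0.
  have -> : 4%:R * A ^+ 3 + 27%:R * B ^+ 2 = - ((e1 - e2) * (e1 - e3) * (e2 - e3)) ^+ 2.
    by rewrite /A /B /t; field.
  by rewrite oppr_eq0 expf_neq0 // !mulf_neq0 // subr_eq0.
pose E' := Curve sm.
have ht : e1 + e2 + e3 = 3%:R * t by rewrite /t; field.
have hE' z : (cubic E').[z - t] = (z - e1) * (z - e2) * (z - e3).
  by rewrite cubicE /= /A /B /t; field.
have /boolp.choice [phi hphi] : forall V, exists Q : ept_on E',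
   (V \in G -> Q = 0) /\ (V \notin G -> [/\ Q != 0, xc Q = qx V - t & yc Q = qy V]).
  move=> V; have [hV|hV] := boolP (V \in G); first by exists 0.
  have [Q hQ] : exists Q : ept_on E', [/\ Q != 0, xc Q = qx V - t & yc Q = qy V].
    by apply: ept_of_xy; rewrite hE' hq.
  by exists Q.
have p0 V : V \in G -> phi V = 0 by case: (hphi V).
have p1 V : V \notin G -> [/\ phi V != 0, xc (phi V) = qx V - t & yc (phi V) = qy V].
  by case: (hphi V).
have hh : ishom phi by exact: (phi_hom n12 n13 n23 hq hW ht p0 p1).
have hk V : (phi V == 0) = (V \in G).
  by have [/p0 ->|/p1 [/negPf ->]] := boolP (V \in G); rewrite ?eqxx.
have ih : isog phi.
  split => //.
  - by apply: ae_mono ae_notG => V hV; rewrite hk.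
  - apply: (ratf_eq (g := fun V => qx V - t)).
      by apply: ae_mono ae_notG => V /p1 [_ -> _].
    exact: ratfB (regG_ratf regG_qx) (ratfC _ _ _).
  - apply: ratf_eq (regG_ratf regG_qy).
    by apply: ae_mono ae_notG => V /p1 [_ _ ->].
exists E', t, phi; split => //; last by move=> V /p1 [].
split => //; last by exists G; split => // P; rewrite hk.
exists (qr - t *: qs), qs; split; last by rewrite /rdeg size_qr_pencil size_qs (maxn_idPl _).
split; last first.
- apply: ae_mono ae_notG => V hV; have nz := qs_neq0 hV; split => //.
  have [_ -> _] := p1 _ hV; rewrite qrE // hornerD hornerN hornerZ.
  by field.
- exact: qs0.
- apply/Pdiv.ClosedField.coprimepP => z /(root_pencil coprime_qr) [sz _].
  by [].
Qed.

End Quotient.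

(** * Frobenius *)

Section Frobenius.
Variables (k : closedFieldType) (ch : good_char k) (E : curve k).
Variable sg : {rmorphism k -> k}.
Local Notation ept_on := (ept ch).
Local Notation ept := (ept ch E).
Hypotheses (sga : sg (coefA E) = coefA E) (sgb : sg (Defs.coefB E) = Defs.coefB E).

Definition pt_map (P : pt k) : pt k := omap (fun xy => (sg xy.1, sg xy.2)) P.

Lemma pt_map_on P : on_curve E P -> on_curve E (pt_map P).
Proof.
case: P => [[x y]|] //= /eqP h; apply/eqP.
by rewrite -rmorphXn h !rmorphD rmorphXn rmorphM /= sga sgb.
Qed.

Lemma pt_map_add P Q : pt_map (padd E P Q) = padd E (pt_map P) (pt_map Q).
Proof.
case: P Q => [[x1 y1]|] [[x2 y2]|] //=.
rewrite -rmorphN !fmorph_eq; case: ifP => //= _.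
case: (x1 == x2); rewrite !(rmorph_nat, rmorphXn, rmorphB, rmorphM, fmorphV, rmorphD) /= ?sga //.
Qed.

Definition galois_act (P : ept) : ept := exist _ (pt_map (sval P)) (pt_map_on (svalP P)).

Lemma galois_hom : ishom galois_act.
Proof. by move=> P Q; apply: ept_inj; rewrite /= pt_map_add. Qed.

Lemma galois_eq0 P : (galois_act P == 0) = (P == 0).
Proof. by case: P => [[[x y]|] hP]. Qed.

Lemma galois_xc P : xc (galois_act P) = sg (xc P).
Proof. by case: P => [[[x y]|] hP] //; rewrite /xc /= rmorph0. Qed.

Lemma galois_yc P : yc (galois_act P) = sg (yc P).
Proof. by case: P => [[[x y]|] hP] //; rewrite /yc /= rmorph0. Qed.

Lemma galois_inj : injective galois_act.
Proof. by apply: hom_inj galois_hom _ => P /eqP; rewrite galois_eq0 => /eqP. Qed.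

Lemma frobenius_isog q : (forall x, sg x = x ^+ q) -> isog galois_act.
Proof.
move=> hq; split.
- exact: galois_hom.
- by apply: ae_mono (ae_neq (0 : ept)) => P; rewrite galois_eq0.
- apply: (ratf_eq (g := fun P => xc P ^+ q)); last exact: ratfX (ratf_xc _ _).
  by apply: ae_all => P; rewrite galois_xc hq.
- apply: (ratf_eq (g := fun P => yc P ^+ q)); last exact: ratfX (ratf_yc _ _).
  by apply: ae_all => P; rewrite galois_yc hq.
Qed.

(** G being stable, [qx] and [qy] commute with the Galois action, so they satisfy the conjugate of
    their cubic equation as well. That equation is unique, which fixes t and the coefficients of
    E'. *)
Lemma quotient_galois (G : seq ept) (E' : curve k) (phi : ept -> ept_on E') t :
  uniq G -> 0 \in G -> (forall P Q, P \in G -> Q \in G -> P - Q \in G) ->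
  (forall T, T \in G -> galois_act T \in G) ->
  (forall V, (phi V == 0) = (V \in G)) ->
  (forall V, V \notin G -> xc (phi V) = qx G V - t /\ yc (phi V) = qy G V) ->
  sg (coefA E') = coefA E' /\ sg (Defs.coefB E') = Defs.coefB E'.
Proof.
move=> uG G0 GB Gs hk hphi.
have pG : perm_eq (map galois_act G) G.
  have uGm : uniq (map galois_act G) by rewrite map_inj_uniq //; exact: galois_inj.
  apply: uniq_perm => //.
  have sub : {subset map galois_act G <= G} by move=> x /mapP [T hT ->]; exact: Gs.
  by have [] := uniq_min_size uGm sub; rewrite ?size_map.
have Gs' V : V \notin G -> galois_act V \notin G.
  apply: contra => hV.
  have : galois_act V \in map galois_act G by rewrite (perm_mem pG).
  by case/mapP => T hT e; rewrite (galois_inj e).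
have sx V : qx G (galois_act V) = sg (qx G V).
  rewrite /qx -(perm_big _ pG) big_map rmorph_sum /=; apply: eq_bigr => T _.
  by rewrite -galois_hom galois_xc.
have sy V : qy G (galois_act V) = sg (qy G V).
  rewrite /qy -(perm_big _ pG) big_map rmorph_sum /=; apply: eq_bigr => T _.
  by rewrite -galois_hom galois_yc.
pose cu (t A B : k) : {poly k} := ('X - t%:P) ^+ 3 + A%:P * ('X - t%:P) + B%:P.
have cuE t' A B z : (cu t' A B).[z] = (z - t') ^+ 3 + A * (z - t') + B.
  by rewrite /cu !hornerE.
pose A := coefA E'; pose B := Defs.coefB E'.
have h1 V : V \notin G -> qy G V ^+ 2 = (cu t A B).[qx G V].
  move=> hV; have [ex ey] := hphi _ hV.
  have nz : phi V != 0 by rewrite hk.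
  by have := ycE nz; rewrite cubicE ex ey cuE.
have e : cu t A B = cu (sg t) (sg A) (sg B).
  apply/eqP; rewrite -subr_eq0; apply/negPn/negP => nz.
  have g1 : ae (fun V : ept => V \notin G) by exact: ae_notin.
  have [r hr] := roots_seq nz.
  have g2 : ae (fun V : ept => sg (qx G V) \notin r).
    elim: r {hr} => [|z r IH]; first exact: ae_all.
    (* A root outside the image of [sg] is avoided by every V. *)
    have [[y hy]|ny] := pselect (exists y, sg y = z); last first.
      by apply: ae_mono IH => V h; rewrite inE negb_or h andbT; apply/eqP => e; apply: ny; exists (qx G V).
    apply: ae_mono2 (ae_qx_neq uG G0 GB y) IH => V h h'.
    by rewrite inE negb_or h' andbT -hy fmorph_eq.
  have [V [hV hr2]] := ae_ex (ae_and g1 g2).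
  move/negP: hr2; apply; apply: hr; rewrite /root hornerD hornerN subr_eq0.
  have := congr1 sg (h1 _ hV); rewrite rmorphXn -sy h1 ?Gs' // sx => ->.
  by rewrite !cuE !(rmorphXn, rmorphB, rmorphD, rmorphM).
have k3 := char_ne3 ch.
(* The second difference of the cubic around 0 isolates 6 t. *)
have et : t = sg t.
  have l u A' B' : 2%:R * 3%:R * u = 2%:R * (cu u A' B').[0] - (cu u A' B').[1] - (cu u A' B').[-1].
    by rewrite !cuE; ring.
  by apply: (mulfI (mulf_neq0 (char_ne2 ch) k3)); rewrite (l t A B) e -l.
have h0 : B = sg B.
  by have := congr1 (fun p : {poly k} => p.[t]) e; rewrite /= !cuE -et subrr expr0n !mulr0 !add0r.
have h2 : A = sg A.
  have := congr1 (fun p : {poly k} => p.[1 + t]) e; rewrite /= !cuE -et addrK !mulr1 -h0.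
  by move/addIr/addrI.
by split.
Qed.

End Frobenius.

(** The map x -> x^q is an iterate of the p-Frobenius. Its fixed points are roots of X^q - X, and
    the image of F already supplies q of them. *)
Lemma frobenius_exists (k : closedFieldType) (F : finFieldType)
  (iota : {rmorphism F -> k}) p : p \in [pchar F] ->
  exists sg : {rmorphism k -> k}, (forall x, sg x = x ^+ #|F|) /\
    forall x, sg x = x <-> exists c, x = iota c.
Proof.
move=> hF.
have hk : p \in [pchar k].
  have := hF; rewrite !inE => /andP[-> /eqP h] /=.
  by rewrite -(rmorph_nat iota) h rmorph0.
have [n hn] : exists n, #|F| = (p ^ n)%N by eexists; exact: card_pprimeChar hF.
have [sg hsg] : exists sg : {rmorphism k -> k}, forall x, sg x = x ^+ (p ^ n).
  elim: n {hn} => [|n [sg IH]]; first by exists idfun => x; rewrite expn0 expr1.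
  exists (pFrobenius_aut hk \o sg) => x /=.
  by rewrite pFrobenius_autE IH -exprM expnSr.
exists sg; split => [x|x]; first by rewrite hn hsg.
split; last by move=> [c ->]; rewrite hsg -hn -rmorphXn expf_card.
move=> hx.
have c1 : (1 < #|F|)%N := finRing_gt1 F.
pose g : {poly k} := 'X^#|F| - 'X.
have sgm : size g = #|F|.+1.
  by rewrite /g size_polyDl size_polyXn // size_polyN size_polyX ltnS.
have g0 : g != 0 by rewrite -size_poly_eq0 sgm.
have rg z : root g (iota z).
  by rewrite /root /g !(hornerD, hornerN, hornerXn, hornerX) -rmorphXn expf_card subrr.
have ui : uniq (map iota (enum F)) by rewrite map_inj_uniq ?enum_uniq //; exact: fmorph_inj.
have [/mapP [c _ ->]|nx] := boolP (x \in map iota (enum F)); first by exists c.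
exfalso; have u2 : uniq (x :: map iota (enum F)) by rewrite /= nx.
have r2 : all (root g) (x :: map iota (enum F)).
  apply/allP => z; rewrite inE => /orP[/eqP->|/mapP [c _ ->]] //.
  by rewrite /root /g !(hornerD, hornerN, hornerXn, hornerX) hn -hsg hx subrr.
by have := max_poly_roots g0 r2 u2; rewrite /= size_map -cardE sgm ltnn.
Qed.

(** * Isomorphisms and automorphisms *)

Section Isomorphisms.
Variables (k : closedFieldType) (ch : good_char k).
Local Notation ept := (ept ch).
Implicit Types E : curve k.

Definition iso E E' (f : ept E -> ept E') :=
  isog f /\ exists g : ept E' -> ept E, [/\ isog g, cancel f g & cancel g f].

Lemma isog0_isog E E' (f : ept E -> ept E') P : isog0 f -> f P != 0 -> isog f.
Proof. by case=> [//|->]; rewrite eqxx. Qed.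

Lemma sepk_id E : sepk (@id (ept E)) 1.
Proof.
split; first exact: isog_id.
- exists 'X, 1; split; last by rewrite /rdeg size_polyX size_poly1.
  split; [exact: coprimep1 | exact: oner_neq0 |].
  by apply: ae_all => P; rewrite !hornerE oner_neq0 divr1.
- by exists [:: 0]; split => // P; rewrite inE.
Qed.

Lemma iso_sepk E E' (f : ept E -> ept E') : iso f -> sepk f 1.
Proof.
move=> [hf [g [hg fg gf]]].
have h : sepk (g \o f) 1.
  by rewrite (_ : g \o f = id); [exact: sepk_id | apply/funext => P; exact: fg].
have [a [b [e ha hb]]] := sepk_compP hf hg h.
suff -> : 1%N = a by [].
by move/eqP: e; rewrite eq_sym muln_eq1 => /andP[/eqP ->].
Qed.

Lemma iso_comp E E' E'' (f : ept E -> ept E') (g : ept E' -> ept E'') :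
  iso f -> iso g -> iso (g \o f).
Proof.
move=> [hf [f' [hf' c1 c2]]] [hg [g' [hg' c3 c4]]]; split; first exact: isog_comp.
exists (f' \o g'); split; first exact: isog_comp.
- exact: can_comp.
- exact: can_comp.
Qed.

Lemma iso_id E : iso (@id (ept E)).
Proof. by split; [exact: isog_id | exists id; split => //; exact: isog_id]. Qed.

(** Each isogeny factors through the other, and the two cofactors are inverse to each other because
    the isogenies are onto. *)
Lemma isog_same_ker E E' E'' (f : ept E -> ept E') (g : ept E -> ept E'') m n :
  sepk f m -> sepk g n -> (forall P, (f P == 0) = (g P == 0)) ->
  exists2 h : ept E' -> ept E'', iso h & forall P, h (f P) = g P.
Proof.
move=> hf hg hk; have [fi _ kf] := hf; have [gi _ kg] := hg.
have [h hh e] : exists2 h : ept E' -> ept E'', isog0 h & forall P, h (f P) = g P.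
  by apply: isog_factor hf (or_introl gi) _ => P /eqP; rewrite hk => /eqP.
have [h' hh' e'] : exists2 h' : ept E'' -> ept E', isog0 h' & forall P, h' (g P) = f P.
  by apply: isog_factor hg (or_introl fi) _ => P /eqP; rewrite -hk => /eqP.
have [_ ng _ _] := gi; have [P1 g1] := ae_ex ng.
have ih : isog h by apply: (isog0_isog (P := f P1)) => //; rewrite e.
have f1 : f P1 != 0 by rewrite hk.
have ih' : isog h' by apply: (isog0_isog (P := g P1)) => //; rewrite e'.
exists h => //; split => //; exists h'; split => // Q.
- by have [P <-] := isog_surj fi Q; rewrite e e'.
- by have [P <-] := isog_surj gi Q; rewrite e' e.
Qed.

End Isomorphisms.

(** * Automorphisms when j is neither 0 nor 1728 *)

Section Automorphisms.
Variables (k : closedFieldType) (ch : good_char k) (E : curve k).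
Local Notation ept := (ept ch E).
Local Notation a := (coefA E).
Local Notation b := (Defs.coefB E).
Local Notation fE := (cubic E).
Local Notation k2 := (char_ne2 ch).
Local Notation k3 := (char_ne3 ch).

Lemma poly_points (p q : {poly k}) : ae (fun P : ept => p.[xc P] = q.[xc P]) -> p = q.
Proof.
move=> h; apply/eqP; rewrite -subr_eq0; apply/negPn/negP => nz.
have [P [e1]] := ae_ex (ae_and h (ae_xc ch E nz)).
by rewrite hornerD hornerN e1 subrr eqxx.
Qed.

Let n4 : (4%:R : k) != 0.
Proof. by rewrite (_ : 4%:R = 2%:R * 2%:R :> k) ?mulf_neq0 ?k2 //; ring. Qed.

Let max_1_pred u : (maxn u 1).-1 = 1 -> u = 2.
Proof. lia. Qed.
Let max_pred1 u v : (maxn u v).-1 = 1 -> (u <= 2)%N /\ (v <= 2)%N.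
Proof. lia. Qed.

(* A pole z of the x-coordinate of an automorphism would satisfy f(z) = 0, by
   the parity of multiplicities in the curve equation, and x(2P) = x(P) for
   the points P above z. *)
Lemma iso_linear (f : ept -> ept) : iso f -> exists al be : k, exists c d : {poly k},
  [/\ al != 0, coprimep c d, d != 0 &
      ae (fun P => [/\ d.[xc P] != 0, xc (f P) = al * xc P + be &
                       yc (f P) = yc P * (c.[xc P] / d.[xc P])])].
Proof.
move=> hf; have [fi hd _] := iso_sepk hf; have f1 : ishom f by case: fi.
have [r [s [c0 [d0 [cop s0 d00 h0]]]]] := isog_std fi.
have er : rdeg r s = 1.
  apply: has_deg_unique hd; exists r, s; split => //; split => //.
  by apply: ae_mono h0 => P [].
have [c [d [copcd dn0 hcd]]] : exists c d : {poly k}, [/\ coprimep c d, d != 0 &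
    ae (fun P : ept => d.[xc P] != 0 /\ c0.[xc P] / d0.[xc P] = c.[xc P] / d.[xc P])].
  have [|c [d [h1 h2 h3]]] := @ratx_reduce k ch E (fun P => c0.[xc P] / d0.[xc P]).
    by exists c0, d0; split => //; exact: ae_all.
  by exists c, d.
have h : ae (fun P => [/\ s.[xc P] != 0, d.[xc P] != 0, xc (f P) = r.[xc P] / s.[xc P] &
                       yc (f P) = yc P * (c.[xc P] / d.[xc P])]).
  by apply: ae_mono2 h0 hcd => P [h1 h2 h3] [h4 h5]; split => //; rewrite h3 h5.
have fne : ae (fun P => f P != 0) by case: fi.
pose C := r ^+ 3 + a *: (r * s ^+ 2) + b *: s ^+ 3.
have CE z : C.[z] = r.[z] ^+ 3 + a * (r.[z] * s.[z] ^+ 2) + b * s.[z] ^+ 3.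
  by rewrite /C !(hornerD, hornerZ, hornerM, horner_exp).
clearbody C.
(* The curve equation at f P, cleared of denominators; [C] is the cubic homogenized at (r, s). *)
have eqC : fE * c ^+ 2 * s ^+ 3 = C * d ^+ 2.
  apply: poly_points; apply: ae_mono (ae_and (ae_and h fne) (ae_neq (0 : ept))).
  move=> P [[[h1 h2 h3 h4] h5] P0].
  have := ycE h5; rewrite h3 h4 exprMn ycE // [in RHS]cubicE => e.
  rewrite !(horner_exp, hornerM) CE.
  transitivity (fE.[xc P] * (c.[xc P] / d.[xc P]) ^+ 2 * d.[xc P] ^+ 2 * s.[xc P] ^+ 3).
    by field.
  by rewrite e; field.
have [cn0 Cn0] : c != 0 /\ C != 0.
  have n1 : c != 0.
    apply/eqP => c00; have [P [[h1 h2 h3 h4] h5]] := ae_ex (ae_and h (isog_yc_neq0 fi)).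
    by move: h5; rewrite h4 c00 horner0 mul0r mulr0 eqxx.
  split => //; apply/eqP => C0; move: eqC; rewrite C0 mul0r => /eqP.
  by apply/negP; rewrite !mulf_neq0 ?expf_neq0 ?cubic_neq0.
have [sr ss] := max_pred1 er.
have [s1|s2] := leqP (size s) 1.
  have [s' s'0 es] : exists2 s' : k, s' != 0 & s = s'%:P.
    have : size s == 1%N by rewrite eqn_leq s1 size_poly_gt0.
    by move=> /size_poly1P [s' ? ->]; exists s'.
  have sr2 : size r = 2.
    by move: er; rewrite /rdeg es size_polyC s'0; exact: max_1_pred.
  have rE z : r.[z] = r`_0 + r`_1 * z.
    by rewrite (horner_coef_wide _ sr) !big_ord_recr big_ord0 /=; ring.
  have r1 : r`_1 != 0.
    have -> : r`_1 = lead_coef r by rewrite lead_coefE sr2.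
    by rewrite lead_coef_eq0 -size_poly_eq0 sr2.
  exists (r`_1 / s'), (r`_0 / s'), c, d; split => //.
    by rewrite mulf_neq0 ?invr_eq0.
  apply: ae_mono h => P [h1 h2 h3 h4]; split => //.
  by rewrite h3 es hornerC rE; field.
exfalso.
have [z rz] := closed_rootP s (negbT (gtn_eqF s2)).
have sz : s.[z] = 0 by apply/eqP.
have rz0 : r.[z] != 0.
  by apply/eqP => r0; have := coprimep_rootP cop r0; rewrite sz eqxx.
have Cz : C.[z] != 0 by rewrite CE sz !expr0n /= !mulr0 !addr0 expf_neq0.
have ms : mup z s = 1%N.
  apply/eqP; rewrite eqn_leq mup_geq // mup_leq // expr1 -root_factor_theorem.
  rewrite /root sz eqxx andbT; apply/negP => /(dvdp_leq s0).
  by rewrite size_exp_XsubC leqNgt ltnS ss.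
(* If f(z) were nonzero, the multiplicity of z in [eqC] would be odd on the left, because of s^3,
   and even on the right. *)
have fz : fE.[z] = 0.
  apply/eqP/negPn/negP => fz.
  have := congr1 (mup z) eqC.
  rewrite -mulrA mupMr // [RHS]mupMr // mupM ?expf_neq0 //.
  rewrite (expr2 c) (expr2 d) !exprS expr0 mulr1 !mupM ?mulf_neq0 // ms.
  by move: (mup z c) (mup z d) => u v; clear; lia.
pose N : {poly k} := (3%:R *: 'X^2 + a%:P) ^+ 2 - 8%:R *: ('X * fE).
have NE w : N.[w] = (3%:R * w ^+ 2 + a) ^+ 2 - 8%:R * (w * fE.[w]).
  by rewrite /N !(hornerD, hornerN, hornerZ, hornerM, horner_exp, hornerX, hornerC).
pose Nh := (3%:R *: r ^+ 2 + a *: s ^+ 2) ^+ 2 - 8%:R *: (r * C).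
have NhE w : Nh.[w] = (3%:R * r.[w] ^+ 2 + a * s.[w] ^+ 2) ^+ 2 - 8%:R * (r.[w] * C.[w]).
  by rewrite /Nh !(hornerD, hornerN, hornerZ, hornerM, horner_exp).
clearbody N Nh.
pose r0 := r`_0; pose r1 := r`_1; pose q0 := s`_0; pose q1 := s`_1.
have rE w : r.[w] = r0 + r1 * w.
  by rewrite (horner_coef_wide _ sr) !big_ord_recr big_ord0 /= /r0 /r1; ring.
have sE w : s.[w] = q0 + q1 * w.
  by rewrite (horner_coef_wide _ ss) !big_ord_recr big_ord0 /= /q0 /q1; ring.
have i2 : isog (fun P : ept => P *+ 2) by case: (@muln_sepk k ch E 2 k2).
have dbl (P : ept) : P != 0 -> yc P != 0 -> xc (P *+ 2) = N.[xc P] / (4%:R * fE.[xc P]).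
  move=> P0 y0; have [_ e _] := ept_double P0 y0.
  rewrite mulr2n e NE -ycE //; field.
  by rewrite n4 y0 k2.
(* x(f(2P)) = x(2 f(P)) cleared of denominators; [N] is the numerator of the duplication formula and
   [Nh] its homogenization at (r, s). *)
have key : (r0 *: (4%:R *: fE) + r1 *: N) * (4%:R *: (s * C)) =
           Nh * (q0 *: (4%:R *: fE) + q1 *: N).
  apply: poly_points.
  have g1 := ae_and (ae_and h (ae_isog i2 h)) (ae_and (ae_neq (0 : ept)) (@ae_yc_neq0 k ch E)).
  have g2 := ae_and (ae_and fne (isog_yc_neq0 fi)) (ae_and (ae_xc ch E (cubic_neq0 E)) (ae_xc ch E Cn0)).
  apply: ae_mono (ae_and g1 g2) => P [[[[h1 h2 h3 h4] [u1 u2 u3 u4]] [P0 yP]] [[fP yf] [f0 CP]]].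
  have y0 := yP P0; have e1 := dbl _ P0 y0.
  have e2 : xc (f (P *+ 2)) = N.[xc (f P)] / (4%:R * fE.[xc (f P)]).
    by rewrite homMn // dbl.
  have fC : fE.[xc (f P)] = C.[xc P] / s.[xc P] ^+ 3.
    by rewrite cubicE h3 CE; field.
  have fN : N.[xc (f P)] = Nh.[xc P] / s.[xc P] ^+ 4.
    by rewrite NE fC h3 NhE; field.
  move: e2; rewrite u3 rE sE e1 fN fC => e2.
  have u1' : q0 * (4%:R * fE.[xc P]) + q1 * N.[xc P] != 0.
    move: u1; rewrite sE e1; apply: contra => /eqP e.
    rewrite -(mulrI_eq0 _ (mulfI (mulf_neq0 n4 f0))).
    by apply/eqP; rewrite -[RHS]e; field; rewrite n4 f0.
  rewrite !(hornerM, hornerD, hornerZ).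
  have e3 : (r0 * (4%:R * fE.[xc P]) + r1 * N.[xc P]) / (q0 * (4%:R * fE.[xc P]) + q1 * N.[xc P])
     = Nh.[xc P] / (4%:R * (s.[xc P] * C.[xc P])).
    have -> : Nh.[xc P] / (4%:R * (s.[xc P] * C.[xc P])) =
       Nh.[xc P] / s.[xc P] ^+ 4 / (4%:R * (C.[xc P] / s.[xc P] ^+ 3)).
      by field; rewrite h1 n4 CP.
    by rewrite -e2; field; rewrite n4 f0 u1'.
  have t0 : 4%:R * (s.[xc P] * C.[xc P]) != 0 by rewrite mulf_neq0 ?mulf_neq0 ?n4.
  by apply/eqP; rewrite -(eqr_div _ _ u1' t0); apply/eqP.
(* At z the left side vanishes, while on the right Nh(z) = r(z)^4, q1 and N(z) = f'(z)^2 are all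
   nonzero. *)
have := congr1 (fun p : {poly k} => p.[z]) key.
rewrite /= !(hornerM, hornerD, hornerZ) sz fz !(mul0r, mulr0, add0r) => /esym/eqP.
have Nhz : Nh.[z] != 0.
  rewrite NhE CE sz expr0n /= !mulr0 !addr0.
  rewrite (_ : _ - _ = r.[z] ^+ 4); last by ring.
  by rewrite expf_neq0.
have q10 : q1 != 0.
  apply/negP => /eqP q10; move: sz; rewrite sE q10 mul0r addr0 => q00.
  move/negP: s0; apply; apply/eqP/polyP => i; rewrite coef0.
  case: i => [|[|i]]; [exact: q00|exact: q10|].
  by apply: nth_default; rewrite (leq_trans ss).
rewrite mulf_eq0 (negPf Nhz) mulf_eq0 (negPf q10) NE fz !mulr0 subr0 sqrf_eq0.
by rewrite (negPf (cubic_simple fz)).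
Qed.

(** The cubic is squarefree, so the factor by which f multiplies y has constant denominator, and
    degrees make it a constant ka with ka^2 f(x) = f(al x + be). Values at 0, 1, -1 and 2 give be =
    0, then ka^2 = 1 as b != 0, and al = 1 as a != 0. *)
Lemma automorphism_pm1 (f : ept -> ept) : a != 0 -> b != 0 -> iso f ->
  f = id \/ f = -%R.
Proof.
move=> a0 b0 hf; have [al [be [c [d [al0 cop d0 h]]]]] := iso_linear hf.
have [fi _] := hf; have f1 : ishom f by case: fi.
have fne : ae (fun P => f P != 0) by case: fi.
pose C : {poly k} := (al *: 'X + be%:P) ^+ 3 + a *: (al *: 'X + be%:P) + b%:P.
have CE z : C.[z] = (al * z + be) ^+ 3 + a * (al * z + be) + b.
  by rewrite /C !(hornerD, hornerZ, hornerM, horner_exp, hornerX, hornerC).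
have eqC : fE * c ^+ 2 = C * d ^+ 2.
  apply: poly_points; apply: ae_mono (ae_and (ae_and h fne) (ae_neq (0 : ept))).
  move=> P [[[h1 h2 h3] h4] P0].
  have := ycE h4; rewrite h2 h3 exprMn ycE // [in RHS]cubicE -CE => e.
  by rewrite !(horner_exp, hornerM) -e; field.
have dv : d ^+ 2 %| fE.
  have cp : coprimep (d ^+ 2) (c ^+ 2).
    by rewrite coprimep_expl // coprimep_expr // coprimep_sym.
  by rewrite -(Gauss_dvdpl _ cp) eqC dvdp_mull.
have d1 : size d = 1%N.
  apply/eqP/negPn/negP => nd; have [z rz] := closed_rootP _ nd.
  have dz : ('X - z%:P) ^+ 2 %| fE.
    apply: dvdp_trans dv; rewrite dvdp_exp2r //; by rewrite -root_factor_theorem.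
  have /dvdpP [q eq] := dz.
  have fz : fE.[z] = 0 by rewrite eq hornerM horner_exp hornerXsubC subrr expr0n mulr0.
  have := cubic_simple fz; rewrite -cubic_deriv eq => /negP; apply.
  by apply/eqP; rewrite !derivE !hornerE subrr /=; ring.
have [d' d'0 ed] : exists2 d' : k, d' != 0 & d = d'%:P.
  by move/eqP: d1 => /size_poly1P [d' ? ->]; exists d'.
have sC : (size C <= 4)%N.
  have s1 : (size (al *: 'X + be%:P)%R <= 2)%N.
    rewrite (leq_trans (size_polyD _ _)) // geq_max (leq_trans (size_scale_leq _ _)) ?size_polyX //.
    by rewrite (leq_trans (size_polyC_leq1 _)).
  rewrite /C (leq_trans (size_polyD _ _)) // geq_max (leq_trans (size_polyC_leq1 _)) // andbT.
  rewrite (leq_trans (size_polyD _ _)) // geq_max.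
  rewrite (leq_trans (size_poly_exp_leq _ _)) /=; last first.
    by move: s1; move: (size _) => u; clear; lia.
  by rewrite (leq_trans (size_scale_leq _ _)) // (leq_trans s1).
have c1 : (size c <= 1)%N.
  have := congr1 (size \o polyseq) eqC; rewrite /= ed -polyC_exp mulrC [C * _]mulrC mul_polyC.
  rewrite size_scale ?expf_neq0 // => e.
  have cn0 : c != 0.
    apply/eqP => c00; have [P [[h1 h2 h3] h5]] := ae_ex (ae_and h (isog_yc_neq0 fi)).
    by move: h5; rewrite h3 c00 horner0 mul0r mulr0 eqxx.
  move: e sC; rewrite size_mul ?expf_neq0 ?cubic_neq0 // size_cubic expr2 size_mul //.
  by move: (size c) (size C) => u v; clear; lia.
have [ka hka] : exists ka : k, forall P : ept, c.[xc P] / d.[xc P] = ka.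
  exists (c`_0 / d') => P; rewrite ed hornerC; congr (_ / _).
  by rewrite (size1_polyC c1) hornerC coefC.
have eqK : ka ^+ 2 *: fE = C.
  apply: poly_points; apply: ae_mono (ae_and (ae_and h fne) (ae_neq (0 : ept))).
  move=> P [[[h1 h2 h3] h4] P0].
  by have := ycE h4; rewrite h2 h3 hka exprMn ycE // [in RHS]cubicE -CE hornerZ mulrC.
have ev z : ka ^+ 2 * (z ^+ 3 + a * z + b) = (al * z + be) ^+ 3 + a * (al * z + be) + b.
  by rewrite -CE -eqK hornerZ cubicE.
have v0 := ev 0; have v1 := ev 1; have v2 := ev (-1); have v3 := ev 2%:R.
have be0 : be = 0.
  have : 2%:R * 3%:R * al ^+ 2 * be = 0.
    transitivity ((((al * 1 + be) ^+ 3 + a * (al * 1 + be) + b) + ((al * -1 + be) ^+ 3 + a * (al * -1 + be) + b))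
      - 2%:R * ((al * 0 + be) ^+ 3 + a * (al * 0 + be) + b)); first by ring.
    by rewrite -v0 -v1 -v2; ring.
  by move/eqP; rewrite mulf_eq0 mulf_eq0 expf_eq0 (negPf al0) andbF mulf_eq0 (negPf k2) (negPf k3) => /eqP.
have ka1 : ka ^+ 2 = 1.
  apply: (mulIf b0); rewrite mul1r.
  have <- : ka ^+ 2 * (0 ^+ 3 + a * 0 + b) = ka ^+ 2 * b by ring.
  by rewrite v0 be0; ring.
have al1 : al = 1.
  apply: (mulfI (mulf_neq0 k2 (mulf_neq0 k3 a0))).
  have E1 : 1 + a + b = al ^+ 3 + a * al + b.
    have := v1; rewrite ka1 be0 mul1r expr1n mulr1 => ->; ring.
  have E2 : 8%:R + 2%:R * a + b = 8%:R * al ^+ 3 + 2%:R * a * al + b.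
    have := v3; rewrite ka1 be0 mul1r => h'.
    transitivity (2%:R ^+ 3 + a * 2%:R + b); first by ring.
    by rewrite h'; ring.
  transitivity ((8%:R * (al ^+ 3 + a * al + b) - (8%:R * al ^+ 3 + 2%:R * a * al + b)) - 7%:R * b); first by ring.
  by rewrite -E1 -E2; ring.
have /orP[/eqP k1|/eqP k1] : (ka == 1) || (ka == -1) by rewrite -sqrf_eq1 ka1.
- left; apply: hom_ae_eq => //.
  apply: ae_mono (ae_and (ae_and h fne) (ae_neq (0 : ept))) => P [[[h1 h2 h3] h4] P0].
  by apply: ept_eq => //; rewrite ?h2 ?h3 ?hka ?k1 ?al1 ?be0 ?mul1r ?mulr1 ?addr0.
- right; apply: hom_ae_eq => //; first by move=> P Q; rewrite opprD.
  apply: ae_mono (ae_and (ae_and h fne) (ae_neq (0 : ept))) => P [[[h1 h2 h3] h4] P0].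
  apply: ept_eq; rewrite ?oppr_eq0 ?xcN ?ycN ?h2 ?h3 ?hka ?k1 ?al1 ?be0 ?mul1r ?mulrN1 ?addr0 //.
Qed.

End Automorphisms.

(** * Comparison with maps on raw points *)

Section Bridge.
Variables (k : closedFieldType) (ch : good_char k).
Local Notation ept := (ept ch).
Implicit Types E : curve k.

(** Raw points off the curve go to infinity by default, so maps on raw points restrict to total maps
    on [ept]. *)
Definition mkpt E (P : pt k) : ept E :=
  match @idP (on_curve E P) with
  | ReflectT h => exist _ P h
  | ReflectF _ => ept0
  end.

Lemma mkptK E P : points E P -> sval (mkpt E P) = P.
Proof. by move=> /on_curveP h; rewrite /mkpt; case: {-}_ / idP => // n; case: n. Qed.

Lemma svalK E (P : ept E) : mkpt E (sval P) = P.
Proof. by apply: ept_inj; apply: mkptK; apply/on_curveP; exact: svalP P. Qed.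

Lemma points_sval E (P : ept E) : points E (sval P).
Proof. by apply/on_curveP; exact: svalP P. Qed.

Lemma points_ex E P : points E P -> exists Q : ept E, P = sval Q.
Proof. by move=> h; exists (mkpt E P); rewrite mkptK. Qed.

Definition restr E E' (phi : pt k -> pt k) (P : ept E) : ept E' := mkpt E' (phi (sval P)).
Definition extp E E' (f : ept E -> ept E') (P : pt k) : pt k := sval (f (mkpt E P)).
Arguments restr {E E'}.
Arguments extp {E E'}.

Definition maps E E' (phi : pt k -> pt k) := forall P, points E P -> points E' (phi P).

Lemma maps_extp E E' (f : ept E -> ept E') : maps E E' (extp f).
Proof. by move=> P _; apply: points_sval. Qed.

Lemma restrK E E' (f : ept E -> ept E') : restr (extp f) = f.
Proof. by apply/funext => P; rewrite /restr /extp !svalK. Qed.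

Lemma restrE E E' phi : maps E E' phi -> forall P : ept E, sval (restr phi P : ept E') = phi (sval P).
Proof. by move=> h P; rewrite mkptK //; apply: h; exact: points_sval. Qed.

Lemma extpE E E' (f : ept E -> ept E') (P : ept E) : extp f (sval P) = sval (f P).
Proof. by rewrite /extp svalK. Qed.

Lemma sval_eq0 E (P : ept E) : sval P = None <-> P = 0.
Proof. by split=> [h|->//]; apply: ept_inj. Qed.

Lemma aeP E (Q : pt k -> Prop) :
  almost_everywhere E Q <-> ae (fun P : ept E => Q (sval P)).
Proof.
split.
- move=> /finite_seqP [s hs]; exists (map (mkpt E) s) => P hP.
  apply: contrapT => nQ; move/negP: hP; apply.
  have : [set` s] (sval P) by rewrite -hs; split => //; exact: points_sval.
  by move=> h; rewrite -[P]svalK; exact: map_f.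
- move=> [s hs]; apply: (@sub_finite_set _ _ [set` map (fun P : ept E => sval P : pt k) s]).
    move=> P [hP nQ]; have [Q' e] := points_ex hP; subst P.
    rewrite /= map_f //; apply/negPn/negP => h; exact: nQ (hs _ h).
  exact: finite_seq.
Qed.

Lemma ratf_biv E (U : {poly {poly k}}) :
  ratf (fun P : ept E => (U.[(xc P)%:P]).[yc P]).
Proof.
elim/poly_ind: U => [|U c IH].
  by apply: ratf_eq (ratfC _ _ 0); apply: ae_all => P; rewrite !horner0.
apply: (ratf_eq (g := fun P : ept E => (U.[(xc P)%:P]).[yc P] * xc P + c.[yc P])).
  by apply: ae_all => P; rewrite hornerMXaddC hornerD hornerM hornerC.
apply: ratfD; last by apply: ratf_horner; exact: ratf_yc.
by apply: ratfM IH (ratf_xc _ _).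
Qed.

Lemma point_homP E E' phi : maps E E' phi ->
  (point_hom E E' phi <-> ishom (restr phi : ept E -> ept E')).
Proof.
move=> hm; split=> [[_ h] P Q|h].
  by apply: ept_inj; rewrite ept_addE !restrE // ept_addE h //; exact: points_sval.
split => // P Q /points_ex [P' ->] /points_ex [Q' ->].
by rewrite -ept_addE -!(restrE hm) h ept_addE.
Qed.

Lemma isogenyP E E' phi :
  isogeny E E' phi <-> maps E E' phi /\ isog (restr phi : ept E -> ept E').
Proof.
split.
- move=> [hp [U [V [W hae]]]]; have hm : maps E E' phi by case: hp.
  split => //; have hh := proj1 (point_homP hm) hp.
  have h : ae (fun P : ept E => [/\ restr phi P != 0 :> ept E',
     xc (restr phi P : ept E') = (U.[(xc P)%:P]).[yc P] / (W.[(xc P)%:P]).[yc P] &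
     yc (restr phi P : ept E') = (V.[(xc P)%:P]).[yc P] / (W.[(xc P)%:P]).[yc P]]).
    apply: ae_mono (proj1 (aeP E _) hae) => P [x [y [eP nW ephi]]].
    have e : sval (restr phi P : ept E') = Some ((U.[x%:P]).[y] / (W.[x%:P]).[y], (V.[x%:P]).[y] / (W.[x%:P]).[y]).
      by rewrite restrE.
    have [ex ey] : xc P = x /\ yc P = y by rewrite /xc /yc eP.
    rewrite ex ey; split; last 2 first.
    - by rewrite /xc e.
    - by rewrite /yc e.
    by apply/eqP => z; move: e; rewrite z.
  split => //.
  + by apply: ae_mono h => P [].
  + apply: (ratf_eq _ (ratf_div (ratf_biv E U) (ratf_biv E W))).
    by apply: ae_mono h => P [_ ->].
  + apply: (ratf_eq _ (ratf_div (ratf_biv E V) (ratf_biv E W))).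
    by apply: ae_mono h => P [_ _ ->].
- move=> [hm [f1 f2 [A [B [D [D0 hx]]]] [A' [B' [D' [D0' hy]]]]]].
  split; first exact/(point_homP hm).
  (* In [U.[x%:P].[y]] the outer variable is x and the inner one y: [lft] embeds polynomials in x,
     and the constant [('X)%:P] is y. *)
  pose lft (p : {poly k}) : {poly {poly k}} := map_poly polyC p.
  have lE p x y : ((lft p).[x%:P]).[y] = p.[x] by rewrite /lft horner_map hornerC.
  exists (lft (A * D') + lft (B * D') * ('X)%:P), (lft (A' * D) + lft (B' * D) * ('X)%:P), (lft (D * D')).
  apply/aeP; have g := ae_and (ae_and hx hy) (ae_and (ae_xc ch E D0) (ae_xc ch E D0')).
  apply: ae_mono (ae_and (ae_and f2 (ae_neq (0 : ept E))) g) => P [[fP P0] [[ex ey] [d d']]].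
  exists (xc P), (yc P); rewrite !(hornerD, hornerM) !lE !hornerC !hornerX !hornerM.
  split; [exact: eptS | by rewrite mulf_neq0 |].
  rewrite -(restrE hm) (eptS fP) ex ey; congr (Some (_, _)); field.
    by rewrite d d'.
  by rewrite d d'.
Qed.

Lemma isogeny_degreeP E E' phi n : maps E E' phi -> isog (restr phi : ept E -> ept E') ->
  (isogeny_degree E phi n <-> has_deg (restr phi : ept E -> ept E') n).
Proof.
move=> hm hf; split.
- move=> [r [s [cop -> h]]].
  have h' : ae (fun P : ept E => s.[xc P] != 0 /\ xc (restr phi P : ept E') = r.[xc P] / s.[xc P]).
    apply: ae_mono (proj1 (aeP E _) h) => P [x [y [y' [eP ns ep]]]].
    have e : sval (restr phi P : ept E') = Some (r.[x] / s.[x], y') by rewrite restrE.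
    by rewrite {2}/xc e /xc eP.
  exists r, s; split => //; split => //.
  by apply/eqP => s0; have [P []] := ae_ex h'; rewrite s0 horner0 eqxx.
- move=> [r [s [[cop s0 h] ->]]]; exists r, s; split => //; apply/aeP.
  have fne : ae (fun P : ept E => restr phi P != 0 :> ept E') by case: hf.
  apply: ae_mono (ae_and (ae_and h fne) (ae_neq (0 : ept E))) => P [[[h1 h2] h3] h4].
  exists (xc P), (yc P), (yc (restr phi P : ept E')); split => //; first exact: eptS.
  by rewrite -(restrE hm) (eptS h3) h2.
Qed.

Lemma degree_isogenyP E E' phi n :
  degree_isogeny E E' n phi <->
  [/\ maps E E' phi, isog (restr phi : ept E -> ept E') & has_deg (restr phi : ept E -> ept E') n].
Proof.
split.
- move=> [/isogenyP [hm hf] hd]; split => //; exact/(isogeny_degreeP n hm hf).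
- move=> [hm hf hd]; split; [exact/isogenyP | exact/(isogeny_degreeP n hm hf)].
Qed.

Lemma isomorphismP E E' phi :
  isomorphism E E' phi <-> maps E E' phi /\ iso (restr phi : ept E -> ept E').
Proof.
split.
- move=> [/isogenyP [hm hf] [psi [/isogenyP [hm' hf'] c1 c2]]]; split => //.
  split => //; exists (restr psi); split => //.
  + by move=> P; apply: ept_inj; rewrite !restrE // c1 //; exact: points_sval.
  + by move=> P; apply: ept_inj; rewrite !restrE // c2 //; exact: points_sval.
- move=> [hm [hf [g [hg c1 c2]]]]; split; first exact/isogenyP.
  exists (extp g); split.
  + by apply/isogenyP; split; [exact: maps_extp | rewrite restrK].
  + by move=> P /points_ex [Q ->]; rewrite -(restrE hm) extpE c1.
  + by move=> P /points_ex [Q ->]; rewrite extpE -(restrE hm) c2.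
Qed.

Lemma endomorphismP E phi :
  endomorphism E phi <-> maps E E phi /\ isog0 (restr phi : ept E -> ept E).
Proof.
split.
- move=> [/isogenyP [hm hf]|h]; first by split => //; left.
  split; first by move=> P /h ->.
  by right; apply/funext => P; apply: ept_inj; rewrite /restr (h _ (points_sval P)) mkptK.
- move=> [hm [hf|e]]; [by left; apply/isogenyP | right => P /points_ex [Q ->]].
  by rewrite -(restrE hm) e.
Qed.

Record cm (O : set algC) E (R : algC -> ept E -> ept E) : Prop := Cm {
  cm_isog : forall a, O a -> isog0 (R a);
  cm1 : forall P, R 1 P = P;
  cmD : forall a b P, O a -> O b -> R (a + b) P = R a P + R b P;
  cmM : forall a b P, O a -> O b -> R (a * b) P = R a (R b P);
  cm_inj : forall a, O a -> (forall P, R a P = 0) -> a = 0;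
  cm_surj : forall f : ept E -> ept E, isog0 f -> exists2 a, O a & forall P, f P = R a P }.

Lemma End_iso_cm O E rho : O 1 -> (forall a b, O a -> O b -> O (a + b)) ->
  (forall a b, O a -> O b -> O (a * b)) ->
  End_iso O E rho -> cm O (fun a => restr (rho a) : ept E -> ept E).
Proof.
move=> O1 OD OM [h1 [h2 h3 h4] h5 h6].
have hm a : O a -> maps E E (rho a) by move=> /h1 /endomorphismP [].
split.
- by move=> a /h1 /endomorphismP [].
- by move=> P; apply: ept_inj; rewrite restrE ?h2 //; [exact: points_sval | exact: hm].
- move=> a b P Oa Ob; apply: ept_inj; rewrite restrE; last exact/hm/OD.
  rewrite h3 //; last exact: points_sval.
  by rewrite ept_addE !restrE //; exact: hm.
- move=> a b P Oa Ob; apply: ept_inj; rewrite !restrE; [|exact: hm|exact: hm|exact/hm/OM].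
  by rewrite h4 //; exact: points_sval.
- move=> a Oa h; apply: h5 => // P /points_ex [Q ->].
  by rewrite -(restrE (hm a Oa)) h.
- move=> f hf; have [|a Oa ha] := h6 (extp f).
    by apply/endomorphismP; split; [exact: maps_extp | rewrite restrK].
  exists a => // P; apply: ept_inj; rewrite restrE; last exact: hm.
  by rewrite -ha ?extpE //; exact: points_sval.
Qed.

Lemma cm_End_iso O E (R : algC -> ept E -> ept E) :
  cm O R -> End_iso O E (fun a => extp (R a)).
Proof.
move=> [h1 h2 h3 h4 h5 h6]; split.
- by move=> a Oa; apply/endomorphismP; split; [exact: maps_extp | rewrite restrK; exact: h1].
- split.
  + by move=> P /points_ex [Q ->]; rewrite extpE h2.
  + by move=> a b P Oa Ob /points_ex [Q ->]; rewrite !extpE h3 // ept_addE.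
  + by move=> a b P Oa Ob /points_ex [Q ->]; rewrite !extpE h4.
- move=> a Oa h; apply: h5 => // P; apply: ept_inj; rewrite -extpE h //.
  exact: points_sval.
- move=> phi /endomorphismP [hm hf]; have [a Oa ha] := h6 _ hf.
  by exists a => // P /points_ex [Q ->]; rewrite extpE -ha restrE.
Qed.

End Bridge.

Arguments mkpt {k ch}.
Arguments restr {k ch E E'}.

(** * Imaginary quadratic orders *)

Section ImaginaryQuadraticField.
Variables (d : nat) (hd : (0 < d)%N).
Local Notation K := (imag_quad_field d).
Local Notation w := (sqrtC (- d%:R) : algC).

Lemma imag_quad_gen_sqr : w ^+ 2 = - d%:R.
Proof. exact: sqrtCK. Qed.

(** The conjugate is w or -w, and w is not real because its square is negative. *)
Lemma imag_quad_gen_conj : w^* = - w.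
Proof.
have : (w^* - w) * (w^* + w) == 0.
  by rewrite -subr_sqr -rmorphXn imag_quad_gen_sqr rmorphN rmorph_nat subrr.
rewrite mulf_eq0 subr_eq0 addr_eq0 => /orP [/eqP h|/eqP //].
have hr : w \is Num.real by apply/CrealP.
have : 0 <= w ^+ 2 by rewrite real_exprn_even_ge0.
by rewrite imag_quad_gen_sqr oppr_ge0 lern0 => /eqP d0; move: hd; rewrite d0.
Qed.

Lemma imag_quadD x y : K x -> K y -> K (x + y).
Proof.
move=> [a [b ->]] [a' [b' ->]]; exists (a + a'), (b + b').
by rewrite !rmorphD /=; ring.
Qed.

Lemma imag_quadM x y : K x -> K y -> K (x * y).
Proof.
move=> [a [b ->]] [a' [b' ->]]; exists (a * a' - d%:R * b * b'), (a * b' + a' * b).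
rewrite !(rmorphD, rmorphN, rmorphM, rmorph_nat) /=.
rewrite [LHS](_ : _ = ratr a * ratr a' + ratr b * ratr b' * w ^+ 2 +
  (ratr a * ratr b' + ratr a' * ratr b) * w); last by ring.
by rewrite imag_quad_gen_sqr; ring.
Qed.

Lemma imag_quad_rat r : K (ratr r).
Proof. by exists r, 0; rewrite rmorph0 mul0r addr0. Qed.

Lemma imag_quad_conjE (a b : rat) : (ratr a + ratr b * w)^* = ratr a - ratr b * w.
Proof.
by rewrite rmorphD (rmorphM _ (ratr b)) /= imag_quad_gen_conj !conj_Crat ?Crat_rat // mulrN.
Qed.

Lemma imag_quad_conj x : K x -> K x^*.
Proof.
move=> [a [b ->]]; exists a, (- b).
by rewrite imag_quad_conjE rmorphN mulNr.
Qed.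

Lemma imag_quad_norm x : K x -> x * x^* \in Crat.
Proof.
move=> [a [b ->]]; apply/CratP; exists (a ^+ 2 + d%:R * b ^+ 2).
rewrite imag_quad_conjE rmorphD rmorphM rmorph_nat !rmorphXn /=.
rewrite [LHS](_ : _ = ratr a ^+ 2 - ratr b ^+ 2 * w ^+ 2); last by ring.
by rewrite imag_quad_gen_sqr; ring.
Qed.

Lemma imag_quad_trace x : K x -> x + x^* \in Crat.
Proof.
move=> [a [b ->]]; apply/CratP; exists (a + a).
by rewrite imag_quad_conjE rmorphD /=; ring.
Qed.

End ImaginaryQuadraticField.

(** Every power of the reduced denominator divides e. *)
Lemma Crat_bounded_denominators (e : nat) (c : algC) : (0 < e)%N -> c \in Crat ->
  (forall j : nat, e%:R * c ^+ j \is a Num.int) -> c \is a Num.int.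
Proof.
move=> e0 /CratP [r ->] h.
suff : denq r = 1.
  move=> d1; apply/intrP; exists (numq r); rewrite -[r in LHS]divq_num_den d1 divr1.
  by rewrite ratr_int.
have hdvd (j : nat) : (`|denq r|%N ^ j %| e)%N.
  have /intrP [t ht] := h j.
  have ht' : (e%:R * r ^+ j = t%:~R :> rat).
    by apply: (fmorph_inj (ratr : rat -> algC)); rewrite rmorphM rmorph_nat rmorphXn /= ht ratr_int.
  have d0 : (denq r)%:~R != 0 :> rat by rewrite intr_eq0 denq_neq0.
  have hz : e%:Z * numq r ^+ j = t * denq r ^+ j.
    apply: (@intr_inj rat); rewrite !rmorphM !rmorphXn /= -ht' numqE.
    by rewrite exprMn; ring.
  have : (`|(denq r ^+ j)%R| %| `|(e%:Z * numq r ^+ j)%R|)%N by rewrite hz; apply/dvdnP; exists `|t|%N; rewrite abszM.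
  rewrite abszM !abszX absz_nat Gauss_dvdl // coprimeXl // coprimeXr // coprime_sym.
  exact: coprime_num_den.
have : (`|denq r|%N <= 1)%N.
  rewrite leqNgt; apply/negP => g1.
  have := dvdn_leq e0 (hdvd e); rewrite leqNgt => /negP; apply.
  exact: ltn_expl.
have := denq_gt0 r; case: (denq r) => // -[|[|x]] //.
Qed.

Section QuadraticOrder.
Variables (d f : nat) (hd : (0 < d)%N).
Local Notation K := (imag_quad_field d).
Local Notation OK := (ring_of_integers K).
Local Notation O := (order_of_conductor K f).

Lemma intringD x y : OK x -> OK y -> OK (x + y).
Proof. by move=> [h1 h2] [h3 h4]; split; [exact: imag_quadD | exact: rpredD]. Qed.

Lemma intringM x y : OK x -> OK y -> OK (x * y).
Proof. by move=> [h1 h2] [h3 h4]; split; [exact: imag_quadM | exact: rpredM]. Qed.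

Lemma intring_int (z : int) : OK z%:~R.
Proof.
split; last exact: Aint_int.
by have := imag_quad_rat d z%:~R; rewrite ratr_int.
Qed.

Lemma intring_conj x : OK x -> OK x^*.
Proof. by move=> [h1 h2]; split; [exact: (imag_quad_conj hd h1) | rewrite Aint_aut]. Qed.

Lemma order_int (z : int) : O z%:~R.
Proof. by exists z, 0; split; [exact: (intring_int 0) | rewrite mulr0 addr0]. Qed.

Lemma order_nat (n : nat) : O n%:R.
Proof. exact: (order_int n). Qed.

Lemma order1 : O 1.
Proof. exact: (order_int 1). Qed.

Lemma orderD x y : O x -> O y -> O (x + y).
Proof.
move=> [a [b [hb ->]]] [a' [b' [hb' ->]]]; exists (a + a'), (b + b').
by split; [exact: intringD | rewrite rmorphD /=; ring].
Qed.

Lemma orderM x y : O x -> O y -> O (x * y).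
Proof.
move=> [a [b [hb ->]]] [a' [b' [hb' ->]]].
exists (a * a'), (a%:~R * b' + a'%:~R * b + f%:R * (b * b')); split.
  have hM := intringM; have hi := intring_int.
  by apply: intringD; [apply: intringD; apply: hM | apply: (intringM (intring_int f)); apply: hM].
by rewrite rmorphM /=; ring.
Qed.

Lemma orderN x : O x -> O (- x).
Proof. by move=> h; rewrite -mulN1r; apply: orderM => //; exact: (order_int (- 1)). Qed.

Lemma order_conj x : O x -> O x^*.
Proof.
move=> [a [b [hb ->]]]; exists a, b^*; split; first exact: intring_conj.
by rewrite rmorphD rmorphM /= rmorph_int rmorph_nat.
Qed.

Lemma order_sub_intring x : O x -> OK x.
Proof.
move=> [a [b [hb ->]]]; apply: intringD; first exact: intring_int.
exact: (intringM (intring_int f)).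
Qed.

Lemma intring_norm x : OK x -> x * x^* \is a Num.int.
Proof.
move=> [h1 h2]; apply: Cint_rat_Aint; first exact: (imag_quad_norm hd h1).
by rewrite rpredM // Aint_aut.
Qed.

Lemma order_norm x : O x -> exists z : int, x * x^* = z%:~R.
Proof. by move=> /order_sub_intring/intring_norm/intrP. Qed.

Lemma order_trace x : O x -> exists z : int, x + x^* = z%:~R.
Proof.
move=> /order_sub_intring [h1 h2]; apply/intrP; apply: Cint_rat_Aint; first exact: (imag_quad_trace hd h1).
by rewrite rpredD // Aint_aut.
Qed.

Section Saturation.
Variables (ell : nat) (ell0 : (0 < ell)%N).

Lemma intring_powers z : (forall j : nat, O (ell%:R * z ^+ j)) -> z * z^* \is a Num.int.
Proof.
move=> h; apply: (@Crat_bounded_denominators (ell ^ 2)); rewrite ?expn_gt0 ?ell0 //.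
  have e0 : ell%:R != 0 :> algC by rewrite pnatr_eq0 -lt0n.
  have -> : z = ratr (ell%:R^-1) * (ell%:R * z ^+ 1).
    by rewrite fmorphV rmorph_nat expr1 mulrA mulVf ?mul1r.
  by apply: (imag_quad_norm hd); apply: imag_quadM; [exact: imag_quad_rat | exact: (order_sub_intring (h 1%N)).1].
move=> j; have := intring_norm (order_sub_intring (h j)).
by rewrite rmorphM rmorph_nat rmorphXn /= natrX exprMn mulrACA expr2.
Qed.

(** The norms of z and 1 + z are integers by [intring_powers], hence so is the trace, and z is
    integral. Bezout for ell and f writes z as a multiple of ell z minus an element of f O_K. *)
Lemma order_saturated z : coprime ell f ->
  (forall j : nat, O (ell%:R * z ^+ j)) -> (forall j : nat, O (ell%:R * (1 + z) ^+ j)) ->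
  O z.
Proof.
move=> cop h1 h2; have e0 : ell%:R != 0 :> algC by rewrite pnatr_eq0 -lt0n.
have Kz : K z.
  have -> : z = ratr (ell%:R^-1) * (ell%:R * z ^+ 1).
    by rewrite fmorphV rmorph_nat expr1 mulrA mulVf ?mul1r.
  by apply: imag_quadM; [exact: imag_quad_rat | exact: (order_sub_intring (h1 1%N)).1].
have /intrP [n hn] := intring_powers h1.
have /intrP [t ht] : z + z^* \is a Num.int.
  have -> : z + z^* = (1 + z) * (1 + z)^* - 1 - z * z^* by rewrite rmorphD rmorph1; ring.
  by rewrite !rpredB ?intring_powers // rpred1.
have hz : OK z.
  split => //; pose q : {poly algC} := 'X^2 - t%:~R%:P * 'X + n%:~R%:P.
  have qE : q = 'X^2 + (- t%:~R%:P * 'X + n%:~R%:P) by rewrite /q addrA mulNr.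
  have sq : (size (- (t%:~R : algC)%:P * 'X + (n%:~R : algC)%:P)%R <= 2)%N.
    by rewrite -polyCN size_MXaddC; case: ifP => // _; rewrite ltnS size_polyC_leq1.
  apply: (@root_monic_Aint q).
  - rewrite /root /q !hornerE -ht -hn; apply/eqP; ring.
  - by rewrite qE monicE lead_coefDl ?lead_coefXn // size_polyXn ltnS.
  - apply/polyOverP => i; rewrite /q coefD poly.coefB coefXn coefCM coefX coefC.
    by apply: rpredD; [apply: rpredB; [exact: rpred_nat | rewrite rpredM ?rpred_int ?rpred_nat] |
       case: ifP => _; [exact: rpred_int | exact: rpred0]].
have [u v huv _] := egcdnP f ell0.
rewrite (eqP cop) in huv.
have -> : z = u%:R * (ell%:R * z ^+ 1) - (0 + f%:R * (v%:R * z)).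
  have e1 : u%:R * ell%:R - v%:R * f%:R = 1 :> algC by rewrite -!natrM huv natrD addrC addKr.
  by rewrite -[LHS]mul1r; transitivity ((u%:R * ell%:R - v%:R * f%:R) * z); [rewrite e1 | ring].
apply: orderD; first by apply: orderM => //; exact: order_nat.
apply: orderN; exists 0, (v%:R * z); split => //.
by apply: intringM => //; exact: (intring_int v).
Qed.

End Saturation.

(** s x is a root of the quadratic equation of x, so it is x or its conjugate; additivity rules out
    a mixture of the two choices. *)
Lemma order_endomorphism (s : algC -> algC) :
  (forall x, O x -> O (s x)) -> s 1 = 1 ->
  (forall x y, O x -> O y -> s (x + y) = s x + s y) ->
  (forall x y, O x -> O y -> s (x * y) = s x * s y) ->
  (forall x, O x -> s x = x) \/ (forall x, O x -> s x = x^*).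
Proof.
move=> hs s1 sD sM.
have s0 : s 0 = 0.
  apply: (@addrI _ (s 0)); rewrite -sD ?addr0 //; exact: (order_int 0).
have sN x : O x -> s (- x) = - s x.
  move=> Ox; apply/eqP; rewrite -addr_eq0 -sD ?addNr ?s0 //; exact: orderN.
have snat (n : nat) : s n%:R = n%:R.
  elim: n => [|n IH]; first exact: s0.
  by rewrite -natr1 sD ?IH ?s1 //; [exact: order_nat | exact: order1].
have sint (z : int) : s z%:~R = z%:~R.
  case: z => n; first exact: snat.
  by rewrite NegzE rmorphN /= sN ?(snat n.+1) //; exact: (order_nat n.+1).
have alt x : O x -> s x = x \/ s x = x^*.
  move=> Ox; have [t ht] := order_trace Ox; have [n hn] := order_norm Ox.
  have e : x * x = t%:~R * x - n%:~R by rewrite -ht -hn; ring.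
  have e' : s x * s x = t%:~R * s x - n%:~R.
    have Oi := order_int.
    by rewrite -sM // e sD ?sN ?sM ?sint //; [exact: orderM | exact: orderN].
  have : (s x - x) * (s x - x^*) == 0.
    have -> : (s x - x) * (s x - x^*) = s x * s x - (x + x^*) * s x + x * x^* by ring.
    by rewrite e' ht hn; apply/eqP; ring.
  by rewrite mulf_eq0 !subr_eq0 => /orP [] /eqP; [left | right].
have [h|] := pselect (forall x, O x -> s x = x); first by left.
move=> /existsNP [y /not_implyP [Oy sy]]; right => x Ox.
have {}sy' : s y = y^* by case: (alt y Oy).
have yc : y^* <> y by rewrite -sy'.
case: (alt x Ox) => // sx; rewrite sx.
case: (alt _ (orderD Ox Oy)); rewrite sD // sx sy'; first by move=> /addrI.
by rewrite rmorphD => /addIr.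
Qed.

(** * The prime l and the conductor *)

Section Prime.
Variables (ell : nat) (hell : prime ell) (l : set algC).
Hypotheses (hl : is_prime_ideal O l)
  (hll : scale_ideal ell%:R O = mul_ideal l (conj_ideal l)).

Lemma ell_in_prime : l ell%:R.
Proof.
have : scale_ideal ell%:R O ell%:R by exists 1; [exact: order1 | rewrite mulr1].
rewrite hll => -[r [x [y [h ->]]]].
case: hl => [[lO l0 lD lM] _ _].
apply: (big_ind l) => // i _; rewrite mulrC; apply: lM; last exact: (h i).1.
by have := order_conj (lO _ (h i).2); rewrite conjCK.
Qed.

(** If ell divided f, elements of f O_K would have squares in ell O and so lie in l, which would
    then be ell Z + f O_K. Products of elements of l with elements of its conjugate would lie in ell
    l, giving ell = ell z with z in l, that is 1 in l. *)
Lemma conductor_coprime : coprime ell f.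
Proof.
case: (boolP (coprime ell f)) => //; rewrite prime_coprime // negbK => /dvdnP [f' hf'].
exfalso; case: hl => [[lO l0 lD lM] l1 lp].
have lfO b : OK b -> l (f%:R * b).
  move=> hb; have Ob c : OK c -> O (f%:R * c) by move=> hc; exists 0, c; rewrite add0r.
  have [//|//] : l (f%:R * b) \/ l (f%:R * b).
  apply: lp; [exact: Ob | exact: Ob|].
  have -> : f%:R * b * (f%:R * b) = (f'%:R * (f%:R * (b * b))) * ell%:R.
    by rewrite {1}hf' natrM; ring.
  apply: lM; last exact: ell_in_prime.
  by apply: orderM; [exact: order_nat | apply: Ob; exact: intringM].
have shape x : l x -> exists (a : int) b, [/\ OK b & x = ell%:R * a%:~R + f%:R * b].
  move=> lx; have [a [b [hb e]]] := lO _ lx.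
  have la : l a%:~R.
    have -> : a%:~R = x + (- 1) * (f%:R * b) :> algC by rewrite e; ring.
    by apply: lD => //; apply: lM; [exact: (order_int (- 1)) | exact: lfO].
  have : (ell %| `|a|)%N.
    case: (boolP (ell %| `|a|)%N) => // nd; case: l1.
    have cop : coprimez ell a by rewrite /coprimez /gcdz absz_nat; apply/eqP; congr Posz; apply/eqP; rewrite -/(coprime _ _) prime_coprime.
    have [[u v] /= huv] := coprimezP _ _ cop.
    have -> : 1 = u%:~R * ell%:R + v%:~R * a%:~R :> algC.
      by rewrite -[ell%:R]/(ell%:Z%:~R) -!rmorphM -rmorphD /= huv.
    by apply: lD; apply: lM => //; [exact: order_int | exact: ell_in_prime | exact: order_int].
  move=> /dvdnP [c hc]; exists (sgz a * c%:Z), b; split => //.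
  by rewrite e {1}[a]intEsg hc PoszM mulrA rmorphM /= mulrC.
have hprod x y : l x -> l y^* -> exists2 z, l z & x * y = ell%:R * z.
  move=> /shape [a [b [hb ->]]] /shape [a' [b' [hb' e]]].
  have -> : y = ell%:R * a'%:~R + f%:R * b'^*.
    by rewrite -[y]conjCK e rmorphD !rmorphM /= !rmorph_nat rmorph_int.
  exists (ell%:R * (a * a')%:~R + f%:R * (a%:~R * b'^* + a'%:~R * b + f'%:R * (b * b'^*))).
    apply: lD; first by rewrite mulrC; apply: lM; [exact: order_int | exact: ell_in_prime].
    have hb'' := intring_conj hb'; have hi := intring_int.
    apply: lfO; apply: intringD; [apply: intringD; apply: intringM => // |].
    by apply: (intringM (intring_int f')); apply: intringM.
  by rewrite rmorphM /= hf' natrM; ring.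
have : scale_ideal ell%:R O ell%:R by exists 1; [exact: order1 | rewrite mulr1].
rewrite hll => -[r [x [y [h hs]]]].
have [z lz hz] : exists2 z, l z & \sum_(i < r) x i * y i = ell%:R * z.
  apply: (big_ind (fun s => exists2 z, l z & s = ell%:R * z)).
  - by exists 0; rewrite ?mulr0.
  - by move=> _ _ [z1 h1 ->] [z2 h2 ->]; exists (z1 + z2); [exact: lD | rewrite mulrDr].
  - by move=> i _; apply: hprod; case: (h i).
apply: l1; have e0 : ell%:R != 0 :> algC by rewrite pnatr_eq0 -lt0n prime_gt0.
by have <- : z = 1 by apply: (mulfI e0); rewrite -hz -hs mulr1.
Qed.

Lemma conj_prime_ideal : is_prime_ideal O (conj_ideal l).
Proof.
have cO x : O x^* -> O x by move=> /order_conj; rewrite conjCK.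
case: hl => [[lO l0 lD lM] l1 lp]; split; first split.
- by move=> x /lO/cO.
- by rewrite /conj_ideal /= rmorph0.
- by move=> x y; rewrite /conj_ideal /= rmorphD; exact: lD.
- by move=> r x Or; rewrite /conj_ideal /= rmorphM; apply: lM; exact: order_conj.
- by rewrite /conj_ideal /= rmorph1.
- move=> x y Ox Oy; rewrite /conj_ideal /= rmorphM; apply: lp; exact: order_conj.
Qed.

End Prime.

End QuadraticOrder.

(** * Complex multiplication *)

Record order_ring (O : set algC) : Prop := OrderRing {
  or1 : O 1;
  orD : forall x y, O x -> O y -> O (x + y);
  orN : forall x, O x -> O (- x);
  orM : forall x y, O x -> O y -> O (x * y) }.

(* The situation l l' = ell O, made symmetric in l and l'. *)
Record prime_pair (O : set algC) (ell : nat) (l l' : set algC) : Prop := PrimePair {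
  pp_ideal : is_ideal O l;
  pp_ideal' : is_ideal O l';
  pp_ell : l ell%:R;
  pp_ell' : l' ell%:R;
  pp_proper : exists2 a, l a & ~ scale_ideal ell%:R O a;
  pp_proper' : exists2 a, l' a & ~ scale_ideal ell%:R O a;
  pp_mul : forall a b, l a -> l' b -> scale_ideal ell%:R O (a * b);
  pp_sum : exists (r : nat) (a b : 'I_r -> algC),
     (forall i, l (a i) /\ l' (b i)) /\ ell%:R = \sum_(i < r) a i * b i }.

Lemma prime_pair_sym O ell l l' : prime_pair O ell l l' -> prime_pair O ell l' l.
Proof.
case=> i i' e e' p p' m [r [a [b [h s]]]]; split => //.
  by move=> x y hx hy; rewrite mulrC; apply: m.
exists r, b, a; split; first by move=> j; have [] := h j.
by rewrite s; apply: eq_bigr => j _; rewrite mulrC.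
Qed.

(** A form of integral closure at ell that endomorphisms can test: for an isogeny phi with dual psi
    and an endomorphism g of its target, psi g^j phi and psi (1 + g)^j phi are the elements ell z^j
    and ell (1 + z)^j. *)
Definition saturated (O : set algC) (ell : nat) := forall z : algC,
  (forall j : nat, O (ell%:R * z ^+ j)) ->
  (forall j : nat, O (ell%:R * (1 + z) ^+ j)) -> O z.

Section ComplexMultiplication.
Variables (k : closedFieldType) (ch : good_char k).
Local Notation ept := (ept ch).
Variables (O : set algC) (hO : order_ring O).
Implicit Types (E : curve k) (a b c : algC).

Let or0 : O 0.
Proof. by rewrite -(subrr 1); apply: (orD hO); [exact: or1 | apply: orN => //; exact: or1]. Qed.

Lemma or_nat n : O n%:R.
Proof. by elim: n => [//|n IH]; rewrite -natr1; apply: orD => //; exact: or1. Qed.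

Section Action.
Variables (E : curve k) (R : algC -> ept E -> ept E) (HR : cm O R).

Lemma cm_hom a : O a -> ishom (R a).
Proof. by move=> Oa; apply: isog0_hom; exact: (cm_isog HR). Qed.

Lemma cm_zero P : R 0 P = 0.
Proof. by apply: (@addrI _ (R 0 P)); rewrite -(cmD HR) // !addr0. Qed.

Lemma cm_opp a P : O a -> R (- a) P = - R a P.
Proof.
move=> Oa; apply/eqP; rewrite -addr_eq0 -(cmD HR) ?addNr ?cm_zero //; exact: orN.
Qed.

Lemma cm_nat n P : R n%:R P = P *+ n.
Proof.
elim: n => [|n IH]; first by rewrite mulr0n; exact: cm_zero.
by rewrite -natr1 (cmD HR) ?(cm1 HR) ?IH ?mulrSr //; [exact: or_nat | exact: or1].
Qed.

Lemma cm_comm a b P : O a -> O b -> R a (R b P) = R b (R a P).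
Proof. by move=> Oa Ob; rewrite -!(cmM HR) // mulrC. Qed.

Lemma cm_isog_neq0 a : O a -> a != 0 -> isog (R a).
Proof.
move=> Oa a0; case: (cm_isog HR Oa) => // e; case/eqP: a0.
by apply: (cm_inj HR Oa) => P; rewrite e.
Qed.

Lemma cm_eq a b : O a -> O b -> (forall P, R a P = R b P) -> a = b.
Proof.
move=> Oa Ob h; apply/eqP; rewrite -subr_eq0; apply/eqP; apply: (cm_inj HR).
  by apply: (orD hO) => //; exact: orN.
by move=> P; rewrite (cmD HR) ?cm_opp ?h ?subrr //; exact: orN.
Qed.

Lemma cm_sum r (a : 'I_r -> algC) P : (forall i, O (a i)) ->
  O (\sum_(i < r) a i) /\ R (\sum_(i < r) a i) P = \sum_(i < r) R (a i) P.
Proof.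
move=> Oa; apply: (big_rec2 (fun x y => O x /\ R x P = y)); first by rewrite cm_zero.
by move=> i x y _ [Ox <-]; split; [exact: orD | rewrite (cmD HR)].
Qed.

Definition tor (I : set algC) (P : ept E) := forall a, I a -> R a P = 0.

Lemma torB I P Q : (forall a, I a -> O a) -> tor I P -> tor I Q -> tor I (P - Q).
Proof.
move=> IO hP hQ a Ia; rewrite (homB (cm_hom (IO _ Ia))).
by rewrite hP // hQ // subr0.
Qed.

Lemma tor0 I : (forall a, I a -> O a) -> tor I 0.
Proof. by move=> IO a Ia; apply: hom0; apply: cm_hom; exact: IO. Qed.

Variables (ell : nat) (hell : prime ell) (ellk : ell%:R != 0 :> k).

(** R(a) factors through [ell], and the cofactor is an endomorphism, hence comes from O. *)
Lemma cm_divisible a : O a -> (forall P : ept E, P *+ ell = 0 -> R a P = 0) ->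
  scale_ideal ell%:R O a.
Proof.
move=> Oa h.
have [g hg e] := isog_factor (@muln_sepk k ch E ell ellk) (cm_isog HR Oa) h.
have [c Oc hc] := cm_surj HR hg; exists c => //.
apply: cm_eq => //; first by apply: orM => //; exact: or_nat.
move=> P; rewrite -e hc mulrC (cmM HR) //; last exact: or_nat.
by rewrite cm_nat.
Qed.

Variables (l l' : set algC) (hl : prime_pair O ell l l').

Let lO a : l a -> O a.
Proof. by case: (pp_ideal hl) => h _ _ _ /h. Qed.
Let lO' a : l' a -> O a.
Proof. by case: (pp_ideal' hl) => h _ _ _ /h. Qed.

Lemma tor_ell P : tor l P -> P *+ ell = 0.
Proof. by move=> /(_ _ (pp_ell hl)); rewrite cm_nat. Qed.

Lemma tor_conj b P : l' b -> P *+ ell = 0 -> tor l (R b P).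
Proof.
move=> lb hP a la; rewrite -(cmM HR) //; [|exact: lO|exact: lO'].
have [c Oc ->] := pp_mul hl la lb.
rewrite (cmM HR) //; last exact: or_nat.
by rewrite cm_comm // ?cm_nat ?hP; [apply: hom0; exact: cm_hom | exact: or_nat].
Qed.

Lemma tor_seq : exists2 G : seq (ept E), uniq G & forall P, (P \in G) <-> tor l P.
Proof.
have [_ _ [s [us _ hs]]] := @muln_sepk k ch E ell ellk.
exists (filter (fun P => `[< tor l P >]) s); first exact: filter_uniq.
move=> P; rewrite mem_filter; split=> [/andP [/asboolP //]|h].
by apply/andP; split; [exact/asboolP | rewrite hs; apply/eqP; exact: tor_ell].
Qed.

Lemma tor_group (G : seq (ept E)) : (forall P, (P \in G) <-> tor l P) ->
  0 \in G /\ forall P Q, P \in G -> Q \in G -> P - Q \in G.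
Proof.
move=> hG; split; first by apply/hG; exact: tor0.
by move=> P Q /hG hP /hG hQ; apply/hG; exact: torB.
Qed.

(* If E[l] had order 1 then l' would kill E[ell], and if it had order ell^2 then l would. *)
Lemma tor_size (G : seq (ept E)) : uniq G -> (forall P, (P \in G) <-> tor l P) -> size G = ell.
Proof.
move=> uG hG; have [G0 GB] := tor_group hG.
have [E' [t [phi [hs hk _]]]] := quotient_exists uG G0 GB.
have m2 := @muln_sepk k ch E ell ellk.
have hm : isog0 (fun P : ept E => P *+ ell) by exact: isog0_muln.
have [psi hp e] : exists2 psi : ept E' -> ept E, isog0 psi & forall P, psi (phi P) = P *+ ell.
  apply: (isog_factor hs hm) => P hP; apply: tor_ell; apply/hG; rewrite -hk; exact/eqP.
have e' : psi \o phi = (fun P => P *+ ell) by apply/funext.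
have ip : isog psi.
  case: hp => // p0; case: m2 => m2 _ _; case: (isog_not0 m2); rewrite -e'.
  by apply/funext => P; rewrite /= p0.
have [x [y [hxy sx sy]]] : exists x y, [/\ (ell ^ 2 = x * y)%N, sepk phi x & sepk psi y].
  by apply: sepk_compP => //; [case: hs | rewrite e'].
have xE : x = size G by case: sx hs => _ _ h [_ _ h']; exact: kersize_unique h h'.
have : (x %| ell ^ 2)%N by rewrite hxy dvdn_mulr.
move=> /(dvdn_pfactor _ _ hell) [[|[|[|//]]] _ e1]; rewrite -xE e1 ?expn1 //; exfalso.
- have [b lb] := pp_proper' hl; apply; apply: cm_divisible; first exact: lO'.
  have eG : G = [:: 0].
    by move: G0 e1; rewrite expn0 xE; case: (G) => [|Q [|? ?]] //; rewrite inE => /eqP <-.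
  by move=> P hP; have /hG := tor_conj lb hP; rewrite eG inE => /eqP.
- have [a la] := pp_proper hl; apply; apply: cm_divisible; first exact: lO.
  case: m2 => _ _ [s [us ss hs2]].
  have sub : {subset G <= s}.
    by move=> P /hG /tor_ell h; rewrite hs2; apply/eqP.
  have [_ eqs] : (size s = size G)%N /\ G =i s.
    by have [] := uniq_min_size uG sub; rewrite ss -xE e1.
  move=> P hP; have : P \in G by rewrite eqs hs2; apply/eqP.
  by move=> /hG; apply.
Qed.

Section Quotient.
Variables (E' : curve k) (phi : ept E -> ept E').
Hypotheses (iphi : isog phi) (dphi : has_deg phi ell) (kphi : forall P, phi P = 0 <-> tor l P).

Lemma quotient_sepk : sepk phi ell.
Proof. exact: deg_sepk. Qed.

(** [ell] kills ker phi = E[l], so it factors through phi; its degree ell^2 leaves ell for the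
    cofactor, and surjectivity of phi gives the second composite. *)
Lemma dual_exists : exists psi : ept E' -> ept E, [/\ sepk psi ell,
  forall P, psi (phi P) = P *+ ell & forall Q, phi (psi Q) = Q *+ ell].
Proof.
have [|psi hp e] := isog_factor quotient_sepk (isog0_muln ch E ell).
  by move=> P /kphi; exact: tor_ell.
have e' : psi \o phi = (fun P => P *+ ell) by apply/funext.
have m2 := @muln_sepk k ch E ell ellk.
have ip : isog psi.
  case: hp => // p0; case: m2 => m2 _ _; case: (isog_not0 m2); rewrite -e'.
  by apply/funext => P; rewrite /= p0.
have [x [y [hxy sx sy]]] : exists x y, [/\ (ell ^ 2 = x * y)%N, sepk phi x & sepk psi y].
  by apply: sepk_compP => //; rewrite e'.
have xE : x = ell by case: sx quotient_sepk => _ h _ [_ h' _]; exact: has_deg_unique h h'.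
exists psi; split => //.
  suff <- : y = ell by [].
  by apply/eqP; rewrite -(eqn_pmul2l (prime_gt0 hell)) -{1}xE -hxy mulnn.
move=> Q; have [P <-] := isog_surj iphi Q.
by rewrite e (homMn _ (isog0_hom (or_introl iphi))).
Qed.

Hypothesis sat : saturated O ell.

(** E[l] is O-stable, so each R(a) descends along phi, and faithfully, since phi h = 0 forces h = 0.
    Saturation serves to show that E' has no further endomorphisms. *)
Lemma cm_transport : exists2 R' : algC -> ept E' -> ept E', cm O R' &
  forall a P, O a -> R' a (phi P) = phi (R a P).
Proof.
have [psi [sp e e']] := dual_exists.
have hphi : ishom phi by case: iphi.
have hpsi : ishom psi by case: sp => [[]].
have : forall a, exists f : ept E' -> ept E', O a -> isog0 f /\ forall P, f (phi P) = phi (R a P).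
  move=> a; have [Oa|nO] := pselect (O a); last by exists id.
  have [|P /kphi hP|f hf e1] := isog_factor (g := fun P => phi (R a P)) quotient_sepk.
  - by apply: (isog0_comp (cm_isog HR Oa)); left.
  - apply/kphi => b lb.
    by rewrite cm_comm //; [rewrite hP //; apply: hom0; exact: cm_hom | exact: lO].
  by exists f.
move=> /boolp.choice [R' hR'].
have surj := isog_surj iphi.
have R'i a : O a -> isog0 (R' a) by move=> /hR' [].
have R'E a P : O a -> R' a (phi P) = phi (R a P) by move=> /hR' [].
have null (h : ept E -> ept E) : isog0 h -> (forall P, phi (h P) = 0) -> forall P, h P = 0.
  move=> [ih|-> //] h0 P; exfalso.
  have [Q hQ] := ae_ex (isog_ae_neq 0 (isog_comp ih iphi)).
  by case/eqP: hQ; exact: h0.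
exists R'; last by move=> a P; exact: R'E.
split.
- exact: R'i.
- by move=> Q; have [P <-] := surj Q; rewrite R'E ?(cm1 HR) //; exact: or1.
- by move=> a b Q Oa Ob; have [P <-] := surj Q; rewrite !R'E ?(cmD HR) ?hphi //; exact: orD.
- by move=> a b Q Oa Ob; have [P <-] := surj Q; rewrite !R'E ?(cmM HR) //; exact: orM.
- move=> a Oa h; apply: (cm_inj HR) => //; apply: null; first exact: (cm_isog HR).
  by move=> P; rewrite -R'E.
- move=> f hf; have hhf := isog0_hom hf.
  (* psi f^j phi = R(ell z^j) for a single z, which must then lie in O. *)
  have conjg (g : ept E' -> ept E') : isog0 g -> exists2 c, O c & forall P, psi (g (phi P)) = R c P.
    move=> hg; apply: (cm_surj HR (f := psi \o (g \o phi))).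
    by apply: isog0_comp; [apply: isog0_comp => //; left | left; case: sp].
  (* Stated for arbitrary g because saturation needs the powers of both f and 1 + f. *)
  have powers (g : ept E' -> ept E') c : isog0 g -> O c -> (forall P, psi (g (phi P)) = R c P) ->
      forall j : nat, exists2 d, O d & ell%:R * (c / ell%:R) ^+ j = d.
    move=> hg Oc hc.
    have ell0 : ell%:R != 0 :> algC by rewrite pnatr_eq0 -lt0n prime_gt0.
    suff H j : exists2 d, O d & (forall P, psi (iter j g (phi P)) = R d P) /\ ell%:R * (c / ell%:R) ^+ j = d.
      by move=> j; have [d Od [_ hd]] := H j; exists d.
    elim: j => [|j [d Od [hd he]]].
      exists ell%:R; first exact: or_nat.
      by split=> [P|]; rewrite ?expr0 ?mulr1 //= e cm_nat.
    have ig : isog0 (iter j.+1 g).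
      elim: {d Od hd he} j => [|j IH]; first exact: hg.
      exact: (isog0_comp IH hg).
    have [d' Od' hd'] := conjg _ ig; exists d' => //; split => //.
    apply: (mulfI ell0).
    have -> : ell%:R * (ell%:R * (c / ell%:R) ^+ j.+1) = c * (ell%:R * (c / ell%:R) ^+ j).
      by rewrite exprS [ell%:R * (c / _ * _)]mulrA [ell%:R * (c / _)]mulrC divfK // mulrCA.
    rewrite he; apply: cm_eq; [exact: orM | apply: orM => //; exact: or_nat |].
    move=> P; rewrite !(cmM HR) //; last exact: or_nat.
    rewrite -hd -hc e' (homMn _ (isog0_hom hg)) (homMn _ hpsi).
    by rewrite cm_nat -hd' /=.
  have [c Oc hc] := conjg f hf.
  have hf1 : isog0 (fun Q => Q + f Q) by apply: isog0_add => //; left; exact: isog_id.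
  have hc1 P : psi (phi P + f (phi P)) = R (ell%:R + c) P.
    by rewrite hpsi (cmD HR) ?cm_nat ?e ?hc //; exact: or_nat.
  have ell0 : ell%:R != 0 :> algC by rewrite pnatr_eq0 -lt0n prime_gt0.
  have Oz : O (c / ell%:R).
    apply: sat => j; first by have [d Od ->] := powers f c hf Oc hc j.
    have Oc1 : O (ell%:R + c) by apply: orD => //; exact: or_nat.
    by have [d Od] := powers _ _ hf1 Oc1 hc1 j; rewrite mulrDl divff // => ->.
  exists (c / ell%:R) => // Q; have [P <-] := surj Q; rewrite R'E //.
  apply/eqP; rewrite -subr_eq0; apply/eqP.
  have [P' hP'] := surj (f (phi P) - phi (R (c / ell%:R) P)).
  (* This difference is an isogeny or zero; composed with the isogeny psi it vanishes, so it is
     zero. *)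
  have hdiff : isog0 (fun P => f (phi P) - phi (R (c / ell%:R) P)).
    apply: isog0_add; first by apply: isog0_comp => //; left.
    by apply: isog0_opp; apply: (isog0_comp (cm_isog HR Oz)); left.
  have hz Q' : psi (f (phi Q') - phi (R (c / ell%:R) Q')) = 0.
    rewrite (homB hpsi) hc e -cm_nat -(cmM HR) //; last exact: or_nat.
    by rewrite mulrCA divff // mulr1 subrr.
  case: hdiff => [hd|/(congr1 (fun h => h P)) //].
  have [Q' hQ'] := ae_ex (isog_ae_neq 0 (isog_comp hd (let: And3 i _ _ := sp in i))).
  by case/eqP: hQ'; exact: hz.
Qed.

End Quotient.

End Action.

End ComplexMultiplication.

(** * Level structures *)

Section LevelStructures.
Variables (k : closedFieldType) (ch : good_char k).
Local Notation ept := (ept ch).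
Implicit Types (E : curve k) (G : set (pt k)).

Lemma pmulE E n (P : ept E) : pmul E n (sval P) = sval (P *+ n).
Proof. by elim: n => [|n IH] //=; rewrite IH -ept_addE -mulrS. Qed.

Lemma torsionP E n (P : ept E) : torsion E n (sval P) <-> P *+ n = 0.
Proof.
rewrite /torsion /= pmulE; split=> [[_ /sval_eq0]|->] //; split => //; exact: points_sval.
Qed.

Lemma extp_comp E1 E2 E3 (f : ept E1 -> ept E2) (g : ept E2 -> ept E3) P :
  extp g (extp f P) = extp (fun Q => g (f Q)) P.
Proof. by rewrite /extp svalK. Qed.

Lemma image_extp_comp E1 E2 E3 (f : ept E1 -> ept E2) (g : ept E2 -> ept E3) G :
  extp g @` (extp f @` G) = extp (fun Q => g (f Q)) @` G.
Proof.
by rewrite image_comp; congr (_ @` _); apply/funext => P; rewrite /= extp_comp.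
Qed.

Lemma image_extp_id E (f : ept E -> ept E) G : G `<=` points E ->
  (forall P : ept E, G (sval P) -> f P = P) -> extp f @` G = G.
Proof.
move=> GE h; have e P : G P -> extp f P = P.
  by move=> hP; have [Q eQ] := points_ex ch (GE _ hP); subst P; rewrite extpE h.
apply/seteqP; split=> [_ [P hP <-]|P hP]; first by rewrite e.
by exists P => //; exact: e.
Qed.

Definition multiples E (P : ept E) : set (pt k) := range (fun i => sval (P *+ i)).

Lemma multiples_points E (P : ept E) : multiples P `<=` points E.
Proof. by move=> _ [i _ <-]; exact: points_sval. Qed.

Lemma image_multiples E E' (f : ept E -> ept E') (P : ept E) : ishom f ->
  extp f @` multiples P = multiples (f P).
Proof.
move=> hf; apply/seteqP; split.
  by move=> _ [_ [i _ <-] <-]; exists i => //; rewrite extpE homMn.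
move=> _ [i _ <-]; exists (sval (P *+ i)); first by exists i.
by rewrite extpE homMn.
Qed.

Definition exact_order E (N : nat) (P : ept E) := forall i : nat, P *+ i = 0 <-> (N %| i)%N.

Lemma exact_order_inj E N (P : ept E) i j : exact_order N P ->
  (P *+ i == P *+ j) = (i == j %[mod N]).
Proof.
move=> hP; wlog ij : i j / (i <= j)%N.
  move=> h; have [ij|/ltnW ij] := leqP i j; first exact: h.
  by rewrite eq_sym [RHS]eq_sym h.
rewrite [RHS]eq_sym eqn_mod_dvd // eq_sym -subr_eq0 -mulrnBr //.
by apply/eqP/idP => /hP.
Qed.

Lemma mulrn_modn E N (P : ept E) i : P *+ N = 0 -> P *+ (i %% N) = P *+ i.
Proof. by move=> hP; rewrite [in RHS](divn_eq i N) mulrnDr mulnC mulrnA hP mul0rn add0r. Qed.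

Lemma multiples_image E N (P : ept E) : (0 < N)%N -> P *+ N = 0 ->
  multiples P = (fun i => sval (P *+ i)) @` `I_N.
Proof.
move=> N0 hP; apply/seteqP; split; last by move=> _ [i _ <-]; exists i.
move=> _ [i _ <-]; exists (i %% N)%N; first by rewrite /= ltn_pmod.
by rewrite mulrn_modn.
Qed.

Lemma multiples_card E N (P : ept E) : (0 < N)%N -> exact_order N P ->
  multiples P #= `I_N.
Proof.
move=> N0 hP; rewrite (multiples_image N0); last exact/hP.
apply: inj_card_eq => i j; rewrite !inE /= => iN jN /ept_inj /eqP.
by rewrite (exact_order_inj _ _ hP) !modn_small // => /eqP.
Qed.

Lemma exact_order_exists E N (P : ept E) : (0 < N)%N -> P *+ N = 0 ->
  exists2 e, (0 < e)%N & exact_order e P.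
Proof.
move=> N0 hP; have ex : exists e, (0 < e)%N && (P *+ e == 0) by exists N; rewrite N0; apply/eqP.
case: (ex_minnP ex) => e /andP [e0 /eqP he] hmin; exists e => // i; split; last first.
  by move=> /dvdnP [j ->]; rewrite mulnC mulrnA he mul0rn.
move=> hi; rewrite /dvdn; apply: contraT => ne.
have := hmin (i %% e)%N; rewrite lt0n ne mulrn_modn // hi eqxx => /(_ isT).
by rewrite leqNgt ltn_pmod.
Qed.

Lemma cyclic_subgroupE E (P : ept E) : cyclic_subgroup E (sval P) = multiples P.
Proof. by rewrite /cyclic_subgroup /multiples; congr (_ @` _); apply/funext => i; rewrite pmulE. Qed.

Lemma exact_order_card E N (P : ept E) : (0 < N)%N -> P *+ N = 0 ->
  multiples P #= `I_N -> exact_order N P.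
Proof.
move=> N0 PN hc; have [e e0 he] := exact_order_exists N0 PN.
suff <- : e = N by [].
apply/card_eq_II; apply: card_eq_trans hc.
by rewrite card_eq_sym; exact: multiples_card.
Qed.

Lemma Gamma0P E N G : (0 < N)%N ->
  Gamma0_structure E N G <-> exists2 P : ept E, exact_order N P & G = multiples P.
Proof.
move=> N0; split.
- move=> [[P0 [hP hN] ->] hc]; have [P eP] := points_ex ch hP; subst P0.
  rewrite cyclic_subgroupE in hc *; exists P => //; apply: exact_order_card => //.
  by apply/torsionP.
- move=> [P hP ->]; split; last exact: multiples_card.
  by exists (sval P); [apply/torsionP/hP | rewrite cyclic_subgroupE].
Qed.

Lemma Gamma0_points E N G : (0 < N)%N -> Gamma0_structure E N G -> G `<=` points E.
Proof. by move=> N0 /(Gamma0P _ _ N0) [P _ ->]; exact: multiples_points. Qed.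

Lemma Gamma0_image E E' N G (f : ept E -> ept E') : (0 < N)%N -> ishom f ->
  (forall P, P *+ N = 0 -> f P = 0 -> P = 0) ->
  Gamma0_structure E N G -> Gamma0_structure E' N (extp f @` G).
Proof.
move=> N0 hf hinj /(Gamma0P _ _ N0) [P hP ->]; apply/(Gamma0P _ _ N0).
exists (f P); last exact: image_multiples.
move=> i; rewrite -homMn //; split; last by move=> /hP ->; rewrite hom0.
move=> h; apply/hP; apply: hinj => //.
by rewrite -mulrnA mulnC mulrnA (_ : P *+ N = 0) ?mul0rn //; apply/hP.
Qed.

Lemma Gamma0_muln E N G e : (0 < N)%N -> coprime e N -> Gamma0_structure E N G ->
  extp (fun P : ept E => P *+ e) @` G = G.
Proof.
move=> N0 cop /(Gamma0P _ _ N0) [P hP ->].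
rewrite image_multiples; last by move=> ? ?; exact: mulrnDl.
have PN : P *+ N = 0 by apply/hP.
apply/seteqP; split=> _ [i _ <-]; first by exists (e * i)%N; rewrite ?mulrnA.
(* [egcdnP] wants a positive e; e = 0 is coprime to N only when N = 1, and then P = 0. *)
have e0 : (0 < e)%N \/ N = 1%N.
  by case: (e) cop => [|e']; [rewrite /coprime gcd0n => /eqP ->; right | left].
case: e0 => [e0|N1]; last by exists 0%N => //; congr sval; apply/esym; rewrite mulr0n; apply/hP; rewrite N1.
have [u v huv _] := egcdnP N e0; rewrite (eqP cop) in huv.
exists (u * i)%N => //; congr sval.
by rewrite -mulrnA mulnA [(e * u)%N]mulnC huv mulnDl mul1n mulrnDr -mulnA mulnCA mulrnA PN mul0rn add0r.
Qed.

Lemma multiples_eqP E N (P Q : ept E) : (0 < N)%N -> exact_order N P -> exact_order N Q ->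
  multiples P = multiples Q <-> exists i, [/\ (i < N)%N, coprime N i & P = Q *+ i].
Proof.
move=> N0 hP hQ; have QN : Q *+ N = 0 by apply/hQ.
split=> [e|[i [_ cop ->]]].
- have : multiples Q (sval P) by rewrite -e; exists 1%N; rewrite ?mulr1n.
  rewrite (multiples_image N0 QN) => -[i iN /ept_inj ePi].
  exists i; split => //; have g0 : (0 < gcdn N i)%N by rewrite gcdn_gt0 N0.
  have : (N %| N %/ gcdn N i)%N.
    apply/hP; rewrite -ePi -mulrnA muln_divCA ?dvdn_gcdl ?dvdn_gcdr //.
    by rewrite mulrnA QN mul0rn.
  move=> /dvdn_leq; rewrite divn_gt0 // dvdn_leq ?dvdn_gcdl // => /(_ isT).
  rewrite leq_divRL // /coprime; move: g0; case: (gcdn N i) => // -[|g] // _.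
  by rewrite mulnS -[X in (_ <= X)%N]addn0 leq_add2l leqn0 muln_eq0 orbF eqn0Ngt N0.
- have hG : Gamma0_structure E N (multiples Q) by apply/(Gamma0P _ _ N0); exists Q.
  rewrite -[RHS](Gamma0_muln N0 _ hG (e := i)); last by rewrite coprime_sym.
  by rewrite image_multiples // => ? ?; exact: mulrnDl.
Qed.

Lemma Gamma0_opp E N G : (0 < N)%N -> Gamma0_structure E N G ->
  extp (fun P : ept E => - P) @` G = G.
Proof.
move=> N0 hG; have [P hP eG] := proj1 (Gamma0P _ _ N0) hG.
have PN : P *+ N = 0 by apply/hP.
(* [N.*2.-1] is a natural number congruent to -1 modulo N, which reduces negation to
   [Gamma0_muln]. *)
have cop : coprime N.*2.-1 N.
  rewrite -addnn; case: (N) N0 => // N' _.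
  by rewrite addnS /= coprime_sym /coprime gcdnDl; exact: coprimeSn.
rewrite -[RHS](Gamma0_muln N0 cop hG) eG !image_multiples //; last 2 first.
  by move=> ? ?; exact: mulrnDl.
  by move=> ? ?; exact: opprD.
congr multiples; apply/eqP; rewrite eq_sym -subr_eq0 opprK -mulrSr prednK ?double_gt0 //.
by rewrite -muln2 mulrnA PN mul0rn.
Qed.

Definition lequiv (x y : level_curve k) :=
  exists2 w : ept x.1 -> ept y.1, iso w & extp w @` x.2 = y.2.

Lemma level_equivP x y : x.2 `<=` points x.1 -> level_equiv x y <-> lequiv x y.
Proof.
move=> hx; split.
- move=> [phi /(isomorphismP ch) [hm iw] e]; exists (restr phi) => //.
  rewrite -e; have eq P : x.2 P -> extp (restr phi : ept x.1 -> ept y.1) P = phi P.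
    by move=> /hx/(points_ex ch) [Q ->]; rewrite extpE restrE.
  apply/seteqP; split=> _ [P hP <-]; first by exists P => //; rewrite eq.
  by exists P => //; rewrite eq.
- move=> [w iw e]; exists (extp w) => //; apply/(isomorphismP ch).
  by split; [exact: maps_extp | rewrite restrK].
Qed.

Lemma iso_inv E E' (w : ept E -> ept E') : iso w ->
  exists v, [/\ iso v, cancel w v & cancel v w].
Proof. by move=> [iw [v [iv vK wK]]]; exists v; split => //; split => //; exists w. Qed.

Lemma lequiv_refl x : x.2 `<=` points x.1 -> lequiv x x.
Proof. by move=> h; exists (fun P => P); [exact: iso_id | exact: image_extp_id]. Qed.

Lemma lequiv_sym x y : x.2 `<=` points x.1 -> lequiv x y -> lequiv y x.
Proof.
move=> hx [w iw e]; have [v [iv vK wK]] := iso_inv iw; exists v => //.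
by rewrite -e image_extp_comp image_extp_id // => P _; exact: vK.
Qed.

Lemma lequiv_trans x y z : lequiv x y -> lequiv y z -> lequiv x z.
Proof.
move=> [v iv ev] [w iw ew]; exists (fun P => w (v P)); first exact: (iso_comp iv iw).
by rewrite -ew -ev image_extp_comp.
Qed.

Section Classes.
Variables (C : set (curve k)) (N : nat) (N0 : (0 < N)%N).

Lemma level_points x : level_curves C N x -> x.2 `<=` points x.1.
Proof. by move=> [_ h]; exact: Gamma0_points h. Qed.

Lemma level_classP x y : level_curves C N x ->
  level_class C N x y <-> level_curves C N y /\ lequiv x y.
Proof.
move=> hx; rewrite /level_class /=; split=> -[hy e]; split => //;
  by apply/(level_equivP _ (level_points hx)).
Qed.

Lemma level_class_eqP x y : level_curves C N x -> level_curves C N y ->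
  level_class C N x = level_class C N y <-> lequiv x y.
Proof.
move=> hx hy; split=> [e|e].
  suff /(level_classP _ hx) [] : level_class C N x y by [].
  by rewrite e; apply/(level_classP _ hy); split => //; apply: lequiv_refl; exact: level_points hy.
have e' := lequiv_sym (level_points hx) e.
apply/seteqP; split=> z.
  by move=> /(level_classP _ hx) [hz h]; apply/(level_classP _ hy); split => //; exact: lequiv_trans e' h.
by move=> /(level_classP _ hy) [hz h]; apply/(level_classP _ hx); split => //; exact: lequiv_trans e h.
Qed.

End Classes.

End LevelStructures.

(** * Counting *)

Lemma fibres_card (T : eqType) (U : Type) (f : T -> U) (t : nat) (s : seq T) :
  (forall x, x \in s -> count (fun y => `[< f y = f x >]) s = t) ->
  exists2 r, size s = (r * t)%N & f @` [set` s] #= `I_r.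
Proof.
have [z sz] := ubnP (size s); elim: z => // z IH in s sz *.
case: s sz => [|x s] sz ht.
  exists 0%N => //; rewrite (_ : [set` [::]] = set0) ?image_set0 //.
    by rewrite (_ : `I_0 = set0) ?card_eqxx //; apply/seteqP; split.
  by apply/seteqP; split.
set a := fun y => `[< f y = f x >]; set s1 := filter (predC a) (x :: s).
have ax : a x by apply/asboolP.
have sz1 : (size s1 < z)%N.
  rewrite /s1 /= ax /=; apply: leq_ltn_trans (_ : (size s < z)%N) => //.
  by rewrite size_filter count_size.
have [|r hr cr] := IH s1 sz1.
  move=> y; rewrite mem_filter => /andP [/= /asboolP ny ys].
  rewrite -(ht y ys) /s1 count_filter; apply: eq_count => w /=.
  apply/andP/idP => [[] //|/asboolP e]; split; apply/asboolP => //.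
  by rewrite e.
exists r.+1.
  by rewrite -(count_predC a (x :: s)) (ht x) ?mem_head // mulSn -hr /s1 size_filter.
apply/eq_cardSP; exists (f x); first by exists x => //=; rewrite mem_head.
rewrite (_ : _ `\ _ = f @` [set` s1]) //; apply/seteqP; split.
  move=> _ [[y /= ys <-] ne]; exists y => //=; rewrite mem_filter ys andbT /=.
  by apply/asboolP.
move=> _ [y + <-] => /=; rewrite mem_filter => /andP [/asboolP ny ys].
by split => //; exists y.
Qed.

Lemma totient_count N : totient N = count (fun j => coprime N j) (iota 0 N).
Proof.
rewrite totient_count_coprime /index_iota subn0 -sum1_count [RHS]big_mkcond /=.
by apply: eq_bigr => j _; case: coprime.
Qed.

(** * Chains of isogenies and the level graph *)

Section Isogeny_chain.
Variables (k : closedFieldType) (ch : good_char k).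
Local Notation ept := (ept ch).
Variables (O : set algC) (hO : order_ring O).
Variables (ell : nat) (hell : prime ell) (ellk : ell%:R != 0 :> k).
Hypothesis sat : saturated O ell.

(** ker psi is the image under phi of E[ell], and l' maps E[ell] into E[l] = ker phi; so ker psi
    lies in E'[l'], and both have ell points. *)
Lemma dual_kernel (l l' : set algC) (hl : prime_pair O ell l l') (E E' : curve k)
  (R : algC -> ept E -> ept E) (R' : algC -> ept E' -> ept E') (phi : ept E -> ept E')
  (psi : ept E' -> ept E) : cm O R -> cm O R' ->
  isog phi -> (forall P, phi P = 0 <-> tor R l P) ->
  sepk psi ell -> (forall P, psi (phi P) = P *+ ell) ->
  (forall a P, O a -> R' a (phi P) = phi (R a P)) ->
  forall Q, psi Q = 0 <-> tor R' l' Q.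
Proof.
move=> HR HR' iphi kphi [_ _ [s [us ss hs]]] e hRR'.
have lO' a : l' a -> O a by case: (pp_ideal' hl) => h _ _ _ /h.
have imp Q : psi Q = 0 -> tor R' l' Q.
  have [P <-] := isog_surj iphi Q; rewrite e => hP b lb.
  by rewrite hRR'; [apply/kphi; exact: (tor_conj hO HR hl) | exact: lO'].
have [G uG hG] := tor_seq hO HR' ellk (prime_pair_sym hl).
have sG := tor_size hO HR' hell ellk (prime_pair_sym hl) uG hG.
have sub : {subset s <= G} by move=> Q; rewrite hs => /eqP /imp /hG.
have [_ eqs] : (size G = size s)%N /\ s =i G.
  by have [] := uniq_min_size us sub; rewrite ss sG.
by move=> Q; split; [exact: imp | move/hG; rewrite -eqs hs => /eqP].
Qed.

Variables (F : finFieldType) (iota : {rmorphism F -> k}) (p : nat).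
Hypothesis hF : p \in [pchar F].

(** Frobenius is an endomorphism of E, hence in R(O), and commutes with the elements of l; so it
    preserves E[l] and [quotient_galois] applies. *)
Lemma rational_quotient (l l' : set algC) (E : curve k) (R : algC -> ept E -> ept E) :
  prime_pair O ell l l' -> cm O R -> defined_over iota E ->
  exists (E' : curve k) (phi : ept E -> ept E'),
    [/\ sepk phi ell, (forall P, phi P = 0 <-> tor R l P) & defined_over iota E'].
Proof.
move=> hl HR [a [b [ea eb]]].
have lO c : l c -> O c by case: (pp_ideal hl) => h _ _ _ /h.
have [G uG hG] := tor_seq hO HR ellk hl.
have sG := tor_size hO HR hell ellk hl uG hG.
have [G0 GB] := tor_group HR hl hG.
have [E' [t [phi [sphi kphi hphi]]]] := quotient_exists uG G0 GB.
have [sg [hsg fix_sg]] := frobenius_exists iota hF.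
have sga : sg (coefA E) = coefA E by apply/fix_sg; exists a.
have sgb : sg (Defs.coefB E) = Defs.coefB E by apply/fix_sg; exists b.
have [pi0 Opi hpi] := cm_surj HR (or_introl (@frobenius_isog k ch E sg sga sgb _ hsg)).
have Gs T : T \in G -> galois_act sga sgb T \in G.
  move=> /hG hT; apply/hG => c lc.
  rewrite hpi (cm_comm HR) //; last exact: lO.
  by rewrite hT //; apply: hom0; exact: (cm_hom HR).
have [/fix_sg [a' ea'] /fix_sg [b' eb']] := quotient_galois uG G0 GB Gs kphi hphi.
exists E', phi; split; first by rewrite -sG.
  by move=> P; split=> [/eqP|/hG]; [rewrite kphi => /hG | rewrite -kphi => /eqP].
by exists a', b'.
Qed.

(** The action is part of the data because it, and not the curve alone, singles out E[l] among E[l]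
    and E[l']. *)
Record cmcurve := CMCurve {
  cv :> curve k;
  cR : algC -> ept cv -> ept cv;
  cv_cm : cm O cR;
  cv_def : defined_over iota cv }.

Record cm_step (l l' : set algC) (c c' : cmcurve) (phi : ept c -> ept c')
    (psi : ept c' -> ept c) : Prop := CMStep {
  st_sepk : sepk phi ell;
  st_ker : forall P, phi P = 0 <-> tor (@cR c) l P;
  st_dual_sepk : sepk psi ell;
  st_dual_ker : forall Q, psi Q = 0 <-> tor (@cR c') l' Q;
  st_dual1 : forall P, psi (phi P) = P *+ ell;
  st_dual2 : forall Q, phi (psi Q) = Q *+ ell;
  st_cm : forall a P, O a -> cR a (phi P) = phi (cR a P) }.

Lemma cm_step_exists l l' (hl : prime_pair O ell l l') (c : cmcurve) :
  exists (c' : cmcurve) (f : (ept c -> ept c') * (ept c' -> ept c)), cm_step l l' f.1 f.2.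
Proof.
have [E' [phi [sphi kphi dE']]] := rational_quotient hl (cv_cm c) (cv_def c).
have [iphi dphi _] := sphi.
have [R' HR' hRR'] := cm_transport hO (cv_cm c) hell ellk hl iphi dphi kphi sat.
have [psi [spsi e1 e2]] := dual_exists hO (cv_cm c) hell ellk hl iphi dphi kphi.
exists (CMCurve HR' dE'), (phi, psi); split => //=.
exact: (dual_kernel hl (cv_cm c) HR' iphi kphi).
Qed.

Variables (l l' : set algC) (hl : prime_pair O ell l l').

Let lO a : l a -> O a.
Proof. by case: (pp_ideal hl) => h _ _ _ /h. Qed.
Let lO' a : l' a -> O a.
Proof. by case: (pp_ideal' hl) => h _ _ _ /h. Qed.

Definition next_cm (c : cmcurve) : cmcurve := projT1 (cid (cm_step_exists hl c)).
Definition next_maps c := projT1 (cid (projT2 (cid (cm_step_exists hl c)))).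
Definition up (c : cmcurve) : ept c -> ept (next_cm c) := (next_maps c).1.
Definition down (c : cmcurve) : ept (next_cm c) -> ept c := (next_maps c).2.
Lemma next_step (c : cmcurve) : cm_step l l' (@up c) (@down c).
Proof. exact: (projT2 (cid (projT2 (cid (cm_step_exists hl c))))). Qed.

(** Recursion at the head matches [exp_ideal], whose successor multiplies by l on the left: the
    first step takes care of l, the remaining chain of l^i. *)
Fixpoint tgt i (c : cmcurve) : cmcurve := if i is j.+1 then tgt j (next_cm c) else c.
Fixpoint ups i : forall c : cmcurve, ept c -> ept (tgt i c) :=
  match i with
  | 0 => fun c P => P
  | j.+1 => fun c P => ups j (up P)
  end.

Lemma ups_sepk i (c : cmcurve) : sepk (@ups i c) (ell ^ i).
Proof.
elim: i c => [|i IH] c /=; first exact: sepk_id.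
by rewrite expnS; apply: sepk_comp (IH _); exact: st_sepk (next_step c).
Qed.

Lemma ups_cm i (c : cmcurve) a P : O a -> cR a (@ups i c P) = ups i (cR a P).
Proof.
move=> Oa; elim: i c P => [|i IH] c P //=.
by rewrite IH (st_cm (next_step c)).
Qed.

Lemma mem_mul_ideal (I J : set algC) a b : I a -> J b -> mul_ideal I J (a * b).
Proof. by move=> Ia Jb; exists 1%N, (fun=> a), (fun=> b); split => //; rewrite big_ord1. Qed.

(* If c kills the kernel of up followed by the remaining chain, then c = h up
   for some h killing the kernel of that chain; expanding ell = sum a_j b_j and
   writing b_j = chi_j down, the endomorphisms chi_j h of the next curve are
   elements c_j of the smaller power with ell c_j = b_j c, so c = sum a_j c_j. *)
Lemma exp_ideal_ups i (c : cmcurve) a :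
  exp_ideal O l i a <-> O a /\ forall P, @ups i c P = 0 -> cR a P = 0.
Proof.
elim: i c a => [|i IH] c a.
  split=> [Oa|[] //]; split=> // P /= ->; apply: hom0; exact: (cm_hom (cv_cm c)).
have st := next_step c; have HR := cv_cm c; have HR' := cv_cm (next_cm c).
split.
- move=> [r [x [y [h ->]]]].
  have Ox j : O (x j) by apply: lO; case: (h j).
  have Oy j : O (y j) by have [_ /(IH (next_cm c)) []] := h j.
  have Oxy j : O (x j * y j) by exact: orM.
  have hs P := cm_sum hO HR P Oxy.
  split; first by have [] := hs 0.
  move=> P hP; have [_ ->] := hs P; rewrite big1 // => j _.
  have [lx /(IH (next_cm c)) [_ hy]] := h j.
  rewrite (cmM HR) //; apply: (proj1 (st_ker st _)) => //.
  by rewrite -(st_cm st) // hy.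
- move=> [Oa ha].
  have iup : isog (@up c) by case: (st_sepk st).
  have [|h hh he] := isog_factor (st_sepk st) (cm_isog HR Oa).
    by move=> P hP; apply: ha; rewrite /= hP; apply: hom0; case: (ups_sepk i (next_cm c)) => [[]].
  have [r [x [y [hxy hsum]]]] := pp_sum hl.
  have : forall j, exists z, exp_ideal O l i z /\ ell%:R * z = y j * a.
    move=> j; have [lx ly] := hxy j; have Oy := lO' ly.
    have [|chi hchi hce] := isog_factor (st_dual_sepk st) (cm_isog HR' Oy).
      by move=> Q /(st_dual_ker st); apply.
    have [z Oz hz] := cm_surj HR' (isog0_comp hh hchi).
    exists z; split.
      apply/(IH (next_cm c)); split => // Q hQ; rewrite -hz /=.
      have [P eP] := isog_surj iup Q; rewrite -eP he ha ?(hom0 (isog0_hom hchi)) //.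
      by rewrite /= eP.
    apply: (cm_eq hO HR'); [apply: orM => //; exact: or_nat | exact: orM |].
    move=> Q; rewrite !(cmM HR') //; last exact: or_nat.
    rewrite (cm_nat hO HR') -hz /= -hce -(homMn _ (isog0_hom hchi)) -(homMn _ (isog0_hom hh)).
    rewrite -(st_dual2 st) he; congr chi.
    have [P <-] := isog_surj iup Q.
    rewrite (st_cm st) // !(st_dual1 st) (homMn _ (cm_hom HR Oa)) //.
  move=> /boolp.choice [z hz].
  exists r, x, z; split; first by move=> j; case: (hxy j) (hz j) => ? _ [].
  have ell0 : ell%:R != 0 :> algC by rewrite pnatr_eq0 -lt0n prime_gt0.
  apply: (mulfI ell0); rewrite mulr_sumr {1}hsum mulr_suml; apply: eq_bigr => j _.
  by have [_ e] := hz j; rewrite -mulrA -e mulrCA.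
Qed.

(** If l^(i+1) kills P, then for b in l^i the point R(b) P is killed by l, so R(b) kills [up P];
    induction applies to the next curve. *)
Lemma ker_ups i (c : cmcurve) P :
  @ups i c P = 0 <-> forall a, exp_ideal O l i a -> cR a P = 0.
Proof.
split; first by move=> h a /(exp_ideal_ups i c) [_]; apply.
elim: i c P => [|i IH] c P h /=; first by rewrite -(cm1 (cv_cm c) P) h //; exact: or1.
apply: IH => b hb; have [Ob _] := proj1 (exp_ideal_ups i (next_cm c) b) hb.
rewrite (st_cm (next_step c)) //; apply/(st_ker (next_step c)) => a la.
rewrite -(cmM (cv_cm c)) //; last exact: lO.
by apply: h; exact: mem_mul_ideal.
Qed.

Definition cm_iso (c c' : cmcurve) (w : ept c -> ept c') :=
  iso w /\ forall a P, O a -> cR a (w P) = w (cR a P).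

Lemma cm_iso_id c : cm_iso (fun P : ept (cv c) => P).
Proof. by split => //; exact: iso_id. Qed.

Lemma cm_iso_comp (c1 c2 c3 : cmcurve) (v : ept c1 -> ept c2) (w : ept c2 -> ept c3) :
  cm_iso v -> cm_iso w -> cm_iso (fun P => w (v P)).
Proof.
move=> [iv hv] [iw hw]; split; first exact: (iso_comp iv iw).
by move=> a P Oa; rewrite hw // hv.
Qed.

Lemma cm_iso_inv (c c' : cmcurve) (w : ept c -> ept c') : cm_iso w ->
  exists w', [/\ cm_iso w', cancel w w' & cancel w' w].
Proof.
move=> [[iw [v [iv vK wK]]] hw]; exists v; split => //; split.
  by split => //; exists w.
by move=> a P Oa; rewrite -[in RHS](wK P) hw // vK.
Qed.

(** An O-linear isomorphism carries E[l] onto its counterpart, so the two quotient maps from [c]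
    have the same kernel. *)
Lemma up_cm_iso (c c' : cmcurve) (w : ept c -> ept c') : cm_iso w ->
  exists2 v : ept (next_cm c) -> ept (next_cm c'), cm_iso v & forall P, v (up P) = up (w P).
Proof.
move=> [iw hw]; have st := next_step c; have st' := next_step c'.
have sw : sepk (@up c' \o w) (1 * ell).
  by apply: sepk_comp; [exact: iso_sepk | exact: st_sepk st'].
have winj P : w P = 0 -> P = 0.
  case: iw => [iw [v [iv vK _]]] h; rewrite -(vK P) h; apply: hom0; by case: iv.
have wh : ishom w by case: iw => [[]].
have [|v iv e] := isog_same_ker (st_sepk st) sw.
  move=> P; apply/eqP/eqP => /=.
    move=> /(st_ker st) h; apply/(st_ker st') => a la.
    by rewrite hw ?h //; [exact: hom0 | exact: lO].
  move=> /(st_ker st') h; apply/(st_ker st) => a la; apply: winj.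
  by rewrite -hw ?h //; exact: lO.
exists v => //; split => // a Q Oa.
have [P <-] : exists P, up P = Q by apply: isog_surj; case: (st_sepk st).
by rewrite e /= (st_cm st') // hw // (st_cm st) // e.
Qed.

Section Principal.
Variables (n : nat) (lambda : algC) (hn : class_order O l n) (hlambda : O lambda)
  (hln : exp_ideal O l n = scale_ideal lambda O).

Lemma exp_ideal_ell i : exp_ideal O l i (ell ^ i)%:R.
Proof.
elim: i => [|i IH]; first by rewrite expn0; exact: or1.
by rewrite expnS natrM; apply: mem_mul_ideal => //; exact: pp_ell hl.
Qed.

Lemma lambda_dvd : exists2 mu, O mu & (ell ^ n)%:R = lambda * mu.
Proof. by have := exp_ideal_ell n; rewrite hln => -[mu]; exists mu. Qed.

(** [ups n] and R(lambda) both have kernel E[l^n]. R(lambda) is separable as a factor of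
    multiplication by ell^n, which is invertible in k. *)
Lemma lambda_cm_iso (c : cmcurve) :
  exists2 h : ept (tgt n c) -> ept c, cm_iso h & forall P, h (ups n P) = cR lambda P.
Proof.
have HR := cv_cm c; have [mu Omu e] := lambda_dvd.
have en0 : (ell ^ n)%:R != 0 :> algC by rewrite pnatr_eq0 -lt0n expn_gt0 prime_gt0.
have [l0 m0] : lambda != 0 /\ mu != 0.
  by apply/andP; move: en0; rewrite e mulf_eq0 negb_or.
have enk : (ell ^ n)%:R != 0 :> k by rewrite natrX expf_neq0.
have [D sD] : exists D, sepk (cR (c := c) lambda) D.
  have [|||D [D' [_ h _]]] := sepk_compP (f := cR (c := c) lambda) (g := cR (c := c) mu) (n := (ell ^ n) ^ 2).
  - exact: (cm_isog_neq0 HR).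
  - exact: (cm_isog_neq0 HR).
  - have -> : cR (c := c) mu \o cR lambda = fun P => P *+ (ell ^ n).
      by apply/funext => P; rewrite /= -(cmM HR) // mulrC -e (cm_nat hO HR).
    exact: (@muln_sepk k ch c _ enk).
  - by exists D.
have [|h ih he] := isog_same_ker (ups_sepk n c) sD.
  move=> P; apply/eqP/eqP.
    by move/ker_ups; apply; rewrite hln; exists 1; [exact: or1 | rewrite mulr1].
  move=> hP; apply/ker_ups => a; rewrite hln => -[b Ob ->].
  by rewrite mulrC (cmM HR) // hP; apply: hom0; exact: (cm_hom HR).
exists h => //; split => // a Q Oa.
have [P <-] : exists P, ups n P = Q by apply: isog_surj; case: (ups_sepk n c).
by rewrite he ups_cm // he (cm_comm HR).
Qed.

(* An isomorphism v from E to E_i gives the endomorphism mu = v^-1 ups, and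
   then l^i = mu O. *)
Lemma iso_tgt i (c : cmcurve) (v : ept c -> ept (tgt i c)) : iso v ->
  cm_iso v /\ trivial_class O (exp_ideal O l i).
Proof.
move=> iv; have HR := cv_cm c; have [isv [w [isw wK vK]]] := iv.
have iw : iso w by split => //; exists v.
have su := ups_sepk i c.
have [mu Omu hmu] := cm_surj HR (isog0_comp (or_introl (let: And3 a _ _ := su in a)) (or_introl isw)).
have eu P : ups i P = v (cR mu P) by rewrite -hmu /= vK.
have smu : sepk (cR (c := c) mu) (ell ^ i * 1).
  by rewrite (_ : cR mu = w \o @ups i c); [apply: sepk_comp => //; exact: iso_sepk | apply/funext => P; rewrite -hmu].
split.
  split => // a P Oa; have [Q <-] : exists Q, cR mu Q = P by apply: isog_surj; case: smu.
  by rewrite -eu ups_cm // eu (cm_comm HR).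
have vh : ishom v by case: isv.
exists mu.
  apply/eqP => m0; case: smu => /isog_not0 + _ _; apply; apply/funext => P.
  by rewrite m0 (cm_zero hO HR).
apply/seteqP; split=> a.
- move=> /(exp_ideal_ups i c) [Oa ha].
  have [|h hh e] := isog_factor smu (cm_isog HR Oa).
    by move=> P hP; apply: ha; rewrite eu hP hom0.
  have [b Ob hb] := cm_surj HR hh; exists b => //.
  apply: (cm_eq hO HR) => //; first exact: orM.
  by move=> P; rewrite -e hb mulrC (cmM HR).
- move=> [b Ob ->]; apply/(exp_ideal_ups i c); split; first exact: orM.
  move=> P; rewrite eu => h; have hP : cR mu P = 0 by rewrite -(wK (cR mu P)) h; apply: hom0; case: isw.
  by rewrite mulrC (cmM HR) // hP; apply: hom0; exact: (cm_hom HR).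
Qed.

End Principal.

(** * The level graph in terms of the chain *)

Section Graph.
Hypotheses (Oconj : forall x, O x -> O x^*)
  (Oendo : forall s : algC -> algC, (forall x, O x -> O (s x)) -> s 1 = 1 ->
     (forall x y, O x -> O y -> s (x + y) = s x + s y) ->
     (forall x y, O x -> O y -> s (x * y) = s x * s y) ->
     (forall x, O x -> s x = x) \/ (forall x, O x -> s x = x^*))
  (hl' : l' = conj_ideal l).
Variables (E0 : curve k) (hE0 : defined_over iota E0).
Variables (N : nat) (N0 : (0 < N)%N) (cop : coprime ell N).
Local Notation C := (crater iota O ell E0).

Lemma crater_defined E : C E -> defined_over iota E.
Proof.
move=> [h _]; suff [H _] : defined_over iota E0 <-> defined_over iota E by exact: H.
by elim: h => [x y []|x|x y _|x y z _ h1 _ h2] //; [move=> [] | rewrite h1].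
Qed.

Lemma crater_next (c : cmcurve) : C c -> C (next_cm c).
Proof.
move=> [h _]; split; last by exists (fun a => extp (@cR (next_cm c) a)); apply: cm_End_iso (cv_cm _).
apply: rst_trans h _; apply: rst_step; split; [exact: cv_def | exact: cv_def |].
exists (extp (@up c)); right; apply/(degree_isogenyP ch); rewrite restrK.
by have [h1 h2 _] := st_sepk (next_step c); split => //; exact: maps_extp.
Qed.

Lemma crater_lift E : C E -> exists c : cmcurve, cv c = E.
Proof.
move=> hE; have [_ [rho hrho]] := hE.
by exists (CMCurve (End_iso_cm ch (or1 hO) (orD hO) (orM hO) hrho) (crater_defined hE)).
Qed.

(** Writing R' through R defines a ring endomorphism of O, to which [Oendo] applies. *)
Lemma cm_unique (E : curve k) (R R' : algC -> ept E -> ept E) : cm O R -> cm O R' ->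
  (forall a P, O a -> R' a P = R a P) \/ (forall a P, O a -> R' a P = R a^* P).
Proof.
move=> HR HR'.
have : forall a, exists b, O a -> O b /\ forall P, R' a P = R b P.
  move=> a; have [Oa|nO] := pselect (O a); last by exists 0.
  by have [b Ob h] := cm_surj HR (cm_isog HR' Oa); exists b.
move=> /boolp.choice [s hs].
have sO x : O x -> O (s x) by move=> /hs [].
have sE x P : O x -> R' x P = R (s x) P by move=> /hs [].
have [||||h|h] := Oendo (s := s) => //.
- by apply: (cm_eq hO HR); [apply: sO|..|move=> P; rewrite -sE ?(cm1 HR) ?(cm1 HR')] => //; exact: or1.
- move=> x y Ox Oy; have Oxy := orD hO Ox Oy; apply: (cm_eq hO HR); [exact: sO | by apply: orD => //; exact: sO |].
  by move=> P; rewrite -sE // (cmD HR) -?sE ?(cmD HR') //; exact: sO.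
- move=> x y Ox Oy; have Oxy := orM hO Ox Oy; apply: (cm_eq hO HR); [exact: sO | by apply: orM => //; exact: sO |].
  by move=> P; rewrite -sE // (cmM HR) -?sE ?(cmM HR') //; exact: sO.
- by left=> a P Oa; rewrite sE // h.
- by right=> a P Oa; rewrite sE // h.
Qed.

Lemma conj_cm (E : curve k) (R : algC -> ept E -> ept E) : cm O R -> cm O (fun a => R a^*).
Proof.
move=> HR; split.
- by move=> a Oa; apply: (cm_isog HR); exact: Oconj.
- by move=> P; rewrite rmorph1 (cm1 HR).
- by move=> a b P Oa Ob; rewrite rmorphD (cmD HR) //; exact: Oconj.
- by move=> a b P Oa Ob; rewrite rmorphM (cmM HR) //; exact: Oconj.
- move=> a Oa h; have /eqP := cm_inj HR (Oconj Oa) h.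
  by rewrite fmorph_eq0 => /eqP.
- move=> f hf; have [a Oa h] := cm_surj HR hf; exists a^*; first exact: Oconj.
  by move=> P; rewrite conjCK h.
Qed.

(** With the conjugate action, the l-step is the quotient by the conjugate ideal; this gives the
    backward steps without a second chain. *)
Definition bar (c : cmcurve) : cmcurve := CMCurve (conj_cm (cv_cm c)) (cv_def c).

Lemma tor_bar (c : cmcurve) I (P : ept c) :
  tor (@cR (bar c)) I P <-> tor (@cR c) (conj_ideal I) P.
Proof.
split=> h a Ia; last by apply: h; rewrite /conj_ideal /= conjCK.
by have := h _ Ia; rewrite /= conjCK.
Qed.

Definition rtor (c : cmcurve) (I : set algC) : set (pt k) :=
  [set P | points c P /\ tor (@cR c) I (mkpt c P)].

Lemma rtor_bar c I : rtor (bar c) I = rtor c (conj_ideal I).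
Proof. by apply/seteqP; split=> P [h1 h2]; split => //; exact/tor_bar. Qed.

Lemma ker_rtor (c : cmcurve) (E' : curve k) phi I : maps c E' phi ->
  (ker c phi = rtor c I <-> forall P, (restr phi P : ept E') = 0 <-> tor (@cR c) I P).
Proof.
move=> hm; have e (P : ept c) : ker c phi (sval P) <-> (restr phi P : ept E') = 0.
  rewrite -sval_eq0 restrE // /ker /=; split=> [[] //|h].
  by split => //; exact: points_sval.
have e' (P : ept c) : rtor c I (sval P) <-> tor (@cR c) I P.
  by rewrite /rtor /= svalK; split=> [[] //|h]; split => //; exact: points_sval.
split=> [h P|h]; first by rewrite -e -e' h.
apply/seteqP; split=> P hP.
  by have [Q eQ] := points_ex ch (proj1 hP); subst P; apply/e'/h/e.
by have [Q eQ] := points_ex ch (proj1 hP); subst P; apply/e/h/e'.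
Qed.

(** By [cm_unique], the identification hidden in [crater_isogeny] is the one carried by [c] or its
    conjugate, and the latter only exchanges the two kernels. *)
Lemma crater_isogenyP (c : cmcurve) E' phi : crater_isogeny O l ell c E' phi <->
  [/\ maps c E' phi, sepk (restr phi : ept c -> ept E') ell &
      ker c phi = rtor c l \/ ker c phi = rtor c l'].
Proof.
have Il a : l a -> O a by exact: lO.
have Il' a : conj_ideal l a -> O a by rewrite -hl'; exact: lO'.
split.
- move=> [/(degree_isogenyP ch) [hm iphi dphi] [rho hrho hk]]; split => //; first exact: deg_sepk.
  have hR := End_iso_cm ch (or1 hO) (orD hO) (orM hO) hrho.
  pose Rr : algC -> ept c -> ept c := fun a => restr (rho a).
  have hmr a : O a -> maps c c (rho a).
    by case: hrho => [h _ _ _] /h /(endomorphismP ch) [].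
  have itE I : (forall a, I a -> O a) ->
      ideal_torsion c rho I = [set P | points c P /\ tor Rr I (mkpt c P)].
    move=> IO; apply/seteqP; split=> P [hP h]; split => // a Ia.
      by apply/sval_eq0; rewrite restrE ?mkptK ?h //; apply: hmr; exact: IO.
    by have /sval_eq0 := h a Ia; rewrite restrE ?mkptK //; apply: hmr; exact: IO.
  rewrite !itE // -hl' in hk.
  have e1 I J : (forall P, tor Rr I P <-> tor (@cR c) J P) ->
      [set P | points c P /\ tor Rr I (mkpt c P)] = rtor c J.
    by move=> h; apply/seteqP; split=> P [h1 h2]; split => //; apply/h.
  case: (cm_unique (cv_cm c) (hR : cm O Rr)) => hc.
    have eI I : (forall a, I a -> O a) -> [set P | points c P /\ tor Rr I (mkpt c P)] = rtor c I.
      move=> IO; apply: e1 => P; split=> h a Ia; first by rewrite -hc; [exact: h | exact: IO].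
      by rewrite [LHS]hc; [exact: h | exact: IO].
    by rewrite -(eI l lO) -(eI l' lO').
  have eI I : (forall a, I a -> O a) -> [set P | points c P /\ tor Rr I (mkpt c P)] = rtor c (conj_ideal I).
    move=> IO; apply: e1 => P; split=> h a Ia.
      by rewrite -[a]conjCK -hc; [exact: h | exact: IO].
    by rewrite [LHS]hc; [apply: h; rewrite /conj_ideal /= conjCK | exact: IO].
  rewrite (eI l lO) (eI l' lO') -hl' [in conj_ideal l']hl' in hk.
  have ecc : conj_ideal (conj_ideal l) = l by apply/seteqP; split=> a; rewrite /conj_ideal /= conjCK.
  by rewrite ecc in hk; case: hk; [right | left].
- move=> [hm [iphi dphi kphi] hk]; split; first exact/(degree_isogenyP ch).
  exists (fun a => extp (@cR c a)); first exact: cm_End_iso (cv_cm c).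
  have it I : ideal_torsion c (fun a => extp (@cR c a)) I = rtor c I.
    apply/seteqP; split=> P [hP h]; split => // a Ia.
      by apply/sval_eq0; rewrite -[RHS](h a Ia).
    by rewrite /extp h.
  by rewrite !it -hl'.
Qed.

Definition level_cm := (cmcurve * set (pt k))%type.
Implicit Types x y : level_cm.

Definition raw x : level_curve k := (cv x.1, x.2).
Definition good x := level_curves C N (raw x).
Definition nx x : level_cm := (next_cm x.1, extp (@up x.1) @` x.2).
Definition barx x : level_cm := (bar x.1, x.2).
(** The O-linear refinement of [lequiv]: an isomorphism that conjugates the action need not respect
    E[l], so it is [sim] that is compatible with [nx]. *)
Definition sim x y := exists2 w : ept x.1 -> ept y.1, cm_iso w & extp w @` x.2 = y.2.

Lemma good_points x : good x -> x.2 `<=` points x.1.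
Proof. exact: (level_points ch N0). Qed.

Lemma raw_points x : good x -> (raw x).2 `<=` points (raw x).1.
Proof. exact: good_points. Qed.

Lemma muln_coprime_inj (e : nat) (E : curve k) (P : ept E) : coprime e N ->
  P *+ N = 0 -> P *+ e = 0 -> P = 0.
Proof.
move=> copm hN he; have [u v huv _] := egcdnP e N0.
rewrite gcdnC (eqP copm) in huv.
have : P *+ (u * N) = P *+ (v * e + 1) by rewrite huv.
by rewrite mulnC mulrnA hN mul0rn mulrnDr mulnC mulrnA he mul0rn add0r mulr1n => <-.
Qed.

Lemma good_nx x : good x -> good (nx x).
Proof.
move=> [h1 h2]; split; first exact: crater_next.
have st := next_step x.1.
apply: (Gamma0_image N0 _ _ h2); first by case: (st_sepk st) => [[]].
move=> P hN hP; apply: (muln_coprime_inj cop hN).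
by rewrite -(st_dual1 st) hP; apply: hom0; case: (st_dual_sepk st) => [[]].
Qed.

Lemma good_bar x : good x -> good (barx x).
Proof. by []. Qed.

Lemma sim_refl x : good x -> sim x x.
Proof.
move=> h; exists (fun P => P); first exact: cm_iso_id.
by apply: image_extp_id => //; exact: good_points.
Qed.

Lemma sim_sym x y : good x -> sim x y -> sim y x.
Proof.
move=> h [w iw e]; have [v [iv vK wK]] := cm_iso_inv iw; exists v => //.
by rewrite -e image_extp_comp image_extp_id //; exact: good_points.
Qed.

Lemma sim_trans x y z : sim x y -> sim y z -> sim x z.
Proof.
move=> [v iv ev] [w iw ew]; exists (fun P => w (v P)); first exact: cm_iso_comp iv iw.
by rewrite -ew -ev image_extp_comp.
Qed.

Lemma sim_lequiv x y : sim x y -> lequiv ch (raw x) (raw y).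
Proof. by move=> [w [iw _] e]; exists w. Qed.

Lemma sim_nx x y : sim x y -> sim (nx x) (nx y).
Proof.
move=> [w iw e]; have [v iv hv] := up_cm_iso iw; exists v => //=.
rewrite -e !image_extp_comp; congr (_ @` _); apply/funext => P.
by rewrite /extp hv.
Qed.

Lemma sim_bar x y : sim x y -> sim (barx x) (barx y).
Proof.
move=> [w [iw hw] e]; exists w => //; split => // a P Oa.
by rewrite /= hw //; exact: Oconj.
Qed.

Lemma image_restr (E E' : curve k) phi (G : set (pt k)) : G `<=` points E ->
  maps E E' phi -> extp (restr phi : ept E -> ept E') @` G = phi @` G.
Proof.
move=> GE hm; have e P : G P -> extp (restr phi : ept E -> ept E') P = phi P.
  by move=> /GE /(points_ex ch) [Q ->]; rewrite extpE restrE.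
by apply/seteqP; split=> _ [P hP <-]; exists P => //; rewrite e.
Qed.

Lemma arc_target x E' phi : good x -> maps x.1 E' phi ->
  sepk (restr phi : ept x.1 -> ept E') ell -> ker x.1 phi = rtor x.1 l ->
  lequiv ch (raw (nx x)) (E', phi @` x.2).
Proof.
move=> gx hm sphi /(ker_rtor _ hm) hk; have st := next_step x.1.
have [|h ih he] := isog_same_ker (st_sepk st) sphi.
  by move=> P; apply/eqP/eqP => [/(st_ker st) /hk|/hk /(st_ker st)].
exists h => //=; rewrite image_extp_comp -(image_restr (good_points gx) hm).
by congr (_ @` _); apply/funext => P; rewrite /extp he.
Qed.

(** The step by the conjugate ideal is the dual isogeny, and the composite, multiplication by ell,
    fixes the level structure since ell is prime to N. *)
Lemma nx_back x : good x -> lequiv ch (raw (nx (barx (nx x)))) (raw x).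
Proof.
move=> gx; have st := next_step x.1; have [_ hG] := gx.
have -> : raw x = (cv x.1, extp (@down x.1) @` (nx x).2).
  congr pair; rewrite /= image_extp_comp -[LHS](Gamma0_muln ch N0 cop hG).
  by congr (_ @` _); apply/funext => P; rewrite /extp (st_dual1 st).
apply: (arc_target (x := barx (nx x))); first exact: good_nx.
- exact: maps_extp.
- by rewrite restrK; exact: st_dual_sepk st.
- rewrite rtor_bar -hl'; apply/(ker_rtor _ (maps_extp (@down x.1))) => Q.
  by rewrite restrK; exact: st_dual_ker st _.
Qed.

Lemma vertex_closed v z z' : level_vertices C N v -> v z -> lequiv ch z z' ->
  level_curves C N z' -> v z'.
Proof.
move=> [y hy <-] /(level_classP ch N0 _ hy) [hz h] e hz'.
by apply/(level_classP ch N0 _ hy); split => //; exact: lequiv_trans h e.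
Qed.

Lemma vertex_lequiv v z z' : level_vertices C N v -> v z -> v z' -> lequiv ch z z'.
Proof.
move=> [y hy <-] /(level_classP ch N0 _ hy) [hz h] /(level_classP ch N0 _ hy) [_ h'].
exact: lequiv_trans (lequiv_sym (level_points ch N0 hy) h) h'.
Qed.

(** Stated as a set of kernels, so the ramified case, where the two kernels coincide, needs no
    separate treatment. *)
Lemma arcsP x w : good x -> level_vertices C N w ->
  arcs O l ell (raw x) w = [set H | (H = rtor x.1 l /\ w (raw (nx x))) \/
                                    (H = rtor x.1 l' /\ w (raw (nx (barx x))))].
Proof.
move=> gx hw; have gn := good_nx gx; have gb := good_nx (good_bar gx).
have wl z : w z -> level_curves C N z.
  by case: hw => y hy <- /(level_classP ch N0 _ hy) [].
have wc z z' : w z -> level_curves C N z' -> lequiv ch z' z -> w z'.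
  by move=> wz gz' h; apply: (vertex_closed hw wz) => //; apply: lequiv_sym h; exact: (level_points ch N0 gz').
have st := next_step x.1; have stb := next_step (bar x.1).
apply/seteqP; split=> H.
- move=> [E' [phi [/crater_isogenyP [hm sphi hk] wphi ->]]].
  case: hk => hk; [left | right]; split => //.
    by apply: wc wphi gn _; exact: arc_target.
  apply: wc wphi gb _; apply: (arc_target (x := barx x)) => //.
  by rewrite rtor_bar -hl'.
- move=> [[-> h]|[-> h]].
    have hk : ker x.1 (extp (@up x.1)) = rtor x.1 l.
      by apply/(ker_rtor _ (maps_extp (@up x.1))); rewrite restrK; exact: st_ker st.
    exists (next_cm x.1), (extp (@up x.1)); split => //; apply/crater_isogenyP.
    by split; [exact: maps_extp | rewrite restrK; exact: st_sepk st | left].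
  have hk : ker x.1 (extp (@up (bar x.1))) = rtor x.1 l'.
    rewrite hl' -rtor_bar; apply/(ker_rtor _ (maps_extp (@up (bar x.1)))).
    by rewrite restrK; exact: st_ker stb.
  exists (next_cm (bar x.1)), (extp (@up (bar x.1))); split => //; apply/crater_isogenyP.
  by split; [exact: maps_extp | rewrite restrK; exact: st_sepk stb | right].
Qed.

Lemma level_lift z : level_curves C N z -> exists2 x, good x & raw x = z.
Proof.
case: z => E G h; have [c hc] := crater_lift h.1; exists (c, G); last by rewrite /raw /= hc.
by rewrite /good /raw /= hc.
Qed.

Lemma vertex_mem v z : level_vertices C N v -> v z -> level_curves C N z.
Proof. by move=> [y hy <-] /(level_classP ch N0 _ hy) []. Qed.

Lemma adjacent_sym v w : level_vertices C N v -> level_vertices C N w ->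
  adjacent O l ell v w -> adjacent O l ell w v.
Proof.
move=> hv hw [z vz [H hH]]; have [x gx ex] := level_lift (vertex_mem hv vz); subst z.
have back y : good y -> v (raw y) -> w (raw (nx y)) -> adjacent O l ell w v.
  move=> gy vy wy; have gn := good_nx gy; exists (raw (nx y)) => //.
  exists (rtor (nx y).1 l'); rewrite arcsP //; right; split => //.
  apply: (vertex_closed hv vy); last exact: (good_nx (good_bar gn)).
  by apply: lequiv_sym (nx_back gy); exact: good_points (good_nx (good_bar gn)).
by move: hH; rewrite arcsP // => -[[_ h]|[_ h]]; apply: back h.
Qed.

Section Orbit.
Variables (n : nat) (lambda : algC) (hn : class_order O l n) (hlambda : O lambda)
  (hln : exp_ideal O l n = scale_ideal lambda O).
Hypothesis hj : forall E, C E -> jinv E != 0 /\ jinv E != 1728%:R.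

Definition orb i x : level_cm := (tgt i x.1, extp (@ups i x.1) @` x.2).

Lemma orbE i x : good x -> iter i nx x = orb i x.
Proof.
elim: i x => [|i IH] x gx.
  case: x gx => c G gx; congr pair; rewrite image_extp_id //; exact: (good_points gx).
by rewrite iterSr IH; [rewrite /orb /= image_extp_comp | exact: good_nx].
Qed.

Lemma good_iter i x : good x -> good (iter i nx x).
Proof. by move=> gx; elim: i => [|i IH] //=; exact: good_nx. Qed.

Lemma sim_iter i x y : sim x y -> sim (iter i nx x) (iter i nx y).
Proof. by move=> h; elim: i => [|i IH] //=; exact: sim_nx. Qed.

Lemma orbit_lequiv i x : good x -> lequiv ch (raw x) (raw (iter i nx x)) ->
  sim x (iter i nx x) /\ trivial_class O (exp_ideal O l i).
Proof.
move=> gx; rewrite orbE // => -[w iw e].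
by have [ciw ht] := iso_tgt iw; split => //; exists w.
Qed.

Definition twist a x : level_cm := (x.1, extp (@cR x.1 a) @` x.2).

Lemma lambda_unit_ell : exists2 mu, O mu & exists2 e, coprime e N & e%:R = lambda * mu.
Proof.
have [mu Omu e] := lambda_dvd hln; exists mu => //; exists (ell ^ n)%N => //.
by rewrite coprimeXl.
Qed.

Lemma good_twist a b e x : O a -> O b -> coprime e N -> e%:R = a * b ->
  good x -> good (twist a x).
Proof.
move=> Oa Ob cope eab [h1 h2]; split => //; have HR := cv_cm x.1.
apply: (Gamma0_image N0 _ _ h2); first exact: (cm_hom HR).
move=> P hN hP; apply: (muln_coprime_inj cope hN).
rewrite -(cm_nat hO HR) eab mulrC (cmM HR) // hP; apply: hom0; exact: (cm_hom HR).
Qed.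

Lemma expr_order a i : O a -> O (a ^+ i).
Proof. by move=> Oa; elim: i => [|i IH]; rewrite ?expr0 ?exprS; [exact: or1 | exact: orM]. Qed.

Lemma twistM a b x : O a -> O b -> twist a (twist b x) = twist (a * b) x.
Proof.
move=> Oa Ob; congr pair; rewrite image_extp_comp; congr (_ @` _).
by apply/funext => P; rewrite /extp /= (cmM (cv_cm x.1)).
Qed.

Lemma good_twist_lambda i x : good x -> good (twist (lambda ^+ i) x).
Proof.
move=> gx; have [mu Omu [e cope ee]] := lambda_unit_ell.
apply: (@good_twist _ (mu ^+ i) (e ^ i)) => //; try exact: expr_order.
  by rewrite coprimeXl.
by rewrite natrX ee exprMn.
Qed.

Lemma sim_twist x : good x -> sim (iter n nx x) (twist lambda x).
Proof.
move=> gx; rewrite orbE //; have [h ih e] := lambda_cm_iso hlambda hln x.1.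
exists h => //=; rewrite image_extp_comp; congr (_ @` _).
by apply/funext => P; rewrite /extp e.
Qed.

Lemma sim_twist_iter i x : good x -> sim (iter (n * i) nx x) (twist (lambda ^+ i) x).
Proof.
move=> gx; elim: i => [|i IH].
  rewrite muln0 expr0 (_ : twist 1 x = x); first exact: sim_refl.
  case: x gx => c G gx; congr pair; apply: image_extp_id; first exact: (good_points gx).
  by move=> P _; exact: (cm1 (cv_cm c)).
rewrite mulnS iterD; apply: sim_trans (sim_iter n IH) _.
rewrite exprS -twistM //; last exact: expr_order.
by apply: sim_twist; exact: good_twist_lambda.
Qed.

Lemma crater_automorphism x (w : ept x.1 -> ept x.1) : good x -> iso w ->
  extp w @` x.2 = x.2.
Proof.
move=> gx iw; have [hC hG] := gx; have [j0 j1] := hj hC.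
(* j != 0 excludes a = 0, and j != 1728 excludes b = 0. *)
have a0 : coefA x.1 != 0.
  by apply: contraNneq j0 => a0; rewrite /jinv /= a0 expr0n /= !mulr0 mul0r.
have b0 : Defs.coefB x.1 != 0.
  apply: contraNneq j1 => b0; rewrite /jinv /= b0 expr0n /= mulr0 addr0 mulfK //.
  by have := smooth x.1; rewrite b0 expr0n /= mulr0 addr0.
case: (automorphism_pm1 a0 b0 iw) => ->; last exact: (Gamma0_opp ch N0 hG).
by apply: image_extp_id => //; exact: (good_points gx).
Qed.

(* m is the order of lambda modulo the stabilizer of the level structure. *)
Definition stab_period x m :=
  (0 < m)%N /\ forall i, (twist (lambda ^+ i) x).2 = x.2 <-> (m %| i)%N.

Lemma orbit_period x m : good x -> stab_period x m -> sim (iter (n * m) nx x) x.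
Proof.
move=> gx [_ h]; have := sim_twist_iter m gx.
by rewrite (_ : twist _ x = x) //; case: x gx h => c G gx h; congr pair; apply/h.
Qed.

(** Write i = n q + r with r < n. Then n q of the steps amount to a twist by lambda^q, so an
    isomorphism makes l^r principal and r = 0 by minimality of n. What remains is an automorphism of
    the curve, which fixes G. *)
Lemma orbit_same_curve x (G : set (pt k)) i : good x -> good (x.1, G) ->
  lequiv ch (raw (x.1, G)) (raw (iter i nx x)) ->
  (n %| i)%N /\ (twist (lambda ^+ (i %/ n)) x).2 = G.
Proof.
move=> gx gG hx; have [n0 _ hmin] := hn.
have key r q : lequiv ch (raw (x.1, G)) (raw (iter (n * q + r) nx x)) ->
    lequiv ch (raw (x.1, G)) (raw (twist (lambda ^+ q) (iter r nx x))).
  move=> h; apply: lequiv_trans h _; rewrite iterD.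
  by apply: sim_lequiv; apply: sim_twist_iter; exact: good_iter.
rewrite [i in iter i](divn_eq i n) mulnC in hx.
have hq := key _ _ hx.
have r0 : (i %% n = 0)%N.
  apply/eqP; rewrite -[_ == _]negbK -lt0n; apply/negP => r0.
  case: (hmin (i %% n)%N); first by rewrite r0 ltn_pmod.
  move: hq; rewrite orbE // => -[w iw _].
  by have [] := iso_tgt iw.
move: hq; rewrite r0 /= => -[w iw e]; split; first exact/eqP.
rewrite -[LHS](_ : extp w @` G = _); last exact: e.
exact: (crater_automorphism (x := (x.1, G))).
Qed.

Lemma orbit_distinct x m i : good x -> stab_period x m ->
  lequiv ch (raw x) (raw (iter i nx x)) -> (n * m %| i)%N.
Proof.
move=> gx [m0 hm] hx; have [n0 _ _] := hn.
have [|/dvdnP [q ->] /hm] := orbit_same_curve (G := x.2) gx _ hx; first by case: x gx {hm hx}.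
by rewrite mulnK // mulnC dvdn_pmul2r.
Qed.

Lemma level_class_mem (z : level_cm) v : good z -> level_vertices C N v ->
  v (raw z) <-> v = level_class C N (raw z).
Proof.
move=> gz hy; split=> [yz|->]; last first.
  by apply/(level_classP ch N0 _ gz); split => //; apply: lequiv_refl; exact: good_points.
case: hy yz => u hu <- /(level_classP ch N0 _ hu) [_ h].
exact/(level_class_eqP ch N0 hu gz).
Qed.

Lemma sim_class x y : good x -> good y -> sim x y ->
  level_class C N (raw x) = level_class C N (raw y).
Proof. by move=> gx gy h; apply/(level_class_eqP ch N0 gx gy); exact: sim_lequiv. Qed.

Lemma iso_transport_cm (E E' : curve k) (R : algC -> ept E -> ept E) (w : ept E -> ept E')
  (v : ept E' -> ept E) : cm O R -> iso w -> iso v -> cancel w v -> cancel v w ->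
  cm O (fun a P => w (R a (v P))).
Proof.
move=> HR iw iv wK vK; have iw0 : isog0 w by left; case: iw.
have iv0 : isog0 v by left; case: iv.
split.
- by move=> a Oa; exact: (isog0_comp (isog0_comp iv0 (cm_isog HR Oa)) iw0).
- by move=> P; rewrite (cm1 HR).
- by move=> a b P Oa Ob; rewrite (cmD HR) // (isog0_hom iw0).
- by move=> a b P Oa Ob; rewrite (cmM HR) // wK.
- move=> a Oa h; apply: (cm_inj HR Oa) => P.
  have := h (w P); rewrite wK => e; rewrite -(wK (R a P)) e; exact: (hom0 (isog0_hom iv0)).
- move=> f hf; have [a Oa h] := cm_surj HR (isog0_comp iw0 (isog0_comp hf iv0)).
  by exists a => // P; rewrite -h /= vK vK.
Qed.

(** The action is transported along the isomorphism, which upgrades [lequiv] to [sim]; every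
    representative of a class can thus be handled through the chain. *)
Lemma level_lift_sim x (z : level_curve k) : good x -> level_curves C N z -> lequiv ch (raw x) z ->
  exists y, [/\ good y, raw y = z & sim x y].
Proof.
case: z => E G gx hz [w iw e]; have [v [iv wK vK]] := iso_inv iw.
have HR' := iso_transport_cm (cv_cm x.1) iw iv wK vK.
exists (CMCurve HR' (crater_defined hz.1), G); split => //; exists w => //; split => //.
by move=> a P Oa /=; rewrite wK.
Qed.

Lemma arcs_sim x y w : good x -> good y -> sim x y -> level_vertices C N w ->
  arcs O l ell (raw x) w #= arcs O l ell (raw y) w.
Proof.
move=> gx gy sxy hw; have [u iu _] := sxy; have [v [iv uK vK]] := cm_iso_inv iu.
have gn := good_nx gx; have gn' := good_nx gy.
have gb := good_nx (good_bar gx); have gb' := good_nx (good_bar gy).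
have ruI I : (forall a, I a -> O a) -> extp u @` rtor x.1 I = rtor y.1 I.
  move=> IO; apply/seteqP; split.
    move=> _ [P [hP tP] <-]; split; first exact: points_sval.
    move=> a Ia; rewrite /extp svalK iu.2 ?tP //; last exact: IO.
    by apply: hom0; case: (iu.1) => [[]].
  move=> P [hP tP]; exists (sval (v (mkpt _ P))).
    split; first exact: points_sval.
    move=> a Ia; rewrite svalK iv.2 ?tP //; last exact: IO.
    by apply: hom0; case: (iv.1) => [[]].
  by rewrite /extp svalK vK mkptK.
have -> : arcs O l ell (raw y) w = (fun H => extp u @` H) @` arcs O l ell (raw x) w.
  have p1 : w (raw (nx x)) <-> w (raw (nx y)).
    by rewrite !level_class_mem // (sim_class gn gn' (sim_nx sxy)).
  have p2 : w (raw (nx (barx x))) <-> w (raw (nx (barx y))).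
    by rewrite !level_class_mem // (sim_class gb gb' (sim_nx (sim_bar sxy))).
  rewrite !arcsP //; apply/seteqP; split=> H.
    move=> [[-> h]|[-> h]].
      by exists (rtor x.1 l); [left; split => //; exact/p1 | exact: ruI].
    by exists (rtor x.1 l'); [right; split => //; exact/p2 | exact: ruI].
  move=> [K [[-> h]|[-> h]] <-]; [left | right]; split; [exact: ruI|exact/p1|exact: ruI|exact/p2].
rewrite card_eq_sym; apply: inj_card_eq => H K; rewrite !inE !arcsP //= => hH hK e.
have hp J : (J = rtor x.1 l /\ w (raw (nx x))) \/ (J = rtor x.1 l' /\ w (raw (nx (barx x)))) ->
    extp v @` (extp u @` J) = J.
  move=> hJ; rewrite image_extp_comp image_extp_id //.
  by case: hJ => -[-> _] P [].
by rewrite -(hp _ hH) e hp.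
Qed.

(** * The cycle through one vertex *)

Section OneOrbit.
Variables (x0 : level_cm) (gx0 : good x0) (m : nat) (hm : stab_period x0 m).
Local Notation M := (n * m)%N.

Definition vertex i := level_class C N (raw (iter i nx x0)).

Let M0 : (0 < M)%N.
Proof. by rewrite muln_gt0; case: hn => -> _ _; case: hm => ->. Qed.

Let gi i : good (iter i nx x0).
Proof. exact: good_iter. Qed.

Lemma vertex_vertex i : level_vertices C N (vertex i).
Proof. by exists (raw (iter i nx x0)) => //; exact: gi. Qed.

Lemma sim_period i j : sim (iter (M * i + j) nx x0) (iter j nx x0).
Proof.
elim: i => [|i IH]; first by rewrite muln0; exact: sim_refl.
rewrite mulnS -addnA addnC iterD; apply: sim_trans IH.
by apply: sim_iter; exact: orbit_period.
Qed.

Lemma vertex_eq i j : vertex i = vertex j <-> (i == j %[mod M])%N.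
Proof.
wlog ij : i j / (i <= j)%N.
  move=> h; have [ij|/ltnW ij] := leqP i j; first exact: h.
  by rewrite eq_sym -h //; split.
rewrite [X in is_true X]eq_sym eqn_mod_dvd //.
rewrite (level_class_eqP ch N0 (gi i) (gi j)).
split=> [h|/dvdnP [t ht]]; last first.
  have -> : j = (M * t + i)%N by rewrite mulnC -ht subnK.
  by apply: (lequiv_sym (raw_points (gi (M * t + i)))); apply: sim_lequiv; exact: sim_period.
rewrite -(subnK ij) iterD in h; have [hs _] := orbit_lequiv (gi i) h.
(* Continuing from position i up to a multiple of M turns the equivalence of positions i and j into
   one that starts at [x0]. *)
have iM : (i <= M * i)%N by rewrite leq_pmull.
have := sim_iter (M * i - i)%N hs; rewrite -!iterD [in X in sim _ X]addnAC subnK //.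
move=> h1; apply: (orbit_distinct gx0 hm); apply: sim_lequiv.
have h0 := sim_period i 0; rewrite addn0 in h0.
exact: sim_trans (sim_sym (gi _) h0) (sim_trans h1 (sim_period i (j - i))).
Qed.

Lemma vertex_card : range vertex #= `I_M.
Proof.
have -> : range vertex = vertex @` `I_M.
  apply/seteqP; split=> _ [i _ <-]; last by exists i.
  exists (i %% M)%N; first by rewrite /= ltn_pmod.
  by apply/vertex_eq; rewrite modn_mod.
apply: inj_card_eq => i j; rewrite !inE /= => iM jM /vertex_eq.
by rewrite !modn_small // => /eqP.
Qed.

Lemma vertex_nx i : vertex i.+1 = level_class C N (raw (nx (iter i nx x0))).
Proof. by []. Qed.

(** The conjugate step goes back by one; as positions count modulo M, adding [M.-1] replaces a
    subtraction. *)
Lemma vertex_pred i : vertex (i + M.-1) = level_class C N (raw (nx (barx (iter i nx x0)))).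
Proof.
have gb j : good (nx (barx (iter j nx x0))) by apply: good_nx; exact: good_bar.
apply/(level_class_eqP ch N0 (gi (i + M.-1)) (gb i)).
have h := nx_back (gi (i + M.-1)).
apply: (lequiv_trans (lequiv_sym (raw_points (gb (i + M.-1).+1)) h)).
apply: sim_lequiv; apply: sim_nx; apply: sim_bar.
by rewrite -addnS prednK // addnC -[M in (M + _)%N]muln1; exact: sim_period.
Qed.

Lemma arcs_vertex i w : level_vertices C N w ->
  arcs O l ell (raw (iter i nx x0)) w =
  [set H | (H = rtor (tgt i x0.1) l /\ w = vertex i.+1) \/
           (H = rtor (tgt i x0.1) l' /\ w = vertex (i + M.-1))].
Proof.
move=> hw; rewrite arcsP // vertex_nx vertex_pred {1 3}orbE //.
have g1 := good_nx (gi i); have g2 := good_nx (good_bar (gi i)).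
by apply/seteqP; split=> H [[-> h]|[-> h]]; [left|right|left|right]; split => //; exact/level_class_mem.
Qed.

Lemma component_vertex i : component C O l ell N (vertex i) = range vertex.
Proof.
have vv := vertex_vertex.
(* The arc may start at any representative of the class, so that representative first receives the
   action transported from position j. *)
have step j w : level_vertices C N w -> adjacent O l ell (vertex j) w -> range vertex w.
  move=> hw [z vz [H hH]].
  have hx := vertex_lequiv (vv j) (proj2 (level_class_mem (gi j) (vv j)) erefl) vz.
  have [y [gy ey sy]] := level_lift_sim (gi j) (vertex_mem (vv j) vz) hx; subst z.
  have e1 := sim_class (gi j) gy sy.
  move: hH; rewrite arcsP // => -[[_ h]|[_ h]].
    exists j.+1 => //; rewrite vertex_nx; apply/esym; move: h.
    move/level_class_mem => ->; [|exact: good_nx|by []].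
    by apply/esym; apply: sim_class; [exact: good_nx | exact: good_nx | exact: sim_nx].
  exists (j + M.-1)%N => //; rewrite vertex_pred; apply/esym; move: h.
  have gb := good_nx (good_bar gy); have gb' := good_nx (good_bar (gi j)).
  move/level_class_mem => ->; [|exact: gb|by []].
  by apply/esym; apply: sim_class => //; apply: sim_nx; exact: sim_bar.
apply/seteqP; split.
- suff H v w : clos_refl_sym_trans _ (fun u u' => [/\ level_vertices C N u, level_vertices C N u'
                    & adjacent O l ell u u']) v w -> range vertex v <-> range vertex w.
    by move=> w /H h; apply/h; exists i.
  elim=> [u u' [hu hu' h]|//|u u' _ ->//|u u' u'' _ -> _ ->//].
  split=> -[j _ e]; subst; first exact: step h.
  by apply: (step j _ hu); exact: adjacent_sym.
- have up1 j : component C O l ell N (vertex j) (vertex j.+1).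
    apply: rst_step; split => //; exists (raw (iter j nx x0)).
      by apply/(level_class_mem _ (vv j)).
    exists (rtor (tgt j x0.1) l); rewrite arcs_vertex //; left; split => //.
  have up0 j : component C O l ell N (vertex 0) (vertex j).
    elim: j => [|j IH]; first exact: rst_refl.
    exact: rst_trans IH (up1 j).
  move=> _ [j _ <-]; apply: rst_trans (up0 j); exact: rst_sym (up0 i).
Qed.

End OneOrbit.

(** Both cycles run over the same chain of curves and have the same length. Matching positions
    therefore preserves the kernels as well, and the two sets of arcs at a position are literally
    equal. *)
Lemma orbits_iso (c : cmcurve) (G G' : set (pt k)) m : good (c, G) -> good (c, G') ->
  stab_period (c, G) m -> stab_period (c, G') m ->
  subgraph_iso O l ell (range (vertex (c, G))) (range (vertex (c, G'))).
Proof.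
move=> gG gG' sG sG'; set x0 := (c, G); set x1 := (c, G').
(* Some position of [v], with default 0 off the cycle. It is determined modulo the length of the
   cycle only, which is enough by [vertex_eq]. *)
pose idx v := xget 0%N [set i | vertex x0 i = v].
have hE i : vertex x1 (idx (vertex x0 i)) = vertex x1 i.
  apply/(vertex_eq gG' sG'); apply/(vertex_eq gG sG).
  exact: (@xgetPex _ 0%N [set j | vertex x0 j = vertex x0 i] (ex_intro _ i erefl)).
have eqv i j : vertex x0 i = vertex x0 j <-> vertex x1 i = vertex x1 j.
  by split=> h; [apply/(vertex_eq gG' sG')/(vertex_eq gG sG)
               | apply/(vertex_eq gG sG)/(vertex_eq gG' sG')].
exists (fun v => vertex x1 (idx v)).
  split.
  - by move=> _ [i _ <-]; exists (idx (vertex x0 i)).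
  - move=> v w; rewrite !inE => -[i _ <-] [j _ <-]; rewrite !hE => h; exact/eqv.
  - by move=> _ [i _ <-]; exists (vertex x0 i); [exists i | rewrite hE].
move=> v w x y [i _ <-] [j _ <-] vx; rewrite !hE => vy.
have lift z u (gz : good z) : vertex z i u -> exists X, [/\ good X, raw X = u & sim (iter i nx z) X].
  move=> zu; have vz := vertex_vertex gz i; have gi := good_iter i gz.
  apply: level_lift_sim => //; first exact: vertex_mem zu.
  by apply: (vertex_lequiv vz _ zu); apply/(level_class_mem gi vz).
have [X [gX <- sX]] := lift x0 x gG vx.
have [Y [gY <- sY]] := lift x1 y gG' vy.
have g0 := good_iter i gG; have g1 := good_iter i gG'.
have h0 := arcs_sim g0 gX sX (vertex_vertex gG j).
have h1 := arcs_sim g1 gY sY (vertex_vertex gG' j).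
rewrite card_eq_sym in h0; apply: card_eq_trans h0 _; apply: card_eq_trans _ h1.
rewrite (arcs_vertex gG sG i (vertex_vertex gG j)) (arcs_vertex gG' sG' i (vertex_vertex gG' j)).
rewrite (_ : [set H | _] = [set H | H = rtor (tgt i x1.1) l /\ vertex x1 j = vertex x1 i.+1 \/
     H = rtor (tgt i x1.1) l' /\ vertex x1 j = vertex x1 (i + (n * m).-1)]); first exact: card_eqxx.
by apply/seteqP; split=> H [[-> /eqv h]|[-> /eqv h]]; [left|right|left|right].
Qed.

Lemma stab_period_least x m : good x -> (0 < m)%N -> (twist (lambda ^+ m) x).2 = x.2 ->
  (forall i, (0 < i < m)%N -> (twist (lambda ^+ i) x).2 <> x.2) -> stab_period x m.
Proof.
move=> gx m0 hm hmin; pose T i := twist (lambda ^+ i) x = x.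
have TE i : T i <-> (twist (lambda ^+ i) x).2 = x.2.
  by rewrite /T; case: x {gx hm hmin T} => c G; split=> [[]|/= e] //; rewrite /twist /= e.
have TD i j : T i -> (T (j + i)%N <-> T j).
  by move=> hi; rewrite /T exprD -twistM ?hi //; exact: expr_order.
have Tm i : T (i * m)%N.
  elim: i => [|i IH]; last by rewrite mulSn; apply/(TD _ _ IH)/TE.
  rewrite /T mul0n expr0; case: x gx {hm hmin T TE TD} => c G gx.
  congr pair; apply: image_extp_id; first exact: (good_points gx).
  by move=> P _; exact: (cm1 (cv_cm c)).
split => // i; rewrite -TE; split=> [hi|/dvdnP [j ->] //].
move: hi; rewrite {1}(divn_eq i m) addnC => /(TD _ _ (Tm _)) /TE hi.
rewrite /dvdn; apply: contraT; rewrite -lt0n => r0.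
by case: (hmin (i %% m)%N) => //; rewrite r0 ltn_pmod.
Qed.

(** lambda divides ell^n, which is prime to N. *)
Lemma lambda_unit_mod i : unit_mod O (scale_ideal N%:R O) (lambda ^+ i).
Proof.
have [mu Omu e] := lambda_dvd hln; have Ol := expr_order i hlambda.
have Om := expr_order i Omu.
have e0 : (0 < (ell ^ n) ^ i)%N by rewrite !expn_gt0 prime_gt0.
have [u v huv _] := egcdnP N e0.
rewrite (eqP (_ : coprime ((ell ^ n) ^ i) N)) in huv; last by rewrite !coprimeXl.
split => //; exists (mu ^+ i * u%:R); first by apply: orM => //; exact: or_nat.
exists v%:R; first exact: or_nat.
rewrite mulrA -exprMn -e -natrX -[_ * u%:R]natrM mulnC huv natrD addrK natrM; exact: mulrC.
Qed.

(** * Units modulo the annihilator of P, and the number of cycles *)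

Section Counting.
Variables (c : cmcurve) (hC : C c) (th : algC -> ept c) (P : ept c) (piP : algC) (m : nat).
Hypotheses (thM : forall a b, O a -> O b -> th (a * b) = cR a (th b))
  (th_eq0 : forall a, O a -> th a = 0 <-> scale_ideal N%:R O a)
  (hP : exact_order N P) (OpiP : O piP) (thP : th piP = P)
  (hm : stab_period (c, multiples P) m).
Hypothesis hNk : N%:R != 0 :> k.
Let HR := cv_cm c.

Definition ann : set algC := [set x | O x /\ cR x P = 0].

(** x kills P exactly when N divides x piP, and then x / N sends both generators piP and N of the
    ideal into O. *)
Lemma ann_ideal : ann = mul_ideal (inv_ideal O (ideal_gen2 O piP N%:R)) (scale_ideal N%:R O).
Proof.
have n0 : N%:R != 0 :> algC by rewrite pnatr_eq0 -lt0n.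
have annE (x : algC) : O x -> cR x P = 0 <-> scale_ideal N%:R O (x * piP).
  by move=> Ox; rewrite -thP -thM //; apply: th_eq0; exact: orM.
have gen_pi : ideal_gen2 O piP N%:R piP.
  by exists 1, 0; split; [exact: or1 | exact: (or_nat hO 0) | rewrite mul1r mul0r addr0].
have gen_N : ideal_gen2 O piP N%:R N%:R.
  by exists 0, 1; split; [exact: (or_nat hO 0) | exact: or1 | rewrite mul1r mul0r add0r].
apply/seteqP; split=> x.
- move=> [Ox /(annE x Ox) [b Ob e]].
  have -> : x = (x / N%:R) * (N%:R * 1) by rewrite mulr1 divfK.
  apply: mem_mul_ideal; last by exists 1; [exact: or1 |].
  move=> _ [r [s [Or Os ->]]].
  have -> : x / N%:R * (r * piP + s * N%:R) = r * b + s * x.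
    rewrite mulrDr; congr (_ + _); last by rewrite mulrCA divfK.
    by rewrite mulrCA [x / _ * _]mulrAC e [N%:R * b]mulrC mulfK.
  by apply: orD => //; exact: orM.
- move=> [r [u [v [h ->]]]].
  suff H i : ann (u i * v i).
    have Oi i : O (u i * v i) by case: (H i).
    have [h1 h2] := cm_sum hO HR P Oi; split => //.
    by rewrite h2 big1 // => i _; case: (H i).
  have [hu [b Ob ->]] := h i.
  have Ou : O (u i * (N%:R * b)).
    by rewrite mulrA; apply: orM => //; exact: hu.
  split => //; apply/annE => //; exists (b * (u i * piP)); last by ring.
  by apply: orM => //; exact: hu.
Qed.

Lemma ann_sub (x y : algC) : O x -> O y -> cR x P = cR y P <-> ann (x - y).
Proof.
move=> Ox Oy; rewrite /ann /= (cmD HR) //; last exact: orN.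
rewrite (cm_opp hO HR) //; split=> [->|[_ /eqP]]; last by rewrite subr_eq0 => /eqP.
by split; [apply: orD => //; exact: orN | rewrite subrr].
Qed.

Lemma unit_mod_ann (x : algC) : O x -> unit_mod O ann x <-> exists2 y, O y & cR y (cR x P) = P.
Proof.
move=> Ox; split=> [[_ [y Oy h]]|[y Oy h]]; last first.
  split => //; exists y => //; apply/ann_sub; [exact: orM | exact: or1 |].
  by rewrite (cm1 HR) mulrC (cmM HR).
exists y => //; have /ann_sub := h; rewrite mulrC (cmM HR) // (cm1 HR); apply.
  exact: orM.
exact: or1.
Qed.

(** The generators of the O-module O P ([unit_orbitP]); they correspond to the units modulo
    Ann(P). *)
Definition unit_orbit : set (ept c) := [set Q | exists2 x : algC, unit_mod O ann x & Q = cR x P].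

Lemma unit_orbitP Q : unit_orbit Q <->
  exists x y : algC, [/\ O x, O y, Q = cR x P & P = cR y Q].
Proof.
split=> [[x hx ->]|[x [y [Ox Oy -> e]]]].
  have Ox : O x by case: hx.
  by have [y Oy h] := proj1 (unit_mod_ann Ox) hx; exists x, y.
by exists x => //; apply/(unit_mod_ann Ox); exists y.
Qed.

Lemma unit_orbit_exact Q : unit_orbit Q -> exact_order N Q.
Proof.
move=> /unit_orbitP [x [y [Ox Oy eQ eP]]] i; rewrite -hP.
split=> h; first by rewrite eP -(homMn _ (cm_hom HR Oy)) h; apply: hom0; exact: (cm_hom HR).
by rewrite eQ -(homMn _ (cm_hom HR Ox)) h; apply: hom0; exact: (cm_hom HR).
Qed.

Lemma unit_orbit_good Q : unit_orbit Q -> good (c, multiples Q).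
Proof.
move=> /unit_orbit_exact hQ; split => //=; apply/(Gamma0P ch _ _ N0).
by exists Q.
Qed.

Lemma twist_multiples a (Q : ept c) : O a -> (twist a (c, multiples Q)).2 = multiples (cR a Q).
Proof. by move=> Oa; rewrite /= image_multiples //; exact: (cm_hom HR). Qed.

(** O is commutative, so points that are O-multiples of one another have the same period under
    lambda. *)
Lemma unit_orbit_period Q : unit_orbit Q -> stab_period (c, multiples Q) m.
Proof.
case: hm => m0 h /unit_orbitP [x [y [Ox Oy eQ eP]]]; split => // i.
rewrite -h; have Ol := expr_order i hlambda.
rewrite !twist_multiples //.
split=> e; last first.
  by rewrite eQ (cm_comm HR) // -(image_multiples _ (cm_hom HR Ox)) e image_multiples //; exact: (cm_hom HR).
by rewrite eP (cm_comm HR) // -(image_multiples _ (cm_hom HR Oy)) e image_multiples //; exact: (cm_hom HR).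
Qed.

Lemma coprime_unit e (Q : ept c) : coprime e N -> Q *+ N = 0 -> exists u, Q *+ e *+ u = Q.
Proof.
move=> cope QN; have [e0|e0] := posnP e.
  exists 1%N; move: cope; rewrite e0 /coprime gcd0n => /eqP N1.
  by rewrite N1 mulr1n in QN; rewrite QN !mul0rn.
have [u v huv _] := egcdnP N e0; rewrite (eqP cope) in huv.
by exists u; rewrite -mulrnA mulnC huv mulrnDr mulr1n mulnC mulrnA QN mul0rn add0r.
Qed.

Lemma unit_orbit_twist Q q j : unit_orbit Q -> coprime N j ->
  unit_orbit (cR (lambda ^+ q) Q *+ j).
Proof.
move=> /unit_orbitP [x [y [Ox Oy eQ eP]]] copj.
have QN : Q *+ N = 0.
  rewrite eQ -(homMn _ (cm_hom HR Ox)) (_ : P *+ N = 0); last exact/hP.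
  by apply: hom0; exact: (cm_hom HR).
have [mu Omu [e cope eE]] := lambda_unit_ell.
have Ol := expr_order q hlambda; have Om := expr_order q Omu.
have [u hu] : exists u, Q *+ (e ^ q) *+ j *+ u = Q.
  by rewrite -mulrnA; apply: coprime_unit => //; rewrite coprimeMl coprimeXl // coprime_sym.
have On i : O i%:R by exact: or_nat.
apply/unit_orbitP; exists (j%:R * (lambda ^+ q * x)), (y * (u%:R * mu ^+ q)).
have Olx := orM hO Ol Ox; have Oum := orM hO (On u) Om.
split; [exact: orM | exact: orM | |].
  by rewrite !(cmM HR) // (cm_nat hO HR) eQ.
rewrite !(cmM HR) // (cm_nat hO HR) (homMn _ (cm_hom HR Om)) -(cmM HR) //.
rewrite mulrC -exprMn -eE -natrX (cm_nat hO HR) hu.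
exact: eP.
Qed.

Definition orbit_of (Q : ept c) := range (vertex (c, multiples Q)).

(** If Q is met by the cycle of Q', [orbit_same_curve] makes the group of Q a twist of that of Q' by
    a power of lambda. The exponent is reduced modulo m, and equal cyclic groups have generators
    differing by a unit j modulo N. *)
Lemma orbit_of_eqP Q Q' : unit_orbit Q -> unit_orbit Q' ->
  orbit_of Q = orbit_of Q' <->
  exists q j, [/\ (q < m)%N, (j < N)%N, coprime N j & Q = cR (lambda ^+ q) Q' *+ j].
Proof.
move=> hQ hQ'; have gQ := unit_orbit_good hQ; have gQ' := unit_orbit_good hQ'.
have pQ := unit_orbit_period hQ; have pQ' := unit_orbit_period hQ'.
have [m0 _] := hm.
split=> [e|[q [j [qm jN copj eQ]]]].
- have : orbit_of Q' (vertex (c, multiples Q) 0) by rewrite -e; exists 0%N.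
  move=> [i _ /esym /(level_class_eqP ch N0 gQ (good_iter i gQ')) h].
  have [_] := orbit_same_curve gQ' gQ h.
  set t := (i %/ n)%N; have Ot := expr_order t hlambda.
  have Or := expr_order (t %% m) hlambda; have Oq := expr_order (t %/ m * m) hlambda.
  rewrite twist_multiples // (divn_eq t m) addnC exprD (cmM HR) //.
  rewrite -(image_multiples _ (cm_hom HR Or)) -[multiples (cR _ Q')]twist_multiples //.
  rewrite (proj2 (pQ'.2 _)) ?dvdn_mull // image_multiples; last exact: (cm_hom HR).
  have hx : exact_order N (cR (lambda ^+ (t %% m)) Q').
    by have := unit_orbit_exact (unit_orbit_twist (t %% m) hQ' (coprimen1 N)); rewrite mulr1n.
  move=> /esym /(multiples_eqP N0 (unit_orbit_exact hQ) hx) [j [jN copj eQ]].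
  by exists (t %% m)%N, j; split => //; rewrite ltn_pmod.
- have Oq := expr_order q hlambda.
  have hx : exact_order N (cR (lambda ^+ q) Q').
    by have := unit_orbit_exact (unit_orbit_twist q hQ' (coprimen1 N)); rewrite mulr1n.
  have e : multiples Q = multiples (cR (lambda ^+ q) Q').
    by apply/(multiples_eqP N0 (unit_orbit_exact hQ) hx); exists j.
  have s := sim_twist_iter q gQ'.
  have ev : vertex (c, multiples Q) 0 = vertex (c, multiples Q') (n * q).
    apply: sim_class gQ (good_iter _ gQ') _; apply: sim_sym; first exact: good_iter.
    by rewrite e -twist_multiples.
  by rewrite /orbit_of -(component_vertex gQ pQ 0) ev (component_vertex gQ' pQ').
Qed.

Lemma unit_orbit_seq : exists2 s : seq (ept c), uniq s & forall Q, (Q \in s) <-> unit_orbit Q.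
Proof.
have [_ _ [t [ut _ ht]]] := @muln_sepk k ch c N hNk.
exists (filter (fun Q => `[< unit_orbit Q >]) t); first exact: filter_uniq.
move=> Q; rewrite mem_filter; split=> [/andP [/asboolP //]|h].
by apply/andP; split; [exact/asboolP | rewrite ht; apply/eqP/(unit_orbit_exact h)].
Qed.

Lemma unit_orbit_lambda q Q : unit_orbit Q -> unit_orbit (cR (lambda ^+ q) Q).
Proof. by move=> hQ; have := unit_orbit_twist q hQ (coprimen1 N); rewrite mulr1n. Qed.

Lemma multiples_lambda_inj q q' Q : unit_orbit Q -> (q < m)%N -> (q' < m)%N ->
  multiples (cR (lambda ^+ q) Q) = multiples (cR (lambda ^+ q') Q) -> q = q'.
Proof.
wlog le : q q' / (q <= q')%N.
  by move=> h hQ qm qm' e; have [le|/ltnW le] := leqP q q'; [exact: h | apply/esym; exact: h].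
move=> hQ qm qm' e; have [_ hX] := unit_orbit_period (unit_orbit_lambda q hQ).
have Ol i := expr_order i hlambda.
have /hX : (twist (lambda ^+ (q' - q)) (c, multiples (cR (lambda ^+ q) Q))).2 =
    multiples (cR (lambda ^+ q) Q).
  by rewrite twist_multiples // -(cmM HR) // -exprD subnK.
move=> mq; apply/eqP; rewrite eqn_leq le -subn_eq0.
move: mq; case: (posnP (q' - q)) => [-> //|d0 /(dvdn_leq d0) h].
by have := leq_ltn_trans (leq_subr q q') qm'; rewrite ltnNge h.
Qed.

(** The residue class of x modulo Ann(P) consists of the y with y P = x P, so classes correspond to
    points. *)
Lemma unit_group_card (s : seq (ept c)) : uniq s -> (forall Q, (Q \in s) <-> unit_orbit Q) ->
  phi_order O ann = size s.
Proof.
move=> us hs; pose f (Q : ept c) : set algC := [set y | O y /\ cR y P = Q].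
have cls (x : algC) : O x -> residue_class O ann x = f (cR x P).
  move=> Ox; apply/seteqP; split=> y [Oy h]; split => //; exact/ann_sub.
have [|r sr cr] := @fibres_card _ _ f 1 s.
  move=> Q Qs; rewrite (@eq_in_count _ _ (pred1 Q)); first by rewrite count_uniq_mem // Qs.
  move=> Q' Q's /=; apply/asboolP/eqP => [e|-> //].
  have /unit_orbitP [x [y [Ox Oy eQ _]]] := proj1 (hs Q) Qs.
  by have [_ <-] : f Q' x by rewrite e; split.
rewrite /phi_order; apply: card_fset_set; rewrite sr muln1; apply: card_eq_trans cr.
rewrite (_ : unit_group_mod O ann = f @` [set` s]) ?card_eqxx //.
apply/seteqP; split.
- move=> _ [x hx <-]; have Ox : O x by case: hx.
  by exists (cR x P); [apply/hs; exists x | rewrite cls].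
- move=> _ [Q /hs [x hx eQ] <-]; have Ox : O x by case: hx.
  by exists x => //; rewrite cls // eQ.
Qed.

(** The fibre consists of the points j lambda^q Q of [orbit_of_eqP]. They are distinct: equality of
    the groups determines q, and then the exact order N determines j. *)
Lemma orbit_fibre (s : seq (ept c)) Q : uniq s -> (forall Q, (Q \in s) <-> unit_orbit Q) ->
  Q \in s -> count (fun Q' => `[< orbit_of Q' = orbit_of Q >]) s = (totient N * m)%N.
Proof.
move=> us hs Qs; have hQ := proj1 (hs Q) Qs; have pQ := unit_orbit_period hQ.
pose st := [seq j <- seq.iota 0 N | coprime N j].
pose f j q := cR (lambda ^+ q) Q *+ j.
have uL : uniq [seq f j q | j <- st, q <- seq.iota 0 m].
  apply: allpairs_uniq; [exact: filter_uniq (iota_uniq _ _) | exact: iota_uniq |].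
  move=> [? ?] [? ?] /allpairsP [[j q] /= []]; rewrite mem_filter !mem_iota /= !add0n.
  move=> /andP [copj jN] qm [-> ->] /allpairsP [[j' q'] /= []]; rewrite mem_filter !mem_iota /= !add0n.
  move=> /andP [copj' jN'] qm' [-> ->] /= e.
  have ml i (X : ept c) : exact_order N X -> coprime N i -> multiples (X *+ i) = multiples X.
    move=> hX ci; have gX : Gamma0_structure c N (multiples X) by apply/(Gamma0P ch _ _ N0); exists X.
    rewrite -[RHS](Gamma0_muln ch N0 _ gX (e := i)) 1?coprime_sym //.
    by rewrite image_multiples // => ? ?; exact: mulrnDl.
  have eqq : q = q'.
    apply: (multiples_lambda_inj hQ qm qm').
    have h1 := ml j _ (unit_orbit_exact (unit_orbit_lambda q hQ)) copj.
    have h2 := ml j' _ (unit_orbit_exact (unit_orbit_lambda q' hQ)) copj'.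
    by rewrite -h1 -h2; congr multiples.
  congr pair => //; move: e; rewrite -eqq /f => /eqP.
  rewrite (exact_order_inj _ _ (unit_orbit_exact (unit_orbit_lambda q hQ))) !modn_small //.
  by move/eqP.
rewrite totient_count -!size_filter -/st -[m in RHS](size_iota 0) -(size_allpairs f).
apply: perm_size; apply: uniq_perm => //; first exact: filter_uniq.
move=> Q'; rewrite mem_filter; apply/andP/allpairsP.
- move=> [/asboolP e Q's]; have [q [j [qm jN copj eQ]]] := proj1 (orbit_of_eqP (proj1 (hs Q') Q's) hQ) e.
  by exists (j, q); rewrite mem_filter !mem_iota /= copj jN qm.
- move=> [[j q] /= []]; rewrite mem_filter !mem_iota /= !add0n => /andP [copj jN] qm e.
  have hQ' : unit_orbit Q' by rewrite e; exact: unit_orbit_twist.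
  split; last exact/hs.
  by apply/asboolP/(orbit_of_eqP hQ' hQ); exists q, j.
Qed.

Theorem orbit_count : exists2 r, phi_order O ann = (r * (totient N * m))%N &
  orbit_of @` unit_orbit #= `I_r.
Proof.
have [s us hs] := unit_orbit_seq; rewrite (unit_group_card us hs).
have [|r hr cr] := fibres_card (f := orbit_of) (t := (totient N * m)%N) (s := s).
  by move=> Q Qs; exact: orbit_fibre.
exists r => //; rewrite (_ : unit_orbit = [set` s]) //.
by apply/seteqP; split=> Q /hs.
Qed.

End Counting.

End Orbit.

End Graph.

End Isogeny_chain.

(** * Primes above ell, and the count of components *)

Lemma order_of_conductor_ring d f : order_ring (order_of_conductor (imag_quad_field d) f).
Proof.
by split; [exact: order1 | exact: orderD | exact: orderN | exact: orderM].
Qed.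

Lemma prime_pair_of_prime (d f ell : nat) (l : set algC) : (0 < d)%N -> prime ell ->
  is_prime_ideal (order_of_conductor (imag_quad_field d) f) l ->
  scale_ideal ell%:R (order_of_conductor (imag_quad_field d) f) = mul_ideal l (conj_ideal l) ->
  prime_pair (order_of_conductor (imag_quad_field d) f) ell l (conj_ideal l).
Proof.
move=> hd hell; set O := order_of_conductor _ _ => hl hll.
have hl' := conj_prime_ideal hd hl.
have lell := ell_in_prime hd hl hll.
have lell' : conj_ideal l ell%:R by rewrite /conj_ideal /= rmorph_nat.
have ell0 : ell%:R != 0 :> algC by rewrite pnatr_eq0 -lt0n prime_gt0.
have sum : exists (r : nat) (a b : 'I_r -> algC),
     (forall i, l (a i) /\ conj_ideal l (b i)) /\ ell%:R = \sum_(i < r) a i * b i.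
  have : scale_ideal ell%:R O ell%:R by exists 1; [exact: order1 | rewrite mulr1].
  by rewrite hll.
(* If l were inside ell O, so would be its conjugate, and ell would lie in ell^2 O; then 1 would be
   in ell O, hence in l. *)
have proper : exists2 a, l a & ~ scale_ideal ell%:R O a.
  apply: contrapT => h; have sub a : l a -> scale_ideal ell%:R O a.
    by move=> la; apply: contrapT => na; apply: h; exists a.
  have [r [a [b [hab e]]]] := sum.
  have [c Oc hc] : scale_ideal ell%:R (scale_ideal ell%:R O) ell%:R.
    rewrite {3}e; apply: (big_ind (scale_ideal ell%:R (scale_ideal ell%:R O))).
    - by exists 0; [exists 0; [exact: (order_nat d f 0) |]|]; rewrite mulr0.
    - move=> _ _ [_ [x Ox ->] ->] [_ [y Oy ->] ->]; exists (ell%:R * (x + y)); last by ring.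
      by exists (x + y) => //; exact: orderD.
    - move=> i _; have [/sub [x Ox ->] /sub [y Oy ey]] := hab i.
      have -> : b i = ell%:R * y^* by rewrite -[b i]conjCK ey rmorphM rmorph_nat.
      exists (ell%:R * (x * y^*)); last by ring.
      by exists (x * y^*) => //; apply: orderM => //; exact: order_conj.
  have c1 : c = 1 by apply: (mulfI ell0); rewrite -hc mulr1.
  case: hl => [[_ _ _ lM] l1 _]; apply: l1; rewrite -c1.
  by case: Oc => x Ox ->; rewrite mulrC; exact: lM.
split => //; [by case: hl | by case: hl' | | by move=> a b la lb; rewrite hll; exact: mem_mul_ideal].
case: proper => a la na; exists a^*; first by rewrite /conj_ideal /= conjCK.
move=> [c Oc e]; apply: na; exists c^*; first exact: order_conj.
by rewrite -[a]conjCK e rmorphM rmorph_nat.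
Qed.

Theorem theorem4p5
  (* the field F = F_q and its algebraic closure k *)
  (p : nat) (F : finFieldType) (k : closedFieldType)
  (iota : {rmorphism F -> k})
  (hF : p \in [pchar F]) (hp : (5 <= p)%N)
  (hk : forall x : k, algebraicOver iota x)
  (* the order O of conductor f in K = Q(sqrt (- d)) *)
  (d f : nat) (hd : (0 < d)%N) (hf : (0 < f)%N)
  (O : set algC) (hO : O = order_of_conductor (imag_quad_field d) f)
  (ell : nat) (hell : prime ell) (hellp : ell != p)
  (N : nat) (hN : (0 < N)%N)
  (hNp : coprime N p) (hNell : coprime N ell) (hNf : coprime N f)
  (* ell O = l lbar *)
  (l : set algC) (hl : is_prime_ideal O l)
  (hllbar : scale_ideal ell%:R O = mul_ideal l (conj_ideal l))
  (* the crater C of the ordinary component of E0 *)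
  (E0 : curve k) (hE0 : defined_over iota E0) (hord : ordinary p E0)
  (C : set (curve k)) (hC : C = crater iota O ell E0)
  (hj : forall E, C E -> jinv E != 0 /\ jinv E != 1728%:R)
  (n : nat) (hn : class_order O l n)
  (lambda : algC) (hlambda : O lambda)
  (hln : exp_ideal O l n = scale_ideal lambda O)
  (* the vertex (E, G), G = <P>, with E[N] identified with O / N O *)
  (E : curve k) (hE : C E)
  (rho : algC -> pt k -> pt k) (hrho : End_iso O E rho)
  (theta : algC -> pt k) (htheta : torsion_iso O E rho N theta)
  (G : set (pt k)) (hG : Gamma0_structure E N G)
  (P : pt k) (hP : torsion E N P) (hGP : G = cyclic_subgroup E P)
  (* a = (P, N), computed from a lift piP of P to O *)
  (piP : algC) (hpiP : O piP) (hthetaP : theta piP = P)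
  (a : set algC) (ha : a = ideal_gen2 O piP N%:R)
  (m : nat) (hm : order_mod_Stab O N rho G lambda m)
  (CC : set (set (level_curve k)))
  (hCC : CC = component C O l ell N (level_class C N (E, G))) :
  CC #= `I_(n * m) /\
  exists (r : nat) (S : set (set (set (level_curve k)))),
    [/\ r%:R = (phi_order O (mul_ideal (inv_ideal O a) (scale_ideal N%:R O)))%:R
               / ((totient N)%:R * m%:R) :> rat,
        S #= `I_r
      & forall D, S D -> is_component C O l ell N D /\ subgraph_iso O l ell CC D].
Proof.
have pr_p := pcharf_prime hF.
have natk (i : nat) : (i%:R == 0 :> k) = (p %| i)%N.
  by rewrite -(rmorph_nat iota) fmorph_eq0 (dvdn_pcharf hF).
have lt_p i : (0 < i < 5)%N -> (i%:R != 0 :> k).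
  by move=> /andP [i0 i5]; rewrite natk gtnNdvd // (leq_trans i5).
pose ch := GoodChar (lt_p 2 isT) (lt_p 3 isT).
have ellk : ell%:R != 0 :> k by rewrite natk dvdn_prime2 // eq_sym.
have hNk : N%:R != 0 :> k by rewrite natk -prime_coprime // coprime_sym.
have cop : coprime ell N by rewrite coprime_sym.
subst O C; set O := order_of_conductor _ _ in hl hllbar hj hn hlambda hln hE hrho htheta hpiP ha hm hCC *.
have hO : order_ring O := order_of_conductor_ring d f.
have hpp := prime_pair_of_prime hd hell hl hllbar.
have sat : saturated O ell.
  by move=> z; exact: (order_saturated hd (prime_gt0 hell) (conductor_coprime hd hell hl hllbar)).
have Oconj x : O x -> O x^* by exact: order_conj.
have Oendo := @order_endomorphism d f hd.
pose c : cmcurve ch O iota :=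
  CMCurve (End_iso_cm ch (or1 hO) (orD hO) (orM hO) hrho) (crater_defined hE0 hE).
have [P1 eP1] := points_ex ch hP.1; rewrite eP1 in hP hGP hthetaP.
have P1N : P1 *+ N = 0 by apply/torsionP.
have eG : G = multiples P1 by rewrite hGP cyclic_subgroupE.
have hP1 : exact_order N P1 by apply: exact_order_card => //; rewrite -eG; case: hG.
have [tsurj _ tM t0] := htheta.
have tpt x : O x -> points E (theta x).
  by move=> Ox; have [] : torsion E N (theta x) by rewrite -tsurj; exists x.
pose th x := mkpt E (theta x) : ept ch c.
have thM x y : O x -> O y -> th (x * y) = cR x (th y).
  by move=> Ox Oy; rewrite /th tM // /cR /= /restr mkptK //; exact: tpt.
have th0 x : O x -> th x = 0 <-> scale_ideal N%:R O x.
  move=> Ox; rewrite -t0 // /th -sval_eq0 mkptK //; exact: tpt.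
have thP : th piP = P1 by rewrite /th hthetaP svalK.
have Gsub : G `<=` points E by rewrite eG; exact: multiples_points.
have rhoG x : O x -> rho x @` G = (twist x (c, G)).2.
  move=> Ox; rewrite /= /cR /= image_restr //.
  by have [h _ _ _] := hrho; have /(endomorphismP ch) [] := h x Ox.
have gx : good ell E0 N (c, G) by [].
have hper : stab_period lambda (c, multiples P1) m.
  rewrite -eG; have [m0 [_ hm1] hmin] := hm.
  have Ol i : O (lambda ^+ i) by exact: expr_order.
  apply: (stab_period_least hO hN hlambda gx m0); first by rewrite -rhoG.
  move=> i im e; apply: (hmin i im); split; last by rewrite rhoG.
  exact: (lambda_unit_mod hO hell hpp cop hlambda hln).
have eCC : CC = orbit_of hO hell ellk sat hF hpp E0 N (c := c) P1.
  rewrite hCC /orbit_of -eG in hper *.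
  by rewrite -(component_vertex hO hell ellk sat hF hpp Oconj Oendo erefl hE0 hN cop hn hlambda hln gx hper 0).
split.
  rewrite eCC /orbit_of -eG in hper *.
  exact: (vertex_card hO hell ellk sat hF hpp hN cop hn hlambda hln hj gx hper).
have [r hr cr] := orbit_count (c := c) hO hell ellk sat hF hpp Oconj Oendo erefl hE0 hN cop hn hlambda hln hj
  hE hP1 hper hNk.
(* The components exhibited are the cycles through the points x P, for x a unit modulo Ann(P). *)
exists r, (orbit_of hO hell ellk sat hF hpp E0 N (c := c) @` unit_orbit (c := c) P1); split => //.
  rewrite ha -(ann_ideal hO hN thM th0 hpiP thP) hr natrM natrM mulfK //.
  rewrite -natrM pnatr_eq0 muln_eq0 negb_or -!lt0n totient_gt0 hN.
  by case: hper.
move=> _ [Q hQ <-]; have gQ := unit_orbit_good (c := c) hO hN hE hP1 hQ.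
have pQ := unit_orbit_period hO hlambda hper hQ.
split.
  exists (vertex hO hell ellk sat hF hpp E0 N (c, multiples Q) 0).
    by exists (raw (c, multiples Q)).
  by rewrite (component_vertex hO hell ellk sat hF hpp Oconj Oendo erefl hE0 hN cop hn hlambda hln gQ pQ).
rewrite eCC; rewrite eG in gx.
exact: (orbits_iso hO hell ellk sat hF hpp Oconj Oendo erefl hE0 hN cop hn hlambda hln hj gx gQ hper pQ).
Qed.
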